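(* Let $G$ be a linear algebraic group over an infinite field $k$, let $Y$ be an integral scheme of finite type over $k$, and let $\tau \colon V \to Y$ be a $G$-torsor. Then: (a) $\tau$ is weakly (1)-versal $\Longleftrightarrow$ $\tau$ is weakly (2)-versal $\Longleftrightarrow$ $\tau$ is weakly (3)-versal. (b) $\tau$ is (1)-versal $\Longleftrightarrow$ $\tau$ is (2)-versal $\Longleftrightarrow$ $\tau$ is (3)-versal.
   Context: An algebraic group over $k$ means a group scheme of finite type over $k$ (not assumed smooth or connected); linear means affine. A $G$-torsor over a $k$-scheme $X$ means an fppf $G$-torsor: a morphism of $k$-schemes $T \to X$ with a left action of $G$ on $T$ over $X$ such that $G \times_k T \to T \times_X T$, $(g,x) \mapsto (x, g\cdot x)$, is an isomorphism, and such that $T \times_X X' \cong G \times_k X'$ for some faithfully flat, locally finitely presented morphism of $k$-schemes $X' \to X$. Local and semi-local rings are commutative; semi-local means having finitely many maximal ideals. A $G$-torsor $\tau \colon V \to Y$, where $Y$ is an integral scheme of finite type over $k$, is called: - weakly (1)-versal if every $G$-torsor $T_1 \to \operatorname{Spec}(K)$ over an infinite field $K$ containing $k$ is obtained as a pull-back of $\tau$ via some $k$-morphism $\operatorname{Spec}(K) \to Y$, i.e. fits into a Cartesian diagram of $k$-morphisms, with $G$-equivariant top arrow $T_1 \to V$, lying over $\operatorname{Spec}(K) \to Y$; - weakly (2)-versal if every $G$-torsor $T_2 \to \operatorname{Spec}(R)$ over a local ring $R$ containing $k$ is obtained as a pull-back of $\tau$ via some $k$-morphism $\operatorname{Spec}(R)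 \to Y$; - weakly (3)-versal if every $G$-torsor $T_3 \to \operatorname{Spec}(S)$ over a semi-local ring $S$ containing $k$ is obtained as a pull-back of $\tau$ via some $k$-morphism $\operatorname{Spec}(S) \to Y$. For $n = 1,2,3$, $\tau$ is called $(n)$-versal if the restriction of $\tau$ to every dense open subscheme of $Y$ is weakly $(n)$-versal. *)

(* Defs.v *)
From HB Require Import structures.
From mathcomp Require Import all_boot all_order all_algebra.
From mathcomp Require Import boolp classical_sets functions cardinality.

(* Schemes over a field k are set up through their functors of points, as in
   Demazure-Gabriel, "Groupes algebriques", I.1-I.3, and Jantzen,
   "Representations of algebraic groups", I.1: a k-scheme is a functor from
   commutative k-algebras to sets which is a Zariski sheaf and is covered by
   open subfunctors isomorphic to functors Spec R = Hom_k(R, -).  Points of the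
   underlying space are represented by points with values in fields. *)

Set Implicit Arguments.
Unset Strict Implicit.
Unset Printing Implicit Defensive.

Import GRing.Theory.
Local Open Scope classical_set_scope.
Local Open Scope ring_scope.

Section Ideals.
Variable A : comPzRingType.

Definition is_ideal (I : set A) : Prop :=
  [/\ I 0, forall x y, I x -> I y -> I (x + y) & forall a x, I x -> I (a * x)].

Definition ideal_gen (S : set A) : set A :=
  [set x | forall I, is_ideal I -> S `<=` I -> I x].

Definition maximal_ideal (I : set A) : Prop :=
  [/\ is_ideal I, I <> setT &
      forall J, is_ideal J -> I `<=` J -> J = I \/ J = setT].

Definition is_local_ring : Prop := exists! I : set A, maximal_ideal I.

Definition is_semilocal_ring : Prop := finite_set maximal_ideal.

Definition is_domain : Prop :=
  (1 : A) <> 0 /\ forall x y : A, x * y = 0 -> x = 0 \/ y = 0.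

Definition is_unit (x : A) : Prop := exists y, x * y = 1.

End Ideals.

(* [t] exhibits [MB] as the extension of scalars of [M] along [phi], that is,
   as the tensor product of [B] and [M] over [A]. *)
Definition is_scalar_extension (A B : comPzRingType) (phi : {rmorphism A -> B})
    (M : lmodType A) (MB : lmodType B)
    (t : {linear M -> MB | phi \; *:%R}) : Prop :=
  forall (P : lmodType B) (g : {linear M -> P | phi \; *:%R}),
    exists h : {linear MB -> P},
      (forall m, h (t m) = g m) /\
      forall h' : {linear MB -> P}, (forall m, h' (t m) = g m) -> h' =1 h.

Definition flat_rmorphism (A B : comPzRingType) (phi : {rmorphism A -> B}) : Prop :=
  forall (M N : lmodType A) (u : {linear M -> N}) (MB NB : lmodType B)
         (tM : {linear M -> MB | phi \; *:%R})
         (tN : {linear N -> NB | phi \; *:%R})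
         (v : {linear MB -> NB}),
    is_scalar_extension tM -> is_scalar_extension tN ->
    (forall m, v (tM m) = tN (u m)) ->
    injective u -> injective v.

Section Schemes.
Variable k : fieldType.

(* The zero algebra is allowed; it is needed for instance as the localization
   of an algebra at a nilpotent element. *)
Record kalg := KAlg {
  kalg_ring :> comPzRingType;
  kalg_str : {rmorphism k -> kalg_ring} }.

Record khom (A B : kalg) := KHom {
  khom_fun :> {rmorphism A -> B};
  khom_str : forall c, khom_fun (kalg_str A c) = kalg_str B c }.

Lemma khom_ext (A B : kalg) (f g : khom A B) : f =1 g -> f = g.
Proof.
case: f g => [f Hf] [g Hg] /= fg.
have E : f = g.
  case: f g fg {Hf Hg} => [f cf] [g cg] /= /funext fg.
  by subst g; congr GRing.RMorphism.Pack; 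
     case: cf cg => [[?] [?]] [[?] [?]]; f_equal; f_equal; exact: Prop_irrelevance.
by subst g; congr KHom; exact: Prop_irrelevance.
Qed.

Definition kid (A : kalg) : khom A A :=
  @KHom A A idfun (fun=> erefl).

Definition kbase : kalg := @KAlg k idfun.

Definition kinit (A : kalg) : khom kbase A :=
  @KHom kbase A (kalg_str A) (fun=> erefl).

Lemma kcomp_str (A B C : kalg) (g : khom B C) (f : khom A B) c :
  (g \o f) (kalg_str A c) = kalg_str C c.
Proof. by rewrite /= !khom_str. Qed.

Definition kcomp (A B C : kalg) (g : khom B C) (f : khom A B) : khom A C :=
  @KHom A C (g \o f) (kcomp_str g f).

Definition is_polynomial_algebra (A P : kalg) (iota : khom A P)
    (n : nat) (x : 'I_n -> P) : Prop :=
  forall (C : kalg) (chi : khom A C) (c : 'I_n -> C),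
    exists! h : khom P C, kcomp h iota = chi /\ forall i, h (x i) = c i.

Definition finite_type_hom (A B : kalg) (phi : khom A B) : Prop :=
  exists (P : kalg) (iota : khom A P) (n : nat) (x : 'I_n -> P) (p : khom P B),
    [/\ is_polynomial_algebra iota x, kcomp p iota = phi &
        forall b, exists a, p a = b].

Definition finite_presentation_hom (A B : kalg) (phi : khom A B) : Prop :=
  exists (P : kalg) (iota : khom A P) (n : nat) (x : 'I_n -> P) (p : khom P B),
    [/\ is_polynomial_algebra iota x, kcomp p iota = phi,
        forall b, exists a, p a = b &
        exists (m : nat) (r : 'I_m -> P),
          [set a | p a = 0] = ideal_gen (range r)].

Definition is_localization (A B : kalg) (a : A) (phi : khom A B) : Prop :=
  is_unit (phi a) /\
  forall (C : kalg) (chi : khom A C), is_unit (chi a) ->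
    exists! psi : khom B C, kcomp psi phi = chi.

Record kfunctor := KFunctor {
  points :> kalg -> Type;
  fmap : forall A B : kalg, khom A B -> points A -> points B;
  fmap_id : forall A (x : points A), fmap (kid A) x = x;
  fmap_comp : forall (A B C : kalg) (g : khom B C) (f : khom A B) (x : points A),
    fmap (kcomp g f) x = fmap g (fmap f x) }.

Arguments fmap X {A B} : rename.

Record kmor (X Y : kfunctor) := KMor {
  kmor_fun :> forall A : kalg, X A -> Y A;
  kmor_nat : forall (A B : kalg) (f : khom A B) (x : X A),
    kmor_fun (fmap X f x) = fmap Y f (kmor_fun x) }.

Arguments kmor_fun {X Y} f {A} : rename.

Definition is_iso (X Y : kfunctor) (f : kmor X Y) : Prop :=
  exists g : kmor Y X,
    forall A : kalg, cancel (@kmor_fun _ _ f A) (@kmor_fun _ _ g A) /\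
                     cancel (@kmor_fun _ _ g A) (@kmor_fun _ _ f A).

Lemma Spec_id (R A : kalg) (x : khom R A) : kcomp (kid A) x = x.
Proof. exact: khom_ext. Qed.

Lemma Spec_comp (R A B C : kalg) (g : khom B C) (f : khom A B) (x : khom R A) :
  kcomp (kcomp g f) x = kcomp g (kcomp f x).
Proof. exact: khom_ext. Qed.

Definition Spec (R : kalg) : kfunctor :=
  @KFunctor (khom R) (fun A B (f : khom A B) (x : khom R A) => kcomp f x)
    (@Spec_id R) (@Spec_comp R).

Definition prodF (X Z : kfunctor) : kfunctor.
Proof.
refine (@KFunctor (fun A => (X A * Z A)%type)
  (fun A B f p => (fmap X f p.1, fmap Z f p.2)) _ _).
- by move=> A [x z]; rewrite !fmap_id.
- by move=> A B C g f [x z]; rewrite /= !fmap_comp.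
Defined.

Lemma sig_ext (T : Type) (P : T -> Prop) (x y : {t | P t}) :
  sval x = sval y -> x = y.
Proof.
by case: x y => [x Px] [y Py] /= E; subst y; congr exist; exact: Prop_irrelevance.
Qed.

Record subfun (X : kfunctor) := SubFun {
  sub_pts :> forall A : kalg, set (X A);
  sub_stable : forall (A B : kalg) (f : khom A B) (x : X A),
    sub_pts x -> sub_pts (fmap X f x) }.

Definition subF (X : kfunctor) (U : subfun X) : kfunctor.
Proof.
refine (@KFunctor (fun A => {x : X A | U A x})
  (fun A B f p => exist _ (fmap X f (sval p)) (sub_stable f (svalP p))) _ _).
- by move=> A x; apply: sig_ext; rewrite /= fmap_id.
- by move=> A B C g f x; apply: sig_ext; rewrite /= fmap_comp.
Defined.

Definition incl (X : kfunctor) (U : subfun X) : kmor (subF U) X :=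
  @KMor (subF U) X (fun A x => sval x) (fun _ _ _ _ => erefl).

Lemma fibre_stable (X Z Y : kfunctor) (f : kmor X Y) (g : kmor Z Y)
    (A B : kalg) (h : khom A B) (p : prodF X Z A) :
  f A p.1 = g A p.2 ->
  f B (fmap (prodF X Z) h p).1 = g B (fmap (prodF X Z) h p).2.
Proof. by move=> E; rewrite /= !kmor_nat E. Qed.

Definition fibre_product (X Z Y : kfunctor) (f : kmor X Y) (g : kmor Z Y) :
    kfunctor :=
  subF (@SubFun (prodF X Z) (fun A => [set p | f A p.1 = g A p.2])
          (@fibre_stable X Z Y f g)).

Definition image (X Y : kfunctor) (f : kmor X Y) : subfun Y.
Proof.
refine (@SubFun Y (fun A => range (@kmor_fun _ _ f A)) _).
by move=> A B h _ [x _ <-]; exists (fmap X h x) => //; rewrite kmor_nat.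
Defined.

(* For every x : Spec A -> X, the preimage of U under x is the open subfunctor
   D(I) of Spec A for some ideal I of A. *)
Definition is_open (X : kfunctor) (U : subfun X) : Prop :=
  forall (A : kalg) (x : X A),
    exists2 I : set A, is_ideal I &
      forall (B : kalg) (f : khom A B),
        U B (fmap X f x) <-> ideal_gen (f @` I) = setT.

Definition open_immersion (X Y : kfunctor) (j : kmor X Y) : Prop :=
  (forall A : kalg, injective (@kmor_fun _ _ j A)) /\ is_open (image j).

(* Zariski sheaf condition for the covering of Spec A by the D(a i).  Agreement
   over all C is agreement over the overlaps D(a i * a j). *)
Definition is_zariski_sheaf (X : kfunctor) : Prop :=
  forall (A : kalg) (n : nat) (a : 'I_n -> A) (B : 'I_n -> kalg)
         (phi : forall i, khom A (B i)) (x : forall i, X (B i)),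
    ideal_gen (range a) = setT ->
    (forall i, is_localization (a i) (phi i)) ->
    (forall (i j : 'I_n) (C : kalg) (f : khom (B i) C) (g : khom (B j) C),
       kcomp f (phi i) = kcomp g (phi j) -> fmap X f (x i) = fmap X g (x j)) ->
    exists! y : X A, forall i, fmap X (phi i) y = x i.

Definition is_scheme (X : kfunctor) : Prop :=
  is_zariski_sheaf X /\
  forall (F : fieldType) (iF : {rmorphism k -> F}) (x : X (KAlg iF)),
    exists (R : kalg) (j : kmor (Spec R) X),
      open_immersion j /\ image j _ x.

Definition is_affine (X : kfunctor) : Prop :=
  exists (R : kalg) (f : kmor X (Spec R)), is_iso f.

Definition finite_type (X : kfunctor) : Prop :=
  exists (n : nat) (R : 'I_n -> kalg) (j : forall i, kmor (Spec (R i)) X),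
    (forall i, open_immersion (j i) /\ finite_type_hom (kinit (R i))) /\
    forall (F : fieldType) (iF : {rmorphism k -> F}) (x : X (KAlg iF)),
      exists i, image (j i) _ x.

Definition nonempty_functor (X : kfunctor) : Prop :=
  exists (F : fieldType) (iF : {rmorphism k -> F}), inhabited (X (KAlg iF)).

(* Nonempty, and every nonempty affine open subscheme is the spectrum of a
   domain. *)
Definition is_integral (X : kfunctor) : Prop :=
  nonempty_functor X /\
  forall (R : kalg) (j : kmor (Spec R) X),
    open_immersion j -> (1 : R) <> 0 -> is_domain R.

(* Every point x of X has an affine open neighbourhood Spec B mapped by f into
   an affine open Spec A of Y through a homomorphism A -> B satisfying P.  For
   flatness this is the same as flatness of the maps of local rings. *)
Definition locally_hom (P : forall A B : kalg, khom A B -> Prop)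
    (X Y : kfunctor) (f : kmor X Y) : Prop :=
  forall (F : fieldType) (iF : {rmorphism k -> F}) (x : X (KAlg iF)),
    exists (A B : kalg) (phi : khom A B)
           (jB : kmor (Spec B) X) (jA : kmor (Spec A) Y),
      [/\ open_immersion jB, open_immersion jA, image jB _ x, P A B phi &
          forall (C : kalg) (u : khom B C),
            f C (jB C u) = jA C (kcomp u phi)].

Definition is_surjective (X Y : kfunctor) (f : kmor X Y) : Prop :=
  forall (F : fieldType) (iF : {rmorphism k -> F}) (y : Y (KAlg iF)),
    exists (E : fieldType) (iE : {rmorphism k -> E})
           (h : khom (KAlg iF) (KAlg iE)) (x : X (KAlg iE)),
      f _ x = fmap Y h y.

Definition is_flat : forall X Y : kfunctor, kmor X Y -> Prop :=
  locally_hom (fun A B phi => flat_rmorphism phi).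

Definition locally_finitely_presented :
    forall X Y : kfunctor, kmor X Y -> Prop :=
  locally_hom finite_presentation_hom.

Definition is_fppf (X Y : kfunctor) (f : kmor X Y) : Prop :=
  [/\ is_flat f, is_surjective f & locally_finitely_presented f].

Definition is_dense (X : kfunctor) (U : subfun X) : Prop :=
  forall W : subfun X, is_open W -> nonempty_functor (subF W) ->
    exists (F : fieldType) (iF : {rmorphism k -> F}) (x : X (KAlg iF)),
      U _ x /\ W _ x.

Record kgroup := KGroup {
  kgroup_fun :> kfunctor;
  gmul : forall A : kalg, kgroup_fun A -> kgroup_fun A -> kgroup_fun A;
  gone : forall A : kalg, kgroup_fun A;
  ginv : forall A : kalg, kgroup_fun A -> kgroup_fun A;
  gmulA : forall (A : kalg) (x y z : kgroup_fun A),
    gmul x (gmul y z) = gmul (gmul x y) z;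
  gmul1 : forall (A : kalg) (x : kgroup_fun A), gmul (gone A) x = x;
  gmulV : forall (A : kalg) (x : kgroup_fun A), gmul (ginv x) x = gone A;
  gmul_nat : forall (A B : kalg) (f : khom A B) (x y : kgroup_fun A),
    fmap kgroup_fun f (gmul x y) =
    gmul (fmap kgroup_fun f x) (fmap kgroup_fun f y);
  gone_nat : forall (A B : kalg) (f : khom A B),
    fmap kgroup_fun f (gone A) = gone B;
  ginv_nat : forall (A B : kalg) (f : khom A B) (x : kgroup_fun A),
    fmap kgroup_fun f (ginv x) = ginv (fmap kgroup_fun f x) }.

Definition linear_algebraic_group (G : kgroup) : Prop :=
  [/\ is_scheme G, finite_type G & is_affine G].

Section Torsors.
Variable G : kgroup.

Record gspace (X : kfunctor) := GSpace {
  tot : kfunctor;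
  proj : kmor tot X;
  gact : kmor (prodF G tot) tot;
  gact1 : forall (A : kalg) (t : tot A), gact A (gone G A, t) = t;
  gactM : forall (A : kalg) (g h : G A) (t : tot A),
    gact A (gmul g h, t) = gact A (g, gact A (h, t));
  gact_proj : forall (A : kalg) (g : G A) (t : tot A),
    proj A (gact A (g, t)) = proj A t }.

Definition equivariant (X Y : kfunctor) (T : gspace X) (V : gspace Y)
    (f : kmor (tot T) (tot V)) : Prop :=
  forall (A : kalg) (g : G A) (t : tot T A),
    f A (gact T A (g, t)) = gact V A (g, f A t).

(* Isomorphism of G-schemes over X. *)
Definition gspace_iso (X : kfunctor) (T T' : gspace X) : Prop :=
  exists f : kmor (tot T) (tot T'),
    [/\ is_iso f, equivariant f & forall A t, proj T' A (f A t) = proj T A t].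

Definition trivial_proj (X : kfunctor) : kmor (prodF G X) X :=
  @KMor (prodF G X) X (fun A p => p.2) (fun _ _ _ _ => erefl).

Definition trivial_act (X : kfunctor) : kmor (prodF G (prodF G X)) (prodF G X).
Proof.
refine (@KMor (prodF G (prodF G X)) (prodF G X)
  (fun A p => (gmul p.1 p.2.1, p.2.2)) _).
by move=> A B f [g [h x]]; rewrite /= gmul_nat.
Defined.

Definition trivial_gspace (X : kfunctor) : gspace X.
Proof.
refine (@GSpace X (prodF G X) (trivial_proj X) (trivial_act X) _ _ _).
- by move=> A [h x]; rewrite /= gmul1.
- by move=> A g h [h' x]; rewrite /= gmulA.
- by [].
Defined.

Lemma base_change_subproof (X X' : kfunctor) (f : kmor X' X) (T : gspace X)
    (A : kalg) (g : G A) (p : fibre_product (proj T) f A) :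
  proj T A (gact T A (g, (sval p).1)) = f A (sval p).2.
Proof. by rewrite gact_proj; exact: (svalP p). Qed.

Definition base_change_proj (X X' : kfunctor) (f : kmor X' X) (T : gspace X) :
    kmor (fibre_product (proj T) f) X' :=
  @KMor (fibre_product (proj T) f) X' (fun A p => (sval p).2)
    (fun _ _ _ _ => erefl).

Definition base_change_act (X X' : kfunctor) (f : kmor X' X) (T : gspace X) :
  kmor (prodF G (fibre_product (proj T) f)) (fibre_product (proj T) f).
Proof.
refine (@KMor (prodF G (fibre_product (proj T) f)) (fibre_product (proj T) f)
  (fun A p => exist _ (gact T A (p.1, (sval p.2).1), (sval p.2).2)
                (base_change_subproof p.1 p.2)) _).
by move=> A B h [g [[t x] E]]; apply: sig_ext; rewrite /= -kmor_nat.
Defined.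

Definition base_change (X X' : kfunctor) (f : kmor X' X) (T : gspace X) :
  gspace X'.
Proof.
refine (@GSpace X' (fibre_product (proj T) f) (base_change_proj f T)
  (base_change_act f T) _ _ _).
- by move=> A [[t x] E]; apply: sig_ext; rewrite /= gact1.
- by move=> A g h [[t x] E]; apply: sig_ext; rewrite /= gactM.
- by [].
Defined.

Lemma shear_subproof (X : kfunctor) (T : gspace X) (A : kalg)
    (p : prodF G (tot T) A) :
  proj T A p.2 = proj T A (gact T A p).
Proof. by case: p => g t; rewrite gact_proj. Qed.

Definition shear (X : kfunctor) (T : gspace X) :
  kmor (prodF G (tot T)) (fibre_product (proj T) (proj T)).
Proof.
refine (@KMor (prodF G (tot T)) (fibre_product (proj T) (proj T))
  (fun A p => exist _ (p.2, gact T A p) (shear_subproof p)) _).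
by move=> A B h p; apply: sig_ext; rewrite /= -kmor_nat.
Defined.

Definition is_torsor (X : kfunctor) (T : gspace X) : Prop :=
  [/\ is_scheme (tot T),
      is_iso (shear T) &
      exists (X' : kfunctor) (f : kmor X' X),
        [/\ is_scheme X', is_fppf f &
            gspace_iso (base_change f T) (trivial_gspace X')]].

(* The square with sides f, proj T, y, proj V is Cartesian. *)
Definition is_cartesian (X Y : kfunctor) (T : gspace X) (V : gspace Y)
    (f : kmor (tot T) (tot V)) (y : kmor X Y) : Prop :=
  (forall (A : kalg) (t : tot T A), proj V A (f A t) = y A (proj T A t)) /\
  forall (A : kalg) (v : tot V A) (x : X A), proj V A v = y A x ->
    exists! t : tot T A, f A t = v /\ proj T A t = x.

Definition is_pullback_of (X Y : kfunctor) (T : gspace X) (V : gspace Y) : Prop :=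
  exists (y : kmor X Y) (f : kmor (tot T) (tot V)),
    equivariant f /\ is_cartesian f y.

(* The k-algebras R containing k are those with injective structure map; this
   is automatic when R is a field. *)
Definition all_torsors_pulled_back (Y : kfunctor) (V : gspace Y) (R : kalg) : Prop :=
  forall T : gspace (Spec R), is_torsor T -> is_pullback_of T V.

Definition weakly_1_versal (Y : kfunctor) (V : gspace Y) : Prop :=
  forall (K : fieldType) (iK : {rmorphism k -> K}),
    infinite_set [set: K] -> all_torsors_pulled_back V (KAlg iK).

Definition weakly_2_versal (Y : kfunctor) (V : gspace Y) : Prop :=
  forall R : kalg, injective (kalg_str R) -> is_local_ring R ->
    all_torsors_pulled_back V R.

Definition weakly_3_versal (Y : kfunctor) (V : gspace Y) : Prop :=
  forall S : kalg, injective (kalg_str S) -> is_semilocal_ring S ->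
    all_torsors_pulled_back V S.

Definition restriction (Y : kfunctor) (V : gspace Y) (U : subfun Y) :
  gspace (subF U) := base_change (incl U) V.

Definition versal_1 (Y : kfunctor) (V : gspace Y) : Prop :=
  forall U : subfun Y, is_open U -> is_dense U ->
    weakly_1_versal (restriction V U).

Definition versal_2 (Y : kfunctor) (V : gspace Y) : Prop :=
  forall U : subfun Y, is_open U -> is_dense U ->
    weakly_2_versal (restriction V U).

Definition versal_3 (Y : kfunctor) (V : gspace Y) : Prop :=
  forall U : subfun Y, is_open U -> is_dense U ->
    weakly_3_versal (restriction V U).

End Torsors.
End Schemes.

(* Main.v *)
(* Embed G in GL_n by a matrix representation rho and let G act on the algebra
   A = k[x_ij] of generic matrices.  Over the field K of G-invariant elements of
   E = Frac A the matrix x is a point of a G-torsor Spec C, with C generated by K,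
   x and x^-1; transitivity of the action is Artin's lemma on the linear
   disjointness of E and its translate over K.  Weak (1)-versality, applied to
   this torsor, gives a G-equivariant map from Spec C to V over some y0 in Y(K).

   This map spreads out.  Y being of finite type and V -> Y flat of finite
   presentation, there are a nonzero a in A, an algebra D that is free over A_a
   and embeds in a finite extension of E, and a point v of V(D) such that
   v(d2) = g v(d1) whenever d1, d2 : D -> Q satisfy d2(x) = rho(g) d1(x).

   Let now T be a torsor over a semi-local ring S, with a section t over a
   faithfully flat B.  By descent (Hilbert 90) the vectors of B^n that transform
   under rho like t span B^n; as k is infinite, some matrix m with such columns
   has a(m) invertible at a point over each maximal ideal of S.  Then D (x)_A B,
   with A -> B given by m, is faithfully flat over S, and t -> v descends to an
   equivariant map from T to V over a point of Y(S).  Everything takes place over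
   the open subset of Y containing y0, which gives the statement on restrictions. *)
Require Import Defs.
From HB Require Import structures.
From mathcomp Require Import all_boot all_order all_algebra.
From mathcomp Require Import boolp classical_sets functions cardinality.
From mathcomp Require Import ring zify.
Import Defs.
Local Open Scope classical_set_scope.

Set Implicit Arguments.
Unset Strict Implicit.
Unset Printing Implicit Defensive.

Import GRing.Theory.
Local Open Scope ring_scope.

(** * Rings presented by representatives *)

(** Several obstacles shape the argument. The group may be non-reduced or disconnected, so E ⊗ H,
    with H the coordinate algebra of G, can have zero divisors; the translate of the generic matrix
    therefore lives in a localization of E ⊗ H, and invariance and linear disjointness are tested
    there. The map V → Y is accessible only through an fppf cover over which it has a section; a
    point of that cover above y0 exists at first in some unspecified extension of E, and Zariski's
    lemma moves it to a finite one, whence D. Neither Y nor V need be separated, so two points that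
    agree over a field containing the base ring may differ: base points are compared inside one
    affine chart around y0, and points of V through the element of G that relates them. The residue
    fields of a semi-local ring are unrelated, so the conditions to be met at its maximal ideals are
    turned into conditions on coefficients in k. The commutative algebra rests on the equational
    criterion: tensor products are formed along flat maps only, and a vanishing tensor is always
    exploited through the coefficients that certify it. *)

Section Quotient.
Variables (T : Type) (R : T -> T -> Prop).

Definition quo : Type := {P : T -> Prop | exists x, P = R x}.
HB.instance Definition _ := gen_eqMixin quo.
HB.instance Definition _ := gen_choiceMixin quo.

Definition qpi (x : T) : quo := exist _ (R x) (ex_intro _ x erefl).
Definition qrepr (q : quo) : T := projT1 (cid (svalP q)).

Lemma qreprK q : qpi (qrepr q) = q.
Proof.
apply: sig_ext; rewrite /= /qrepr.
by case: cid.
Qed.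

Hypothesis Rrefl : forall x, R x x.
Hypothesis Rsym : forall x y, R x y -> R y x.
Hypothesis Rtrans : forall x y z, R x y -> R y z -> R x z.

Lemma qpiE x y : qpi x = qpi y <-> R x y.
Proof.
split=> [/(congr1 sval) /= E|xy]; first by rewrite E.
apply: sig_ext; rewrite /=; apply/funext => z; apply/propext; split.
  exact/Rtrans/Rsym.
exact: Rtrans.
Qed.

Lemma qreprE x : R (qrepr (qpi x)) x.
Proof. by apply/qpiE; rewrite qreprK. Qed.

End Quotient.

(* Rings presented by representatives: localizations, tensor products,
   quotients, subrings and products are all instances. *)
Record sring := SRing {
  ss :> Type;
  seqv : ss -> ss -> Prop;
  szero : ss; sone : ss; sopp : ss -> ss;
  sadd : ss -> ss -> ss; smul : ss -> ss -> ss;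
  srefl : forall x, seqv x x;
  ssym : forall x y, seqv x y -> seqv y x;
  strans : forall x y z, seqv x y -> seqv y z -> seqv x z;
  soppE : forall x y, seqv x y -> seqv (sopp x) (sopp y);
  saddE : forall x x' y, seqv x x' -> seqv (sadd x y) (sadd x' y);
  smulE : forall x x' y, seqv x x' -> seqv (smul x y) (smul x' y);
  saddA : forall x y z, seqv (sadd x (sadd y z)) (sadd (sadd x y) z);
  saddC : forall x y, seqv (sadd x y) (sadd y x);
  sadd0 : forall x, seqv (sadd szero x) x;
  saddN : forall x, seqv (sadd (sopp x) x) szero;
  smulA : forall x y z, seqv (smul x (smul y z)) (smul (smul x y) z);
  smulC : forall x y, seqv (smul x y) (smul y x);
  smul1 : forall x, seqv (smul sone x) x;
  smulD : forall x y z, seqv (smul (sadd x y) z) (sadd (smul x z) (smul y z)) }.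

Section SRingTheory.
Variable X : sring.

Definition qring : Type := quo (@seqv X).
HB.instance Definition _ := Choice.on qring.
Definition rpi (x : X) : qring := qpi (@seqv X) x.
Definition rrepr (q : qring) : X := qrepr q.

Lemma rreprK q : rpi (rrepr q) = q. Proof. exact: qreprK. Qed.
Lemma rpiE x y : rpi x = rpi y <-> seqv x y.
Proof. exact: qpiE (@srefl X) (@ssym X) (@strans X) x y. Qed.
Lemma rreprE x : seqv (rrepr (rpi x)) x.
Proof. exact: qreprE (@srefl X) (@ssym X) (@strans X) x. Qed.

Definition qadd (a b : qring) := rpi (sadd (rrepr a) (rrepr b)).
Definition qmul (a b : qring) := rpi (smul (rrepr a) (rrepr b)).
Definition qopp (a : qring) := rpi (sopp (rrepr a)).

Lemma qaddE x y : qadd (rpi x) (rpi y) = rpi (sadd x y).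
Proof.
apply/rpiE; apply: (@strans _ _ (sadd x (rrepr (rpi y)))).
  exact/saddE/rreprE.
apply: strans (saddC _ _) _; apply: strans (saddC y x).
exact/saddE/rreprE.
Qed.

Lemma qmulE x y : qmul (rpi x) (rpi y) = rpi (smul x y).
Proof.
apply/rpiE; apply: (@strans _ _ (smul x (rrepr (rpi y)))).
  exact/smulE/rreprE.
apply: strans (smulC _ _) _; apply: strans (smulC y x).
exact/smulE/rreprE.
Qed.

Lemma qoppE x : qopp (rpi x) = rpi (sopp x).
Proof. by apply/rpiE/soppE/rreprE. Qed.

Lemma rpi_surj (q : qring) : exists x, q = rpi x.
Proof. by exists (rrepr q); rewrite rreprK. Qed.

Fact qaddA : associative qadd.
Proof.
move=> a b c; have [x ->] := rpi_surj a; have [y ->] := rpi_surj b.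
by have [z ->] := rpi_surj c; rewrite !qaddE; apply/rpiE/saddA.
Qed.
Fact qaddC : commutative qadd.
Proof.
move=> a b; have [x ->] := rpi_surj a; have [y ->] := rpi_surj b.
by rewrite !qaddE; apply/rpiE/saddC.
Qed.
Fact qadd0 : left_id (rpi (szero X)) qadd.
Proof. by move=> a; have [x ->] := rpi_surj a; rewrite !qaddE; apply/rpiE/sadd0. Qed.
Fact qaddN : left_inverse (rpi (szero X)) qopp qadd.
Proof.
by move=> a; have [x ->] := rpi_surj a; rewrite qoppE !qaddE; apply/rpiE/saddN.
Qed.
Fact qmulA : associative qmul.
Proof.
move=> a b c; have [x ->] := rpi_surj a; have [y ->] := rpi_surj b.
by have [z ->] := rpi_surj c; rewrite !qmulE; apply/rpiE/smulA.
Qed.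
Fact qmulC : commutative qmul.
Proof.
move=> a b; have [x ->] := rpi_surj a; have [y ->] := rpi_surj b.
by rewrite !qmulE; apply/rpiE/smulC.
Qed.
Fact qmul1 : left_id (rpi (sone X)) qmul.
Proof. by move=> a; have [x ->] := rpi_surj a; rewrite !qmulE; apply/rpiE/smul1. Qed.
Fact qmulD : left_distributive qmul qadd.
Proof.
move=> a b c; have [x ->] := rpi_surj a; have [y ->] := rpi_surj b.
by have [z ->] := rpi_surj c; rewrite !(qmulE, qaddE); apply/rpiE/smulD.
Qed.

HB.instance Definition _ := GRing.isZmodule.Build qring qaddA qaddC qadd0 qaddN.
HB.instance Definition _ :=
  GRing.Zmodule_isComPzRing.Build qring qmulA qmulC qmul1 qmulD.

Lemma rpiD x y : rpi (sadd x y) = rpi x + rpi y. Proof. by rewrite -qaddE. Qed.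
Lemma rpiM x y : rpi (smul x y) = rpi x * rpi y. Proof. by rewrite -qmulE. Qed.
Lemma rpi0 : rpi (szero X) = 0. Proof. by []. Qed.
Lemma rpi1 : rpi (sone X) = 1. Proof. by []. Qed.
Lemma rpiN x : rpi (sopp x) = - rpi x. Proof. by rewrite -qoppE. Qed.

End SRingTheory.

Section Homs.
Variables (R S : comPzRingType) (f : R -> S).
Hypothesis (fD : forall x y, f (x + y) = f x + f y).
Hypothesis (fM : forall x y, f (x * y) = f x * f y) (f1 : f 1 = 1).

Definition hom_fun := f.
Fact hom_zmod : zmod_morphism hom_fun.
Proof.
have f0 : f 0 = 0 by apply: (@addrI _ (f 0)); rewrite -fD !addr0.
move=> x y; apply: (@addIr _ (f y)); rewrite /hom_fun -fD addrNK.
by rewrite addrNK.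
Qed.
Fact hom_mon : monoid_morphism hom_fun. Proof. by split. Qed.
HB.instance Definition _ := GRing.isZmodMorphism.Build R S hom_fun hom_zmod.
HB.instance Definition _ := GRing.isMonoidMorphism.Build R S hom_fun hom_mon.
Definition mk_hom : {rmorphism R -> S} := hom_fun.
End Homs.

Section KAlgebras.
Variable k : fieldType.
Implicit Types A B C : kalg k.

Definition mk_kalg (R : comPzRingType) (f : k -> R) fD fM f1 : kalg k :=
  KAlg (@mk_hom k R f fD fM f1).

Definition mk_khom A B (f : A -> B) fD fM f1
    (fk : forall c, f (kalg_str A c) = kalg_str B c) : khom A B :=
  @KHom k A B (@mk_hom A B f fD fM f1) fk.

Lemma khomP A B (f g : khom A B) : (forall x, f x = g x) -> f = g.
Proof. exact: khom_ext. Qed.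

Lemma kcompE A B C (g : khom B C) (f : khom A B) x : kcomp g f x = g (f x).
Proof. by []. Qed.

Lemma kcompA A B C D (h : khom C D) (g : khom B C) (f : khom A B) :
  kcomp h (kcomp g f) = kcomp (kcomp h g) f.
Proof. exact: khom_ext. Qed.

Lemma kcompid A B (f : khom A B) : kcomp f (kid A) = f.
Proof. exact: khom_ext. Qed.

Lemma kidcomp A B (f : khom A B) : kcomp (kid B) f = f.
Proof. exact: khom_ext. Qed.

Lemma khom_comp_eq A B B' C (f : khom B C) (f' : khom B' C) (g : khom A B)
    (g' : khom A B') :
  kcomp f g = kcomp f' g' -> forall x, f (g x) = f' (g' x).
Proof. by move=> E x; rewrite -kcompE E. Qed.

End KAlgebras.

(** * Subalgebras, quotients, products and localizations *)

Section Constructions.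
Variable k : fieldType.
Implicit Types A B C : kalg k.

Definition is_subalg A (U : set A) : Prop :=
  [/\ forall c, U (kalg_str A c), forall x y, U x -> U y -> U (x + y),
      forall x, U x -> U (- x) & forall x y, U x -> U y -> U (x * y)].

Lemma subalg0 A (U : set A) : is_subalg U -> U 0.
Proof. by case=> + _ _ _ => /(_ 0); rewrite rmorph0. Qed.

Lemma subalg1 A (U : set A) : is_subalg U -> U 1.
Proof. by case=> + _ _ _ => /(_ 1); rewrite rmorph1. Qed.

Lemma subalgD A (U : set A) x y : is_subalg U -> U x -> U y -> U (x + y).
Proof. by case=> _ h _ _; apply: h. Qed.

Lemma subalgN A (U : set A) x : is_subalg U -> U x -> U (- x).
Proof. by case=> _ _ h _; apply: h. Qed.

Lemma subalgM A (U : set A) x y : is_subalg U -> U x -> U y -> U (x * y).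
Proof. by case=> _ _ _ h; apply: h. Qed.

Lemma subalg_sum A (U : set A) (I : Type) (r : seq I) (P : pred I) (F : I -> A) :
  is_subalg U -> (forall i, U (F i)) -> U (\sum_(i <- r | P i) F i).
Proof.
move=> sU UF; apply: big_ind => //; first exact: subalg0.
by case: sU.
Qed.

Section Sub.
Variables (A : kalg k) (U : set A) (sU : is_subalg U).

(** A subalgebra is presented as a quotient as well, of a sigma type by equality of values, so that
    [qring] supplies the choice structure that a ring must carry. *)
Definition sub_sring : sring.
Proof.
refine (@SRing {x | U x} (fun x y => sval x = sval y)
  (exist _ 0 (subalg0 sU)) (exist _ 1 (subalg1 sU))
  (fun x => exist _ (- sval x) (subalgN sU (svalP x)))
  (fun x y => exist _ (sval x + sval y) (subalgD sU (svalP x) (svalP y)))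
  (fun x y => exist _ (sval x * sval y) (subalgM sU (svalP x) (svalP y)))
  _ _ _ _ _ _ _ _ _ _ _ _ _ _); rewrite //=.
- by move=> [x ?] [y ?] [z ?] /= -> ->.
- by move=> [x ?] [y ?] /= ->.
- by move=> [x ?] [y ?] [z ?] /= ->.
- by move=> [x ?] [y ?] [z ?] /= ->.
- by move=> [x ?] [y ?] [z ?] /=; rewrite addrA.
- by move=> [x ?] [y ?] /=; rewrite addrC.
- by move=> [x ?] /=; rewrite add0r.
- by move=> [x ?] /=; rewrite addNr.
- by move=> [x ?] [y ?] [z ?] /=; rewrite mulrA.
- by move=> [x ?] [y ?] /=; rewrite mulrC.
- by move=> [x ?] /=; rewrite mul1r.
- by move=> [x ?] [y ?] [z ?] /=; rewrite mulrDl.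
Defined.

Definition sub_str (c : k) : qring sub_sring :=
  rpi (exist _ (kalg_str A c) (let: And4 h _ _ _ := sU in h c) : sub_sring).

Definition sub_kalg : kalg k.
Proof.
apply: (@mk_kalg k (qring sub_sring) sub_str).
- by move=> x y; rewrite -rpiD; apply/rpiE; rewrite /= rmorphD.
- by move=> x y; rewrite -rpiM; apply/rpiE; rewrite /= rmorphM.
- by rewrite -rpi1; apply/rpiE; rewrite /= rmorph1.
Defined.

Definition sub_val_fun (x : sub_kalg) : A := sval (rrepr x).

Lemma sub_val_pi (x : sub_sring) : sub_val_fun (rpi x) = sval x.
Proof. exact: (rreprE x). Qed.

Definition sub_val : khom sub_kalg A.
Proof.
apply: (@mk_khom k sub_kalg A sub_val_fun).
- move=> a b; have [x ->] := rpi_surj a; have [y ->] := rpi_surj b.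
  by rewrite -rpiD !sub_val_pi.
- move=> a b; have [x ->] := rpi_surj a; have [y ->] := rpi_surj b.
  by rewrite -rpiM !sub_val_pi.
- by rewrite -rpi1 sub_val_pi.
- by move=> c; rewrite /= /sub_str sub_val_pi.
Defined.

Lemma sub_val_inj : injective sub_val.
Proof.
move=> a b; have [x ->] := rpi_surj a; have [y ->] := rpi_surj b.
by rewrite /= /hom_fun !sub_val_pi => E; apply/rpiE.
Qed.

Lemma sub_valP x : U (sub_val x).
Proof. exact: svalP (rrepr x). Qed.

Lemma sub_val_surj x : U x -> exists y, sub_val y = x.
Proof.
by move=> Ux; exists (rpi (exist _ x Ux : sub_sring)); exact: sub_val_pi.
Qed.

End Sub.

Lemma factor_inj A B C (i : khom B C) (f : khom A C) :
  injective i -> (forall a, exists b, i b = f a) ->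
  exists h : khom A B, forall a, i (h a) = f a.
Proof.
move=> inj_i im.
pose h a := projT1 (cid (im a)).
have hE a : i (h a) = f a by rewrite /h; case: cid.
unshelve eexists.
  apply: (@mk_khom k A B h).
  - by move=> x y; apply: inj_i; rewrite rmorphD !hE rmorphD.
  - by move=> x y; apply: inj_i; rewrite rmorphM !hE rmorphM.
  - by apply: inj_i; rewrite !hE !rmorph1.
  - by move=> c; apply: inj_i; rewrite !hE !khom_str.
exact: hE.
Qed.

Lemma factor_surj A B C (p : khom A B) (f : khom A C) :
  (forall b, exists a, p a = b) -> (forall a, p a = 0 -> f a = 0) ->
  exists h : khom B C, forall a, h (p a) = f a.
Proof.
move=> sur_p ker.
pose r b := projT1 (cid (sur_p b)).
have rE b : p (r b) = b by rewrite /r; case: cid.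
have fE x y : p x = p y -> f x = f y.
  move=> E; apply: subr0_eq; rewrite -rmorphB; apply: ker.
  by rewrite rmorphB E subrr.
unshelve eexists.
  apply: (@mk_khom k B C (fun b => f (r b))).
  - by move=> x y; rewrite -rmorphD; apply: fE; rewrite rmorphD !rE.
  - by move=> x y; rewrite -rmorphM; apply: fE; rewrite rmorphM !rE.
  - by rewrite -(rmorph1 f); apply: fE; rewrite !rE rmorph1.
  - by move=> c; rewrite -(khom_str f); apply: fE; rewrite rE khom_str.
by move=> a; apply: fE; rewrite rE.
Qed.

(** Reduces lifting to generators: together with [factor_inj], a map lifts through an injection as
    soon as the images of generators do. *)
Lemma subalg_lift A B C (f : khom A C) (g : khom B C) :
  is_subalg [set b | exists a, f a = g b].
Proof.
split=> [c|u v [a ua] [b vb]|u [a ua]|u v [a ua] [b vb]].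
- by exists (kalg_str _ c); rewrite !khom_str.
- by exists (a + b); rewrite !rmorphD ua vb.
- by exists (- a); rewrite !rmorphN ua.
- by exists (a * b); rewrite !rmorphM ua vb.
Qed.

Lemma subalg_range A B (f : khom A B) : is_subalg [set b | exists a, f a = b].
Proof. exact: (subalg_lift f (kid B)). Qed.

Lemma subalg_preim A B (f : khom A B) (U : set B) :
  is_subalg U -> is_subalg [set a | U (f a)].
Proof.
move=> sU; split=> [c|u v|u|u v] /=; first by rewrite khom_str; case: sU.
- by rewrite rmorphD; exact: subalgD.
- by rewrite rmorphN; exact: subalgN.
- by rewrite rmorphM; exact: subalgM.
Qed.

Lemma subalg_eq A B (f g : khom A B) : is_subalg [set a | f a = g a].
Proof.
split=> [c|u v|u|u v] /=; first by rewrite !khom_str.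
- by rewrite !rmorphD => -> ->.
- by rewrite !rmorphN => ->.
- by rewrite !rmorphM => -> ->.
Qed.

Section Quot.
Variables (A : kalg k) (I : set A) (hI : is_ideal I).

Lemma ideal0 : I 0. Proof. by case: hI. Qed.
Lemma idealD x y : I x -> I y -> I (x + y). Proof. by case: hI => _ h _; apply: h. Qed.
Lemma idealM a x : I x -> I (a * x). Proof. by case: hI => _ _; apply. Qed.
Lemma idealMr a x : I x -> I (x * a). Proof. by rewrite mulrC; exact: idealM. Qed.
Lemma idealN x : I x -> I (- x). Proof. by rewrite -mulN1r; exact: idealM. Qed.
Lemma idealB x y : I x -> I y -> I (x - y).
Proof. by move=> Ix Iy; apply: idealD => //; exact: idealN. Qed.
Lemma ideal_sum (J : Type) (r : seq J) (P : pred J) (F : J -> A) :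
  (forall i, I (F i)) -> I (\sum_(i <- r | P i) F i).
Proof. by move=> IF; apply: big_ind => //; [exact: ideal0 | exact: idealD]. Qed.

Definition quot_sring : sring.
Proof.
refine (@SRing A (fun x y => I (x - y)) 0 1 -%R +%R *%R
  _ _ _ _ _ _ _ _ _ _ _ _ _ _).
- by move=> x; rewrite subrr; exact: ideal0.
- by move=> x y /idealN; rewrite opprB.
- by move=> x y z xy yz; have := idealD xy yz; rewrite addrA addrNK.
- by move=> x y /idealN; rewrite opprB opprK addrC.
- by move=> x x' y; rewrite opprD addrACA subrr addr0.
- by move=> x x' y xx; rewrite -mulrBl; exact: idealMr.
all: move=> *; suff E0 : forall z, z = 0 -> I z by apply: E0; ring.
all: by move=> _ ->; exact: ideal0.
Defined.

Definition quot_kalg : kalg k.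
Proof.
apply: (@mk_kalg k (qring quot_sring) (fun c => rpi (kalg_str A c : quot_sring))).
- by move=> x y; rewrite rmorphD -rpiD.
- by move=> x y; rewrite rmorphM -rpiM.
- by rewrite rmorph1.
Defined.

Definition quot_pi : khom A quot_kalg.
Proof.
apply: (@mk_khom k A quot_kalg (fun x => rpi (x : quot_sring))) => //.
- by move=> x y; rewrite -rpiD.
- by move=> x y; rewrite -rpiM.
Defined.

Lemma quot_pi_surj q : exists x, quot_pi x = q.
Proof. by have [x ->] := rpi_surj q; exists x. Qed.

Lemma quot_pi0 x : quot_pi x = 0 <-> I x.
Proof.
rewrite -[0]rpi0 /= /hom_fun rpiE /= subr0.
by split.
Qed.

End Quot.

Section Product.
Variables A B : kalg k.

Definition prod_sring : sring.
Proof.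
refine (@SRing (A * B)%type eq 0 1
  -%R +%R *%R _ _ _ _ _ _ _ _ _ _ _ _ _ _); try by move=> *; congruence.
- exact: addrA.
- exact: addrC.
- exact: add0r.
- exact: addNr.
- exact: mulrA.
- exact: mulrC.
- exact: mul1r.
- exact: mulrDl.
Defined.

Definition prod_kalg : kalg k.
Proof.
apply: (@mk_kalg k (qring prod_sring)
  (fun c => rpi ((kalg_str A c, kalg_str B c) : prod_sring))).
- by move=> x y; rewrite !rmorphD -rpiD.
- by move=> x y; rewrite !rmorphM -rpiM.
- by rewrite !rmorph1.
Defined.

Definition prod_pair (a : A) (b : B) : prod_kalg := rpi ((a, b) : prod_sring).

Lemma prod_fstE (x : prod_sring) : rrepr (rpi x) = x.
Proof. exact: (rreprE x). Qed.

Definition prod_fst : khom prod_kalg A.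
Proof.
apply: (@mk_khom k prod_kalg A (fun x => (rrepr x).1)).
- move=> a b; have [x ->] := rpi_surj a; have [y ->] := rpi_surj b.
  by rewrite -rpiD !prod_fstE.
- move=> a b; have [x ->] := rpi_surj a; have [y ->] := rpi_surj b.
  by rewrite -rpiM !prod_fstE.
- by rewrite -rpi1 prod_fstE.
- by move=> c /=; rewrite prod_fstE.
Defined.

Definition prod_snd : khom prod_kalg B.
Proof.
apply: (@mk_khom k prod_kalg B (fun x => (rrepr x).2)).
- move=> a b; have [x ->] := rpi_surj a; have [y ->] := rpi_surj b.
  by rewrite -rpiD !prod_fstE.
- move=> a b; have [x ->] := rpi_surj a; have [y ->] := rpi_surj b.
  by rewrite -rpiM !prod_fstE.
- by rewrite -rpi1 prod_fstE.
- by move=> c /=; rewrite prod_fstE.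
Defined.

Lemma prod_fst_pair a b : prod_fst (prod_pair a b) = a.
Proof. by rewrite /= /hom_fun prod_fstE. Qed.
Lemma prod_snd_pair a b : prod_snd (prod_pair a b) = b.
Proof. by rewrite /= /hom_fun prod_fstE. Qed.
Lemma prod_eq x y : prod_fst x = prod_fst y -> prod_snd x = prod_snd y -> x = y.
Proof.
have [[a b] ->] := rpi_surj x; have [[c d] ->] := rpi_surj y.
by rewrite /= /hom_fun !prod_fstE /= => -> ->.
Qed.

Lemma prod_lift C (f : khom C A) (g : khom C B) :
  exists h : khom C prod_kalg, kcomp prod_fst h = f /\ kcomp prod_snd h = g.
Proof.
unshelve eexists.
  apply: (@mk_khom k C prod_kalg (fun c => prod_pair (f c) (g c))).
  - by move=> x y; rewrite !rmorphD -rpiD.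
  - by move=> x y; rewrite !rmorphM -rpiM.
  - by rewrite !rmorph1.
  - by move=> c; rewrite !khom_str.
by split; apply: khomP => c; rewrite kcompE (prod_fst_pair, prod_snd_pair).
Qed.

End Product.

Definition is_mult A (M : set A) := M 1 /\ forall x y, M x -> M y -> M (x * y).

Section Localization.
Variables (A : kalg k) (M : set A) (hM : is_mult M).

Let den := {s : A | M s}.
Let dmul (s t : den) : den :=
  exist _ (sval s * sval t) (hM.2 _ _ (svalP s) (svalP t)).
Let done : den := exist _ 1 hM.1.

Definition loc_sring : sring.
Proof.
refine (@SRing (A * den)%type
  (fun x y => exists u, M u /\ u * (x.1 * sval y.2 - y.1 * sval x.2) = 0)
  (0, done) (1, done)
  (fun x => (- x.1, x.2))
  (fun x y => (x.1 * sval y.2 + y.1 * sval x.2, dmul x.2 y.2))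
  (fun x y => (x.1 * y.1, dmul x.2 y.2))
  _ _ _ _ _ _ _ _ _ _ _ _ _ _).
- by move=> x; exists 1; split; [exact: hM.1 | rewrite subrr mulr0].
- move=> x y [u [Mu E]]; exists u; split=> //.
  by rewrite -opprB mulrN E oppr0.
- move=> [a [s Ms]] [b [t Mt]] [c [r Mr]] [u [Mu /= E]] [v [Mv /= E']].
  exists (u * v * t); split; first by do 2?[apply: hM.2].
  transitivity ((u * (a * t - b * s)) * (v * r) + (v * (b * r - c * t)) * (u * s)).
    by ring.
  by rewrite E E' !mul0r addr0.
- move=> [a [s Ms]] [b [t Mt]] [u [Mu /= E]]; exists u; split=> //=.
  by transitivity (- (u * (a * t - b * s))); [ring | rewrite E oppr0].
- move=> [a [s Ms]] [b [t Mt]] [c [r Mr]] [u [Mu /= E]]; exists u; split=> //=.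
  transitivity ((u * (a * t - b * s)) * (r * r)); first by ring.
  by rewrite E mul0r.
- move=> [a [s Ms]] [b [t Mt]] [c [r Mr]] [u [Mu /= E]]; exists u; split=> //=.
  transitivity ((u * (a * t - b * s)) * (c * r)); first by ring.
  by rewrite E mul0r.
all: by move=> *; exists 1; split; [exact: hM.1 | rewrite /=; ring].
Defined.

Definition loc_frac (a : A) (s : A) (Ms : M s) : qring loc_sring :=
  rpi ((a, exist _ s Ms) : loc_sring).

Definition loc_kalg : kalg k.
Proof.
apply: (@mk_kalg k (qring loc_sring) (fun c => loc_frac (kalg_str A c) hM.1)).
- move=> x y; rewrite -rpiD; apply/rpiE; exists 1; split; first exact: hM.1.
  by rewrite /= rmorphD; ring.
- move=> x y; rewrite -rpiM; apply/rpiE; exists 1; split; first exact: hM.1.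
  by rewrite /= rmorphM; ring.
- rewrite -rpi1; apply/rpiE; exists 1; split; first exact: hM.1.
  by rewrite /= rmorph1; ring.
Defined.

Definition loc_in : khom A loc_kalg.
Proof.
apply: (@mk_khom k A loc_kalg (fun a => loc_frac a hM.1)) => //.
- move=> x y; rewrite -rpiD; apply/rpiE; exists 1; split; first exact: hM.1.
  by rewrite /=; ring.
- move=> x y; rewrite -rpiM; apply/rpiE; exists 1; split; first exact: hM.1.
  by rewrite /=; ring.
Defined.

Lemma loc_eq0 a : loc_in a = 0 <-> exists2 u, M u & u * a = 0.
Proof.
rewrite -[X in _ = X]rpi0 /= /hom_fun /loc_frac rpiE /=; split.
  by move=> [u [Mu]]; rewrite mul0r subr0 mulr1; exists u.
by move=> [u Mu E]; exists u; split=> //; rewrite mul0r subr0 mulr1.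
Qed.

Lemma loc_unit s : M s -> is_unit (loc_in s).
Proof.
move=> Ms; exists (loc_frac 1 Ms); rewrite -rpiM -[RHS]rpi1; apply/rpiE.
by exists 1; split; [exact: hM.1 | rewrite /=; ring].
Qed.

Lemma loc_fracP (x : loc_kalg) : exists a s, M s /\ x * loc_in s = loc_in a.
Proof.
have [[a [s Ms]] ->] := rpi_surj x; exists a, s; split=> //.
rewrite -rpiM; apply/rpiE.
by exists 1; split; [exact: hM.1 | rewrite /=; ring].
Qed.

Lemma unit_mulI (R : comPzRingType) (u x y : R) : is_unit u -> x * u = y * u -> x = y.
Proof. by move=> [v uv] /(congr1 (fun z => z * v)); rewrite -!mulrA uv !mulr1. Qed.

Lemma loc_ext C (f g : khom loc_kalg C) : kcomp f loc_in = kcomp g loc_in -> f = g.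
Proof.
move=> E; apply: khomP => x; have [a [s [Ms xs]]] := loc_fracP x.
have us : is_unit (f (loc_in s)).
  by have [v uv] := loc_unit Ms; exists (f v); rewrite -rmorphM uv rmorph1.
have fg := khom_comp_eq E.
by apply: (unit_mulI us); rewrite -rmorphM xs fg -xs rmorphM fg.
Qed.

Lemma loc_lift C (f : khom A C) : (forall s, M s -> is_unit (f s)) ->
  exists h : khom loc_kalg C, kcomp h loc_in = f.
Proof.
move=> uf.
(* The value at x is characterized by all fractions that represent x at once, so the choice of it
   below depends on no presentation. *)
have P x : exists y, forall a s, M s -> x * loc_in s = loc_in a -> y * f s = f a.
  have [b [t [Mt xt]]] := loc_fracP x; have [v vt] := uf t Mt.
  exists (f b * v) => a s Ms xs.
  have : loc_in (b * s - a * t) = 0.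
    by rewrite rmorphB !rmorphM -xt -xs; ring.
  move/loc_eq0 => [u Mu]; have [w uw] := uf u Mu.
  move/(congr1 f)/(congr1 (fun z => w * v * z)).
  rewrite rmorph0 mulr0 rmorphM rmorphB !rmorphM => E; apply: subr0_eq.
  transitivity (f u * w * (f b * v * f s - f a * (f t * v))).
    by rewrite uw mul1r vt mulr1.
  by rewrite -E; ring.
pose h x := projT1 (cid (P x)).
have hE x a s : M s -> x * loc_in s = loc_in a -> h x * f s = f a.
  by move=> Ms; rewrite /h; case: cid => y hy /= /hy; apply.
unshelve eexists.
  apply: (@mk_khom k loc_kalg C h).
  - move=> x y; have [a [s [Ms xs]]] := loc_fracP x; have [b [t [Mt yt]]] := loc_fracP y.
    apply: (unit_mulI (uf _ (hM.2 _ _ Ms Mt))).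
    rewrite (@hE _ (a * t + b * s)); last 2 first.
    + exact: hM.2.
    + by rewrite rmorphD !rmorphM -xs -yt; ring.
    by rewrite !rmorphD !rmorphM -(hE _ _ _ Ms xs) -(hE _ _ _ Mt yt); ring.
  - move=> x y; have [a [s [Ms xs]]] := loc_fracP x; have [b [t [Mt yt]]] := loc_fracP y.
    apply: (unit_mulI (uf _ (hM.2 _ _ Ms Mt))).
    rewrite (@hE _ (a * b)); last 2 first.
    + exact: hM.2.
    + by rewrite !rmorphM -xs -yt; ring.
    by rewrite !rmorphM -(hE _ _ _ Ms xs) -(hE _ _ _ Mt yt); ring.
  - by have := hE 1 1 1 hM.1; rewrite !rmorph1 !mulr1; apply.
  - move=> c; have := hE (kalg_str _ c) (kalg_str _ c) 1 hM.1.
    by rewrite !rmorph1 !mulr1 !khom_str; apply.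
apply: khomP => a /=; rewrite /hom_fun.
by have := hE (loc_in a) a 1 hM.1; rewrite !rmorph1 !mulr1; apply.
Qed.

End Localization.
End Constructions.

Global Opaque sub_kalg sub_val quot_kalg quot_pi.
Global Opaque prod_kalg prod_pair prod_fst prod_snd loc_kalg loc_in.

(** * Tensor products along flat homomorphisms *)

Section Tensor.
Variable k : fieldType.

(* The equational criterion for flatness: every linear relation over [A]
   between elements of [B] comes from relations in [A]. *)
Definition eqflat (A B : kalg k) (phi : khom A B) : Prop :=
  forall (I : finType) (a : I -> A) (b : I -> B),
    \sum_i phi (a i) * b i = 0 ->
    exists (J : finType) (c : J -> B) (s : I -> J -> A),
      (forall i, b i = \sum_l phi (s i l) * c l) /\
      (forall l, \sum_i a i * s i l = 0).

Lemma map_enum_inv (I : finType) (T U : Type) (g : I -> U) (f : T -> U) (N : seq T) :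
  [seq g i | i <- enum I] = map f N -> exists h : I -> T, N = [seq h i | i <- enum I].
Proof.
move=> E; case: (pickP I) => [i0 _|noI]; last first.
  have e0 : enum I = [::] by apply/nilP; rewrite /nilp -cardE (eq_card0 noI).
  by move: E; rewrite e0; case: N => //= _; exists (fun i => False_rect T (Bool.diff_true_false (noI i))).
have szN : size N = #|I| by rewrite cardE -(size_map g) E size_map.
case: N E szN => [|t0 N0] E szN.
  by have := max_card (pred1 i0); rewrite card1 -szN.
move: (t0 :: N0) E szN => {N0} N E szN.
exists (fun i => nth t0 N (index i (enum I))).
apply: (@eq_from_nth _ t0) => [|j jN]; first by rewrite size_map -cardE.
rewrite szN cardE in jN.
by rewrite (nth_map i0) // index_uniq // enum_uniq.
Qed.

Section Triv.
Variables (A B C : kalg k) (psi : khom A C) (phi : khom A B).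

(* [triv L] certifies that the tensor sum of the c (x) b, (c, b) in L, vanishes
   in the tensor product of [C] and [B] over [A]; when [B] is flat over [A] this
   sufficient condition is also necessary, and it serves to define the tensor
   product. *)
Definition triv (L : seq (C * B)) : Prop :=
  exists (J : finType) (c : J -> B) (L' : seq (C * (J -> A))),
    L = [seq (x.1, \sum_l phi (x.2 l) * c l) | x <- L'] /\
    forall l, \sum_(x <- L') psi (x.2 l) * x.1 = 0.

Lemma triv_nil : triv [::].
Proof. by exists 'I_0, (fun=> 0), [::]; split=> // l; rewrite big_nil. Qed.

Lemma triv_fin (I : finType) (p : I -> C) (b : I -> B) :
  triv [seq (p i, b i) | i <- enum I] ->
  exists (J : finType) (c : J -> B) (s : I -> J -> A),
    (forall i, b i = \sum_l phi (s i l) * c l) /\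
    (forall l, \sum_i psi (s i l) * p i = 0).
Proof.
move=> [J [c [L' [E Z]]]]; have [h Eh] := map_enum_inv E.
exists J, c, (fun i => (h i).2).
have EE i : (p i, b i) = ((h i).1, \sum_l phi ((h i).2 l) * c l).
  move: E; rewrite Eh -map_comp => /eq_in_map; apply.
  by rewrite mem_enum.
split=> [i|l]; first by have [_ ->] := EE i.
rewrite -[RHS](Z l) Eh big_map big_enum /=.
by apply: eq_bigr => i _; have [-> _] := EE i.
Qed.

Lemma triv_cat L M : triv L -> triv M -> triv (L ++ M).
Proof.
move=> [J [c [L' [-> Z]]]] [K [d [M' [-> Z']]]].
exists (J + K)%type, (fun l => match l with inl j => c j | inr h => d h end).
exists ([seq (x.1, (fun l : J + K => if l is inl j then x.2 j else 0)) | x <- L'] ++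
   [seq (x.1, (fun l : J + K => if l is inr j then x.2 j else 0)) | x <- M']).
split.
  rewrite map_cat -!map_comp; congr (_ ++ _); apply: eq_map => x /=;
    rewrite big_sumType /=.
    rewrite [X in _ + X]big1 ?addr0 // => i _; by rewrite rmorph0 mul0r.
  rewrite [X in X + _]big1 ?add0r // => i _; by rewrite rmorph0 mul0r.
case=> l; rewrite big_cat /= !big_map /=.
  rewrite Z add0r big1 // => x _; by rewrite rmorph0 mul0r.
rewrite Z' addr0 big1 // => x _; by rewrite rmorph0 mul0r.
Qed.

Lemma triv_perm L M : perm_eq L M -> triv L -> triv M.
Proof.
rewrite perm_sym => LM [J [c [L' [E Z]]]].
case: L' E Z => [|x0 L'] E Z.
  by move: LM; rewrite E => /perm_nilP ->; exact: triv_nil.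
have /(perm_iotaP (x0.1, \sum_l phi (x0.2 l) * c l)) [Is pIs ->] := LM.
exists J, c, [seq nth x0 (x0 :: L') i | i <- Is]; split.
  rewrite -map_comp; apply/eq_in_map => i; rewrite (perm_mem pIs) mem_iota /= E.
  by move=> iL; rewrite (nth_map x0) // -(size_map (fun x => (x.1, \sum_l phi (x.2 l) * c l))).
move=> l; rewrite -[RHS](Z l) big_map (perm_big _ pIs) /=.
by rewrite (big_nth x0) E size_map /index_iota subn0.
Qed.

Definition negt (L : seq (C * B)) := [seq (- x.1, x.2) | x <- L].

Lemma triv_pair p b : triv [:: (p, b); (- p, b)].
Proof.
exists 'I_1, (fun=> b), [:: (p, fun=> 1); (- p, fun=> 1)]; split.
  by rewrite /= !big_ord_recl !big_ord0 !addr0 rmorph1 mul1r.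
by move=> l; rewrite !big_cons big_nil rmorph1 !mul1r addr0 subrr.
Qed.

Lemma triv_self L : triv (L ++ negt L).
Proof.
elim: L => [|[p b] L IH]; first exact: triv_nil.
apply: triv_perm (triv_cat (triv_pair p b) IH).
rewrite /= perm_cons; apply/permP => P.
by rewrite /= !count_cat /=; lia.
Qed.

Lemma triv_neg L : triv L -> triv (negt L).
Proof.
move=> [J [c [L' [-> Z]]]]; exists J, c, [seq (- x.1, x.2) | x <- L'].
split; first by rewrite /negt -!map_comp.
move=> l; rewrite big_map /= -[RHS]oppr0 -[in RHS](Z l) -[RHS]sumrN.
by apply: eq_bigr => x _; rewrite mulrN.
Qed.

Lemma negtK L : negt (negt L) = L.
Proof. by rewrite /negt -map_comp map_id_in // => -[x y] _ /=; rewrite opprK. Qed.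

Lemma negt_cat L M : negt (L ++ M) = negt L ++ negt M.
Proof. exact: map_cat. Qed.

Hypothesis flat : eqflat phi.

(** Here flatness enters, and through it the transitivity of equality of tensors. The two
    expressions of b through the c_l give a relation Σ (u_l - v_l) c_l = 0; writing the c_l through
    elements d_h with coefficients that kill u - v makes the contribution of p disappear. *)
Lemma triv_cancel1 p b L : triv ((p, b) :: (- p, b) :: L) -> triv L.
Proof.
move=> [J [c [L'' [E Z]]]].
case: L'' E Z => [|[p1 u] [|[p2 v] L']] //= [<- Eu <- Ev ->] Z.
have rel : \sum_l phi (u l - v l) * c l = 0.
  under eq_bigr do rewrite rmorphB mulrBl.
  by rewrite sumrB -Eu -Ev subrr.
have [K [d [s [Es Zs]]]] := flat rel.
exists K, d, [seq (x.1, fun h => \sum_l x.2 l * s l h) | x <- L']; split.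
  rewrite -map_comp; apply: eq_map => x /=; congr pair.
  under eq_bigr do rewrite Es mulr_sumr.
  rewrite exchange_big /=; apply: eq_bigr => h _.
  rewrite rmorph_sum /= mulr_suml; apply: eq_bigr => l _.
  by rewrite rmorphM mulrA.
move=> h; rewrite big_map /=.
transitivity (\sum_l psi (s l h) * \sum_(x <- L') psi (x.2 l) * x.1).
  under [RHS]eq_bigr do rewrite mulr_sumr.
  rewrite [RHS]exchange_big /=; apply: eq_bigr => x _.
  rewrite rmorph_sum /= mulr_suml; apply: eq_bigr => l _.
  by rewrite rmorphM mulrCA mulrA.
transitivity (\sum_l psi (s l h) * (psi (v l - u l) * p)).
  apply: eq_bigr => l _; congr (_ * _); have := Z l; rewrite !big_cons /=.
  by move/eqP; rewrite addrA addrC addr_eq0 => /eqP ->; rewrite rmorphB; ring.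
transitivity (- psi (\sum_l (u l - v l) * s l h) * p).
  rewrite rmorph_sum mulNr mulr_suml -sumrN; apply: eq_bigr => l _.
  by rewrite !rmorphM !rmorphB; ring.
by rewrite Zs rmorph0 oppr0 mul0r.
Qed.

Lemma triv_cancel T L : triv (T ++ negt T ++ L) -> triv L.
Proof.
elim: T L => [//|[p b] T IH] L tr; apply: IH; apply: (@triv_cancel1 p b).
apply: triv_perm tr; apply/permP => P.
by rewrite /= !count_cat /= !count_cat; lia.
Qed.

End Triv.

Lemma triv_mul (A B C : kalg k) (psi : khom A C) (phi : khom A B) L p b :
  triv psi phi L -> triv psi phi [seq (x.1 * p, x.2 * b) | x <- L].
Proof.
move=> [J [c [L' [-> Z]]]].
exists J, (fun l => c l * b), [seq (x.1 * p, x.2) | x <- L']; split.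
  rewrite -!map_comp; apply: eq_map => x /=; congr pair.
  by rewrite mulr_suml; apply: eq_bigr => l _; rewrite mulrA.
move=> l; rewrite big_map /= -[RHS](mul0r p) -[in RHS](Z l) [RHS]mulr_suml.
by apply: eq_bigr => x _; rewrite mulrA.
Qed.

Lemma triv_eval (A B C R : kalg k) (psi : khom A C) (phi : khom A B)
    (f : khom C R) (g : khom B R) L : kcomp f psi = kcomp g phi ->
  triv psi phi L -> \sum_(x <- L) f x.1 * g x.2 = 0.
Proof.
move=> /khom_comp_eq fg [J [c [L' [-> Z]]]]; rewrite big_map /=.
transitivity (\sum_l g (c l) * f (\sum_(x <- L') psi (x.2 l) * x.1)); last first.
  by rewrite big1 // => l _; rewrite Z rmorph0 mulr0.
under [RHS]eq_bigr do rewrite rmorph_sum mulr_sumr.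
rewrite [RHS]exchange_big /=; apply: eq_bigr => x _.
rewrite rmorph_sum mulr_sumr; apply: eq_bigr => l _.
by rewrite !rmorphM fg; ring.
Qed.

End Tensor.

Lemma perm_of_eq (T : eqType) (s t : seq T) : s = t -> perm_eq s t.
Proof. by move=> ->. Qed.

Section TensorAlgebra.
Variable k : fieldType.
Variables (A B C : kalg k) (psi : khom A C) (phi : khom A B).
Hypothesis flat : eqflat phi.

Let tv := triv psi phi.

Definition tmul (L M : seq (C * B)) : seq (C * B) :=
  flatten [seq [seq (x.1 * y.1, x.2 * y.2) | x <- L] | y <- M].

Let teq (L M : seq (C * B)) := tv (L ++ negt M).

Let teq_refl L : teq L L. Proof. exact: triv_self. Qed.

Let teq_sym L M : teq L M -> teq M L.
Proof.
move/triv_neg; rewrite negt_cat negtK; apply: triv_perm.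
by rewrite perm_catC.
Qed.

Let teq_trans L M N : teq L M -> teq M N -> teq L N.
Proof.
move=> LM MN; apply: (triv_cancel flat (T := M)).
apply: triv_perm (triv_cat LM MN); apply/permP => P.
by rewrite !count_cat; lia.
Qed.

Let teq_tv L M : tv L -> tv M -> teq L M.
Proof. by move=> tL tM; apply: triv_cat => //; exact: triv_neg. Qed.

Let teq_perm L M : perm_eq L M -> teq L M.
Proof.
move=> LM; apply: triv_perm (teq_refl L).
by rewrite perm_cat2l perm_map.
Qed.

Let teq_add L L' M : teq L L' -> teq (L ++ M) (L' ++ M).
Proof.
move=> LL; apply: triv_perm (triv_cat LL (teq_refl M)).
by rewrite negt_cat; apply/permP => P; rewrite !count_cat addnACA.
Qed.

Let tmul_negl L M : tmul (negt L) M = negt (tmul L M).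
Proof.
rewrite /tmul /negt map_flatten -map_comp; congr flatten; apply: eq_map => y /=.
by rewrite -!map_comp; apply: eq_map => x /=; rewrite mulNr.
Qed.

Let tv_mul L M : tv L -> tv (tmul L M).
Proof.
move=> tL; elim: M => [|[p b] M IH]; first exact: triv_nil.
by apply: triv_cat => //; exact: triv_mul.
Qed.

Let tmul_catl L L' M : perm_eq (tmul (L ++ L') M) (tmul L M ++ tmul L' M).
Proof.
elim: M => [//|y M IH]; rewrite /tmul /= map_cat.
apply/permP => P; move/permP/(_ P): IH.
by rewrite /tmul !count_cat => ->; rewrite addnACA.
Qed.

Let tmul_consl x L M :
  perm_eq (tmul (x :: L) M) ([seq (x.1 * y.1, x.2 * y.2) | y <- M] ++ tmul L M).
Proof.
apply: perm_trans (tmul_catl [:: x] L M) _; rewrite perm_cat2r.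
by elim: M => //= y M IH; rewrite /tmul /= perm_cons.
Qed.

Let tmulC L M : perm_eq (tmul L M) (tmul M L).
Proof.
elim: L => [|x L IH]; first by elim: M.
apply: perm_trans (tmul_consl x L M) _; rewrite {2}/tmul /=.
apply: perm_cat => //; rewrite (_ : [seq _ | y <- M] = [seq (y.1 * x.1, y.2 * x.2) | y <- M]) //.
by apply: eq_map => y; rewrite mulrC (mulrC x.2).
Qed.

Let tmulA L M N : perm_eq (tmul L (tmul M N)) (tmul (tmul L M) N).
Proof.
elim: N => [//|z N IH].
rewrite [tmul M (z :: N)]/tmul /= -/(tmul M N) [tmul (tmul L M) (z :: N)]/tmul /=.
rewrite -/(tmul (tmul L M) N).
have -> P Q : tmul L (P ++ Q) = tmul L P ++ tmul L Q.
  by rewrite /tmul map_cat flatten_cat.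
apply: perm_cat => //; rewrite /tmul map_flatten -!map_comp.
apply: perm_of_eq; congr flatten; apply: eq_map => y /=.
by rewrite -map_comp; apply: eq_map => x /=; rewrite !mulrA.
Qed.

Definition tens_sring : sring.
Proof.
refine (@SRing (seq (C * B)) teq [::] [:: (1, 1)] (@negt k B C) cat tmul
  teq_refl teq_sym teq_trans _ teq_add _ _ _ _ _ _ _ _ _).
- by move=> L M /triv_neg; rewrite negt_cat.
- move=> L L' M LL; apply: triv_perm (tv_mul M LL).
  by rewrite -tmul_negl; exact: tmul_catl.
- by move=> L M N; rewrite catA; exact: teq_refl.
- by move=> L M; apply: teq_perm; rewrite perm_catC.
- by move=> L; exact: teq_refl.
- move=> L; apply: teq_tv; last exact: triv_nil.
  by apply: triv_perm (triv_self _ _ L); rewrite perm_catC.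
- by move=> L M N; apply/teq_perm/tmulA.
- by move=> L M; apply/teq_perm/tmulC.
- move=> L; apply: teq_perm; apply: perm_trans (tmul_consl _ _ _) _.
  rewrite (_ : tmul [::] L = [::]) ?cats0; last by elim: L.
  rewrite map_id_in // => -[x y] _ /=; by rewrite !mul1r.
- by move=> L M N; apply/teq_perm/tmul_catl.
Defined.

Definition tens_ring : comPzRingType := qring tens_sring.

Definition tens (c : C) (b : B) : tens_ring := rpi ([:: (c, b)] : tens_sring).

Lemma tensDl c c' b : tens (c + c') b = tens c b + tens c' b.
Proof.
rewrite -rpiD; apply/rpiE; exists 'I_1, (fun=> b).
exists [:: (c + c', fun=> 1); (- c, fun=> 1); (- c', fun=> 1)]; split.
  by rewrite /= !big_ord_recl !big_ord0 !addr0 rmorph1 mul1r.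
by move=> l; rewrite !big_cons big_nil /= ?rmorph1; ring.
Qed.

Lemma tensDr c b b' : tens c (b + b') = tens c b + tens c b'.
Proof.
rewrite -rpiD; apply/rpiE; exists bool, (fun l => if l then b else b').
exists [:: (c, fun=> 1); (- c, fun l => if l then 1 else 0);
  (- c, fun l => if l then 0 else 1)]; split.
  by rewrite /= !big_bool /= !rmorph1 !rmorph0 !mul1r !mul0r !addr0 add0r.
by case; rewrite !big_cons big_nil /= !rmorph1 !rmorph0; ring.
Qed.

Lemma tensM c c' b b' : tens (c * c') (b * b') = tens c b * tens c' b'.
Proof. by rewrite -rpiM. Qed.

Lemma tens_scal a : tens (psi a) 1 = tens 1 (phi a).
Proof.
apply/rpiE; exists 'I_1, (fun=> 1).
exists [:: (psi a, fun=> 1); (- 1, fun=> a)]; split.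
  by rewrite /= !big_ord_recl !big_ord0 !addr0 rmorph1 mul1r mulr1.
by move=> l; rewrite !big_cons big_nil /= ?rmorph1; ring.
Qed.

Definition tens_kalg : kalg k.
Proof.
apply: (@mk_kalg k tens_ring (fun c => tens (kalg_str C c) 1)).
- by move=> x y; rewrite rmorphD tensDl.
- by move=> x y; rewrite rmorphM -tensM mulr1.
- by rewrite rmorph1.
Defined.

Definition tensl : khom C tens_kalg.
Proof.
apply: (@mk_khom k C tens_kalg (fun c => tens c 1)) => //.
- by move=> x y; rewrite tensDl.
- by move=> x y; rewrite -tensM mulr1.
Defined.

Definition tensr : khom B tens_kalg.
Proof.
apply: (@mk_khom k B tens_kalg (fun c => tens 1 c)) => //.
- by move=> x y; rewrite tensDr.
- by move=> x y; rewrite -tensM mulr1.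
- by move=> c; rewrite -(khom_str phi) -tens_scal khom_str.
Defined.

Lemma tens_comm : kcomp tensl psi = kcomp tensr phi.
Proof. by apply: khomP => a; exact: tens_scal. Qed.

Lemma tensE c b : tens c b = tensl c * tensr b :> tens_kalg.
Proof. by rewrite -[RHS]tensM mulr1 mul1r. Qed.

Lemma rpi_tens (L : tens_sring) :
  rpi L = \sum_(x <- L) tensl x.1 * tensr x.2 :> tens_kalg.
Proof.
elim: L => [|[c b] L IH]; first by rewrite big_nil -rpi0.
by rewrite big_cons -IH -tensE -[RHS]rpiD.
Qed.

Lemma tens_zero (L : seq (C * B)) :
  \sum_(x <- L) tensl x.1 * tensr x.2 = 0 -> triv psi phi L.
Proof. by rewrite -rpi_tens -rpi0 => /rpiE; rewrite /= /teq cats0. Qed.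

(** The form in which a vanishing tensor is used from here on: the right factors are rewritten with
    coefficients in A that kill the left factors. *)
Lemma tens_zero_fin (I : finType) (c : I -> C) (b : I -> B) :
  \sum_i tensl (c i) * tensr (b i) = 0 ->
  exists (J : finType) (d : J -> B) (s : I -> J -> A),
    (forall i, b i = \sum_l phi (s i l) * d l) /\
    (forall l, \sum_i psi (s i l) * c i = 0).
Proof.
move=> E; apply/triv_fin/tens_zero; rewrite -[RHS]E big_map big_enum /=.
by [].
Qed.

Lemma tens_gen (x : tens_kalg) : exists L : seq (C * B),
  x = \sum_(y <- L) tensl y.1 * tensr y.2.
Proof. by have [L ->] := rpi_surj x; exists L; rewrite rpi_tens. Qed.

Lemma tens_gen_fin (x : tens_kalg) : exists n (c : 'I_n -> C) (b : 'I_n -> B),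
  x = \sum_i tensl (c i) * tensr (b i).
Proof.
have [L ->] := tens_gen x; exists (size L).
exists (fun i => (tnth (in_tuple L) i).1), (fun i => (tnth (in_tuple L) i).2).
by rewrite big_tnth.
Qed.

Lemma tens_ext R (f g : khom tens_kalg R) :
  kcomp f tensl = kcomp g tensl -> kcomp f tensr = kcomp g tensr -> f = g.
Proof.
move=> /khom_comp_eq El /khom_comp_eq Er; apply: khomP => x.
have [L ->] := tens_gen x; rewrite !rmorph_sum; apply: eq_bigr => y _.
by rewrite !rmorphM El Er.
Qed.

Lemma tens_lift R (f : khom C R) (g : khom B R) : kcomp f psi = kcomp g phi ->
  exists h : khom tens_kalg R, kcomp h tensl = f /\ kcomp h tensr = g.
Proof.
move=> fg.
pose ev (L : tens_sring) := \sum_(x <- L) f x.1 * g x.2.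
have evN L : ev (negt L) = - ev L.
  by rewrite /ev big_map -sumrN; apply: eq_bigr => x _; rewrite rmorphN mulNr.
have evD L M : ev (L ++ M) = ev L + ev M by rewrite /ev big_cat.
have evM L M : ev (tmul L M) = ev L * ev M.
  rewrite {1 3}/ev big_flatten big_map mulr_sumr; apply: eq_bigr => y _.
  rewrite big_map mulr_suml; apply: eq_bigr => x _ /=.
  by rewrite !rmorphM; ring.
have evE L M : seqv L M -> ev L = ev M.
  by move/(triv_eval fg) => E; apply: subr0_eq; rewrite -evN -evD.
have rE (L : tens_sring) : ev (rrepr (rpi L)) = ev L by apply: evE; exact: rreprE.
unshelve eexists.
  apply: (@mk_khom k tens_kalg R (fun x => ev (rrepr x))).
  - move=> x y; have [L ->] := rpi_surj x; have [M ->] := rpi_surj y.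
    by rewrite -rpiD !rE -evD.
  - move=> x y; have [L ->] := rpi_surj x; have [M ->] := rpi_surj y.
    by rewrite -rpiM !rE -evM.
  - by rewrite -rpi1 rE /ev big_cons big_nil !rmorph1 mulr1 addr0.
  - by move=> c; rewrite /= rE /ev big_cons big_nil /= !rmorph1 mulr1 addr0 khom_str.
split; apply: khomP => x; rewrite /= /hom_fun rE /ev big_cons big_nil /= addr0.
  by rewrite rmorph1 mulr1.
by rewrite rmorph1 mul1r.
Qed.

End TensorAlgebra.

Global Opaque tens_kalg tensl tensr.

(** * Flat and faithfully flat homomorphisms *)

Section FlatFaithful.
Variable k : fieldType.
Implicit Types A B C D R : kalg k.

(** Faithfulness is stated as: an ideal I of A with IB = B is the unit ideal. Finite families
    suffice, since 1 is a finite combination. *)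
Definition ffhom A B (phi : khom A B) : Prop :=
  eqflat phi /\
  forall (I : finType) (a : I -> A) (b : I -> B),
    \sum_i phi (a i) * b i = 1 -> exists c : I -> A, \sum_i a i * c i = 1.

(** The members of the family share their right factors: the index types are summed and the
    coefficients padded with zeros. *)
Lemma tens_gen_fam A B C (psi : khom A C) (phi : khom A B) (fl : eqflat phi)
    (I : finType) (w : I -> tens_kalg psi fl) :
  exists (J : finType) (c : I -> J -> C) (b : J -> B),
    forall i, w i = \sum_j tensl psi fl (c i j) * tensr psi fl (b j).
Proof.
have /choice [n nP] i : exists n : nat, exists (c : 'I_n -> C) (b : 'I_n -> B),
    w i = \sum_j tensl psi fl (c j) * tensr psi fl (b j).
  by have [n [c [b E]]] := tens_gen_fin (w i); exists n, c, b.
have {nP} [cb cbE] : exists cb : forall i, 'I_(n i) -> C * B,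
    forall i, w i = \sum_j tensl psi fl (cb i j).1 * tensr psi fl (cb i j).2.
  have Q i : exists cb : 'I_(n i) -> C * B,
     w i = \sum_j tensl psi fl (cb j).1 * tensr psi fl (cb j).2.
    by have [c [b E]] := nP i; exists (fun j => (c j, b j)).
  exists (fun i => projT1 (cid (Q i))) => i.
  by case: (cid (Q i)).
exists {i : I & 'I_(n i)}.
exists (fun i p => if tag p == i then (cb (tag p) (tagged p)).1 else 0).
exists (fun p => (cb (tag p) (tagged p)).2) => i.
rewrite -(sig_big_dep xpredT (fun=> xpredT) (fun i' j =>
   tensl psi fl (if i' == i then (cb i' j).1 else 0) * tensr psi fl (cb i' j).2)) /=.
rewrite (bigD1 i) //= eqxx -cbE big1 ?addr0 // => i' /negPf ->.
by rewrite big1 // => j _; rewrite rmorph0 mul0r.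
Qed.

Lemma eqflat_comp A B C (phi : khom A B) (chi : khom B C) :
  eqflat phi -> eqflat chi -> eqflat (kcomp chi phi).
Proof.
move=> f1 f2 I a c /f2 [J [d [s [cE /= sE]]]].
(* the relations [sE], one for each [l], are trivialized simultaneously *)
suff [K [e [t [tE tZ]]]] : exists (K : finType) (e : K -> B) (t : I -> J -> K -> A),
    (forall i l, s i l = \sum_h phi (t i l h) * e h) /\
    (forall l h, \sum_i a i * t i l h = 0).
  exists (J * K)%type, (fun p => d p.1 * chi (e p.2)), (fun i p => t i p.1 p.2).
  split=> [i|[l h]]; last exact: tZ.
  rewrite cE -(pair_bigA _ (fun l h => kcomp chi phi (t i l h) * (d l * chi (e h)))) /=.
  apply: eq_bigr => l _; rewrite tE rmorph_sum mulr_suml; apply: eq_bigr => h _.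
  by rewrite rmorphM -mulrA (mulrC (chi (e h))).
have /choice [K KP] l : exists K : finType, exists (e : K -> B) (t : I -> K -> A),
    (forall i, s i l = \sum_h phi (t i h) * e h) /\
    (forall h, \sum_i a i * t i h = 0).
  by have [K [e [t P]]] := f1 _ _ _ (sE l); exists K, e, t.
have Q l : exists et : (K l -> B) * (I -> K l -> A),
    (forall i, s i l = \sum_h phi (et.2 i h) * et.1 h) /\
    (forall h, \sum_i a i * et.2 i h = 0).
  by have [e [t P]] := KP l; exists (e, t).
pose et l := projT1 (cid (Q l)).
have etP l : (forall i, s i l = \sum_h phi ((et l).2 i h) * (et l).1 h) /\
    (forall h, \sum_i a i * (et l).2 i h = 0).
  by rewrite /et; case: cid.
exists {l : J & K l}, (fun p => (et (tag p)).1 (tagged p)).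
exists (fun i l p => if tag p == l then (et (tag p)).2 i (tagged p) else 0).
split=> [i l|l [l' h]] /=.
  rewrite -(sig_big_dep xpredT (fun=> xpredT) (fun l' j =>
     phi (if l' == l then (et l').2 i j else 0) * (et l').1 j)) /=.
  rewrite (bigD1 l) //= eqxx -(etP l).1 big1 ?addr0 // => l' /negPf ->.
  by rewrite big1 // => j _; rewrite rmorph0 mul0r.
case: eqP => _; first by rewrite (etP l').2.
by rewrite big1 // => i _; rewrite mulr0.
Qed.

Section BaseChange.
Variables (A B C : kalg k) (psi : khom A C) (phi : khom A B) (fl : eqflat phi).
Let tl := tensl psi fl.
Let tr := tensr psi fl.

(** Over common right factors, a relation with coefficients in C becomes a vanishing tensor, hence
    is certified by coefficients in A. *)
Lemma eqflat_tensl : eqflat tl.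
Proof.
move=> I a w E; have [J [c [b wE]]] := tens_gen_fam w.
have : \sum_j tl (\sum_i a i * c i j) * tr (b j) = 0.
  rewrite -[RHS]E; under eq_bigr do rewrite rmorph_sum mulr_suml.
  rewrite exchange_big /=; apply: eq_bigr => i _; rewrite wE mulr_sumr.
  by apply: eq_bigr => j _; rewrite rmorphM mulrA.
move/tens_zero_fin => [K [d [s [bE sZ]]]].
exists K, (fun l => tr (d l)), (fun i l => \sum_j c i j * psi (s j l)); split.
  move=> i; rewrite wE; under [RHS]eq_bigr do rewrite rmorph_sum mulr_suml.
  rewrite exchange_big /=; apply: eq_bigr => j _.
  rewrite bE rmorph_sum mulr_sumr; apply: eq_bigr => l _.
  by rewrite !rmorphM (khom_comp_eq (tens_comm psi fl)) mulrA.
move=> l; rewrite -[RHS](sZ l).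
under eq_bigr do rewrite mulr_sumr.
rewrite exchange_big /=; apply: eq_bigr => j _.
by rewrite mulr_sumr; apply: eq_bigr => i _; ring.
Qed.

(** Adding the term -1 ⊗ 1, indexed by [None], turns a unit relation into a vanishing tensor. The
    coefficients at [None] generate the unit ideal of B, and their images in C lie in the ideal of
    the a_i. *)
Lemma tens_unit (I : finType) (a : I -> C) (w : I -> tens_kalg psi fl) :
  \sum_i tl (a i) * w i = 1 ->
  exists (L : finType) (d : L -> B) (s : L -> A) (u : I -> L -> C),
    \sum_l phi (s l) * d l = 1 /\ forall l, psi (s l) = \sum_i a i * u i l.
Proof.
move=> E; have [J [c [b wE]]] := tens_gen_fam w.
pose p o := if o is Some j then \sum_i a i * c i j else - 1.
pose q o := if o is Some j then b j else 1.
have : \sum_(o : option J) tl (p o) * tr (q o) = 0.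
  rewrite (bigD1 None) //= (reindex_omap Some id) /=; last by case.
  rewrite rmorphN !rmorph1 mulr1.
  rewrite [X in _ + X](_ : _ = 1) ?addNr // -[RHS]E.
  rewrite (eq_bigl xpredT); last by move=> j; rewrite eqxx.
  under eq_bigr do rewrite rmorph_sum mulr_suml.
  rewrite exchange_big /=; apply: eq_bigr => i _; rewrite wE mulr_sumr.
  by apply: eq_bigr => j _; rewrite rmorphM mulrA.
move/tens_zero_fin => [K [d [s [bE sZ]]]].
exists K, d, (s None), (fun i l => \sum_j c i j * psi (s (Some j) l)); split.
  by rewrite -(bE None).
move=> l; have := sZ l; rewrite (bigD1 None) //= mulrN1 => /eqP.
rewrite addrC addr_eq0 opprK => /eqP <-.
rewrite (reindex_omap Some id) /=; last by case.
rewrite (eq_bigl xpredT); last by move=> j; rewrite eqxx.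
under [RHS]eq_bigr do rewrite mulr_sumr.
rewrite [RHS]exchange_big /=; apply: eq_bigr => j _.
by rewrite mulr_sumr; apply: eq_bigr => i _; ring.
Qed.

End BaseChange.

Lemma ff_tensl A B C (psi : khom A C) (phi : khom A B) (ff : ffhom phi) :
  ffhom (tensl psi ff.1).
Proof.
split=> [|I a w /tens_unit [L [d [s [u [/ff.2 [e eE] sE]]]]]].
  exact: eqflat_tensl.
exists (fun i => \sum_l u i l * psi (e l)).
rewrite -(rmorph1 psi) -eE rmorph_sum /=.
under [RHS]eq_bigr do rewrite rmorphM sE mulr_suml.
rewrite [RHS]exchange_big /=; apply: eq_bigr => i _.
by rewrite mulr_sumr; apply: eq_bigr => l _; rewrite mulrA.
Qed.

Lemma ff_inj A B (phi : khom A B) : ffhom phi -> injective phi.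
Proof.
move=> [fl ff] x y xy; apply: subr0_eq.
have rel : \sum_(i : 'I_1) phi (x - y) * 1 = 0.
  by rewrite big_ord_recl big_ord0 addr0 mulr1 rmorphB xy subrr.
have [J [c [s [sE sZ]]]] := fl _ _ _ rel.
have /esym/ff [d dE] := sE ord0.
rewrite -[LHS]mulr1 -dE mulr_sumr big1 // => l _.
by have := sZ l; rewrite big_ord_recl big_ord0 addr0 mulrA => ->; rewrite mul0r.
Qed.

(** Exactness of A → B ⇉ B ⊗ B. The vanishing of b ⊗ 1 - 1 ⊗ b yields elements s_l, s'_l of A with
    s_l b = s'_l in B, the s_l generating the unit ideal of B; if Σ e_l s_l = 1 in A, then b = Σ e_l
    s'_l. *)
Lemma ff_equalizer A B (phi : khom A B) (b : B) : ffhom phi ->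
  (forall R (f g : khom B R), kcomp f phi = kcomp g phi -> f b = g b) ->
  exists a, phi a = b.
Proof.
move=> [fl ff] eqb.
have E := eqb _ (tensl phi fl) (tensr phi fl) (tens_comm phi fl).
pose p (o : bool) := if o then b else - 1.
pose q (o : bool) := if o then 1 else b.
have : \sum_o tensl phi fl (p o) * tensr phi fl (q o) = 0.
  by rewrite big_bool /= rmorphN !rmorph1 mulr1 mulN1r E subrr.
move/tens_zero_fin => [J [d [s [sE sZ]]]].
have /esym/ff [e eE] := sE true.
exists (\sum_l e l * s false l).
rewrite -[b]mul1r -(rmorph1 phi) -eE !rmorph_sum mulr_suml; apply: eq_bigr => l _.
have := sZ l; rewrite big_bool /= mulrN1 => /eqP; rewrite subr_eq0 => /eqP sl.
by rewrite !rmorphM -sl; ring.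
Qed.

(** Flatness of B over A: C ⊗ B → D ⊗ B inherits injectivity from C → D. The map f lets the target
    be any algebra in which D ⊗ B embeds. *)
Lemma tens_map_inj A B C D (psi : khom A C) (phi : khom A B) (fl : eqflat phi)
    (i : khom C D) R (h : khom (tens_kalg psi fl) R) (f : khom (tens_kalg (kcomp i psi) fl) R) :
  injective i -> injective f ->
  kcomp h (tensl psi fl) = kcomp f (kcomp (tensl (kcomp i psi) fl) i) ->
  kcomp h (tensr psi fl) = kcomp f (tensr (kcomp i psi) fl) -> injective h.
Proof.
move=> inj_i inj_f /khom_comp_eq hl /khom_comp_eq hr x y xy.
apply: subr0_eq; have : h (x - y) = 0 by rewrite rmorphB xy subrr.
have [n [c [b ->]]] := tens_gen_fin (x - y).
rewrite rmorph_sum.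
under eq_bigr do rewrite rmorphM hl hr kcompE -rmorphM.
rewrite -rmorph_sum -(rmorph0 f) => /inj_f /tens_zero_fin [J [d [s [bE sZ]]]].
under eq_bigr do rewrite bE rmorph_sum mulr_sumr.
rewrite exchange_big big1 // => l _.
transitivity (tensr psi fl (d l) * tensl psi fl (\sum_j psi (s j l) * c j)).
  rewrite rmorph_sum mulr_sumr; apply: eq_bigr => j _.
  by rewrite !rmorphM (khom_comp_eq (tens_comm psi fl)); ring.
suff -> : \sum_j psi (s j l) * c j = 0 by rewrite rmorph0 mulr0.
apply: inj_i; rewrite rmorph_sum rmorph0.
rewrite -[RHS](sZ l).
by apply: eq_bigr => j _; rewrite rmorphM.
Qed.

Lemma eqflat_prod A B C (phi : khom A B) (chi : khom A C) (h : khom A (prod_kalg B C)) :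
  kcomp (prod_fst B C) h = phi -> kcomp (prod_snd B C) h = chi ->
  eqflat phi -> eqflat chi -> eqflat h.
Proof.
move=> E1 E2 f1 f2 I a b rel.
have r1 : \sum_i phi (a i) * prod_fst B C (b i) = 0.
  rewrite -[RHS](rmorph0 (prod_fst B C)) -[in RHS]rel rmorph_sum; apply: eq_bigr => i _.
  by rewrite rmorphM -E1.
have r2 : \sum_i chi (a i) * prod_snd B C (b i) = 0.
  rewrite -[RHS](rmorph0 (prod_snd B C)) -[in RHS]rel rmorph_sum; apply: eq_bigr => i _.
  by rewrite rmorphM -E2.
have [J [c [s [sE sZ]]]] := f1 _ _ _ r1.
have [K [d [t [tE tZ]]]] := f2 _ _ _ r2.
exists (J + K)%type.
exists (fun l => match l with inl j => prod_pair (c j) 0 | inr h => prod_pair 0 (d h) end).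
exists (fun i l => match l with inl j => s i j | inr h => t i h end).
split=> [i|[l|l]] //.
rewrite big_sumType /=; apply: prod_eq; rewrite rmorphD !rmorph_sum /=.
  rewrite [X in _ + X]big1 ?addr0 => [|l _]; last first.
    by rewrite rmorphM /= prod_fst_pair mulr0.
  by rewrite sE; apply: eq_bigr => l _; rewrite rmorphM prod_fst_pair -E1.
rewrite [X in X + _]big1 ?add0r => [|l _]; last first.
  by rewrite rmorphM /= prod_snd_pair mulr0.
by rewrite tE; apply: eq_bigr => l _; rewrite rmorphM prod_snd_pair -E2.
Qed.

Definition is_fld A := (1 : A) <> 0 /\ forall x : A, x <> 0 -> is_unit x.

Lemma eqflat_field A B (phi : khom A B) : is_fld A -> eqflat phi.
Proof.
move=> [nz inv] I a b rel.
case: (pselect (exists i0, a i0 <> 0)) => [[i0 /inv [v av]]|az]; last first.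
  exists I, b, (fun i l => if i == l then 1 else 0); split=> [i|l].
    rewrite (bigD1 i) //= eqxx rmorph1 mul1r big1 ?addr0 // => l /negPf.
    by rewrite eq_sym => ->; rewrite rmorph0 mul0r.
  rewrite big1 // => i _; case: (pselect (a i = 0)) => [->|ai]; first by rewrite mul0r.
  by case: az; exists i.
(* The identity matrix, with v times the relation subtracted from the row of the pivot i0; the
   relation itself shows that b is unchanged. *)
exists I, b, (fun i l => (if i == l then 1 else 0) -
   (if i == i0 then v * a l else 0)); split=> [i|l].
  under eq_bigr do rewrite rmorphB mulrBl.
  rewrite sumrB (bigD1 i) //= eqxx rmorph1 mul1r big1 ?addr0; last first.
    by move=> l /negPf; rewrite eq_sym => ->; rewrite rmorph0 mul0r.
  case: eqP => _; last by rewrite big1 ?subr0 // => l _; rewrite rmorph0 mul0r.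
  transitivity (b i - phi v * \sum_l phi (a l) * b l).
    by rewrite rel mulr0 subr0.
  by rewrite mulr_sumr; congr (_ - _); apply: eq_bigr => l _; rewrite rmorphM mulrA.
under eq_bigr do rewrite mulrBr.
rewrite sumrB (bigD1 l) //= eqxx mulr1 big1 ?addr0; last first.
  by move=> i /negPf ->; rewrite mulr0.
rewrite (bigD1 i0) //= eqxx mulrA av mul1r big1 ?addr0 ?subrr // => i /negPf ->.
by rewrite mulr0.
Qed.

End FlatFaithful.

(** * Prime ideals and field-valued points *)

Section Points.
Variable k : fieldType.
Implicit Types A B C D R F L : kalg k.

Lemma ideal_gen_ideal A (S : set A) : is_ideal (ideal_gen S).
Proof.
split=> [I hI _|x y Sx Sy I hI SI|a x Sx I hI SI]; first exact: ideal0.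
  by apply: idealD => //; [exact: Sx | exact: Sy].
by apply: idealM => //; exact: Sx.
Qed.

Lemma ideal_gen_sub A (S : set A) : S `<=` ideal_gen S.
Proof. by move=> x Sx I _; apply. Qed.

Lemma ideal_genP A (S : set A) x : ideal_gen S x ->
  exists n (c s : 'I_n -> A), (forall i, S (s i)) /\ x = \sum_i c i * s i.
Proof.
move=> Sx; suff [L LS ->] : exists2 L : seq (A * A), (forall y, y \in L -> S y.2) &
    x = \sum_(y <- L) y.1 * y.2.
  exists (size L), (fun i => (tnth (in_tuple L) i).1), (fun i => (tnth (in_tuple L) i).2).
  split=> [i|]; last by rewrite big_tnth.
  by apply: LS; exact: mem_tnth.
apply: (Sx [set x | exists2 L : seq (A * A), (forall y, y \in L -> S y.2) &
    x = \sum_(y <- L) y.1 * y.2]); last first.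
  move=> y Sy; exists [:: (1, y)]; first by move=> z; rewrite inE => /eqP ->.
  by rewrite big_cons big_nil addr0 mul1r.
split.
- by exists [::] => //; rewrite big_nil.
- move=> u v [L LS ->] [M MS ->]; exists (L ++ M); last by rewrite big_cat.
  by move=> y; rewrite mem_cat => /orP[/LS|/MS].
- move=> a u [L LS ->]; exists [seq (a * y.1, y.2) | y <- L].
    by move=> y /mapP [z /LS Sz ->].
  by rewrite big_map mulr_sumr; apply: eq_bigr => y _; rewrite mulrA.
Qed.

Lemma ideal_genT A (S : set A) : ideal_gen S = setT <-> ideal_gen S 1.
Proof.
split=> [->//|S1]; apply/seteqP; split=> // x _.
by rewrite -[x]mulr1; apply: (idealM (ideal_gen_ideal _)).
Qed.

Lemma ideal_gen_image1 A B (f : khom A B) (S : set A) :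
  ideal_gen (f @` S) = setT <->
  exists n (c : 'I_n -> B) (s : 'I_n -> A), (forall i, S (s i)) /\
    \sum_i f (s i) * c i = 1.
Proof.
rewrite ideal_genT; split=> [/ideal_genP [n [c [s [fs E]]]]|[n [c [s [Ss <-]]]]].
  have /choice [t tP] i : exists t, S t /\ f t = s i by have [t St ft] := fs i; exists t.
  exists n, c, t; split=> [i|]; first by have [] := tP i.
  by rewrite E; apply: eq_bigr => i _; rewrite (tP i).2 mulrC.
apply: (ideal_sum (ideal_gen_ideal _)) => i.
apply: (idealMr (ideal_gen_ideal _)).
by apply: ideal_gen_sub; exists (s i).
Qed.

Definition is_prime A (P : set A) : Prop :=
  [/\ is_ideal P, ~ P 1 & forall x y, P (x * y) -> P x \/ P y].

(** By Zorn, an ideal maximal among those that contain I and avoid M is prime. The maximality is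
    kept in the conclusion, so that M = {1} gives maximal ideals. *)
Lemma krull A (I M : set A) : is_ideal I -> is_mult M -> (forall x, I x -> M x -> False) ->
  exists P : set A, [/\ is_prime P, I `<=` P, forall x, P x -> M x -> False &
    forall J, is_ideal J -> P `<=` J -> (forall x, J x -> M x -> False) -> J = P].
Proof.
move=> hI hM IM.
pose T := {J : set A | [/\ is_ideal J, I `<=` J & forall x, J x -> M x -> False]}.
have [| | |C tot|P Pmax] := @Zorn T (fun J K => `[< sval J `<=` sval K >]).
- by move=> J; apply/asboolP.
- by move=> J K L /asboolP JK /asboolP KL; apply/asboolP => x /JK /KL.
- move=> J K /asboolP JK /asboolP KJ; apply: sig_ext; apply/seteqP; split => //.
- case: (pselect (exists J0, C J0)) => [[J0 CJ0]|noC]; last first.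
    have hT : [/\ is_ideal I, I `<=` I & forall x, I x -> M x -> False] by split.
    by exists (exist _ I hT) => s Cs; case: noC; exists s.
  pose U := [set x | exists2 J, C J & sval J x].
  have hU : [/\ is_ideal U, I `<=` U & forall x, U x -> M x -> False].
    split; last 2 first.
    + by move=> x Ix; exists J0 => //; case: (svalP J0) => _ + _; apply.
    + by move=> x [J CJ Jx]; case: (svalP J) => _ _; apply.
    split.
    + by exists J0 => //; case: (svalP J0) => h _ _; exact: ideal0.
    + move=> x y [J CJ Jx] [K CK Ky].
      have [/asboolP JK|/asboolP KJ] := tot _ _ CJ CK.
        by exists K => //; case: (svalP K) => h _ _; apply: idealD => //; exact: JK.
      by exists J => //; case: (svalP J) => h _ _; apply: idealD => //; exact: KJ.
    + by move=> a x [J CJ Jx]; exists J => //; case: (svalP J) => h _ _; exact: idealM.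
  by exists (exist _ U hU) => s Cs; apply/asboolP => x sx; exists s.
case: P Pmax => P [hP IP PM] /= Pmax.
have maxP J : is_ideal J -> P `<=` J -> (forall x, J x -> M x -> False) -> J = P.
  move=> hJ PJ JM.
  have hT : [/\ is_ideal J, I `<=` J & forall x, J x -> M x -> False].
    by split=> // x /IP /PJ.
  by have /(congr1 sval) /= := Pmax (exist _ J hT) (asboolT PJ).
exists P; split=> //; split=> //; first by move=> P1; exact: PM P1 hM.1.
have key x : ~ P x -> exists a p, P p /\ M (p + a * x).
  move=> Px; pose J := [set z | exists a p, P p /\ z = p + a * x].
  have hJ : is_ideal J.
    split; first by exists 0, 0; split; [exact: ideal0 | rewrite mul0r addr0].
    + move=> u v [a [p [Pp ->]]] [b [q [Pq ->]]]; exists (a + b), (p + q).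
      by split; [exact: idealD | ring].
    + move=> c u [a [p [Pp ->]]]; exists (c * a), (c * p).
      by split; [exact: idealM | ring].
  have PJ : P `<=` J by move=> p Pp; exists 0, p; rewrite mul0r addr0.
  have Jx : J x by exists 1, 0; split; [exact: ideal0 | ring].
  case: (pselect (exists2 z, J z & M z)) => [[z [a [p [Pp ->]]] Mz]|no].
    by exists a, p.
  case: Px; rewrite -(maxP J hJ PJ) // => z Jz Mz; apply: no; exists z => //.
move=> x y Pxy; case: (pselect (P x)) => [|/key [a [p [Pp Mx]]]]; first by left.
right; apply: contrapT => /key [b [q [Pq My]]].
apply: (PM _ _ (hM.2 _ _ Mx My)).
rewrite (_ : _ * _ = (p * (q + b * y) + (a * x) * q) + (a * b) * (x * y)); last by ring.
by do 2?[apply: idealD => //]; [exact: idealMr | exact: idealM | exact: idealM].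
Qed.

Lemma exists_maximal A (I : set A) : is_ideal I -> ~ I 1 ->
  exists2 P : set A, maximal_ideal P & I `<=` P.
Proof.
move=> hI I1; have hM : is_mult [set x : A | x = 1].
  by split=> // x y /= -> ->; rewrite mulr1.
have [|P [[hP P1 _] IP _ Pmax]] := krull hI hM; first by move=> x Ix /= x1; rewrite x1 in Ix.
exists P => //; split=> //; first by move=> PT; apply: P1; rewrite PT.
move=> J hJ PJ; case: (pselect (J 1)) => J1; last by left; apply: Pmax => // x Jx /= x1; rewrite x1 in Jx.
right; apply/seteqP; split=> // x _; rewrite -[x]mulr1; exact: idealM.
Qed.

Lemma maximal_prime A (P : set A) : maximal_ideal P -> is_prime P.
Proof.
move=> [hP PT Pmax]; have P1 : ~ P 1.
  by move=> P1; apply: PT; apply/seteqP; split=> // x _; rewrite -[x]mulr1; exact: idealM.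
have hM : is_mult [set x : A | x = 1] by split=> // x y /= -> ->; rewrite mulr1.
have [|Q [pQ PQ _ _]] := krull hP hM; first by move=> x Px /= x1; rewrite x1 in Px.
have [hQ Q1 _] := pQ; have [<- //|QT] := Pmax Q hQ PQ.
by case: Q1; rewrite QT.
Qed.

Lemma field_domain F (x y : F) : is_fld F -> x * y = 0 -> x = 0 \/ y = 0.
Proof.
move=> [nz inv] xy; case: (pselect (x = 0)) => [->|/inv [v xv]]; first by left.
by right; rewrite -[y]mul1r -xv mulrAC xy mul0r.
Qed.

Lemma ker_prime A F (f : khom A F) : is_fld F -> is_prime [set a | f a = 0].
Proof.
move=> hF; split; last first.
- by move=> x y /=; rewrite rmorphM; exact: field_domain.
- by rewrite /= rmorph1; exact: hF.1.
split=> [|x y|a x] /=; first exact: rmorph0.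
- by rewrite rmorphD => -> ->; rewrite addr0.
- by rewrite rmorphM => ->; rewrite mulr0.
Qed.

Lemma nzM_mult A : is_domain A -> is_mult [set x : A | x <> 0].
Proof. by move=> [nz dom]; split=> // x y /= x0 y0 /dom []. Qed.

Lemma loc_fld A (dA : is_domain A) : is_fld (loc_kalg (nzM_mult dA)).
Proof.
split=> [|x x0].
  rewrite -(rmorph1 (loc_in (nzM_mult dA))) => /loc_eq0 [u u0].
  by rewrite mulr1.
have [a [s [Ms xs]]] := loc_fracP x.
have [v sv] := loc_unit (nzM_mult dA) Ms.
have a0 : a <> 0.
  move=> a0; apply: x0; rewrite -[x]mulr1 -sv mulrA xs a0.
  by rewrite rmorph0 mul0r.
have [w aw] := loc_unit (nzM_mult dA) (a0 : [set x | x <> 0] a).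
by exists (loc_in (nzM_mult dA) s * w); rewrite mulrA xs.
Qed.

(** L is the residue field Frac(A/P). Its universal property makes it possible to compare two points
    with the same kernel over a common extension. *)
Lemma prime_point A (P : set A) : is_prime P ->
  exists L (f : khom A L), [/\ is_fld L, forall a, f a = 0 <-> P a &
    forall F (g : khom A F), is_fld F -> (forall a, g a = 0 <-> P a) ->
      exists h : khom L F, kcomp h f = g].
Proof.
move=> [hP P1 pP]; pose Q := quot_kalg hP; pose p := quot_pi hP.
have dQ : is_domain Q.
  split; first by rewrite -(rmorph1 p) => /quot_pi0.
  move=> x y; have [a <-] := quot_pi_surj x; have [b <-] := quot_pi_surj y.
  by rewrite -rmorphM => /quot_pi0 /pP [Pa|Pb]; [left|right]; apply/quot_pi0.
exists (loc_kalg (nzM_mult dQ)), (kcomp (loc_in (nzM_mult dQ)) p).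
split; first exact: loc_fld.
  move=> a; rewrite kcompE loc_eq0 -(quot_pi0 hP) -/p.
  by split=> [[u u0 /dQ.2 []//]|->]; exists 1; [exact: dQ.1|rewrite mulr0].
move=> F g hF kg.
have [|h hE] := @factor_surj _ _ _ _ p g (@quot_pi_surj _ _ _ hP).
  by move=> a /quot_pi0 /kg.
have [|h' h'E] := @loc_lift _ _ _ (nzM_mult dQ) _ h.
  move=> x x0; apply: hF.2; have [a ax] := quot_pi_surj x; rewrite -ax hE => /kg Pa.
  by apply: x0; rewrite -ax; apply/quot_pi0.
by exists h'; rewrite kcompA h'E; apply: khomP => a; exact: hE.
Qed.

Lemma max_point A (P : set A) : maximal_ideal P ->
  exists L (f : khom A L), is_fld L /\ forall a, f a = 0 <-> P a.
Proof. by move/maximal_prime/prime_point => [L [f [? ? _]]]; exists L, f. Qed.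

Lemma nz_point A : (1 : A) <> 0 -> exists L (f : khom A L), is_fld L.
Proof.
move=> nz; have hI : is_ideal [set x : A | x = 0].
  by split=> //= [x y -> ->|a x ->]; rewrite ?addr0 ?mulr0.
have [P /max_point [L [f [? _]]] _] := exists_maximal hI nz.
by exists L, f.
Qed.

(** A residue field of L ⊗ L' over F; this tensor product is nonzero, because a certificate for 1 ⊗
    1 = 0 would have zero coefficients. *)
Lemma common_ext F L L' (f : khom F L) (f' : khom F L') :
  is_fld F -> is_fld L -> is_fld L' ->
  exists E (g : khom L E) (g' : khom L' E), is_fld E /\ kcomp g f = kcomp g' f'.
Proof.
move=> hF hL hL'; have fl : eqflat f' := eqflat_field hF.
have nz : (1 : tens_kalg f fl) <> 0.
  move=> E; have : \sum_(i : 'I_1) tensl f fl 1 * tensr f fl 1 = 0.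
    by rewrite big_ord_recl big_ord0 addr0 !rmorph1 mulr1.
  move/tens_zero_fin => [J [d [s [sE sZ]]]]; apply: hL'.1.
  rewrite (sE ord0) big1 // => l _.
  suff -> : s ord0 l = 0 by rewrite rmorph0 mul0r.
  have := sZ l; rewrite big_ord_recl big_ord0 addr0 mulr1 => fs0.
  apply: contrapT => /hF.2 [v sv]; apply: hL.1.
  by rewrite -(rmorph1 f) -sv rmorphM fs0 mul0r.
have [E [h hE]] := nz_point nz.
exists E, (kcomp h (tensl f fl)), (kcomp h (tensr f fl)); split=> //.
by rewrite -!kcompA tens_comm.
Qed.

Lemma fld_inj F A (f : khom F A) : is_fld F -> (1 : A) <> 0 -> injective f.
Proof.
move=> hF nz x y xy; apply: subr0_eq; apply: contrapT => /hF.2 [v xv].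
by apply: nz; rewrite -(rmorph1 f) -xv rmorphM rmorphB xy subrr mul0r.
Qed.

Lemma fieldType_fld (F : fieldType) (iF : {rmorphism k -> F}) : is_fld (KAlg iF).
Proof.
split; first by apply/eqP; exact: oner_neq0.
by move=> x /eqP x0; exists x^-1; exact: divff.
Qed.

End Points.

Section FieldOf.
Variables (R : comPzRingType) (nz : (1 : R) <> 0).
Hypothesis inv : forall x : R, x <> 0 -> is_unit x.

Definition fldR : Type := R.
HB.instance Definition _ := GRing.ComPzRing.on fldR.
Fact fldR_nz : (1 : fldR) != 0. Proof. exact/eqP. Qed.
HB.instance Definition _ := GRing.PzSemiRing_isNonZero.Build fldR fldR_nz.
Definition fldR_inv (x : fldR) : fldR :=
  if pselect (x <> 0) is left h then projT1 (cid (inv h)) else 0.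
Fact fldR_mulV (x : fldR) : x != 0 -> fldR_inv x * x = 1.
Proof.
by move/eqP => x0; rewrite /fldR_inv; case: pselect => // h; case: cid => y /=; rewrite mulrC.
Qed.
Fact fldR_inv0 : fldR_inv 0 = 0.
Proof. by rewrite /fldR_inv; case: pselect => // h. Qed.
HB.instance Definition _ := GRing.ComNzRing_isField.Build fldR fldR_mulV fldR_inv0.
Definition fld_type : fieldType := fldR.
End FieldOf.

(** * Flat descent for points of schemes *)

(** Connects [is_fld], which is convenient for constructed algebras, with the [fieldType] of the
    definitions of points. Destructing the ring beforehand makes the two structures equal by
    computation. *)
Lemma fld_kalg (k : fieldType) (A : kalg k) : is_fld A ->
  exists (F : fieldType) (iF : {rmorphism k -> F}), A = KAlg iF.
Proof.
case: A => R s [/= nz inv]; move: s nz inv.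
case: R => T [m1 m2 m3 m4 m5 m6 m7 m8 m9 m10 m11] s nz inv.
exists (fld_type nz inv).
exists s.
reflexivity.
Qed.

Section Functors.
Variable k : fieldType.
Implicit Types A B C D R L : kalg k.
Implicit Types X Y : kfunctor k.

Local Notation "x @[ f ]" := (fmap f x) (at level 8, format "x @[ f ]").

Lemma fmapK X A B C (g : khom B C) (f : khom A B) (x : X A) :
  fmap g (fmap f x) = fmap (kcomp g f) x.
Proof. by rewrite fmap_comp. Qed.

Lemma yoneda X R (j : kmor (Spec R) X) A (r : khom R A) :
  j A r = fmap r (j R (kid R)).
Proof. by rewrite -kmor_nat /= kcompid. Qed.

Definition pt X R (x : X R) : kmor (Spec R) X :=
  @KMor k (Spec R) X (fun A r => fmap r x)
    (fun A B f r => fmap_comp f r x).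

Lemma scheme_chart X L (x : X L) : is_scheme X -> is_fld L ->
  exists (R : kalg k) (j : kmor (Spec R) X), open_immersion j /\ image j L x.
Proof.
move=> [_ hX] /fld_kalg [F [iF E]]; subst L; exact: hX.
Qed.

Lemma open_unit X (U : subfun X) (hU : is_open U) A (x : X A) :
  exists2 I : set A, is_ideal I &
    (forall B (f : khom A B) i, I i -> is_unit (f i) -> U B (fmap f x)) /\
    (forall L (f : khom A L), is_fld L -> U L (fmap f x) -> exists2 i, I i & f i <> 0) /\
    (U A x -> I 1) /\
    (forall B (f : khom A B), U B (fmap f x) -> exists n (c : 'I_n -> B) (s : 'I_n -> A),
      (forall i, I (s i)) /\ \sum_i f (s i) * c i = 1).
Proof.
have [I hI IU] := hU A x; exists I => //; do !split.
- move=> B f i Ii [v iv]; apply/IU/ideal_gen_image1.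
  by exists 1%N, (fun=> v), (fun=> i); split=> //; rewrite big_ord_recl big_ord0 addr0.
- move=> L f hL /IU /ideal_gen_image1 [n [c [s [Is E]]]].
  apply: contrapT => no; apply: hL.1; rewrite -E big1 // => i _.
  case: (pselect (f (s i) = 0)) => [->|fi]; first by rewrite mul0r.
  by case: no; exists (s i).
- move=> Ux; have := (IU A (kid A)).1; rewrite fmap_id => /(_ Ux) /ideal_gen_image1.
  move=> [n [c [s [Is <-]]]]; apply: ideal_sum => // i; apply: idealMr => //; exact: Is.
- by move=> B f /IU /ideal_gen_image1.
Qed.

Definition pows A (f : A) : set A := [set x | exists n, x = f ^+ n].
Lemma pows_mult A (f : A) : is_mult (pows f).
Proof.
split; first by exists 0%N.
by move=> x y [n ->] [m ->]; exists (n + m)%N; rewrite exprD.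
Qed.

Definition loc1 A (f : A) : kalg k := loc_kalg (pows_mult f).
Definition loc1_in A (f : A) : khom A (loc1 f) := loc_in (pows_mult f).

Lemma unit_hom A B (f : khom A B) x : is_unit x -> is_unit (f x).
Proof. by move=> [v xv]; exists (f v); rewrite -rmorphM xv rmorph1. Qed.

Lemma unit_exp A (x : A) n : is_unit x -> is_unit (x ^+ n).
Proof. by move=> [v xv]; exists (v ^+ n); rewrite -exprMn xv expr1n. Qed.

Lemma unit_mulP A (x y : A) : is_unit (x * y) <-> is_unit x /\ is_unit y.
Proof.
split=> [[v xv]|[[v xv] [w yw]]].
  by split; [exists (y * v); rewrite mulrA | exists (x * v); rewrite mulrCA mulrA].
by exists (v * w); rewrite mulrACA xv yw mulr1.
Qed.

Lemma loc1_unit A (f : A) : is_unit (loc1_in f f).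
Proof. by apply: loc_unit; exists 1%N; rewrite expr1. Qed.

Lemma loc1_lift A (f : A) C (chi : khom A C) : is_unit (chi f) ->
  exists h : khom (loc1 f) C, kcomp h (loc1_in f) = chi.
Proof.
move=> u; apply: loc_lift => s [n ->]; rewrite rmorphXn; exact: unit_exp.
Qed.

Lemma loc1P A (f : A) : is_localization f (loc1_in f).
Proof.
split; first exact: loc1_unit.
move=> C chi u; have [h hE] := loc1_lift u; exists h; split=> // h' h'E.
by apply: loc_ext; rewrite [LHS]hE [RHS]h'E.
Qed.

Lemma tens_loc1P A A' (phi : khom A A') (fl : eqflat phi) (f : A) :
  is_localization (phi f) (tensr (loc1_in f) fl).
Proof.
have E := tens_comm (loc1_in f) fl; split.
  by rewrite -(khom_comp_eq E); apply: unit_hom; exact: loc1_unit.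
move=> C chi u.
have [h hE] := @loc1_lift _ f C (kcomp chi phi) u.
have [h' [hl hr]] := @tens_lift _ _ _ _ (loc1_in f) _ fl C h chi hE.
exists h'; split=> // h'' h''r; apply: tens_ext; last by rewrite hr h''r.
apply: loc_ext; rewrite hl [LHS]hE -kcompA -/(loc1_in f) [in RHS]E kcompA h''r.
by [].
Qed.

Lemma zar_sep X A n (a : 'I_n -> A) (B : 'I_n -> kalg k) (phi : forall i, khom A (B i))
    (y y' : X A) : is_zariski_sheaf X ->
  ideal_gen (range a) = setT -> (forall i, is_localization (a i) (phi i)) ->
  (forall i, fmap (phi i) y = fmap (phi i) y') -> y = y'.
Proof.
move=> hX aT loc E.
have [|z [_ zu]] := hX A n a B phi (fun i => fmap (phi i) y) aT loc.
  by move=> i j C f g fg; rewrite !fmapK fg.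
by rewrite -(zu y) // -(zu y').
Qed.

Lemma ideal_range A (S : set A) : ideal_gen S 1 ->
  exists n (a : 'I_n -> A), (forall i, S (a i)) /\ ideal_gen (range a) = setT.
Proof.
move=> /ideal_genP [n [c [s [Ss E]]]]; exists n, s; split=> //.
rewrite ideal_genT E; apply: (ideal_sum (ideal_gen_ideal _)) => i.
by apply: (idealM (ideal_gen_ideal _)); apply: ideal_gen_sub; exists i.
Qed.

Lemma ff_point A B (phi : khom A B) (I : set A) : ffhom phi -> is_ideal I -> ~ I 1 ->
  exists L (l : khom B L), is_fld L /\ forall a, I a -> l (phi a) = 0.
Proof.
move=> [_ ff] hI I1.
have [|P /max_point [L [l [hL lP]]] IP] := exists_maximal (ideal_gen_ideal (phi @` I)).
  move/ideal_genT/ideal_gen_image1 => [n [c [s [Is /ff [d dE]]]]]; apply: I1.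
  by rewrite -dE; apply: ideal_sum => // i; exact: idealMr.
exists L, l; split=> // a Ia; apply/lP/IP; apply: ideal_gen_sub; by exists a.
Qed.

(** The elements f of A over which x and y agree generate the unit ideal. Otherwise some point of
    Spec B lies over a maximal ideal m containing them; there x and y lie in one affine chart, hence
    also over A_f for some f outside m, and inside the chart the question is injectivity of A_f →
    A_f ⊗ B. *)
Lemma ff_separated X A B (phi : khom A B) (x y : X A) :
  is_scheme X -> ffhom phi -> fmap phi x = fmap phi y -> x = y.
Proof.
move=> hX ff xy.
pose good := [set f : A | fmap (loc1_in f) x = fmap (loc1_in f) y].
case: (pselect (ideal_gen good 1)) => [/ideal_range [n [a [ga aT]]]|g1].
  by apply: (zar_sep hX.1 aT (fun i => loc1P (a i))) => i; exact: ga.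
have [m mm gm] := exists_maximal (ideal_gen_ideal good) g1.
have [hm m1 _] := maximal_prime mm.
have [L [l [hL lm]]] := ff_point ff hm m1.
have [R [j [[inj_j oj] jx]]] := scheme_chart (fmap (kcomp l phi) x) hX hL.
have [I1 hI1 [I1u [I1f _]]] := open_unit oj x.
have [I2 hI2 [I2u [I2f _]]] := open_unit oj y.
have [f1 I1f1 nz1] := I1f _ _ hL jx.
have [f2 I2f2 nz2] : exists2 i, I2 i & (kcomp l phi) i <> 0.
  by apply: I2f => //; rewrite -fmapK -xy fmapK.
pose f := f1 * f2.
have fm : ~ m f.
  move/lm; rewrite rmorphM rmorphM => /(field_domain hL) []; [exact: nz1 | exact: nz2].
case: fm; apply: gm; apply: ideal_gen_sub; rewrite /good /=.
have uf := loc1_unit f; rewrite rmorphM in uf; have [u1 u2] := (unit_mulP _ _).1 uf.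
have [r1 _ r1E] := I1u _ _ _ I1f1 u1.
have [r2 _ r2E] := I2u _ _ _ I2f2 u2.
rewrite -r1E -r2E; congr (j _ _).
suff E : kcomp (tensl (loc1_in f) ff.1) r1 = kcomp (tensl (loc1_in f) ff.1) r2.
  apply: khomP => z; apply: (ff_inj (ff_tensl (loc1_in f) ff)).
  exact: (khom_comp_eq E).
apply: inj_j; have kn := fun r => kmor_nat j (tensl (loc1_in f) ff.1) r.
rewrite [LHS]kn [RHS]kn r1E r2E !fmapK tens_comm -!fmapK xy //.
Qed.

Lemma prime_comap A B (phi : khom A B) (P : set B) :
  is_prime P -> is_prime [set a | P (phi a)].
Proof.
move=> [hP P1 pP]; split=> /=; last first.
- by move=> x y; rewrite rmorphM; exact: pP.
- by rewrite rmorph1.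
split=> [|x y|a x] /=; first by rewrite rmorph0; exact: ideal0.
- by rewrite rmorphD; exact: idealD.
- by rewrite rmorphM; exact: idealM.
Qed.

(** P is a prime that contains qB and avoids the products φ(f) g with f outside q and g outside w.
    If such a product lay in qB, the equational criterion would write g through coefficients r_l
    with f r_l in q, hence r_l in q, and g would lie in w. *)
Lemma going_down A B (phi : khom A B) (q : set A) (w : set B) :
  eqflat phi -> is_prime q -> is_prime w -> (forall a, q a -> w (phi a)) ->
  exists P : set B, [/\ is_prime P, P `<=` w & forall a, P (phi a) <-> q a].
Proof.
move=> fl [hq q1 pq] [hw w1 pw] qw.
pose M := [set z | exists f g, [/\ ~ q f, ~ w g & z = phi f * g]].
have hM : is_mult M.
  split; first by exists 1, 1; rewrite rmorph1 mulr1.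
  move=> x y [f [g [qf wg ->]]] [f' [g' [qf' wg' ->]]]; exists (f * f'), (g * g').
  split; [by move/pq => []|by move/pw => []|by rewrite rmorphM; ring].
have [|P [pP IP PM _]] := krull (ideal_gen_ideal (phi @` q)) hM.
  move=> x /ideal_genP [n [c [s [Ss ->]]]] [f [g [qf wg E]]].
  have /choice [t tP] i : exists t, q t /\ phi t = s i by have [t St ft] := Ss i; exists t.
  have rel : \sum_(o : option 'I_n) phi (if o is Some i then - t i else f) *
      (if o is Some i then c i else g) = 0.
    rewrite (bigD1 None) //= (reindex_omap Some id) /=; last by case.
    rewrite -E (eq_bigl xpredT); last by move=> j; rewrite eqxx.
    rewrite -big_split big1 //= => i _.
    by rewrite rmorphN (tP i).2; ring.
  have [J [d [r [rE rZ]]]] := fl _ _ _ rel.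
  apply: wg; rewrite (rE None); apply: ideal_sum => // l.
  apply: idealMr => //; apply: qw.
  have : q (f * r None l).
    have := rZ l; rewrite (bigD1 None) //= => /eqP; rewrite addr_eq0 => /eqP ->.
    apply: idealN => //; rewrite (reindex_omap Some id) /=; last by case.
    by apply: ideal_sum => // i; rewrite mulNr; apply: idealN => //; apply: idealMr => //; case: (tP i).
  by move/pq => [].
exists P; split=> //.
  move=> z Pz; apply: contrapT => wz; apply: (PM z Pz).
  by exists 1, z; split=> //; rewrite rmorph1 mul1r.
move=> a; split=> [Pa|qa]; last by apply: IP; apply: ideal_gen_sub; exists a.
apply: contrapT => qa'; apply: (PM _ Pa).
by exists a, 1; split=> //; rewrite mulr1.
Qed.

(** Schemes are sheaves for faithfully flat maps. Near a maximal ideal m of A the point is first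
    brought into one affine chart by inverting an element f of A outside m; in the chart, the
    descent is that of a ring homomorphism, by [ff_equalizer]. The local solutions are glued by the
    Zariski sheaf property. *)
Lemma ff_descent X A B (phi : khom A B) (x : X B) :
  is_scheme X -> ffhom phi ->
  (forall R (f g : khom B R), kcomp f phi = kcomp g phi -> fmap f x = fmap g x) ->
  exists y : X A, fmap phi y = x.
Proof.
move=> hX ff eqx; have fl := ff.1.
pose good := [set f : A | exists y : X (loc1 f),
   fmap (tensl (loc1_in f) ff.1) y = fmap (tensr (loc1_in f) ff.1) x].
case: (pselect (ideal_gen good 1)) => [/ideal_range [n [a [ga aT]]]|g1].
  pose z i : X (loc1 (a i)) := projT1 (cid (ga i)).
  have zE i : fmap (tensl (loc1_in (a i)) ff.1) (z i) = fmap (tensr (loc1_in (a i)) ff.1) x.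
    by rewrite /z; case: cid.
  have zC i C (f : khom (loc1 (a i)) C) (psi : khom A C) : kcomp f (loc1_in (a i)) = psi ->
      fmap (tensl psi ff.1) (fmap f (z i)) = fmap (tensr psi ff.1) x.
    move=> E.
    have [|h [hl hr]] := @tens_lift _ _ _ _ (loc1_in (a i)) _ ff.1 _
      (kcomp (tensl psi ff.1) f) (tensr psi ff.1).
      by rewrite -kcompA E tens_comm.
    by rewrite fmapK -hl -fmapK zE fmapK hr.
  have [|y [yE _]] := hX.1 A n a _ _ z aT (fun i => loc1P (a i)).
    move=> i j C f g fg; apply: (ff_separated hX (ff_tensl (kcomp f (loc1_in (a i))) ff)).
    by rewrite (zC i) // (zC j).
  exists y.
  have aT' : ideal_gen (range (phi \o a)) = setT.
    move: aT; rewrite !ideal_genT => /ideal_genP [m [c [s [rs E]]]].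
    rewrite -(rmorph1 phi) E rmorph_sum; apply: (ideal_sum (ideal_gen_ideal _)) => i.
    rewrite rmorphM; apply: (idealM (ideal_gen_ideal _)); apply: ideal_gen_sub.
    by have [i' _ <-] := rs i; exists i'.
  apply: (zar_sep hX.1 aT' (fun i => tens_loc1P ff.1 (a i))) => i.
  by rewrite fmapK -tens_comm -fmapK yE zE.
have [m mm gm] := exists_maximal (ideal_gen_ideal good) g1.
have pm := maximal_prime mm; have [hm m1 _] := pm.
have [L [l [hL lm]]] := ff_point ff hm m1.
have [R [j [[inj_j oj] jx]]] := scheme_chart (fmap l x) hX hL.
have [I hI [Iu [If _]]] := open_unit oj x.
suff [f fm Ip] : exists2 f, ~ m f & I (phi f).
  case: fm; apply: gm; apply: ideal_gen_sub.
  have [|r _ rE] := Iu _ (tensr (loc1_in f) ff.1) _ Ip.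
    exact: (tens_loc1P ff.1 f).1.
  have im z : exists b, tensl (loc1_in f) ff.1 b = r z.
    apply: (ff_equalizer (ff_tensl (loc1_in f) ff)) => D g h gh.
    suff : kcomp g r = kcomp h r by move/khom_comp_eq; apply.
    apply: inj_j; have kn s t := kmor_nat j (s : khom _ D) t.
    rewrite [LHS]kn [RHS]kn rE !fmapK; apply: eqx.
    by rewrite -!kcompA -tens_comm !kcompA gh.
  have [s sE] := factor_inj (ff_inj (ff_tensl (loc1_in f) ff)) im.
  exists (j _ s); rewrite -rE -kmor_nat; congr (j _ _).
  by apply: khomP => z; exact: sE.
(* If no such f exists, some prime z of B contains I and contracts to a prime inside m. Going down
   yields a prime w below the chosen point with the same contraction as z. Over a common extension
   of their residue fields x takes the same value at both, in the chart at w but not at z. *)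
apply: contrapT => no.
have hM : is_mult [set z | exists2 f, ~ m f & z = phi f].
  split; first by exists 1; rewrite ?rmorph1.
  move=> u v [f mf ->] [g mg ->]; exists (f * g); last by rewrite rmorphM.
  by case: pm => _ _ p /p [].
have [|z [pz Iz zM _]] := krull hI hM.
  by move=> u Iu' [f mf uE]; apply: no; exists f => //; rewrite -uE.
have pq := prime_comap phi pz.
have qm a : z (phi a) -> m a.
  move=> za; apply: contrapT => ma; apply: (zM _ za); by exists a.
have [w [pw ww wq]] := going_down fl pq (ker_prime l hL) (fun a qa => lm a (qm a qa)).
have [K [kq [hK kqE kqU]]] := prime_point pq.
have [K1 [f1 [hK1 f1E _]]] := prime_point pw.
have [K2 [f2 [hK2 f2E _]]] := prime_point pz.
have [|h1 h1E] := kqU _ (kcomp f1 phi) hK1.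
  by move=> a; rewrite kcompE f1E wq.
have [|h2 h2E] := kqU _ (kcomp f2 phi) hK2.
  by move=> a; rewrite kcompE f2E.
have [E [e1 [e2 [hE e12]]]] := common_ext h1 h2 hK hK1 hK2.
have xE : fmap (kcomp e1 f1) x = fmap (kcomp e2 f2) x.
  by apply: eqx; rewrite -!kcompA -h1E -h2E !kcompA e12.
have [i Ii li] := If _ _ hL jx.
have : image j _ (fmap (kcomp e2 f2) x).
  rewrite -xE; apply: (Iu _ _ i Ii); apply: hE.2; rewrite kcompE => /eqP.
  rewrite -(rmorph0 e1) => /eqP /(fld_inj hK1 hE.1) /f1E /ww.
  by rewrite /=.
move/(If _ _ hE) => [i' /Iz /f2E]; rewrite kcompE => ->; apply; exact: rmorph0.
Qed.

End Functors.

(** * Flatness of modules and the equational criterion *)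

Section Linear.
Variables (A B : comPzRingType) (phi : {rmorphism A -> B}).

Section SemiLinear.
Variables (M : lmodType A) (N : lmodType B) (f : M -> N).
Hypothesis (fD : forall x y, f (x + y) = f x + f y).
Hypothesis (fZ : forall a x, f (a *: x) = phi a *: f x).
Definition semilin_fun := f.
Fact semilin_zmod : zmod_morphism semilin_fun.
Proof.
move=> x y; rewrite /semilin_fun fD; congr (_ + _).
by rewrite -scaleN1r fZ rmorphN rmorph1 scaleN1r.
Qed.
Fact semilin_scal : GRing.scalable_for (phi \; *:%R) semilin_fun. Proof. exact: fZ. Qed.
HB.instance Definition _ := GRing.isZmodMorphism.Build M N semilin_fun semilin_zmod.
HB.instance Definition _ :=
  GRing.isScalable.Build A M N (phi \; *:%R) semilin_fun semilin_scal.
Definition mk_semilin : {linear M -> N | phi \; *:%R} := semilin_fun.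
Lemma mk_semilinE x : mk_semilin x = f x. Proof. by []. Qed.
End SemiLinear.

Section Lin.
Variables (M N : lmodType A) (f : M -> N).
Hypothesis (fD : forall x y, f (x + y) = f x + f y).
Hypothesis (fZ : forall a x, f (a *: x) = a *: f x).
Definition lin_fun := f.
Fact lin_zmod : zmod_morphism lin_fun.
Proof.
by move=> x y; rewrite /lin_fun fD; congr (_ + _); rewrite -scaleN1r fZ scaleN1r.
Qed.
Fact lin_scal : scalable lin_fun. Proof. exact: fZ. Qed.
HB.instance Definition _ := GRing.isZmodMorphism.Build M N lin_fun lin_zmod.
HB.instance Definition _ := GRing.isScalable.Build A M N *:%R lin_fun lin_scal.
Definition mk_lin : {linear M -> N} := lin_fun.
Lemma mk_linE x : mk_lin x = f x. Proof. by []. Qed.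
End Lin.
End Linear.

Section QuotientModule.
Variables (A : comPzRingType) (V : lmodType A) (W : set V).
Hypothesis (W0 : W 0) (WD : forall x y, W x -> W y -> W (x + y)).
Hypothesis (WZ : forall a x, W x -> W (a *: x)).

Let R (x y : V) := W (x - y).
Let Rrefl x : R x x. Proof. by rewrite /R subrr. Qed.
Let Rsym x y : R x y -> R y x.
Proof. by move/(WZ (-1)); rewrite scaleN1r opprB. Qed.
Let Rtrans x y z : R x y -> R y z -> R x z.
Proof. by move=> xy yz; have := WD xy yz; rewrite addrA addrNK. Qed.

(* The hypotheses appear in the type, so that the instances below apply. *)
Definition qmod of W 0 & (forall x y, W x -> W y -> W (x + y)) &
  (forall a x, W x -> W (a *: x)) : Type := quo R.
Local Notation Q := (qmod W0 WD WZ).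
HB.instance Definition _ := Choice.on Q.

Definition mpi (x : V) : Q := qpi R x.
Let mrepr (q : Q) : V := qrepr q.
Let mreprK q : mpi (mrepr q) = q. Proof. exact: qreprK. Qed.
Lemma mpiE x y : mpi x = mpi y <-> W (x - y).
Proof. exact: qpiE Rrefl Rsym Rtrans x y. Qed.
Lemma mpi_surj q : exists x, q = mpi x.
Proof. by exists (mrepr q); rewrite mreprK. Qed.
Let mreprE x : W (mrepr (mpi x) - x).
Proof. by apply/mpiE; rewrite mreprK. Qed.

Definition madd (a b : Q) := mpi (mrepr a + mrepr b).
Definition mopp (a : Q) := mpi (- mrepr a).
Definition mscale c (a : Q) := mpi (c *: mrepr a).

Lemma maddE x y : madd (mpi x) (mpi y) = mpi (x + y).
Proof. by apply/mpiE; rewrite opprD addrACA; apply: WD; exact: mreprE. Qed.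
Lemma moppE x : mopp (mpi x) = mpi (- x).
Proof. by apply/mpiE; rewrite -opprD -[- (_ + _)]scaleN1r; apply: WZ; exact: mreprE. Qed.
Lemma mscaleE c x : mscale c (mpi x) = mpi (c *: x).
Proof. by apply/mpiE; rewrite -scalerBr; apply: WZ; exact: mreprE. Qed.

Fact maddA : associative madd.
Proof.
move=> a b c; have [x ->] := mpi_surj a; have [y ->] := mpi_surj b.
by have [z ->] := mpi_surj c; rewrite !maddE addrA.
Qed.
Fact maddC : commutative madd.
Proof.
move=> a b; have [x ->] := mpi_surj a; have [y ->] := mpi_surj b.
by rewrite !maddE addrC.
Qed.
Fact madd0 : left_id (mpi 0) madd.
Proof. by move=> a; have [x ->] := mpi_surj a; rewrite !maddE add0r. Qed.
Fact maddN : left_inverse (mpi 0) mopp madd.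
Proof. by move=> a; have [x ->] := mpi_surj a; rewrite moppE !maddE addNr. Qed.
HB.instance Definition _ := GRing.isZmodule.Build Q maddA maddC madd0 maddN.

Fact mscaleA a b v : mscale a (mscale b v) = mscale (a * b) v.
Proof. by have [x ->] := mpi_surj v; rewrite !mscaleE scalerA. Qed.
Fact mscale1 : left_id 1 mscale.
Proof. by move=> a; have [x ->] := mpi_surj a; rewrite !mscaleE scale1r. Qed.
Fact mscaleDr : right_distributive mscale +%R.
Proof.
move=> c a b; have [x ->] := mpi_surj a; have [y ->] := mpi_surj b.
by rewrite -[mpi x + mpi y]/(madd _ _) -[RHS]/(madd _ _) !(maddE, mscaleE) scalerDr.
Qed.
Fact mscaleDl v : {morph mscale^~ v : a b / a + b}.
Proof.
move=> a b /=; have [x ->] := mpi_surj v.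
by rewrite -[RHS]/(madd _ _) !mscaleE maddE scalerDl.
Qed.
HB.instance Definition _ :=
  GRing.Zmodule_isLmodule.Build A Q mscaleA mscale1 mscaleDr mscaleDl.

Lemma mpiD x y : mpi (x + y) = mpi x + mpi y. Proof. by rewrite -maddE. Qed.
Lemma mpiZ c x : mpi (c *: x) = c *: mpi x. Proof. by rewrite -mscaleE. Qed.

Lemma mquot_lift (A' : comPzRingType) (P : lmodType A') (f : V -> P) :
  (forall x y, f (x + y) = f x + f y) -> (forall x, W x -> f x = 0) ->
  exists h : Q -> P, forall x, h (mpi x) = f x.
Proof.
move=> fD f0; exists (fun q => f (mrepr q)) => x.
rewrite -[mrepr _](subrK x) fD f0 ?add0r //; exact: mreprE.
Qed.

End QuotientModule.

Section LinearFlatness.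
Variable k : fieldType.

(* The injection [A^n / ker -> A] given by a linear form has as extension of
   scalars [B^n / <ker> -> B]. *)
Lemma flat_eqflat (A B : kalg k) (phi : khom A B) : flat_rmorphism phi -> eqflat phi.
Proof.
move=> fl I a b rel.
pose V := {ffun I -> A^o} : lmodType A; pose VB := {ffun I -> B^o} : lmodType B.
pose W := [set v : V | \sum_i v i * a i = 0].
pose ph (v : V) : VB := [ffun i => phi (v i)].
have phD u v : ph (u + v) = ph u + ph v.
  by apply/ffunP => i; rewrite !ffunE rmorphD.
have phZ c v : ph (c *: v) = phi c *: ph v.
  by apply/ffunP => i; rewrite !ffunE; exact: rmorphM.
pose WB := [set w : VB | exists (J : finType) (c : J -> B) (s : J -> V),
   (forall l, W (s l)) /\ w = \sum_l c l *: ph (s l)].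
have W0 : W 0 by rewrite /W /=; apply: big1 => i _; rewrite ffunE mul0r.
have WD x y : W x -> W y -> W (x + y).
  rewrite /W /= => Wx Wy; under eq_bigr do rewrite ffunE mulrDl.
  by rewrite big_split /= Wx Wy addr0.
have WZ c x : W x -> W (c *: x).
  rewrite /W /= => Wx; under eq_bigr do rewrite ffunE -mulrA.
  by rewrite -mulr_sumr Wx mulr0.
have WB0 : WB 0 by exists 'I_0, (fun=> 0), (fun=> 0); rewrite big_ord0.
have WBD x y : WB x -> WB y -> WB (x + y).
  move=> [J [c [s [Ws ->]]]] [K [d [t [Wt ->]]]]; exists (J + K)%type.
  exists (fun l => match l with inl j => c j | inr h => d h end).
  exists (fun l => match l with inl j => s j | inr h => t h end).
  by split; [case | rewrite big_sumType].
have WBZ c x : WB x -> WB (c *: x).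
  move=> [J [d [s [Ws ->]]]]; exists J, (fun l => c * d l), s; split=> //.
  by rewrite scaler_sumr; apply: eq_bigr => l _; rewrite scalerA.
pose M := qmod W0 WD WZ : lmodType A; pose MB := qmod WB0 WBD WBZ : lmodType B.
pose pM v : M := mpi W0 WD WZ v; pose pMB v : MB := mpi WB0 WBD WBZ v.
have [|v Wv|t tE] := @mquot_lift _ _ W W0 WD WZ B MB (fun v => pMB (ph v)).
- by move=> x y; rewrite phD; exact: mpiD.
- apply/mpiE; rewrite subr0; exists 'I_1, (fun=> 1), (fun=> v); split=> //.
  by rewrite big_ord_recl big_ord0 addr0 scale1r.
have [||u uE] := @mquot_lift _ _ W W0 WD WZ A A^o (fun v => \sum_i v i * a i).
- by move=> x y; under eq_bigr do rewrite ffunE mulrDl; rewrite big_split.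
- by [].
have [||v vE] := @mquot_lift _ _ WB WB0 WBD WBZ B B^o (fun v => \sum_i v i * phi (a i)).
- by move=> x y; under eq_bigr do rewrite ffunE mulrDl; rewrite big_split.
- move=> w [J [c [s [Ws ->]]]].
  under eq_bigr do rewrite sum_ffunE mulr_suml.
  rewrite exchange_big big1 //= => l _.
  transitivity (c l * phi (\sum_i s l i * a i)); last by rewrite Ws rmorph0 mulr0.
  rewrite rmorph_sum mulr_sumr; apply: eq_bigr => i _.
  by rewrite !ffunE rmorphM mulrA.
have tD : forall x y, t (x + y) = t x + t y.
  move=> x y; have [x' ->] := mpi_surj x; have [y' ->] := mpi_surj y.
  by rewrite -mpiD !tE phD; exact: mpiD.
have tZ : forall c x, t (c *: x) = phi c *: t x.
  by move=> c x; have [x' ->] := mpi_surj x; rewrite -mpiZ !tE phZ; exact: mpiZ.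
have uD : forall x y, u (x + y) = u x + u y.
  move=> x y; have [x' ->] := mpi_surj x; have [y' ->] := mpi_surj y.
  rewrite -mpiD !uE; under eq_bigr do rewrite ffunE mulrDl.
  by rewrite big_split.
have uZ : forall c x, u (c *: x) = c *: u x.
  move=> c x; have [x' ->] := mpi_surj x; rewrite -mpiZ !uE scaler_sumr.
  by apply: eq_bigr => i _; rewrite ffunE -[LHS]mulrA.
have vD : forall x y, v (x + y) = v x + v y.
  move=> x y; have [x' ->] := mpi_surj x; have [y' ->] := mpi_surj y.
  rewrite -mpiD !vE; under eq_bigr do rewrite ffunE mulrDl.
  by rewrite big_split.
have vZ : forall c x, v (c *: x) = c *: v x.
  move=> c x; have [x' ->] := mpi_surj x; rewrite -mpiZ !vE scaler_sumr.
  by apply: eq_bigr => i _; rewrite ffunE -[LHS]mulrA.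
pose de i : V := [ffun j => (j == i)%:R]; pose deB i : VB := [ffun j => (j == i)%:R].
have deE i : ph (de i) = deB i by apply/ffunP => j; rewrite !ffunE rmorph_nat.
have deS (w : VB) : w = \sum_i w i *: deB i.
  apply/ffunP => j; rewrite sum_ffunE (bigD1 j) //= !ffunE eqxx big1 ?addr0.
    by rewrite -[RHS]/(w j * 1) mulr1.
  by move=> i /negPf ij; rewrite !ffunE eq_sym ij -[LHS]/(w i * 0) mulr0.
have deSA (w : V) : w = \sum_i w i *: de i.
  apply/ffunP => j; rewrite sum_ffunE (bigD1 j) //= !ffunE eqxx big1 ?addr0.
    by rewrite -[RHS]/(w j * 1) mulr1.
  by move=> i /negPf ij; rewrite !ffunE eq_sym ij -[LHS]/(w i * 0) mulr0.
have pM_sum (w : V) : pM w = \sum_i w i *: pM (de i).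
  have pMD : {morph pM : x y / x + y} by move=> x y; exact: mpiD.
  rewrite {1}[w]deSA (big_morph pM pMD (erefl : pM 0 = 0)).
  by apply: eq_bigr => i _; exact: mpiZ.
have pMB_sum (w : VB) : pMB w = \sum_i w i *: pMB (deB i).
  have pMD : {morph pMB : x y / x + y} by move=> x y; exact: mpiD.
  rewrite {1}[w]deS (big_morph pMB pMD (erefl : pMB 0 = 0)).
  by apply: eq_bigr => i _; exact: mpiZ.
have extM : is_scalar_extension (mk_semilin tD tZ).
  move=> P g.
  have gE w : g (pM w) = \sum_i phi (w i) *: g (pM (de i)).
    by rewrite pM_sum linear_sum; apply: eq_bigr => i _; rewrite linearZ.
  have [|w|h hE] := @mquot_lift _ _ WB WB0 WBD WBZ B P
     (fun w => \sum_i w i *: g (pM (de i))).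
  - by move=> x y; under eq_bigr do rewrite ffunE scalerDl; rewrite big_split.
  - move=> [J [c [s [Ws ->]]]].
    under eq_bigr do rewrite sum_ffunE scaler_suml.
    rewrite exchange_big big1 //= => l _.
    transitivity (c l *: g (pM (s l))).
      rewrite gE scaler_sumr; apply: eq_bigr => i _.
      by rewrite !ffunE scalerA.
    suff -> : pM (s l) = 0 by rewrite linear0 scaler0.
    by apply/mpiE; rewrite subr0.
  have hD : forall x y, h (x + y) = h x + h y.
    move=> x y; have [x' ->] := mpi_surj x; have [y' ->] := mpi_surj y.
    rewrite -mpiD !hE; under eq_bigr do rewrite ffunE scalerDl.
    by rewrite big_split.
  have hZ : forall c x, h (c *: x) = c *: h x.
    move=> c x; have [x' ->] := mpi_surj x; rewrite -mpiZ !hE scaler_sumr.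
    by apply: eq_bigr => i _; rewrite ffunE scalerA.
  exists (mk_lin hD hZ); split=> [m|h' h'E x].
    have [w ->] := mpi_surj m; rewrite mk_linE mk_semilinE.
    by rewrite tE hE gE; apply: eq_bigr => i _; rewrite ffunE.
  have [w ->] := mpi_surj x; rewrite mk_linE hE -/(pMB w) pMB_sum linear_sum.
  apply: eq_bigr => i _; rewrite linearZ -h'E; congr (_ *: h' _).
  by rewrite mk_semilinE tE deE.
have phoD : forall x y : A^o, phi (x + y) = phi x + phi y :> B^o by exact: rmorphD.
have phoZ : forall (c : A) (x : A^o), phi (c *: x) = phi c *: (phi x : B^o) by exact: rmorphM.
have extN : is_scalar_extension (@mk_semilin _ _ phi A^o B^o _ phoD phoZ).
  move=> P g.
  have hD : forall x y : B^o, (x + y) *: g 1 = x *: g 1 + y *: g 1.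
    by move=> x y; rewrite scalerDl.
  have hZ : forall (c : B) (x : B^o), (c *: x : B^o) *: g 1 = c *: (x *: g 1).
    by move=> c x; rewrite scalerA.
  exists (@mk_lin _ B^o P (fun x : B^o => x *: g 1) hD hZ); split=> [m|h' h'E x].
    rewrite -[LHS]/(phi m *: g 1); rewrite -{2}[m]mulr1.
    by rewrite -[m * 1]/(m *: (1 : A^o)) linearZ.
  rewrite -[RHS]/(x *: g 1) -h'E -linearZ; congr (h' _).
  by rewrite mk_semilinE rmorph1 -[RHS]/(x * 1) mulr1.
have inj_u : injective (mk_lin uD uZ).
  move=> x y; have [x' ->] := mpi_surj x; have [y' ->] := mpi_surj y.
  rewrite !mk_linE !uE => xy; apply/mpiE; rewrite /W /=.
  under eq_bigr do rewrite !ffunE mulrBl.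
  by rewrite sumrB xy subrr.
have /(_ _)/= inj_v := fl _ _ (mk_lin uD uZ) _ _ _ _ (mk_lin vD vZ) extM extN _ inj_u.
have {}inj_v : injective v.
  apply: inj_v => m; have [w ->] := mpi_surj m.
  rewrite -[LHS]/(v (t _)) -[RHS]/(phi (u _)) tE vE uE rmorph_sum.
  by apply: eq_bigr => i _; rewrite ffunE rmorphM.
(* The given relation says that the extended linear form kills the class of b; injectivity puts b
   into the B-span of the relations over A. *)
have : WB [ffun i => b i].
  rewrite -[X in WB X]subr0; apply/(mpiE WB0 WBD WBZ)/inj_v; rewrite !vE.
  under eq_bigr do rewrite ffunE mulrC.
  by rewrite rel big1 // => i _; rewrite ffunE mul0r.
move=> [J [c [s [Ws bE]]]]; exists J, c, (fun i l => s l i); split=> [i|l].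
  have /ffunP/(_ i) := bE; rewrite ffunE sum_ffunE => ->.
  by apply: eq_bigr => l _; rewrite !ffunE mulrC.
by rewrite -[RHS](Ws l); apply: eq_bigr => i _; rewrite mulrC.
Qed.

End LinearFlatness.

(** * Flatness over a field *)

Section FieldFlat.
Variable k : fieldType.

(** A subspace W maximal among those meeting the image of u trivially is a complement of it: a
    vector outside W gives a relation c n + w = u m with m nonzero, where c is invertible. *)
Lemma field_retraction (F : kalg k) (M N : lmodType F) (u : {linear M -> N}) :
  is_fld F -> injective u -> exists r : {linear N -> M}, forall m, r (u m) = m.
Proof.
move=> hF inj_u.
pose sub (W : set N) := [/\ W 0, forall x y, W x -> W y -> W (x + y) &
  forall c x, W x -> W (c *: x)].
pose dis (W : set N) := forall m, W (u m) -> m = 0.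
pose T := {W : set N | sub W /\ dis W}.
have T0 : sub [set x | x = 0] /\ dis [set x | x = 0].
  split; first by split=> [//|x y /= -> ->|c x /= ->]; rewrite ?addr0 ?scaler0.
  by move=> m /= um; apply: inj_u; rewrite um linear0.
have [| | |C tot|W Wmax] := @Zorn T (fun J K => `[< sval J `<=` sval K >]).
- by move=> J; apply/asboolP.
- by move=> J K L /asboolP JK /asboolP KL; apply/asboolP => x /JK /KL.
- move=> J K /asboolP JK /asboolP KJ; apply: sig_ext; apply/seteqP; split => //.
- case: (pselect (exists J0, C J0)) => [[J0 CJ0]|noC]; last first.
    by exists (exist (fun W => sub W /\ dis W) _ T0) => s Cs; case: noC; exists s.
  pose U := [set x | exists2 J, C J & sval J x].
  have hU : sub U /\ dis U.
    split; last by move=> m [J CJ Jm]; case: (svalP J) => _; apply.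
    split.
    + by exists J0 => //; case: (svalP J0) => -[].
    + move=> x y [J CJ Jx] [K CK Ky].
      have [/asboolP JK|/asboolP KJ] := tot _ _ CJ CK.
        by exists K => //; case: (svalP K) => -[_ h _] _; apply: h => //; exact: JK.
      by exists J => //; case: (svalP J) => -[_ h _] _; apply: h => //; exact: KJ.
    + by move=> a x [J CJ Jx]; exists J => //; case: (svalP J) => -[_ _ h] _; exact: h.
  by exists (exist _ U hU) => s Cs; apply/asboolP => x sx; exists s.
case: W Wmax => W [sW disW] /= Wmax; have [W0 WD WZ] := sW.
have dec n : exists m, W (n - u m).
  pose W' := [set x | exists c w, W w /\ x = c *: n + w].
  have sW' : sub W'.
    split; first by exists 0, 0; rewrite scale0r addr0.
    + move=> x y [c [w [Ww ->]]] [d [v [Wv ->]]]; exists (c + d), (w + v).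
      by split; [exact: WD | rewrite scalerDl addrACA].
    + move=> a x [c [w [Ww ->]]]; exists (a * c), (a *: w).
      by split; [exact: WZ | rewrite scalerDr scalerA].
  have WW' : W `<=` W' by move=> w Ww; exists 0, w; rewrite scale0r add0r.
  have nW' : W' n by exists 1, 0; rewrite scale1r addr0.
  case: (pselect (dis W')) => [dW'|].
    exists 0; rewrite linear0 subr0.
    have /(congr1 sval) /= E := Wmax (exist _ W' (conj sW' dW')) (asboolT WW').
    by rewrite -E.
  move/existsNP => [m /not_implyP [[c [w [Ww um]]] m0]].
  have [v cv] : is_unit c.
    apply: hF.2 => c0; apply: m0; apply: (disW _).
    by rewrite um c0 scale0r add0r.
  exists (v *: m); rewrite linearZ um /= scalerDr scalerA mulrC cv scale1r.
  rewrite opprD addrA subrr add0r -scaleN1r; by do 2!apply/WZ.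
pose r n := projT1 (cid (dec n)).
have rE n : W (n - u (r n)) by rewrite /r; case: cid.
have uniq n m : W (n - u m) -> r n = m.
  move=> Wm; apply: subr0_eq; apply: (disW _); rewrite linearB.
  have := WD _ _ Wm (WZ (-1) _ (rE n)); rewrite scaleN1r opprB.
  by rewrite addrC addrA addrNK.
have rD : forall x y, r (x + y) = r x + r y.
  move=> x y; apply: uniq; rewrite linearD opprD addrACA; apply: WD; exact: rE.
have rZ : forall c x, r (c *: x) = c *: r x.
  by move=> c x; apply: uniq; rewrite linearZ /= -scalerBr; apply: WZ; exact: rE.
exists (mk_lin rD rZ) => m; rewrite mk_linE; apply: uniq.
by rewrite subrr.
Qed.

(** A retraction of u extends to the scalar extensions and gives a left inverse of v. This
    module-theoretic form is the one required of fppf covers. *)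
Lemma field_flat (F A : kalg k) (phi : khom F A) : is_fld F -> flat_rmorphism phi.
Proof.
move=> hF M N u MB NB tM tN v eM eN vE /(field_retraction hF) [r rE].
have gD : forall x y, (tM \o r) (x + y) = (tM \o r) x + (tM \o r) y.
  by move=> x y; rewrite /= !linearD.
have gZ : forall c x, (tM \o r) (c *: x) = phi c *: (tM \o r) x.
  by move=> c x; rewrite /= !linearZ.
have [h [hE _]] := eN _ (mk_semilin gD gZ).
have [i [_ iU]] := eM _ tM.
have hvD : forall x y, h (v (x + y)) = h (v x) + h (v y) by move=> x y; rewrite !linearD.
have hvZ : forall c x, h (v (c *: x)) = c *: h (v x) by move=> c x; rewrite !linearZ.
have idD : forall x y : MB, x + y = x + y by [].
have idZ : forall c (x : MB), c *: x = c *: x by [].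
have hv : mk_lin hvD hvZ =1 i.
  by apply: iU => m; rewrite mk_linE vE hE mk_semilinE /= rE.
have hi : @mk_lin _ _ _ (fun x => x) idD idZ =1 i.
  by apply: iU.
move=> x y xy; have := hv x; have := hv y; rewrite !mk_linE xy => -> E.
by have := hi x; have := hi y; rewrite !mk_linE -E => <- <-.
Qed.

End FieldFlat.

(** * Affine schemes and torsors *)

Section AffineSchemes.
Variable k : fieldType.
Implicit Types A B C D R S L : kalg k.
Implicit Types X Y : kfunctor k.

Lemma is_iso_bij X Y (f : kmor X Y) :
  (forall A (y : Y A), exists x : X A, f A x = y) ->
  (forall A, injective (kmor_fun f (A := A))) -> is_iso f.
Proof.
move=> sur inj.
pose g A y := projT1 (cid (sur A y)).
have gE A y : f A (g A y) = y by rewrite /g; case: cid.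
exists (@KMor k Y X g (fun A B h y => inj B _ _ (etrans (gE _ _)
   (esym (etrans (kmor_nat f h _) (congr1 _ (gE _ _))))))).
by move=> A; split=> x /=; [apply: inj|]; rewrite gE.
Qed.

Lemma iso_inj X Y (f : kmor X Y) A : is_iso f -> injective (kmor_fun f (A := A)).
Proof. by move=> [g /(_ A) [fg _]]; exact: can_inj fg. Qed.

Lemma iso_surj X Y (f : kmor X Y) A (y : Y A) : is_iso f -> exists x : X A, f A x = y.
Proof. by move=> [g /(_ A) [_ gf]]; exists (g A y). Qed.

Definition idmor X : kmor X X := @KMor k X X (fun A x => x) (fun _ _ _ _ => erefl).

Lemma idmor_open X : open_immersion (idmor X).
Proof.
split=> [A|A x]; first by move=> x y.
exists setT; first by split.
move=> B f; split=> [_|_].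
  by rewrite ideal_genT; apply: ideal_gen_sub; exists 1 => //; exact: rmorph1.
by exists (fmap f x).
Qed.

(** A proper I would lie in a maximal ideal, which, being prime, would contain every a_i. *)
Lemma ideal_pow A n (a : 'I_n -> A) (I : set A) : is_ideal I ->
  ideal_gen (range a) = setT -> (forall i, exists m, I (a i ^+ m)) -> I 1.
Proof.
move=> hI aT Ia; apply: contrapT => I1.
have [P /maximal_prime [hP P1 pP] IP] := exists_maximal hI I1.
apply: P1; have a1 : ideal_gen (range a) 1 by rewrite aT.
apply: (a1 P hP) => _ [i _ <-]; have [m /IP] := Ia i.
elim: m => [|m IH]; first by rewrite expr0 => I1'; rewrite -[a i]mulr1; exact: idealM.
by rewrite exprS => /pP [].
Qed.

Lemma locP A B (a : A) (phi : khom A B) : is_localization a phi ->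
  (forall x, phi x = 0 -> exists n, a ^+ n * x = 0) /\
  (forall b, exists n x, phi (a ^+ n) * b = phi x).
Proof.
move=> [u univ].
have [h [hE _]] := univ _ (loc1_in a) (loc1_unit a).
have [h' h'E] := loc1_lift u.
have hh : kcomp h' h = kid B.
  have [g [_ gU]] := univ _ phi u.
  transitivity g; [symmetry|]; apply: gU; last exact: kidcomp.
  by rewrite -kcompA hE h'E.
split=> [x x0|b].
  have : loc1_in a x = 0 by rewrite -hE kcompE x0; exact: rmorph0.
  by move/loc_eq0 => [_ [n ->] E]; exists n.
have [x [_ [[n ->] E]]] := loc_fracP (h b); exists n, x.
have h'E' y : h' (loc_in (pows_mult a) y) = phi y by rewrite -h'E.
have /(congr1 h') := E; rewrite rmorphM !h'E' mulrC => <-.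
by rewrite -[h' (h b)]kcompE hh.
Qed.

Lemma zar_inj A n (a : 'I_n -> A) (B : 'I_n -> kalg k) (phi : forall i, khom A (B i)) x y :
  ideal_gen (range a) = setT -> (forall i, is_localization (a i) (phi i)) ->
  (forall i, phi i x = phi i y) -> x = y.
Proof.
move=> aT loc E; apply: subr0_eq; rewrite -[_ - _]mul1r.
apply: (@ideal_pow _ _ a [set z | z * (x - y) = 0]) => //.
  split=> [|u v /= uE vE|c u /= uE]; rewrite /= ?mul0r //.
    by rewrite mulrDl uE vE addr0.
  by rewrite -mulrA uE mulr0.
move=> i; apply: (locP (loc i)).1.
by rewrite rmorphB E subrr.
Qed.

(** The s for which the sections s b_i come from a global element form an ideal, and it contains a
    power of each a_j: clear the denominator of b_j, then the finitely many discrepancies on the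
    overlaps. *)
Lemma zar_glue A n (a : 'I_n -> A) (B : 'I_n -> kalg k) (phi : forall i, khom A (B i))
    (b : forall i, B i) :
  ideal_gen (range a) = setT -> (forall i, is_localization (a i) (phi i)) ->
  (forall (i j : 'I_n) C (f : khom (B i) C) (g : khom (B j) C),
       kcomp f (phi i) = kcomp g (phi j) -> f (b i) = g (b j)) ->
  exists x, forall i, phi i x = b i.
Proof.
move=> aT loc E.
suff : [set s | exists c, forall i, phi i c = phi i s * b i] 1.
  by move=> [c cE]; exists c => i; rewrite cE rmorph1 mul1r.
apply: (@ideal_pow _ _ a) => //.
  split=> [|u v [c cE] [d dE]|e u [c cE]].
  - by exists 0 => i; rewrite rmorph0 mul0r.
  - by exists (c + d) => i; rewrite !rmorphD cE dE mulrDl.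
  - by exists (e * c) => i; rewrite !rmorphM cE mulrA.
move=> j; have [m [x xE]] := (locP (loc j)).2 (b j).
have /choice [N NE] i : exists N, phi i (a j) ^+ N * (phi i (a j ^+ m) * b i - phi i x) = 0.
  set d := _ - _; pose q := loc1_in (phi i (a j)).
  suff : q d = 0 by move/loc_eq0 => [_ [N ->] ?]; exists N.
  have [_ univ] := loc j.
  have [|g [gE _]] := univ _ (kcomp q (phi i)); first exact: loc1_unit.
  have bE := E i j _ q g (esym gE); have qE := khom_comp_eq gE.
  by rewrite rmorphB rmorphM bE -!qE -rmorphM xE subrr.
exists (\sum_i N i + m)%N, (a j ^+ (\sum_i N i)%N * x) => i.
have : phi i (a j) ^+ (\sum_i N i)%N * (phi i (a j ^+ m) * b i - phi i x) = 0.
  by rewrite (bigD1 i) //= addnC exprD -mulrA NE mulr0.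
move/eqP; rewrite mulrBr subr_eq0 => /eqP E'.
by rewrite exprD !rmorphM !rmorphXn -mulrA -E' rmorphXn.
Qed.

Lemma Spec_scheme R : is_scheme (Spec R).
Proof.
split=> [A n a B phi x aT loc E|F iF x].
  have /choice [y yE] r : exists z, forall i, phi i z = x i r.
    apply: zar_glue aT loc _ => i j C f g fg.
    by have := E i j C f g fg => /khom_comp_eq; apply.
  have inj u v := zar_inj (x := u) (y := v) aT loc.
  unshelve eexists.
    apply: (@mk_khom k R A y).
    - by move=> u v; apply/inj => i; rewrite rmorphD !yE rmorphD.
    - by move=> u v; apply/inj => i; rewrite rmorphM !yE rmorphM.
    - by apply/inj => i; rewrite yE !rmorph1.
    - by move=> c; apply/inj => i; rewrite yE !khom_str.
  split; first by move=> i; apply: khomP => r; exact: yE.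
  move=> z zE; apply: khomP => r; apply/inj => i.
  by transitivity (x i r); [exact: yE | rewrite -(zE i)].
exists R, (idmor (Spec R)); split; first exact: idmor_open.
by exists x.
Qed.

(** For D(s) inside an open Spec A of Spec S one has A_s = S_s. The two clauses express this by
    elements, as surjectivity and injectivity up to powers of s. *)
Lemma open_immersion_den S A (j : kmor (Spec A) (Spec S)) (s : S) (r : khom A (loc1 s)) :
  open_immersion j -> kcomp r (j A (kid A)) = loc1_in s ->
  (forall b, exists m x, j A (kid A) (s ^+ m) * b = j A (kid A) x) /\
  (forall z, j A (kid A) z = 0 -> exists m, s ^+ m * z = 0).
Proof.
move=> [inj_j _]; set ja := j A (kid A) => rE.
have jE B (q : khom A B) : j B q = kcomp q ja by exact: yoneda.
split=> [b|z]; last first.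
  move/(congr1 r); rewrite -[LHS]kcompE rE rmorph0.
  by move/loc_eq0 => [_ [P ->] PE]; exists P.
have [x [_ [[m ->] bE]]] := loc_fracP (r b).
pose q := loc1_in (ja s).
have [|h hE] := @loc1_lift _ _ s _ (kcomp q ja); first exact: loc1_unit.
have hr : kcomp h r = q.
  by apply: inj_j; rewrite !jE -kcompA rE hE.
have : q (ja (s ^+ m) * b - ja x) = 0.
  have qb : q b = h (r b) by rewrite -hr.
  have qE y : q (ja y) = h (loc1_in s y) by rewrite (khom_comp_eq hE).
  by rewrite rmorphB rmorphM qb !qE -rmorphM mulrC bE subrr.
move/loc_eq0 => [_ [N ->]] /eqP; rewrite mulrBr subr_eq0 => /eqP E.
by exists (N + m)%N, (s ^+ N * x); rewrite exprD !rmorphM rmorphXn -mulrA E.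
Qed.

(** On each D(s_t) contained in Spec A a relation is solved in S after multiplication by a power of
    s_t. These powers generate the unit ideal of A, whose partition of unity combines the
    solutions. *)
Lemma open_immersion_flat S A (j : kmor (Spec A) (Spec S)) :
  open_immersion j -> eqflat (j A (kid A)).
Proof.
move=> oj'; have [inj_j oj] := oj'; set ja := j A (kid A).
have jE B (r : khom A B) : j B r = kcomp r ja by exact: yoneda.
have [I hI [Iu [_ [_ Ig]]]] := open_unit oj (kid S).
have [|n [c [s [Is sE]]]] := Ig A ja; first by exists (kid A) => //; rewrite jE kidcomp; symmetry; exact: kcompid.
have R t : exists r : khom A (loc1 (s t)), kcomp r ja = loc1_in (s t).
  have [|r _ rE] := Iu _ (loc1_in (s t)) (s t) (Is t); first exact: loc1_unit.
  by exists r; rewrite -jE rE; exact: kcompid.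
move=> J a b rel.
have tr t : exists m (x : J -> S), (forall i, ja (s t ^+ m) * b i = ja (x i)) /\
    \sum_i a i * x i = 0.
  have [r rE] := R t; have [den ker] := open_immersion_den oj' rE.
  have /choice [m mP] i := den (b i); have /choice [x xE] := mP.
  pose M := (\sum_i m i)%N.
  have [x' x'E] : exists x', forall i, ja (s t ^+ M) * b i = ja (x' i).
    exists (fun i => s t ^+ (M - m i) * x i) => i.
    have le : (m i <= M)%N by rewrite /M (bigD1 i) //= leq_addr.
    by rewrite -{1}(subnK le) exprD rmorphM -mulrA xE -rmorphM.
  have : ja (\sum_i a i * x' i) = 0.
    rewrite rmorph_sum; under eq_bigr do rewrite rmorphM -x'E mulrCA.
    by rewrite -mulr_sumr rel mulr0.
  move/ker => [P PE].
  exists (P + M)%N, (fun i => s t ^+ P * x' i); split=> [i|].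
    by rewrite exprD !rmorphM -mulrA x'E.
  rewrite -[RHS]PE mulr_sumr; apply: eq_bigr => i _; ring.
have /choice [m /choice [x xE]] := tr.
have : ideal_gen (range (fun t => ja (s t) ^+ m t)) 1.
  apply: (@ideal_pow _ _ (ja \o s)); first exact: ideal_gen_ideal.
    rewrite ideal_genT -sE; apply: (ideal_sum (ideal_gen_ideal _)) => i.
    by apply: (idealMr (ideal_gen_ideal _)); apply: ideal_gen_sub; exists i.
  by move=> i; exists (m i); apply: ideal_gen_sub; exists i.
move/ideal_genP => [p [d [u [uP E]]]].
have /choice [t tE] i : exists t, ja (s t) ^+ m t = u i by have [t _ tE] := uP i; exists t.
exists 'I_p, d, (fun i l => x (t l) i); split=> [i|l]; last exact: (xE (t l)).2.
rewrite -[b i]mulr1 E mulr_sumr; apply: eq_bigr => l _.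
by rewrite -(xE (t l)).1 rmorphXn tE; ring.
Qed.

End AffineSchemes.

(** * Torsors and their flat local sections *)

Section TorsorBasics.
Variable k : fieldType.
Implicit Types A B C D R S L : kalg k.
Implicit Types X Y : kfunctor k.
Variable G : kgroup k.

Lemma gmulrV A (x : G A) : gmul x (ginv x) = gone G A.
Proof.
rewrite -[LHS]gmul1 -{1}(gmulV (ginv x)) -gmulA [gmul (ginv x) _]gmulA gmulV gmul1.
exact: gmulV.
Qed.

Lemma gmulr1 A (x : G A) : gmul x (gone G A) = x.
Proof. by rewrite -(gmulV x) gmulA gmulrV gmul1. Qed.

Definition act X (T : gspace G X) A (g : G A) (t : tot T A) : tot T A :=
  gact T A (g, t).

Lemma act1 X (T : gspace G X) A (t : tot T A) : act (gone G A) t = t.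
Proof. exact: gact1. Qed.
Lemma actM X (T : gspace G X) A (g h : G A) (t : tot T A) :
  act (gmul g h) t = act g (act h t).
Proof. exact: gactM. Qed.
Lemma act_proj X (T : gspace G X) A (g : G A) (t : tot T A) :
  proj T A (act g t) = proj T A t.
Proof. exact: gact_proj. Qed.
Lemma act_nat X (T : gspace G X) A B (f : khom A B) (g : G A) (t : tot T A) :
  fmap f (act g t) = act (fmap f g) (fmap f t).
Proof. by rewrite /act -kmor_nat. Qed.

Lemma torsor_trans X (T : gspace G X) A (t t' : tot T A) :
  is_iso (shear T) -> proj T A t = proj T A t' -> exists g, t' = act g t.
Proof.
move=> iT E.
pose p : fibre_product (proj T) (proj T) A := exist _ (t, t') E.
have [[g u] /(congr1 sval) [ut gt]] := iso_surj p iT.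
by exists g; rewrite -gt ut.
Qed.

Lemma torsor_free X (T : gspace G X) A (g g' : G A) (t : tot T A) :
  is_iso (shear T) -> act g t = act g' t -> g = g'.
Proof.
move=> iT E; suff : (g, t) = (g', t) by case.
by apply: (iso_inj iT); apply: sig_ext; rewrite /= -/(act g t) E.
Qed.

Lemma torsor_section X (T : gspace G X) : is_torsor T ->
  exists (X' : kfunctor k) (f : kmor X' X), is_fppf f /\
    forall B (x' : X' B), exists t, proj T B t = f B x'.
Proof.
move=> [_ _ [X' [f [_ ff [h [ih _ hp]]]]]]; exists X', f; split=> // B x'.
have [u uE] := iso_surj ((gone G B, x') : prodF G X' B) ih.
exists (sval u).1; have /= := svalP u => ->.
by have := hp B u; rewrite uE /= => <-.
Qed.

(** B is a chart of the trivializing cover at a point above P. It is flat over a chart of Spec S,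
    which is flat over S; only P has to be in its image. *)
Lemma torsor_flat_section S (T : gspace G (Spec S)) (P : set S) :
  is_torsor T -> maximal_ideal P ->
  exists B (phi : khom S B) (t : tot T B) L (l : khom B L),
    [/\ eqflat phi, proj T B t = phi, is_fld L & forall s, P s -> l (phi s) = 0].
Proof.
move=> hT mP; have [F [s [hF sP]]] := max_point mP.
have [X' [f [[flf surf _] sec]]] := torsor_section hT.
have [F' [iF E]] := fld_kalg hF; subst F.
have [E [iE [h [x' fx']]]] := surf F' iF s.
have [A [B [phi [jB [jA [oB oA [b _ bE] flphi fj]]]]]] := flf E iE x'.
pose ja := jA A (kid A).
have jaE C (r : khom A C) : jA C r = kcomp r ja by exact: yoneda.
have [t tE] := sec B (jB B (kid B)).
exists B, (kcomp phi ja), t, (KAlg iE), b; split.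
- apply: eqflat_comp; [exact: open_immersion_flat | exact: flat_eqflat].
- by rewrite tE fj jaE kidcomp.
- exact: fieldType_fld.
move=> z Pz; have := congr1 (fun r : khom S (KAlg iE) => r z) fx'.
rewrite -bE fj jaE /= => E'; rewrite [LHS]E'.
by move/sP: Pz => /= ->; exact: rmorph0.
Qed.

(** The sheaf condition for the empty covering of Spec 0. *)
Lemma zero_point X A : is_zariski_sheaf X -> (1 : A) = 0 -> exists x : X A, True.
Proof.
move=> hX z; have [||i|y _] := hX A 0%N (fun=> 0) (fun=> A) (fun=> kid A) (fun i => match i with Ordinal _ h => False_rect _ (notF h) end).
- by apply/ideal_genT => I hI _; rewrite z; exact: ideal0.
- by case.
- by case: i.
by exists y.
Qed.

Lemma zero_uniq X A (x y : X A) : is_zariski_sheaf X -> (1 : A) = 0 -> x = y.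
Proof.
move=> hX z; apply: (@zar_sep _ X A 0%N (fun=> 0) (fun=> A) (fun=> kid A)) => //.
- by apply/ideal_genT => I hI _; rewrite z; exact: ideal0.
- by case.
- by case.
Qed.

(** The idempotents (1,0) and (0,1) give a Zariski covering with localizations A and B, and any
    algebra over the overlap is zero. *)
Lemma prod_point X A B (x : X A) (y : X B) : is_zariski_sheaf X ->
  exists z : X (prod_kalg A B), fmap (prod_fst A B) z = x /\ fmap (prod_snd A B) z = y.
Proof.
move=> hX; pose e (b : bool) : prod_kalg A B :=
  if b then prod_pair 1 0 else prod_pair 0 1.
pose a (i : 'I_2) := e (i == ord0).
pose R (i : 'I_2) := if i == ord0 then A else B.
pose phi (i : 'I_2) : khom (prod_kalg A B) (R i) :=
  if i == ord0 as b return khom (prod_kalg A B) (if b then A else B)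
  then prod_fst A B else prod_snd A B.
pose u (i : 'I_2) : X (R i) :=
  if i == ord0 as b return X (if b then A else B) then x else y.
have aT : ideal_gen (range a) = setT.
  have e1 : (1 : prod_kalg A B) = e true + e false.
    by apply: prod_eq; rewrite rmorph1 rmorphD !(prod_fst_pair, prod_snd_pair) (addr0, add0r).
  rewrite ideal_genT e1; apply: (idealD (ideal_gen_ideal _)); apply: ideal_gen_sub.
    by exists ord0.
  by exists ord_max.
have loc i : is_localization (a i) (phi i).
  rewrite /a /phi /R; case: (i == ord0) => /=.
    split; first by exists 1; rewrite prod_fst_pair mulr1.
    move=> C chi [v cv].
    have c0 : chi (prod_pair 0 1) = 0.
      have z : prod_pair 0 1 * prod_pair 1 0 = 0 :> prod_kalg A B.
        by apply: prod_eq; rewrite rmorphM rmorph0 !(prod_fst_pair, prod_snd_pair) ?mul0r ?mulr0.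
      by rewrite -[LHS]mulr1 -cv mulrA -rmorphM z rmorph0 mul0r.
    have [|r|h hE] := @factor_surj _ _ _ _ (prod_fst A B) chi.
    - by move=> r; exists (prod_pair r 0); rewrite prod_fst_pair.
    - move=> r0; rewrite (_ : r = prod_pair 0 1 * r :> prod_kalg A B) ?rmorphM ?c0 ?mul0r //.
      by apply: prod_eq; rewrite rmorphM !(prod_fst_pair, prod_snd_pair) ?mul1r ?mul0r.
    exists h; split; first by apply: khomP.
    move=> h' h'E; apply: khomP => r; rewrite -(prod_fst_pair r (0 : B)) hE.
    by rewrite -h'E.
  split; first by exists 1; rewrite prod_snd_pair mulr1.
  move=> C chi [v cv].
  have c0 : chi (prod_pair 1 0) = 0.
      have z : prod_pair 1 0 * prod_pair 0 1 = 0 :> prod_kalg A B.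
        by apply: prod_eq; rewrite rmorphM rmorph0 !(prod_fst_pair, prod_snd_pair) ?mul0r ?mulr0.
      by rewrite -[LHS]mulr1 -cv mulrA -rmorphM z rmorph0 mul0r.
  have [|r|h hE] := @factor_surj _ _ _ _ (prod_snd A B) chi.
  - by move=> r; exists (prod_pair 0 r); rewrite prod_snd_pair.
  - move=> r0; rewrite (_ : r = prod_pair 1 0 * r :> prod_kalg A B) ?rmorphM ?c0 ?mul0r //.
    by apply: prod_eq; rewrite rmorphM !(prod_fst_pair, prod_snd_pair) ?mul1r ?mul0r.
  exists h; split; first by apply: khomP.
  move=> h' h'E; apply: khomP => r; rewrite -(prod_snd_pair (0 : A) r) hE.
  by rewrite -h'E.
have dis C (f : khom A C) (g : khom B C) :
    kcomp f (prod_fst A B) = kcomp g (prod_snd A B) -> (1 : C) = 0.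
  move/khom_comp_eq/(_ (prod_pair 1 0)).
  by rewrite prod_fst_pair prod_snd_pair rmorph1 rmorph0.
have [|z [zE _]] := hX _ _ a R phi u aT loc.
  move=> i j C f g; move: f g; rewrite /phi /u /R.
  case: (i == ord0); case: (j == ord0) => f g fg.
  - congr fmap; apply: khomP => r.
    by rewrite -(prod_fst_pair r (0 : B)) (khom_comp_eq fg).
  - by apply: zero_uniq => //; exact: dis fg.
  - by apply: zero_uniq => //; exact: (dis _ _ _ (esym fg)).
  - congr fmap; apply: khomP => r.
    by rewrite -(prod_snd_pair (0 : A) r) (khom_comp_eq fg).
by exists z; split; [have := zE ord0 | have := zE ord_max].
Qed.

(** The flat algebras found at the individual maximal ideals are multiplied together, starting from
    the zero algebra, so that one section serves all of them. *)
Lemma torsor_flat_sections S (T : gspace G (Spec S)) (Ps : seq (set S)) :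
  is_torsor T -> (forall P, P \in Ps -> maximal_ideal P) ->
  exists B (phi : khom S B) (t : tot T B), [/\ eqflat phi, proj T B t = phi &
    forall P, P \in Ps -> exists L (l : khom B L), is_fld L /\ forall s, P s -> l (phi s) = 0].
Proof.
move=> hT; have [[zT _] _ _] := hT; elim: Ps => [_|P Ps IH hP].
  have hI : is_ideal (@setT S) by [].
  have z : (1 : quot_kalg hI) = 0.
    by rewrite -(rmorph1 (quot_pi hI)); apply/quot_pi0.
  have [t _] := zero_point zT z.
  exists (quot_kalg hI), (quot_pi hI), t; split=> //.
  - move=> I a b _; exists 'I_0, (fun=> 0), (fun _ _ => 0); split=> [i|[]//].
    by rewrite big_ord0 -[b i]mulr1 z mulr0.
  - by apply: zero_uniq z; exact: (Spec_scheme _).1.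
have [|B1 [phi1 [t1 [fl1 p1 h1]]]] := IH.
  by move=> Q QP; apply: hP; rewrite inE QP orbT.
have [|B2 [phi2 [t2 [L [l [fl2 p2 hL h2]]]]]] := @torsor_flat_section S T P hT.
  by apply: hP; rewrite inE eqxx.
have [phi [e1 e2]] := prod_lift phi1 phi2.
have [t [tE1 tE2]] := prod_point t1 t2 zT.
exists (prod_kalg B1 B2), phi, t; split.
- exact: eqflat_prod e1 e2 fl1 fl2.
- apply: khomP => s; apply: prod_eq.
    by have := congr1 (fun r : khom S B1 => r s) p1; rewrite -tE1 kmor_nat -e1.
  by have := congr1 (fun r : khom S B2 => r s) p2; rewrite -tE2 kmor_nat -e2.
move=> Q; rewrite inE => /orP[/eqP ->|/h1 [K [m [hK mQ]]]].
  exists L, (kcomp l (prod_snd B1 B2)); split=> // s Ps'.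
  by rewrite -[RHS](h2 s) // -e2.
exists K, (kcomp m (prod_fst B1 B2)); split=> // s Qs.
by rewrite -[RHS](mQ s) // -e1.
Qed.

Lemma ff_criterion S B (phi : khom S B) : eqflat phi ->
  (forall P, maximal_ideal P -> exists L (l : khom B L), is_fld L /\
      forall s, P s -> l (phi s) = 0) -> ffhom phi.
Proof.
move=> fl pts; split=> // I a b E; apply: contrapT => no.
pose J := [set s : S | exists c, s = \sum_i a i * c i].
have hJ : is_ideal J.
  split.
  - by exists (fun=> 0); rewrite big1 // => i _; rewrite mulr0.
  - move=> x y [c ->] [d ->]; exists (fun i => c i + d i).
    by rewrite -big_split; apply: eq_bigr => i _; rewrite mulrDr.
  - move=> e x [c ->]; exists (fun i => e * c i).
    by rewrite mulr_sumr; apply: eq_bigr => i _; rewrite mulrCA.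
have [|P mP JP] := exists_maximal hJ; first by move=> [c c1]; apply: no; exists c.
have [L [l [hL lP]]] := pts P mP; apply: hL.1.
rewrite -(rmorph1 l) -E rmorph_sum big1 // => i _.
rewrite rmorphM lP ?mul0r //; apply: JP; exists (fun j => (j == i)%:R).
rewrite (bigD1 i) //= eqxx mulr1 big1 ?addr0 // => j /negPf ->.
by rewrite mulr0.
Qed.

End TorsorBasics.

(** * Finite generation and matrix representations *)

Section FiniteGeneration.
Variable k : fieldType.
Implicit Types A B C R H : kalg k.

Lemma kcomp_at A B C (f : khom B C) (g : khom A B) (h : khom A C) :
  kcomp f g = h -> forall x, f (g x) = h x.
Proof. by move=> <-. Qed.

(** Generation is tested against subalgebras: a property that defines a subalgebra need then be
    checked on generators only. *)
Definition generated A B (phi : khom A B) (J : Type) (x : J -> B) : Prop :=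
  forall U : set B, is_subalg U -> (forall a, U (phi a)) -> (forall i, U (x i)) ->
    forall b, U b.

Lemma ft_generated A B (phi : khom A B) : finite_type_hom phi ->
  exists n (x : 'I_n -> B), generated phi x.
Proof.
move=> [P [iota [n [x [p [polP pE sur]]]]]]; exists n, (p \o x) => U sU Up Ux b.
have [a <-] := sur b.
have [c cE] : exists c : khom A (sub_kalg sU), kcomp (sub_val sU) c = phi.
  have [|c cE] := @factor_inj _ A _ _ (sub_val sU) phi (@sub_val_inj _ _ _ sU).
    by move=> z; exact: sub_val_surj.
  by exists c; exact: khomP.
have /choice [y yE] i : exists y : sub_kalg sU, sub_val sU y = p (x i).
  by apply: sub_val_surj; exact: Ux.
have [h [[hi hx] _]] := polP _ c y.
have [q [_ qU]] := polP _ phi (p \o x).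
have <- : kcomp (sub_val sU) h = p.
  transitivity q; first by symmetry; apply: qU; rewrite -kcompA hi cE; split=> // i; rewrite kcompE hx yE.
  by apply: qU.
exact: sub_valP.
Qed.

Lemma generated_subalgebra A B (phi : khom A B) (J : Type) (x : J -> B) :
  exists (B0 : kalg k) (i : khom B0 B) (phi0 : khom A B0) (x0 : J -> B0),
    [/\ injective i, kcomp i phi0 = phi, forall j, i (x0 j) = x j & generated phi0 x0].
Proof.
pose S := [set a : B | forall U, is_subalg U -> (forall c, U (phi c)) ->
  (forall i, U (x i)) -> U a].
have sS : is_subalg S.
  split=> [c|a b Sa Sb|a Sa|a b Sa Sb] U sU Up Ux.
  - by case: sU.
  - by apply: subalgD => //; [exact: Sa | exact: Sb].
  - by apply: subalgN => //; exact: Sa.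
  - by apply: subalgM => //; [exact: Sa | exact: Sb].
have xS i : exists c, sub_val sS c = x i by apply: sub_val_surj => U.
have [phi0 phi0E] : exists kC : khom A (sub_kalg sS), forall a, sub_val sS (kC a) = phi a.
  apply: factor_inj; first exact: sub_val_inj.
  by move=> a; apply: sub_val_surj => U.
exists (sub_kalg sS), (sub_val sS), phi0, (fun i => projT1 (cid (xS i))); split.
- exact: sub_val_inj.
- exact: khomP.
- by move=> i; case: cid.
move=> U sU Up Ux c.
pose U' := [set a : B | exists2 c, U c & sub_val sS c = a].
have sU' : is_subalg U'.
  split=> [d|a b [c1 U1 <-] [c2 U2 <-]|a [c1 U1 <-]|a b [c1 U1 <-] [c2 U2 <-]].
  - by exists (kalg_str _ d); [case: sU | rewrite khom_str].
  - by exists (c1 + c2); [exact: subalgD | rewrite rmorphD].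
  - by exists (- c1); [exact: subalgN | rewrite rmorphN].
  - by exists (c1 * c2); [exact: subalgM | rewrite rmorphM].
suff [c' Uc' /(@sub_val_inj _ _ _ sS) <-//] : U' (sub_val sS c).
apply: (sub_valP c U' sU').
- by move=> a; exists (phi0 a).
- by move=> i; exists (projT1 (cid (xS i))) => //; case: cid.
Qed.

(** Finitely many D(f_t) covering Spec H lie in charts with finitely generated algebras. Numerators
    of those generators, with the f_t and a partition of unity, generate H: for each h and t some
    f_t^N h lies in the subalgebra, and hence so does h. *)
Lemma affine_finite_type H : finite_type (Spec H) ->
  exists n (x : 'I_n -> H), generated (kinit H) x.
Proof.
move=> [n [R [j [oj cov]]]].
pose J := [set f : H | exists i, image (j i) _ (loc1_in f)].
have J1 : ideal_gen J 1.
  apply: contrapT => J1.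
  have [P /max_point [L [l [hL lP]]] JP] := exists_maximal (ideal_gen_ideal J) J1.
  have [F [iF E]] := fld_kalg hL; subst L.
  have [i im] := cov F iF l.
  have [I hI [Iu [If _]]] := open_unit (oj i).1.2 (kid H).
  have [|f If' nz] := If _ l hL; first by rewrite [fmap _ _]kcompid.
  suff Jf : J f by apply: nz; apply/lP; apply/JP; apply: ideal_gen_sub.
  exists i.
  by have := Iu _ (loc1_in f) f If' (loc1_unit f); rewrite [fmap _ _]kcompid.
have [m [c [f [fJ cE]]]] := ideal_genP J1.
have fU t : exists (g : seq H), forall (U : set H), is_subalg U -> U (f t) ->
    (forall z, z \in g -> U z) -> forall h, exists N, U (f t ^+ N * h).
  have [i [r _ rE]] := fJ t.
  have rE' : kcomp r (j i _ (kid (R i))) = loc1_in (f t).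
    by rewrite -rE [RHS]yoneda.
  have [den ker] := open_immersion_den (oj i).1 rE'.
  have [p [y gy]] := ft_generated (oj i).2.
  have /choice [M MP] := fun s => den (y s); have /choice [x xE] := MP.
  exists [seq x s | s <- enum 'I_p] => U sU Uf Ug h.
  have Ux s : U (x s) by apply: Ug; apply: map_f; rewrite mem_enum.
  have Ufn N : U (f t ^+ N).
    by elim: N => [|N IH]; [rewrite expr0; exact: subalg1 | rewrite exprS; exact: subalgM].
  set ja := j i _ _ in rE' den ker xE.
  suff [N [z [Uz zE]]] : exists N z, U z /\ ja (f t ^+ N) * ja h = ja z.
    have /ker [P PE] : ja (f t ^+ N * h - z) = 0 by rewrite rmorphB rmorphM zE subrr.
    exists (P + N)%N; move/eqP: PE; rewrite mulrBr subr_eq0 mulrA -exprD => /eqP ->.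
    exact: subalgM.
  apply: (gy [set b | exists N z, U z /\ ja (f t ^+ N) * b = ja z]); last first.
  - by move=> s; exists (M s), (x s).
  - move=> a; exists 0%N, (kalg_str H a); split; first by case: sU.
    by rewrite expr0 rmorph1 mul1r !khom_str.
  split=> /=.
  - move=> a; exists 0%N, (kalg_str H a); split; first by case: sU.
    by rewrite expr0 rmorph1 mul1r !khom_str.
  - move=> u v [N [z [Uz zE]]] [N' [z' [Uz' zE']]].
    exists (N + N')%N, (f t ^+ N' * z + f t ^+ N * z'); split.
      by apply: subalgD => //; exact: subalgM.
    by rewrite exprD rmorphD !rmorphM -zE -zE'; ring.
  - move=> u [N [z [Uz zE]]]; exists N, (- z); split; first exact: subalgN.
    by rewrite mulrN zE rmorphN.
  - move=> u v [N [z [Uz zE]]] [N' [z' [Uz' zE']]].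
    exists (N + N')%N, (z * z'); split; first exact: subalgM.
    by rewrite exprD !rmorphM -zE -zE'; ring.
have /choice [g gP] := fU.
(* The coefficients c_t are adjoined so that the f_t generate the unit ideal already in the
   subalgebra. *)
pose gs := [seq f t | t <- enum 'I_m] ++ [seq c t | t <- enum 'I_m] ++
  flatten [seq g t | t <- enum 'I_m].
exists (size gs), (fun i => tnth (in_tuple gs) i) => U sU _ Ux h.
have {}Ux z : z \in gs -> U z.
  by move=> zg; have := Ux (Ordinal (etrans (index_mem z gs) zg)); rewrite (tnth_nth 0) /= nth_index.
have Uf t : U (f t) by apply: Ux; rewrite !mem_cat map_f ?mem_enum.
have Uc t : U (c t).
  apply: Ux; rewrite !mem_cat; apply/orP; right; apply/orP; left.
  by apply: map_f; rewrite mem_enum.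
have Ug t z : z \in g t -> U z.
  move=> zg; apply: Ux; rewrite !mem_cat; apply/orP; right; apply/orP; right.
  by apply/flattenP; exists (g t) => //; apply: map_f; rewrite mem_enum.
have /choice [f' f'E] t : exists y, sub_val sU y = f t by exact: sub_val_surj.
have /choice [c' c'E] t : exists y, sub_val sU y = c t by exact: sub_val_surj.
suff : [set s : sub_kalg sU | U (sub_val sU s * h)] 1 by rewrite /= rmorph1 mul1r.
apply: (@ideal_pow _ _ _ f').
- split=> [|x y /= Ux' Uy'|a x /= Ux'].
  + by rewrite /= rmorph0 mul0r; exact: subalg0.
  + by rewrite rmorphD mulrDl; exact: subalgD.
  + by rewrite rmorphM -mulrA; apply: subalgM => //; exact: sub_valP.
- rewrite ideal_genT (_ : 1 = \sum_t c' t * f' t).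
    apply: (ideal_sum (ideal_gen_ideal _)) => t; apply: (idealM (ideal_gen_ideal _)).
    by apply: ideal_gen_sub; exists t.
  apply: (@sub_val_inj _ _ _ sU); rewrite rmorph1 cE rmorph_sum.
  by apply: eq_bigr => t _; rewrite rmorphM c'E f'E.
move=> t; have [N UN] := gP t U sU (Uf t) (Ug t) h; exists N.
by rewrite /= rmorphXn f'E.
Qed.

Lemma kbase_fld : is_fld (kbase k).
Proof. exact: fieldType_fld. Qed.

Lemma kinit_flat A : eqflat (kinit A).
Proof. exact: eqflat_field kbase_fld. Qed.

Lemma kinit_comp A B (f : khom A B) : kcomp f (kinit A) = kinit B.
Proof. by apply: khomP => c; rewrite kcompE khom_str. Qed.

Lemma kinit_eq A B B' (f : khom B A) (g : khom B' A) :
  kcomp f (kinit B) = kcomp g (kinit B').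
Proof. by rewrite !kinit_comp. Qed.

Definition kt A B : kalg k := tens_kalg (kinit A) (@kinit_flat B).
Definition ktl A B : khom A (kt A B) := tensl (kinit A) (@kinit_flat B).
Definition ktr A B : khom B (kt A B) := tensr (kinit A) (@kinit_flat B).

Lemma kt_lift A B R (f : khom A R) (g : khom B R) :
  exists h : khom (kt A B) R, kcomp h (ktl A B) = f /\ kcomp h (ktr A B) = g.
Proof. by apply: tens_lift; exact: kinit_eq. Qed.

Lemma kt_ext A B R (f g : khom (kt A B) R) :
  kcomp f (ktl A B) = kcomp g (ktl A B) -> kcomp f (ktr A B) = kcomp g (ktr A B) -> f = g.
Proof. exact: tens_ext. Qed.

Definition indep A (I : finType) (w : I -> A) : Prop :=
  forall c : I -> k, \sum_i kalg_str A (c i) * w i = 0 -> forall i, c i = 0.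

Lemma kt_indepl A B (I : finType) (w : I -> A) (r : I -> B) : indep w ->
  \sum_i ktl A B (w i) * ktr A B (r i) = 0 -> forall i, r i = 0.
Proof.
move=> iw /tens_zero_fin [J [d [s [rE sZ]]]] i; rewrite rE big1 // => l _.
by rewrite (iw _ (sZ l)) rmorph0 mul0r.
Qed.

Lemma kt_indepr A B (I : finType) (w : I -> B) (r : I -> A) : indep w ->
  \sum_i ktl A B (r i) * ktr A B (w i) = 0 -> forall i, r i = 0.
Proof.
move=> iw E; have [h [hl hr]] := kt_lift (ktr B A) (ktl B A).
apply: (kt_indepl iw); rewrite -[RHS](rmorph0 h) -[in RHS]E rmorph_sum.
by apply: eq_bigr => i _; rewrite rmorphM (kcomp_at hl) (kcomp_at hr) mulrC.
Qed.

Definition comb A (L : seq A) (c : nat -> k) : A :=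
  \sum_(i < size L) kalg_str A (c i) * L`_i.
Definition span A (L : seq A) (x : A) : Prop := exists c, x = comb L c.
Definition indeps A (L : seq A) : Prop :=
  forall c, comb L c = 0 -> forall i, (i < size L)%N -> c i = 0.

Lemma indeps_indep A (L : seq A) : indeps L -> indep (fun i : 'I_(size L) => L`_i).
Proof.
move=> iL c E i; pose c' n := if insub n is Some j then c j else 0.
have c'E (j : 'I_(size L)) : c' j = c j by rewrite /c' valK.
rewrite -c'E; apply: iL => //; rewrite -[RHS]E.
by apply: eq_bigr => j _; rewrite c'E.
Qed.

Lemma comb_rcons A (L : seq A) x c :
  comb (rcons L x) c = comb L c + kalg_str A (c (size L)) * x.
Proof.
rewrite /comb size_rcons big_ord_recr /= nth_rcons ltnn eqxx; congr (_ + _).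
by apply: eq_bigr => i _; rewrite nth_rcons ltn_ord.
Qed.

Lemma span_mem A (L : seq A) x : x \in L -> span L x.
Proof.
move=> xL; exists (fun i => (i == index x L)%:R).
have iL : (index x L < size L)%N by rewrite index_mem.
rewrite /comb (bigD1 (Ordinal iL)) //= eqxx rmorph1 mul1r nth_index // big1 ?addr0 //.
by move=> i /negPf; rewrite -val_eqE /= => ->; rewrite rmorph0 mul0r.
Qed.

Lemma combD A (L : seq A) c d : comb L (fun i => c i + d i) = comb L c + comb L d.
Proof. by rewrite -big_split; apply: eq_bigr => i _; rewrite rmorphD mulrDl. Qed.
Lemma combZ A (L : seq A) a c : comb L (fun i => a * c i) = kalg_str A a * comb L c.
Proof. by rewrite mulr_sumr; apply: eq_bigr => i _; rewrite rmorphM mulrA. Qed.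
Lemma comb0 A (L : seq A) : comb L (fun=> 0) = 0.
Proof. by rewrite /comb big1 // => i _; rewrite rmorph0 mul0r. Qed.

Lemma span_sum A (L : seq A) (I : Type) (r : seq I) (c : I -> k) (x : I -> A) :
  (forall i, span L (x i)) -> span L (\sum_(i <- r) kalg_str A (c i) * x i).
Proof.
move=> sx; elim: r => [|i r [d IH]]; first by rewrite big_nil; exists (fun=> 0); rewrite comb0.
rewrite big_cons IH; have [d' ->] := sx i.
by exists (fun n => c i * d' n + d n); rewrite combD combZ.
Qed.

Lemma span_catl A (L M : seq A) x : span L x -> span (L ++ M) x.
Proof.
move=> [c ->]; apply: span_sum => i; apply: span_mem.
by rewrite mem_cat mem_nth.
Qed.

Lemma indeps_rcons A (L : seq A) x : indeps L -> ~ span L x -> indeps (rcons L x).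
Proof.
move=> iL nx c; rewrite comb_rcons => E i.
have cs : c (size L) = 0.
  apply: contrapT => cs; apply: nx; exists (fun i => - (c (size L))^-1 * c i).
  rewrite combZ rmorphN mulNr; apply/esym/eqP; rewrite eqr_oppLR; apply/eqP.
  have -> : comb L c = - (kalg_str A (c (size L)) * x).
    by apply/eqP; rewrite -addr_eq0 E.
  by rewrite mulrN mulrA -rmorphM mulVf ?rmorph1 ?mul1r //; exact/eqP.
rewrite size_rcons ltnS leq_eqVlt => /orP[/eqP -> //|]; apply: iL.
by rewrite -[RHS]E cs rmorph0 mul0r addr0.
Qed.

Lemma indeps_ext A (L v : seq A) : indeps L -> exists L',
  [/\ forall x, x \in L' -> x \in v, indeps (L ++ L') & forall x, x \in v -> span (L ++ L') x].
Proof.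
elim: v L => [|y v IH] L iL; first by exists [::]; rewrite cats0; split.
case: (pselect (span L y)) => [sy|/(indeps_rcons iL) iy].
  have [L' [sub iL' sp]] := IH L iL; exists L'; split=> // x.
    by move=> /sub; rewrite inE orbC => ->.
  by rewrite inE => /orP[/eqP ->|/sp //]; exact: span_catl.
have [L' [sub iL' sp]] := IH _ iy; exists (y :: L'); rewrite -cat_rcons; split=> // x.
  by rewrite !inE => /orP[->//|/sub ->]; rewrite orbT.
rewrite inE => /orP[/eqP ->|/sp //]; apply: span_mem.
by rewrite mem_cat mem_rcons inE eqxx.
Qed.

Lemma indeps_nil A : indeps (@nil A). Proof. by move=> c _ []. Qed.

End FiniteGeneration.

(** * A matrix representation that generates the coordinate algebra *)

Section Representation.
Variable k : fieldType.
Implicit Types A B C R : kalg k.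
Variables (G : kgroup k) (H : kalg k) (e : kmor G (Spec H)).
Hypothesis ie : is_iso e.

Lemma ev_nat A B (f : khom A B) (g : G A) (x : H) : e B (fmap f g) x = f (e A g x).
Proof. by rewrite kmor_nat. Qed.

Lemma G_pt A (r : khom H A) : exists g : G A, e A g = r.
Proof. exact: iso_surj. Qed.

Lemma G_eq A (g g' : G A) : (forall x, e A g x = e A g' x) -> g = g'.
Proof. by move=> E; apply: (iso_inj ie); exact: khomP. Qed.

(** The comultiplication of H: w is evaluated at the product of the two universal points over H ⊗ H,
    and any pair of points is a specialization of these. *)
Lemma comul (w : H) : exists n (a b : 'I_n -> H), forall R (g g' : G R),
  e R (gmul g g') w = \sum_i e R g (a i) * e R g' (b i).
Proof.
have [gl glE] := G_pt (ktl H H); have [gr grE] := G_pt (ktr H H).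
have [n [a [b E]]] := tens_gen_fin (e _ (gmul gl gr) w).
exists n, a, b => R g g'; have [h [hl hr]] := kt_lift (e R g) (e R g').
have -> : g = fmap h gl by apply: G_eq => x; rewrite ev_nat glE (kcomp_at hl).
have -> : g' = fmap h gr by apply: G_eq => x; rewrite ev_nat grE (kcomp_at hr).
rewrite -gmul_nat ev_nat E rmorph_sum; apply: eq_bigr => i _.
by rewrite rmorphM !ev_nat glE grE.
Qed.

Lemma ev_comb R (g : G R) L c :
  e R g (comb L c) = \sum_(i < size L) kalg_str R (c i) * e R g L`_i.
Proof. by rewrite rmorph_sum; apply: eq_bigr => i _; rewrite rmorphM khom_str. Qed.

Lemma comul_span (w : H) (L : seq H) n (a b : 'I_n -> H) :
  (forall R (g g' : G R), e R (gmul g g') w = \sum_i e R g (a i) * e R g' (b i)) ->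
  (forall i, span L (b i)) ->
  exists a' : nat -> H, forall R (g g' : G R),
    e R (gmul g g') w = \sum_(i < size L) e R g (a' i) * e R g' L`_i.
Proof.
move=> E sb; have /choice [c cE] := sb.
exists (fun j => \sum_i kalg_str H (c i j) * a i) => R g g'; rewrite E.
under eq_bigr do rewrite cE ev_comb mulr_sumr.
rewrite exchange_big; apply: eq_bigr => j _ /=.
rewrite rmorph_sum mulr_suml; apply: eq_bigr => i _.
by rewrite rmorphM khom_str; ring.
Qed.

Lemma comul_list (v L : seq H) : indeps L -> exists L', indeps (L ++ L') /\
  forall w, w \in v -> exists a' : nat -> H, forall R (g g' : G R),
    e R (gmul g g') w = \sum_(i < size (L ++ L')) e R g (a' i) * e R g' (L ++ L')`_i.
Proof.
move=> iL.
have [b bP] : exists b : seq H, forall w, w \in v -> exists n (a b' : 'I_n -> H),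
   (forall R (g g' : G R), e R (gmul g g') w = \sum_i e R g (a i) * e R g' (b' i)) /\
   forall i, b' i \in b.
  elim: v => [|x v [b IH]]; first by exists [::].
  have [n [a [b' E]]] := comul x; exists (codom b' ++ b) => w; rewrite inE => /orP[/eqP ->|].
    by exists n, a, b'; split=> // i; rewrite mem_cat codom_f.
  move=> /IH [n1 [a1 [b1 [E1 bb]]]]; exists n1, a1, b1; split=> // i.
  by rewrite mem_cat bb orbT.
have [L' [_ iL' sp]] := indeps_ext b iL; exists L'; split=> // w /bP [n [a [b' [E bb]]]].
by apply: comul_span E _ => i; apply: sp.
Qed.

(** Coefficients are compared in H ⊗ R, where elements independent over k remain independent over
    R. *)
Lemma indep_coef R (L : seq H) (r s : nat -> R) : indeps L ->
  \sum_(i < size L) ktl H R L`_i * ktr H R (r i) =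
  \sum_(i < size L) ktl H R L`_i * ktr H R (s i) ->
  forall i, (i < size L)%N -> r i = s i.
Proof.
move=> /indeps_indep iL /eqP; rewrite -subr_eq0 -sumrB => /eqP E i iL'.
apply: subr0_eq.
have := kt_indepl (r := fun j : 'I_(size L) => r j - s j) iL _ (Ordinal iL'); apply.
by rewrite -[RHS]E; apply: eq_bigr => j _; rewrite rmorphB mulrBr.
Qed.

(** Local finiteness of the regular representation. Write x_t(gg') = Σ a_ti(g) L_i(g') with
    independent L_i. Associativity of x_t(g g' u) shows that translations preserve the span W of the
    a_ti; h is the matrix of this action in a basis of W. *)
Lemma matrix_rep n0 (x : 'I_n0 -> H) : generated (kinit H) x ->
  exists n (h : 'I_n -> 'I_n -> H),
    [/\ forall R (g g' : G R) i j,
          e R (gmul g g') (h i j) = \sum_l e R g (h i l) * e R g' (h l j),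
        forall R i j, e R (gone G R) (h i j) = (i == j)%:R &
        forall U, is_subalg U -> (forall i j, U (h i j)) -> forall y, U y].
Proof.
move=> gx; pose xs := codom x.
have [L [iL xL]] := comul_list xs (@indeps_nil _ H).
rewrite /= in iL xL.
have [L' [iL' LL]] := comul_list L iL.
have /choice [a aP] (t : 'I_n0) : exists a : nat -> H, forall R (g g' : G R),
    e R (gmul g g') (x t) = \sum_(i < size L) e R g (a i) * e R g' L`_i.
  by apply: xL; exact: codom_f.
have /choice [d dP] (i : 'I_(size L)) : exists a : nat -> H, forall R (g g' : G R),
    e R (gmul g g') L`_i = \sum_(j < size (L ++ L')) e R g (a j) * e R g' (L ++ L')`_j.
  by apply: LL; exact: mem_nth.
have aM t (j : 'I_(size L)) R (g g' : G R) :
    e R (gmul g g') (a t j) = \sum_(i < size L) e R g (a t i) * e R g' (d i j).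
  have [gu guE] := G_pt (ktl H R); pose f := ktr H R.
  (* The expansion of x_t involves L only, so its coefficients on L' are 0. *)
  pose r m := if (m < size L)%N then e R (gmul g g') (a t m) else 0.
  pose s m := \sum_(i < size L) e R g (a t i) * e R g' (d i m).
  suff /(_ j) : forall m, (m < size (L ++ L'))%N -> r m = s m.
    by rewrite /r ltn_ord size_cat ltn_addr // => /(_ isT).
  apply: (indep_coef iL').
  have E : e _ (gmul (gmul (fmap f g) (fmap f g')) gu) (x t) =
         e _ (gmul (fmap f g) (gmul (fmap f g') gu)) (x t) by rewrite gmulA.
  transitivity (e _ (gmul (gmul (fmap f g) (fmap f g')) gu) (x t)).
    rewrite aP size_cat big_split_ord /= [X in _ + X]big1 ?addr0 => [|i _].
      by apply: eq_bigr => i _; rewrite /r ltn_ord nth_cat ltn_ord -gmul_nat ev_nat guE mulrC.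
    by rewrite /r ltnNge leq_addr rmorph0 mulr0.
  rewrite E aP; under eq_bigr do rewrite dP mulr_sumr.
  rewrite exchange_big; apply: eq_bigr => m _ /=.
  rewrite /s rmorph_sum mulr_sumr; apply: eq_bigr => i _.
  by rewrite rmorphM !ev_nat guE; ring.
pose va := [seq a t (nat_of_ord i) | t <- enum 'I_n0, i <- enum 'I_(size L)].
have [W [subW iW spW]] := indeps_ext va (@indeps_nil _ H); rewrite /= in iW spW.
have va_in t (i : 'I_(size L)) : a t i \in va.
  by apply/allpairsP; exists (t, i); rewrite !mem_enum.
have W_a (w : 'I_(size W)) : exists t (i : 'I_(size L)), W`_w = a t i.
  have /subW/allpairsP [[t i] [_ _ ->]] : W`_w \in W by exact: mem_nth.
  by exists t, i.
have /choice [h' h'P] (i : 'I_(size W)) : exists h : nat -> H, forall R (g g' : G R),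
    e R (gmul g g') W`_i = \sum_(j < size W) e R g W`_j * e R g' (h j).
  have [t [m ->]] := W_a i.
  have /choice [c cE] (l : 'I_(size L)) : span W (a t l) by exact/spW/va_in.
  exists (fun j => \sum_l kalg_str H (c l j) * d l m) => R g g'; rewrite aM.
  under eq_bigr do rewrite cE ev_comb mulr_suml.
  rewrite exchange_big; apply: eq_bigr => j _ /=.
  rewrite rmorph_sum mulr_sumr; apply: eq_bigr => l _.
  by rewrite rmorphM khom_str; ring.
(* The indices are exchanged because W_i(gg') = Σ W_j(g) h'_ij(g'): this order makes h(gg') = h(g)
   h(g'). *)
exists (size W), (fun j i => h' i j).
have unit R (i j : 'I_(size W)) : e R (gone G R) (h' j i) = (i == j)%:R.
  have [gu guE] := G_pt (ktl H R).
  apply: (indep_coef (r := fun m => e R (gone G R) (h' j m))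
    (s := fun m => (m == j)%:R) iW _ (ltn_ord i)).
  transitivity (e _ (gmul gu (gone G _)) W`_j).
    rewrite h'P; apply: eq_bigr => m _.
    by rewrite -(gone_nat G (ktr H R)) ev_nat guE.
  rewrite gmulr1 (bigD1 j) //= eqxx rmorph1 mulr1 big1 ?addr0 ?guE //.
  by move=> m /negPf; rewrite -val_eqE => ->; rewrite rmorph0 mulr0.
split=> [R g g' i j|R i j|U sU Uh y]; [|exact: unit|].
  have [gu guE] := G_pt (ktl H R); pose f := ktr H R.
  apply: (indep_coef (r := fun m => e R (gmul g g') (h' j m))
    (s := fun m => \sum_(l < size W) e R g (h' l m) * e R g' (h' j l)) iW _ (ltn_ord i)).
  transitivity (e _ (gmul gu (gmul (fmap f g) (fmap f g'))) W`_j).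
    by rewrite h'P; apply: eq_bigr => m _; rewrite -gmul_nat ev_nat guE.
  rewrite gmulA h'P; under eq_bigr do rewrite h'P mulr_suml.
  rewrite exchange_big; apply: eq_bigr => m _ /=.
  rewrite rmorph_sum mulr_sumr; apply: eq_bigr => l _.
  by rewrite rmorphM !ev_nat guE; ring.
(* Generation: at the universal point [g1], multiplied by the unit, W_i = Σ ε(W_j) h'_ij and x_t = Σ
   ε(L_i) a_ti, where the counit ε has values in k. *)
have [g1 g1E] := G_pt (kid H).
have one z : exists c, e H (gone G H) z = kalg_str H c.
  have [q qE] := G_pt (kid H).
  exists (e (kbase k) (gone G _) z).
  by rewrite -(gone_nat G (kinit H)) ev_nat.
have Uc z : U (e H (gone G H) z) by have [c ->] := one z; case: sU.
have g1x z : e H g1 z = z by rewrite g1E.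
have UW (i : 'I_(size W)) : U W`_i.
  have := h'P i H (gone G H) g1; rewrite gmul1 g1x => ->.
  by apply: subalg_sum => // j; rewrite g1x; apply: subalgM.
have Ua t (i : 'I_(size L)) : U (a t i).
  have [c ->] := spW _ (va_in t i); apply: subalg_sum => // j.
  by apply: subalgM => //; case: sU.
apply: (gx U sU) => [c|t]; first by case: sU.
have := aP t H g1 (gone G H); rewrite gmulr1 g1x => ->.
by apply: subalg_sum => // j; rewrite g1x; apply: subalgM.
Qed.

End Representation.

(** * Polynomials and genericity *)

Section NzOf.
Variables (R : comPzRingType) (nz : (1 : R) <> 0).
Definition nzR : Type := R.
HB.instance Definition _ := GRing.ComPzRing.on nzR.
Fact nzR_nz : (1 : nzR) != 0. Proof. exact/eqP. Qed.
HB.instance Definition _ := GRing.PzSemiRing_isNonZero.Build nzR nzR_nz.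
Definition nz_type : comNzRingType := nzR.
End NzOf.

Lemma nz_kalg (k : fieldType) (C : kalg k) : (1 : C) <> 0 ->
  exists (R : comNzRingType) (iR : {rmorphism k -> R}), C = KAlg iR.
Proof.
case: C => R s /= nz; move: s nz.
case: R => T [m1 m2 m3 m4 m5 m6 m7 m8 m9 m10 m11] s nz.
by exists (nz_type nz), s.
Qed.

Section Polynomials.
Variable k : fieldType.
Implicit Types A B C R L : kalg k.

(* Polynomials are formal expressions, identified when they take the same values
   in every algebra. *)
Inductive pterm (T V : Type) : Type :=
  | PV of V | PC of T | PA of pterm T V & pterm T V | PM of pterm T V & pterm T V
  | PN of pterm T V.

Section Pol.
Variables (A : kalg k) (V : Type).

Fixpoint peval C (chi : khom A C) (c : V -> C) (t : pterm A V) : C :=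
  match t with
  | PV v => c v | PC a => chi a
  | PA t1 t2 => peval chi c t1 + peval chi c t2
  | PM t1 t2 => peval chi c t1 * peval chi c t2
  | PN t1 => - peval chi c t1
  end.

Definition pol_sring : sring.
Proof.
refine (@SRing (pterm A V)
  (fun t t' => forall C (chi : khom A C) (c : V -> C), peval chi c t = peval chi c t')
  (PC V 0) (PC V 1) (@PN A V) (@PA A V) (@PM A V)
  _ _ _ _ _ _ _ _ _ _ _ _ _ _) => //=.
- by move=> x y z xy yz C chi c; rewrite xy yz.
- by move=> x y xy C chi c; rewrite xy.
- by move=> x y z xy C chi c; rewrite xy.
- by move=> x y z xy C chi c; rewrite xy.
- by move=> x y z C chi c; rewrite addrA.
- by move=> x y C chi c; rewrite addrC.
- by move=> x C chi c; rewrite rmorph0 add0r.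
- by move=> x C chi c; rewrite rmorph0 addNr.
- by move=> x y z C chi c; rewrite mulrA.
- by move=> x y C chi c; rewrite mulrC.
- by move=> x C chi c; rewrite rmorph1 mul1r.
- by move=> x y z C chi c; rewrite mulrDl.
Defined.

Definition pol : kalg k.
Proof.
apply: (@mk_kalg k (qring pol_sring) (fun c => rpi (PC V (kalg_str A c) : pol_sring))).
- by move=> x y; rewrite -rpiD; apply/rpiE => C chi c /=; rewrite !rmorphD.
- by move=> x y; rewrite -rpiM; apply/rpiE => C chi c /=; rewrite !rmorphM.
- by rewrite rmorph1.
Defined.

Definition pol_const : khom A pol.
Proof.
apply: (@mk_khom k A pol (fun a => rpi (PC V a : pol_sring))) => //.
- by move=> x y; rewrite -rpiD; apply/rpiE => C chi c /=; rewrite rmorphD.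
- by move=> x y; rewrite -rpiM; apply/rpiE => C chi c /=; rewrite rmorphM.
Defined.

Definition pol_var (v : V) : pol := rpi (PV A v : pol_sring).

Section Eval.
Variables (C : kalg k) (chi : khom A C) (c : V -> C).

Let ev (x : pol) : C := peval chi c (rrepr (x : qring pol_sring)).
Let evE (t : pol_sring) : ev (rpi t) = peval chi c t.
Proof. exact: (rreprE t). Qed.

Definition pol_ev : khom pol C.
Proof.
apply: (@mk_khom k pol C ev).
- move=> a b; have [x ->] := rpi_surj a; have [y ->] := rpi_surj b.
  by rewrite -rpiD !evE.
- move=> a b; have [x ->] := rpi_surj a; have [y ->] := rpi_surj b.
  by rewrite -rpiM !evE.
- by rewrite -rpi1 evE /= rmorph1.
- by move=> d; rewrite /= evE /= khom_str.
Defined.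

Lemma pol_ev_const : kcomp pol_ev pol_const = chi.
Proof. by apply: khomP => a; exact: evE. Qed.

Lemma pol_ev_var v : pol_ev (pol_var v) = c v.
Proof. exact: evE. Qed.
End Eval.

Lemma pol_ind (P : pol -> Prop) : (forall v, P (pol_var v)) -> (forall a, P (pol_const a)) ->
  (forall x y, P x -> P y -> P (x + y)) -> (forall x y, P x -> P y -> P (x * y)) ->
  (forall x, P x -> P (- x)) -> forall x, P x.
Proof.
move=> Pv Pc PD PM PN x; have [t ->] := rpi_surj x.
elim: t => [v|a|t1 IH1 t2 IH2|t1 IH1 t2 IH2|t1 IH1].
- exact: Pv.
- exact: Pc.
- by have := PD _ _ IH1 IH2; rewrite -rpiD.
- by have := PM _ _ IH1 IH2; rewrite -rpiM.
- by have := PN _ IH1; rewrite -rpiN.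
Qed.

Lemma pol_ext C (f g : khom pol C) : kcomp f pol_const = kcomp g pol_const ->
  (forall v, f (pol_var v) = g (pol_var v)) -> f = g.
Proof.
move=> /khom_comp_eq Ec Ev; apply: khomP; apply: pol_ind => //.
- by move=> x y; rewrite !rmorphD => -> ->.
- by move=> x y; rewrite !rmorphM => -> ->.
- by move=> x; rewrite !rmorphN => ->.
Qed.

Lemma pol_eq0 (x : pol) :
  (forall C (chi : khom A C) (c : V -> C), pol_ev chi c x = 0) -> x = 0.
Proof.
move=> E; have := E pol pol_const pol_var.
suff -> : pol_ev pol_const pol_var = kid pol by [].
by apply: pol_ext => [|v]; rewrite ?pol_ev_const ?pol_ev_var // kidcomp.
Qed.

Lemma pol_ev_comp C D (f : khom C D) (chi : khom A C) (c : V -> C) x :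
  f (pol_ev chi c x) = pol_ev (kcomp f chi) (fun v => f (c v)) x.
Proof.
have : kcomp f (pol_ev chi c) = pol_ev (kcomp f chi) (fun v => f (c v)).
  apply: pol_ext => [|v]; first by rewrite -kcompA !pol_ev_const.
  by rewrite kcompE !pol_ev_var.
by move=> <-.
Qed.

End Pol.

Lemma pol_polynomial A n : is_polynomial_algebra (pol_const A 'I_n) (@pol_var A 'I_n).
Proof.
move=> C chi c; exists (pol_ev chi c); split.
  by split; [exact: pol_ev_const | exact: pol_ev_var].
move=> h [hc hv]; apply: pol_ext; first by rewrite pol_ev_const hc.
by move=> v; rewrite pol_ev_var hv.
Qed.

Global Opaque pol pol_const pol_var pol_ev.

End Polynomials.

(** * Polynomials over an infinite field *)

Section Genericity.
Variable k : fieldType.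
Implicit Types A B C R L : kalg k.

(** R need not be a domain: the roots are scalars, and differences of distinct scalars are units. *)
Lemma poly_roots0 (R : comNzRingType) (iR : {rmorphism k -> R}) (p : {poly R}) (s : seq k) :
  uniq s -> (size p <= size s)%N -> (forall u, u \in s -> p.[iR u] = 0) -> p = 0.
Proof.
elim: s p => [|u s IH] p /=; first by move=> _; rewrite leqn0 size_poly_eq0 => /eqP.
move=> /andP[us us'] sz z; have /factor_theorem [q pE] : root p (iR u).
  by apply/eqP/z; rewrite inE eqxx.
suff q0 : q = 0 by rewrite pE q0 mul0r.
apply: IH => // [|v vs].
  have [->|q0] := eqVneq q 0; first by rewrite size_poly0.
  by move: sz; rewrite pE size_Mmonic ?monicXsubC // size_XsubC addn2.
have := z v; rewrite inE vs orbT => /(_ isT); rewrite pE !hornerE => E.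
have uv : u != v by apply: contraNneq us => ->.
have inv : iR (v - u) * iR (v - u)^-1 = 1.
  by rewrite -rmorphM mulfV ?rmorph1 // subr_eq0 eq_sym.
by rewrite -[LHS]mulr1 -inv mulrA rmorphB E mul0r.
Qed.

Lemma poly_infinite_roots (R : comNzRingType) (iR : {rmorphism k -> R}) (p : {poly R}) :
  infinite_set [set u : k | p.[iR u] = 0] -> p = 0.
Proof.
move=> /(@infinite_set_fset _ _ (size p)) [B Bz szB].
by apply: poly_roots0 (finmap.fset_uniq B) szB _ => u uB; apply: Bz.
Qed.

Lemma pol_ev_eq A V C (chi chi' : khom A C) (c c' : V -> C) (F : pol A V) :
  chi = chi' -> c =1 c' -> pol_ev chi c F = pol_ev chi' c' F.
Proof. by move=> -> /funext ->. Qed.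

Definition polyK (R : comNzRingType) (iR : {rmorphism k -> R}) : kalg k :=
  @KAlg k {poly R} (polyC \o iR).
Definition polyC_hom (R : comNzRingType) iR : khom (KAlg iR) (@polyK R iR) :=
  @KHom k (KAlg iR) (polyK iR) polyC (fun=> erefl).
Definition horner_hom (R : comNzRingType) iR (x : R) : khom (@polyK R iR) (KAlg iR) :=
  @KHom k (polyK iR) (KAlg iR) (horner_eval x) (fun c => hornerC (iR c) x).

Lemma horner_homC (R : comNzRingType) (iR : {rmorphism k -> R}) (x c : R) :
  horner_hom iR x c%:P = c.
Proof. exact: hornerC. Qed.
Lemma horner_homX (R : comNzRingType) (iR : {rmorphism k -> R}) (x : R) :
  horner_hom iR x 'X = x.
Proof. exact: hornerX. Qed.

Hypothesis hk : infinite_set [set: k].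

(** Induction on the coordinates not known to be scalars: replacing one of them by an indeterminate
    gives a polynomial that vanishes on all of k, hence is zero. *)
Lemma pol_ev_scalars A (W : finType) (F : pol A W) C (chi : khom A C) :
  (forall c : W -> k, pol_ev chi (fun w => kalg_str C (c w)) F = 0) ->
  forall c, pol_ev chi c F = 0.
Proof.
case: (pselect ((1 : C) = 0)) => [z _ c|]; first by rewrite -[LHS]mulr1 z mulr0.
move/nz_kalg => [R [iR E]]; subst C => F0 c.
suff H : forall (s : seq W) (c : W -> KAlg iR),
    (forall w, w \notin s -> exists u, c w = iR u) -> pol_ev chi c F = 0.
  by apply: (H (enum W)) => w; rewrite mem_enum.
elim=> [|w s IH] {}c cs.
  have /choice [d dE] := fun w => cs w isT.
  by rewrite -[RHS](F0 d); apply: pol_ev_eq.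
pose sub (x : R) (v : W) : KAlg iR := if v == w then x else c v.
pose p : {poly R} := pol_ev (kcomp (polyC_hom iR) chi) (fun v => if v == w then 'X else (c v)%:P) F.
have pE x : horner_hom iR x p = pol_ev chi (sub x) F.
  rewrite pol_ev_comp; apply: pol_ev_eq.
    by apply: khomP => a; rewrite !kcompE; exact: hornerC.
  move=> v; rewrite /sub; case: eqP => _; first exact: hornerX.
  exact: hornerC.
have p0 : p = 0.
  apply: (poly_infinite_roots (iR := iR)); apply: sub_infinite_set hk => u _ /=.
  rewrite -[LHS]/(horner_hom iR (iR u) p) pE; apply: IH => v vs; rewrite /sub; case: eqP => [_|/eqP vw]; first by exists u.
  by apply: cs; rewrite inE negb_or vw.
have -> : c = sub (c w) by apply/funext => v; rewrite /sub; case: eqP => [->|].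
by rewrite -pE p0 rmorph0.
Qed.

Definition line (W : Type) (c0 c1 : W -> k) (u : k) (w : W) : k := c0 w + u * (c1 w - c0 w).

(* Sets of scalar points meeting each affine line in a cofinite set, or not at all;
   over an infinite field finitely many nonempty ones have a common point. *)
Definition lineopen (W : Type) (O : set (W -> k)) : Prop :=
  forall c0 c1, (exists u, O (line c0 c1 u)) -> finite_set [set u | ~ O (line c0 c1 u)].

(** On the line through a point of one set and a point of another both complements are finite, while
    k is infinite. Lines are used because the conditions at different maximal ideals are polynomials
    over unrelated fields, which cannot be multiplied together. *)
Lemma lineopen_meet (W : Type) (Os : seq (set (W -> k))) :
  (forall O, O \in Os -> lineopen O /\ O !=set0) ->
  exists c, forall O, O \in Os -> O c.
Proof.
move=> hO; suff [U [_ [c Uc] sub]] : exists U : set (W -> k),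
    [/\ lineopen U, U !=set0 & forall O, O \in Os -> U `<=` O].
  by exists c => O /sub; apply.
elim: Os hO => [_|O Os IH hO].
  exists setT; split; [|by exists (fun=> 0)|by []].
  by move=> c0 c1 _; apply: sub_finite_set (finite_set0 _) => u /= h; case: h.
have [|U [lU [c Uc] sub]] := IH _; first by move=> O' h; apply: hO; rewrite inE h orbT.
have [lO [d Od]] : lineopen O /\ O !=set0 by apply: hO; rewrite inE eqxx.
exists (U `&` O); split.
- move=> c0 c1 [u [Uu Ou]]; apply: sub_finite_set (_ : finite_set
    ([set u | ~ U (line c0 c1 u)] `|` [set u | ~ O (line c0 c1 u)])).
    by move=> v /= /not_andP.
  by rewrite finite_setU; split; [apply: lU | apply: lO]; exists u.
- have fU : finite_set [set u | ~ U (line c d u)].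
    by apply: lU; exists 0; rewrite (_ : line c d 0 = c) //; apply/funext => w; rewrite /line mul0r addr0.
  have fO : finite_set [set u | ~ O (line c d u)].
    by apply: lO; exists 1; rewrite (_ : line c d 1 = d) //; apply/funext => w; rewrite /line mul1r addrC subrK.
  have [u [_ /= nu]] := infinite_setN0 (infinite_setD hk (eq_ind_r id (conj fU fO) (finite_setU _ _))).
  by exists (line c d u); split; apply: contrapT => h; apply: nu; [left|right].
by move=> O'; rewrite inE => /orP[/eqP -> c' []//|/sub h c' [/h]].
Qed.

(** On a line the polynomial has one variable and coefficients in L; it is zero or has finitely many
    roots in k. *)
Lemma pol_lineopen A (W : finType) (F : pol A W) L (chi : khom A L) : is_fld L ->
  lineopen [set c : W -> k | pol_ev chi (fun w => kalg_str L (c w)) F <> 0].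
Proof.
move=> hL; have [R [iR E]] := fld_kalg hL; subst L => c0 c1 [u0 /= nz].
pose p : {poly R} := pol_ev (kcomp (polyC_hom iR) chi)
  (fun v => (iR (c0 v))%:P + 'X * (iR (c1 v - c0 v))%:P   : polyK iR) F.
have pE u : horner_hom iR (iR u) p = pol_ev chi (fun w => kalg_str (KAlg iR) (line c0 c1 u w)) F.
  rewrite pol_ev_comp; apply: pol_ev_eq.
    by apply: khomP => a; rewrite !kcompE; exact: hornerC.
  move=> v; rewrite rmorphD rmorphM !horner_homC horner_homX -[RHS]/(iR _) /line.
  by rewrite [RHS](rmorphD iR); congr (_ + _); rewrite [RHS](rmorphM iR).
apply: contrapT => inf; apply: nz; rewrite -pE.
suff -> : p = 0 by rewrite rmorph0.
apply: (poly_infinite_roots (iR := iR)); apply: sub_infinite_set inf => u /= /contrapT.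
by rewrite -pE.
Qed.

Lemma pol_nonvanishing A (W : finType) (F : pol A W) L (chi : khom A L) (c : W -> L) :
  pol_ev chi c F <> 0 ->
  [set c : W -> k | pol_ev chi (fun w => kalg_str L (c w)) F <> 0] !=set0.
Proof.
move=> nz; apply: contrapT => no; apply: nz; apply: pol_ev_scalars => d.
by apply: contrapT => nz; apply: no; exists d.
Qed.

Lemma pol_nonzero (W : finType) (F : pol (kbase k) W) : F <> 0 ->
  [set c : W -> k | pol_ev (kid (kbase k)) c F <> 0] !=set0.
Proof.
move=> nz; apply: contrapT => no; apply: nz; apply: pol_eq0 => C chi c.
apply: pol_ev_scalars => d.
have chiE : chi = kinit C by apply: khomP => a; exact: (khom_str chi).
rewrite chiE; have -> : (fun w => kalg_str C (d w)) = (fun w => kinit C (d w)) by [].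
rewrite -{1}(kcompid (kinit C)) -pol_ev_comp.
suff -> : pol_ev (kid (kbase k)) d F = 0 by rewrite rmorph0.
by apply: contrapT => nz; apply: no; exists d.
Qed.

(** Nonzero polynomials have scalar points of nonvanishing, and two such loci meet. *)
Lemma pol_domain (W : finType) : is_domain (pol (kbase k) W).
Proof.
split.
  move/(congr1 (pol_ev (kid (kbase k)) (fun _ : W => 0))); rewrite rmorph1 rmorph0.
  exact: (@kbase_fld k).1.
move=> x y xy; apply: contrapT => /not_orP [/pol_nonzero nx /pol_nonzero ny].
have lo F := @pol_lineopen (kbase k) W F _ (kid (kbase k)) (@kbase_fld k).
pose O F := [set c : W -> k | pol_ev (kid (kbase k)) c F <> 0].
have [|c cP] := @lineopen_meet W [:: O x; O y].
  move=> U; rewrite !inE => /orP[/eqP ->|/eqP ->]; split; by [exact: lo|].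
have cx : O x c by apply: cP; rewrite inE eqxx.
have cy : O y c by apply: cP; rewrite !inE eqxx orbT.
have : pol_ev (kid (kbase k)) c (x * y) = 0 by rewrite xy rmorph0.
by rewrite rmorphM => /(field_domain (@kbase_fld k)) [].
Qed.

End Genericity.

(** * The generic torsor *)

Lemma loc_domain_inj (k : fieldType) (A : kalg k) (dA : is_domain A) :
  injective (loc_in (nzM_mult dA)).
Proof.
move=> x y xy; apply: subr0_eq.
have : loc_in (nzM_mult dA) (x - y) = 0 by rewrite rmorphB xy subrr.
by move/loc_eq0 => [u u0 /dA.2 []].
Qed.

Lemma rmorph_det (R S : comPzRingType) (f : {rmorphism R -> S}) n (a : 'I_n -> 'I_n -> R) :
  f (\det (\matrix_(i, j) a i j)) = \det (\matrix_(i, j) f (a i j)).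
Proof. by rewrite -det_map_mx; congr (\det _); apply/matrixP => i j; rewrite !mxE. Qed.

Lemma inverse_entries (R : comPzRingType) n (x : 'I_n -> 'I_n -> R) (v : R) :
  \det (\matrix_(i, j) x i j) * v = 1 -> exists y : 'I_n -> 'I_n -> R,
  (forall i j, \sum_l x i l * y l j = (i == j)%:R) /\
  (forall i j, \sum_l y i l * x l j = (i == j)%:R).
Proof.
set X := \matrix_(i, j) x i j => dv.
exists (fun i j => (\adj X) i j * v); split=> i j.
  have /matrixP/(_ i j) := mul_mx_adj X; rewrite mxE [RHS]mxE => E.
  transitivity ((\sum_l X i l * (\adj X) l j) * v); last by rewrite E mulrnAl dv.
  by rewrite mulr_suml; apply: eq_bigr => l _; rewrite [X i l]mxE mulrA.
have /matrixP/(_ i j) := mul_adj_mx X; rewrite mxE [RHS]mxE => E.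
transitivity ((\sum_l (\adj X) i l * X l j) * v); last by rewrite E mulrnAl dv.
by rewrite mulr_suml; apply: eq_bigr => l _; rewrite [X l j]mxE mulrAC.
Qed.

(** * Complements on tensor products *)

Section TensorComplements.
Variable k : fieldType.
Implicit Types A B C D R L : kalg k.

Lemma tens_triv0 A B C (psi : khom A C) (phi : khom A B) (fl : eqflat phi)
    (I J : finType) (c : I -> C) (b : I -> B) (d : J -> B) (s : I -> J -> A) :
  (forall i, b i = \sum_l phi (s i l) * d l) ->
  (forall l, \sum_i psi (s i l) * c i = 0) ->
  \sum_i tensl psi fl (c i) * tensr psi fl (b i) = 0.
Proof.
move=> bE sZ; under eq_bigr do rewrite bE rmorph_sum mulr_sumr.
rewrite exchange_big big1 // => l _.
transitivity (tensr psi fl (d l) * tensl psi fl (\sum_j psi (s j l) * c j)).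
  rewrite rmorph_sum mulr_sumr; apply: eq_bigr => j _.
  by rewrite !rmorphM (khom_comp_eq (tens_comm psi fl)); ring.
by rewrite sZ rmorph0 mulr0.
Qed.

(** One family d certifies all the relations: they are treated one after the other, each rewriting
    the d obtained so far, which preserves the earlier certificates. *)
Lemma tens_zero_simul A B C (psi : khom A C) (phi : khom A B) (fl : eqflat phi)
    (I J : finType) (p : I -> J -> C) (b : I -> B) :
  (forall j, \sum_i tensl psi fl (p i j) * tensr psi fl (b i) = 0) ->
  exists (K : finType) (d : K -> B) (s : I -> K -> A),
    (forall i, b i = \sum_l phi (s i l) * d l) /\
    (forall j l, \sum_i psi (s i l) * p i j = 0).
Proof.
move=> E; suff [K [d [s [bE sZ]]]] : exists (K : finType) (d : K -> B) (s : I -> K -> A),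
    (forall i, b i = \sum_l phi (s i l) * d l) /\
    (forall j l, j \in enum J -> \sum_i psi (s i l) * p i j = 0).
  by exists K, d, s; split=> // j l; apply: sZ; rewrite mem_enum.
elim: (enum J) => [|j js [K [d [s [bE sZ]]]]].
  exists I, b, (fun i l => (i == l)%:R); split=> // i.
  rewrite (bigD1 i) //= eqxx rmorph1 mul1r big1 ?addr0 // => l /negPf.
  by rewrite eq_sym => ->; rewrite rmorph0 mul0r.
have : \sum_l tensl psi fl (\sum_i psi (s i l) * p i j) * tensr psi fl (d l) = 0.
  rewrite -[RHS](E j).
  under eq_bigr do rewrite rmorph_sum mulr_suml.
  rewrite exchange_big; apply: eq_bigr => i _ /=.
  rewrite [in RHS]bE rmorph_sum mulr_sumr; apply: eq_bigr => l _.
  by rewrite !rmorphM (khom_comp_eq (tens_comm psi fl)); ring.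
move/tens_zero_fin => [M [f [t [dE tZ]]]].
exists M, f, (fun i h => \sum_l s i l * t l h); split=> [i|j' h].
  rewrite bE; under eq_bigr do rewrite dE mulr_sumr.
  rewrite exchange_big; apply: eq_bigr => h _ /=.
  rewrite rmorph_sum mulr_suml; apply: eq_bigr => l _.
  by rewrite rmorphM mulrA.
have swap : \sum_i psi (\sum_l s i l * t l h) * p i j' =
    \sum_l psi (t l h) * \sum_i psi (s i l) * p i j'.
  under eq_bigr do rewrite rmorph_sum mulr_suml.
  rewrite exchange_big; apply: eq_bigr => l _ /=.
  by rewrite mulr_sumr; apply: eq_bigr => i _; rewrite rmorphM; ring.
rewrite swap inE => /orP[/eqP ->|js']; first exact: tZ.
by rewrite big1 // => l _; rewrite sZ // mulr0.
Qed.

Lemma eqflat_simul A B (phi : khom A B) (I J : finType) (a : I -> J -> A) (b : I -> B) :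
  eqflat phi -> (forall j, \sum_i phi (a i j) * b i = 0) ->
  exists (K : finType) (d : K -> B) (s : I -> K -> A),
    (forall i, b i = \sum_l phi (s i l) * d l) /\
    (forall j l, \sum_i a i j * s i l = 0).
Proof.
move=> fl E; have [|K [d [s [bE sZ]]]] := @tens_zero_simul _ _ _ (kid A) _ fl I J a b.
  move=> j; rewrite -[RHS](rmorph0 (tensr (kid A) fl)) -[in RHS](E j) rmorph_sum.
  by apply: eq_bigr => i _; rewrite rmorphM -(khom_comp_eq (tens_comm (kid A) fl)).
exists K, d, s; split=> // j l; rewrite -[RHS](sZ j l).
by apply: eq_bigr => i _; rewrite mulrC.
Qed.

Definition kt_pair A B R (f : khom A R) (g : khom B R) : khom (kt A B) R :=
  projT1 (cid (kt_lift f g)).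

Lemma kt_pairl A B R (f : khom A R) (g : khom B R) x : kt_pair f g (ktl A B x) = f x.
Proof. by rewrite /kt_pair; case: cid => h [hl hr]; exact: (kcomp_at hl). Qed.
Lemma kt_pairr A B R (f : khom A R) (g : khom B R) x : kt_pair f g (ktr A B x) = g x.
Proof. by rewrite /kt_pair; case: cid => h [hl hr]; exact: (kcomp_at hr). Qed.

Definition kt_map A A' B (f : khom A A') : khom (kt A B) (kt A' B) :=
  kt_pair (kcomp (ktl A' B) f) (ktr A' B).

Lemma kt_mapl A A' B (f : khom A A') x : kt_map B f (ktl A B x) = ktl A' B (f x).
Proof. exact: kt_pairl. Qed.
Lemma kt_mapr A A' B (f : khom A A') x : kt_map B f (ktr A B x) = ktr A' B x.
Proof. exact: kt_pairr. Qed.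

Lemma kt_gen A B (x : kt A B) : exists n (a : 'I_n -> A) (b : 'I_n -> B),
  x = \sum_i ktl A B (a i) * ktr A B (b i).
Proof. exact: tens_gen_fin. Qed.

Lemma kt_map_inj A A' B (f : khom A A') : injective f -> injective (kt_map B f).
Proof.
move=> inj_f x y xy; apply: subr0_eq.
have : kt_map B f (x - y) = 0 by rewrite rmorphB xy subrr.
have [n [a [b ->]]] := kt_gen (x - y).
rewrite rmorph_sum; under eq_bigr do rewrite rmorphM kt_mapl kt_mapr.
move/tens_zero_fin => [J [d [s [bE sZ]]]].
apply: (tens_triv0 (@kinit_flat k B) bE) => l; apply: inj_f.
rewrite rmorph0 -[RHS](sZ l) rmorph_sum; apply: eq_bigr => i _.
by rewrite rmorphM khom_str.
Qed.

Lemma ktl_reg A B (q : A) (w : kt A B) : (forall a, q * a = 0 -> a = 0) ->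
  ktl A B q * w = 0 -> w = 0.
Proof.
move=> reg; have [n [a [b ->]]] := kt_gen w.
rewrite mulr_sumr; under eq_bigr do rewrite mulrA -rmorphM.
move/tens_zero_fin => [J [d [s [bE sZ]]]].
apply: (tens_triv0 (@kinit_flat k B) bE) => l; apply: reg.
by rewrite -[RHS](sZ l) mulr_sumr; apply: eq_bigr => i _; rewrite mulrCA.
Qed.

Lemma kt_clear A E B (f : khom A E) (M : set A) (w : kt E B) : is_mult M ->
  (forall x, exists a s, M s /\ x * f s = f a) ->
  exists q w', M q /\ ktl E B (f q) * w = kt_map B f w'.
Proof.
move=> hM frac; have [m [a [b ->]]] := kt_gen w.
elim: m a b => [|m IH] a b.
  by exists 1, 0; split; [exact: hM.1 | rewrite big_ord0 mulr0 rmorph0].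
have [q [w' [Mq wE]]] := IH (fun i => a (lift ord0 i)) (fun i => b (lift ord0 i)).
have [c [s [Ms cE]]] := frac (a ord0).
exists (s * q), (ktl A B (c * q) * ktr A B (b ord0) + ktl A B s * w').
split; first exact: hM.2.
rewrite big_ord_recl rmorphD !rmorphM !kt_mapl kt_mapr -wE -cE.
by rewrite !rmorphM; ring.
Qed.

End TensorComplements.

Global Opaque kt ktl ktr kt_pair kt_map.

(** The polynomial algebra and its fraction field, reduced to the properties that the sequel uses;
    [ev] is substitution. *)
Lemma generic_field (k : fieldType) (hk : infinite_set [set: k]) (W : finType) :
  exists (A E : kalg k) (i : khom A E) (v : W -> A) (ev : forall R : kalg k, (W -> R) -> khom A R),
    [/\ forall (R : kalg k) (c : W -> R) p, ev R c (v p) = c p,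
        forall (R : kalg k) (f f' : khom A R), (forall p, f (v p) = f' (v p)) -> f = f',
        is_domain A, is_fld E &
        [/\ injective i, forall q, q <> 0 -> is_unit (i q),
            forall x, exists a s, s <> 0 /\ x * i s = i a,
            forall (R : kalg k) (f : khom A R), (forall q, q <> 0 -> is_unit (f q)) ->
              exists f' : khom E R, kcomp f' i = f &
            forall F, F <> 0 -> exists c : W -> kbase k, ev (kbase k) c F <> 0 ]] .
Proof.
have dA := pol_domain hk W.
exists (pol (kbase k) W), (loc_kalg (nzM_mult dA)), (loc_in (nzM_mult dA)).
exists (@pol_var k (kbase k) W), (fun R c => pol_ev (kinit R) c); split; last split.
- by move=> R c p; exact: pol_ev_var.
- move=> R f f' E; apply: pol_ext; last exact: E.
  apply: khomP => c.
  by rewrite !kcompE -[c]/(kalg_str (kbase k) c) !khom_str.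
- exact: dA.
- exact: loc_fld.
- exact: loc_domain_inj.
- by move=> q q0; apply: loc_unit.
- exact: loc_fracP.
- exact: loc_lift.
- move=> F /(pol_nonzero hk) [c cF]; exists c; rewrite (_ : kinit _ = kid (kbase k)); first exact: cF.
  by apply: khomP.
Qed.

Section Generic.
Variable k : fieldType.
Implicit Types R : kalg k.
Variables (G : kgroup k) (H : kalg k) (e : kmor G (Spec H)).
Hypothesis ie : is_iso e.
Variables (n : nat) (h : 'I_n -> 'I_n -> H).
Hypothesis hM : forall R (g g' : G R) i j,
  e R (gmul g g') (h i j) = \sum_l e R g (h i l) * e R g' (h l j).
Hypothesis h1 : forall R i j, e R (gone G R) (h i j) = (i == j)%:R.
Hypothesis hgen : forall U, is_subalg U -> (forall i j, U (h i j)) -> forall y, U y.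

Local Notation V := ('I_n * 'I_n)%type.

Variables (gA gE : kalg k) (iA : khom gA gE) (gv : V -> gA).
Variable gev : forall R, (V -> R) -> khom gA R.
Hypothesis gevE : forall R (c : V -> R) p, gev c (gv p) = c p.
Hypothesis gA_ext : forall R (f f' : khom gA R), (forall p, f (gv p) = f' (gv p)) -> f = f'.
Hypothesis gA_dom : is_domain gA.
Hypothesis gE_fld : is_fld gE.
Hypothesis iA_inj : injective iA.
Hypothesis iA_unit : forall q, q <> 0 -> is_unit (iA q).
Hypothesis gE_frac : forall x, exists a s, s <> 0 /\ x * iA s = iA a.
Hypothesis gE_lift : forall R (f : khom gA R), (forall q, q <> 0 -> is_unit (f q)) ->
  exists f' : khom gE R, kcomp f' iA = f.

Definition gx i j : gE := iA (gv (i, j)).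

Definition detA : gA := \det (\matrix_(i < n, j < n) gv (i, j)).

Lemma detA_neq0 : detA <> 0.
Proof.
pose d (p : V) : kbase k := (p.1 == p.2)%:R.
move/(congr1 (gev d)); rewrite rmorph0 /detA rmorph_det.
suff -> : \matrix_(i < n, j < n) gev d (gv (i, j)) = 1%:M.
  by rewrite det1; exact: (@kbase_fld k).1.
by apply/matrixP => i j; rewrite !mxE gevE.
Qed.

Lemma gx_inverse : exists y : 'I_n -> 'I_n -> gE,
  (forall i j, \sum_l gx i l * y l j = (i == j)%:R) /\
  (forall i j, \sum_l y i l * gx l j = (i == j)%:R).
Proof.
have [v dv] : is_unit (iA detA) by apply: iA_unit; exact: detA_neq0.
apply: (@inverse_entries _ _ gx v).
by rewrite -dv /detA rmorph_det.
Qed.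

Definition gT : kalg k := kt gE H.

Definition translate R (g : G R) (c : V -> R) (p : V) : R :=
  \sum_l e R g (h p.1 l) * c (l, p.2).

Lemma translateM R (g g' : G R) c p :
  translate (gmul g g') c p = translate g (translate g' c) p.
Proof.
rewrite /translate /=; under eq_bigr do rewrite hM mulr_suml.
rewrite exchange_big; apply: eq_bigr => l _ /=.
by rewrite mulr_sumr; apply: eq_bigr => m _; rewrite mulrA.
Qed.

Lemma translate1 R (c : V -> R) p : translate (gone G R) c p = c p.
Proof.
case: p => i j; rewrite /translate /= (bigD1 i) //= h1 eqxx mul1r big1 ?addr0 //.
by move=> l /negPf; rewrite h1 eq_sym => ->; rewrite mul0r.
Qed.

Lemma translate_nat R R' (f : khom R R') (g : G R) c p :
  f (translate g c p) = translate (fmap f g) (fun p => f (c p)) p.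
Proof.
rewrite rmorph_sum; apply: eq_bigr => l _.
by rewrite rmorphM kmor_nat.
Qed.

Definition upt R (f : khom H R) : G R := projT1 (cid (G_pt ie f)).
Lemma uptE R (f : khom H R) : e R (upt f) = f.
Proof. by rewrite /upt; case: cid. Qed.
Lemma upt_nat R R' (f : khom H R) (q : khom R R') : fmap q (upt f) = upt (kcomp q f).
Proof. by apply: (G_eq ie) => x; rewrite ev_nat !uptE. Qed.

Definition actA R (j : khom gA R) (g : G R) : khom gA R :=
  gev (translate g (fun p => j (gv p))).

Lemma actA_var R (j : khom gA R) (g : G R) p :
  actA j g (gv p) = translate g (fun p => j (gv p)) p.
Proof. exact: gevE. Qed.

Definition thA : khom gA gT := actA (kcomp (ktl gE H) iA) (upt (ktr gE H)).

(** Translation by the universal point is an automorphism of A ⊗ H, with inverse the translation by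
    the inverse point, and it sends q ⊗ 1 to the translate of q. As q ⊗ 1 is regular, so is the
    translate; denominators in E are cleared beforehand. *)
Lemma thA_reg q (w : gT) : q <> 0 -> thA q * w = 0 -> w = 0.
Proof.
move=> q0 E.
have [q' [w' [q'0 wE]]] := kt_clear w (nzM_mult gA_dom) gE_frac.
have inj_m := kt_map_inj (B := H) iA_inj.
have thAE : thA = kcomp (kt_map H iA) (actA (ktl gA H) (upt (ktr gA H))).
  apply: gA_ext => p; rewrite kcompE !actA_var translate_nat upt_nat.
  rewrite (_ : kcomp _ _ = ktr gE H); last by apply: khomP => x; rewrite kcompE kt_mapr.
  by apply: eq_bigr => l _; rewrite kt_mapl.
(* translating back by the inverse of the universal point *)
have [g guE] : exists g : G (kt gA H), e _ g = ktr gA H by exact: G_pt.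
have gnat R (f : khom (kt gA H) R) (g' : G R) : kcomp f (ktr gA H) = e R g' -> fmap f g = g'.
  by move=> E0; apply: (G_eq ie) => x; rewrite ev_nat guE -E0.
have ug : upt (ktr gA H) = g by apply: (G_eq ie) => x; rewrite uptE guE.
rewrite ug in thAE.
have E' : actA (ktl gA H) g q * w' = 0.
  apply: inj_m; rewrite rmorph0 rmorphM -wE -[kt_map _ _ _]/(kcomp _ _ q) -thAE.
  by rewrite mulrCA E mulr0.
have back (g1 g2 : G (kt gA H)) (F : khom (kt gA H) (kt gA H)) :
    gmul g1 g2 = gone G _ -> kcomp F (ktr gA H) = ktr gA H -> fmap F g1 = g1 ->
    kcomp F (ktl gA H) = actA (ktl gA H) g2 -> kcomp F (actA (ktl gA H) g1) = ktl gA H.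
  move=> g12 Fr Fg Fl; apply: gA_ext => p; rewrite kcompE actA_var translate_nat Fg.
  rewrite -[RHS](translate1 (fun p => ktl gA H (gv p)) p) -g12 translateM.
  by apply: eq_bigr => l _; rewrite (kcomp_at Fl) actA_var.
have [Psi [Psil Psir]] := kt_lift (actA (ktl gA H) (ginv g)) (ktr gA H).
have [Psi' [Psil' Psir']] := kt_lift (actA (ktl gA H) g) (ktr gA H).
have Pg : fmap Psi g = g by apply: gnat; rewrite Psir guE.
have Pg' : fmap Psi' g = g by apply: gnat; rewrite Psir' guE.
have PsiK : kcomp Psi' Psi = kid _.
  apply: kt_ext; rewrite -kcompA kidcomp; last by rewrite Psir Psir'.
  rewrite Psil; apply: (back _ g) => //; first exact: gmulV.
  by rewrite (ginv_nat Psi') Pg'.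
have Psi0 (x : kt gA H) : Psi x = 0 -> x = 0.
  by move=> x0; transitivity (Psi' (Psi x)); [rewrite (kcomp_at PsiK) | rewrite x0 rmorph0].
have PsiA : kcomp Psi (actA (ktl gA H) g) = ktl gA H.
  by apply: (back _ (ginv g)) => //; exact: gmulrV.
have w'0 : w' = 0.
  apply: Psi0; apply: (@ktl_reg _ _ _ q) => [a /gA_dom.2 [//|//]|].
  by rewrite -(kcomp_at PsiA) -rmorphM E' rmorph0.
have [v qv] : is_unit (ktl gE H (iA q')) by apply: unit_hom; exact: iA_unit.
by rewrite -[w]mul1r -qv mulrAC wE w'0 rmorph0 mul0r.
Qed.

(** L is E ⊗ H localized at the translates of nonzero polynomials, which are regular; translation
    then extends from A to its fraction field E. L need not be a field. *)
Lemma generic_translation : exists (L : kalg k) (iT : khom gT L) (th : khom gE L),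
  injective iT /\ forall i j,
    th (gx i j) = iT (\sum_l ktr gE H (h i l) * ktl gE H (gx l j)).
Proof.
pose N := [set t : gT | exists2 q, q <> 0 & t = thA q].
have hN : is_mult N.
  split; first by exists 1; [exact: gA_dom.1 | rewrite rmorph1].
  move=> x y [q q0 ->] [r r0 ->]; exists (q * r); last by rewrite rmorphM.
  by move/gA_dom.2 => [].
have [th thE] : exists th : khom gE (loc_kalg hN), kcomp th iA = kcomp (loc_in hN) thA.
  by apply: gE_lift => q q0; rewrite kcompE; apply: loc_unit; exists q.
exists (loc_kalg hN), (loc_in hN), th; split=> [|i j].
  move=> x y xy; apply: subr0_eq.
  have : loc_in hN (x - y) = 0 by rewrite rmorphB xy subrr.
  by move/loc_eq0 => [_ [q q0 ->]]; exact: thA_reg.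
rewrite (kcomp_at thE) kcompE; congr (loc_in hN _); rewrite actA_var.
by apply: eq_bigr => l _; rewrite uptE.
Qed.

End Generic.

Lemma generic_matrix (k : fieldType) (hk : infinite_set [set: k]) (G : kgroup k) (H : kalg k)
    (e : kmor G (Spec H)) (ie : is_iso e) n (h : 'I_n -> 'I_n -> H) :
  (forall (R : kalg k) (g g' : G R) i j,
    e R (gmul g g') (h i j) = \sum_l e R g (h i l) * e R g' (h l j)) ->
  (forall (R : kalg k) i j, e R (gone G R) (h i j) = (i == j)%:R) ->
  exists (A E : kalg k) (i : khom A E) (v : 'I_n * 'I_n -> A)
      (ev : forall R : kalg k, ('I_n * 'I_n -> R) -> khom A R)
      (y : 'I_n -> 'I_n -> E) (L : kalg k) (iT : khom (kt E H) L) (th : khom E L),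
    [/\ forall (R : kalg k) (c : 'I_n * 'I_n -> R) p, ev R c (v p) = c p,
        forall (R : kalg k) (f f' : khom A R), (forall p, f (v p) = f' (v p)) -> f = f',
        is_domain A & forall F, F <> 0 -> exists c, ev (kbase k) c F <> 0 ] /\
    [/\ is_fld E, injective i, (forall x, exists a s, s <> 0 /\ x * i s = i a),
        injective iT & [/\ forall i1 j, \sum_l i (v (i1, l)) * y l j = (i1 == j)%:R,
        forall i1 j, \sum_l y i1 l * i (v (l, j)) = (i1 == j)%:R &
        forall i1 j, th (i (v (i1, j))) =
          iT (\sum_l ktr E H (h i1 l) * ktl E H (i (v (l, j))))]].
Proof.
move=> hM h1.
have [A [E [i [v [ev [evE Aext dA fE [inji iu frac lift nz]]]]]]] :=
  generic_field hk ('I_n * 'I_n)%type.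
have [y [xy yx]] := gx_inverse evE iu.
have [L [iT [th [iTi thE]]]] := generic_translation ie hM h1 evE Aext dA inji iu frac lift.
by exists A, E, i, v, ev, y, L, iT, th.
Qed.

(** * Invariants, linear disjointness and the generic action *)

Section GenericObjects.
Variable k : fieldType.
Implicit Types R : kalg k.
Variables (G : kgroup k) (H : kalg k) (e : kmor G (Spec H)).
Hypothesis ie : is_iso e.
Variables (n : nat) (h : 'I_n -> 'I_n -> H).
Hypothesis hM : forall R (g g' : G R) i j,
  e R (gmul g g') (h i j) = \sum_l e R g (h i l) * e R g' (h l j).
Hypothesis h1 : forall R i j, e R (gone G R) (h i j) = (i == j)%:R.

Variables (E : kalg k) (x y : 'I_n -> 'I_n -> E).
Hypothesis fE : is_fld E.
Hypothesis xy : forall i j, \sum_l x i l * y l j = (i == j)%:R.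
Hypothesis yx : forall i j, \sum_l y i l * x l j = (i == j)%:R.
Variables (L : kalg k) (iT : khom (kt E H) L) (th : khom E L).
Hypothesis iT_inj : injective iT.
Hypothesis thx : forall i j, th (x i j) = iT (\sum_l ktr E H (h i l) * ktl E H (x l j)).

(** An element is invariant when its translate by the universal point equals its constant extension;
    the inverse of an invariant is again invariant, by uniqueness of inverses in L. *)
Lemma invariant_field : exists (K : kalg k) (iK : khom K E),
  [/\ injective iK, is_fld K, forall a, th (iK a) = iT (ktl E H (iK a)) &
      forall a, th a = iT (ktl E H a) -> exists c, iK c = a].
Proof.
pose U := [set a : E | th a = iT (ktl E H a)].
have sU : is_subalg U by exact: (subalg_eq th (kcomp iT (ktl E H))).
exists (sub_kalg sU), (sub_val sU); split.
- exact: sub_val_inj.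
- split=> [E1|a a0].
    by apply: fE.1; rewrite -(rmorph1 (sub_val sU)) E1 rmorph0.
  have a0' : sub_val sU a <> 0 by move=> a0'; apply: a0; apply: (@sub_val_inj _ _ _ sU); rewrite a0' rmorph0.
  have [b ab] := fE.2 _ a0'.
  have Ub : U b.
    rewrite /U /=; have Ua : U (sub_val sU a) := sub_valP a.
    have tb : th (sub_val sU a) * th b = 1 by rewrite -rmorphM ab rmorph1.
    have tb' : th (sub_val sU a) * iT (ktl E H b) = 1.
      by rewrite Ua -!rmorphM ab !rmorph1.
    by rewrite -[LHS]mulr1 -tb' mulrA [th b * _]mulrC tb mul1r.
  have [b' b'E] := sub_val_surj sU Ub.
  by exists b'; apply: (@sub_val_inj _ _ _ sU); rewrite rmorphM b'E ab rmorph1.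
- exact: (@sub_valP _ _ _ sU).
- by move=> a Ua; exact: sub_val_surj.
Qed.

Lemma matrix_subalgebra (K : kalg k) (iK : khom K E) :
  exists (C : kalg k) (iC : khom C E) (kC : khom K C) (xC yC : 'I_n -> 'I_n -> C),
    [/\ injective iC, kcomp iC kC = iK, forall i j, iC (xC i j) = x i j,
        forall i j, iC (yC i j) = y i j &
        forall U, is_subalg U -> (forall a, U (kC a)) -> (forall i j, U (xC i j)) ->
          (forall i j, U (yC i j)) -> forall c, U c].
Proof.
have [C [iC [kC [z [iC_inj iCk iCz Cgen]]]]] := generated_subalgebra iK
  (fun q : 'I_n * 'I_n + 'I_n * 'I_n =>
     match q with inl p => x p.1 p.2 | inr p => y p.1 p.2 end).
exists C, iC, kC, (fun i j => z (inl (i, j))), (fun i j => z (inr (i, j))); split=> //.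
- by move=> i j; rewrite iCz.
- by move=> i j; rewrite iCz.
by move=> U sU Uk Ux Uy; apply: Cgen => // -[[i j]|[i j]].
Qed.

Variables (K : kalg k) (iK : khom K E).
Hypothesis iK_inj : injective iK.
Hypothesis fK : is_fld K.
Hypothesis KP : forall a, th (iK a) = iT (ktl E H (iK a)).
Hypothesis K_surj : forall a, th a = iT (ktl E H a) -> exists c, iK c = a.
Variables (C : kalg k) (iC : khom C E) (kC : khom K C) (xC yC : 'I_n -> 'I_n -> C).
Hypothesis iC_inj : injective iC.
Hypothesis iCk : kcomp iC kC = iK.
Hypothesis iCx : forall i j, iC (xC i j) = x i j.
Hypothesis iCy : forall i j, iC (yC i j) = y i j.
Hypothesis Cgen : forall U, is_subalg U -> (forall a, U (kC a)) -> (forall i j, U (xC i j)) ->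
          (forall i j, U (yC i j)) -> forall c, U c.

Lemma xyC i j : \sum_l xC i l * yC l j = (i == j)%:R.
Proof.
apply: iC_inj; rewrite rmorph_sum rmorph_nat -xy; apply: eq_bigr => l _.
by rewrite rmorphM iCx iCy.
Qed.

Lemma yxC i j : \sum_l yC i l * xC l j = (i == j)%:R.
Proof.
apply: iC_inj; rewrite rmorph_sum rmorph_nat -yx; apply: eq_bigr => l _.
by rewrite rmorphM iCx iCy.
Qed.

Lemma inverse_unique (R : comPzRingType) (a b z : 'I_n -> 'I_n -> R) :
  (forall i j, \sum_l a i l * z l j = (i == j)%:R) ->
  (forall i j, \sum_l z i l * b l j = (i == j)%:R) -> forall i j, a i j = b i j.
Proof.
move=> az zb i j.
transitivity (\sum_l a i l * \sum_m z l m * b m j).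
  rewrite (bigD1 j) //= zb eqxx mulr1 big1 ?addr0 // => l /negPf lj.
  by rewrite zb lj mulr0.
under eq_bigr do rewrite mulr_sumr.
rewrite exchange_big (bigD1 i) //=.
under eq_bigr do rewrite mulrA.
rewrite -mulr_suml az eqxx mul1r big1 ?addr0 // => m /negPf mi.
under eq_bigr do rewrite mulrA.
by rewrite -mulr_suml az eq_sym mi mul0r.
Qed.

Lemma C_ext R (f f' : khom C R) : kcomp f kC = kcomp f' kC ->
  (forall i j, f (xC i j) = f' (xC i j)) -> f = f'.
Proof.
move=> /khom_comp_eq fk fx; apply: khomP => c.
apply: (Cgen (U := [set c | f c = f' c])) => //=.
- exact: subalg_eq.
- apply: (inverse_unique (z := fun i j => f (xC i j))) => i j.
    by rewrite -(rmorph_nat f) -yxC rmorph_sum; apply: eq_bigr => l _; rewrite rmorphM.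
  under eq_bigr do rewrite fx -rmorphM.
  by rewrite -rmorph_sum xyC rmorph_nat.
Qed.

Lemma hV R (g : G R) i j :
  \sum_l e R (ginv g) (h i l) * e R g (h l j) = (i == j)%:R.
Proof. by rewrite -hM gmulV h1. Qed.

Lemma coaction_exists : exists thC : khom C (kt C H),
  [/\ forall c, iT (kt_map H iC (thC c)) = th (iC c),
      forall a, thC (kC a) = ktl C H (kC a) &
      forall i j, thC (xC i j) = \sum_l ktr C H (h i l) * ktl C H (xC l j)].
Proof.
pose j := kcomp iT (kt_map H iC).
have j_inj : injective j by move=> a b /iT_inj /(kt_map_inj iC_inj).
have jx i m : j (\sum_l ktr C H (h i l) * ktl C H (xC l m)) = th (x i m).
  rewrite thx kcompE; congr (iT _); rewrite rmorph_sum; apply: eq_bigr => l _.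
  by rewrite rmorphM kt_mapr kt_mapl iCx.
have jk a : j (ktl C H (kC a)) = th (iC (kC a)).
  by rewrite (kcomp_at iCk) KP kcompE kt_mapl (kcomp_at iCk).
have [gu guE] := G_pt ie (ktr C H).
(* The entries of x^-1 ρ(u)^-1, the translate of x^-1 by the universal point u; they show that the
   translate of C lies in C ⊗ H. *)
pose yT i m := \sum_l ktl C H (yC i l) * e _ (ginv gu) (h l m).
have jy i m : j (yT i m) = th (y i m).
  apply: (@inverse_unique _ (fun i m => j (yT i m)) (fun i m => th (y i m))
    (fun i m => th (x i m))) => {}i {}m; last first.
    by rewrite -(rmorph_nat th) -xy rmorph_sum; apply: eq_bigr => l _; rewrite rmorphM.
  under eq_bigr do rewrite -jx -rmorphM.
  rewrite -rmorph_sum -(rmorph_nat j); congr (j _).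
  transitivity (\sum_p ktl C H (yC i p) * ktl C H (xC p m)); last first.
    under eq_bigr do rewrite -rmorphM.
    by rewrite -rmorph_sum yxC rmorph_nat.
  under eq_bigr do rewrite mulr_suml.
  rewrite exchange_big; apply: eq_bigr => p _ /=.
  transitivity (ktl C H (yC i p) * \sum_q (\sum_l e _ (ginv gu) (h p l) * e _ gu (h l q)) *
      ktl C H (xC q m)).
    rewrite mulr_sumr; under [RHS]eq_bigr do rewrite mulr_suml mulr_sumr.
    rewrite [RHS]exchange_big; apply: eq_bigr => l _ /=.
    by rewrite mulr_sumr; apply: eq_bigr => q _; rewrite guE; ring.
  congr (_ * _); rewrite (bigD1 p) //= hV eqxx mul1r big1 ?addr0 // => q /negPf qp.
  by rewrite hV eq_sym qp mul0r.
have [|thC thCE] := @factor_inj _ C _ _ j (kcomp th iC) j_inj.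
  apply: (Cgen (U := [set c | exists b, j b = kcomp th iC c])).
  - exact: subalg_lift.
  - by move=> a; exists (ktl C H (kC a)); rewrite jk.
  - by move=> i m; exists (\sum_l ktr C H (h i l) * ktl C H (xC l m)); rewrite jx kcompE iCx.
  - by move=> i m; exists (yT i m); rewrite jy kcompE iCy.
exists thC; split=> [c|a|i m]; first exact: thCE.
  by apply: j_inj; rewrite thCE jk.
by apply: j_inj; rewrite thCE jx kcompE iCx.
Qed.

Variable thC : khom C (kt C H).
Hypothesis thCE : forall c, iT (kt_map H iC (thC c)) = th (iC c).
Hypothesis thCk : forall a, thC (kC a) = ktl C H (kC a).
Hypothesis thCx : forall i j, thC (xC i j) = \sum_l ktr C H (h i l) * ktl C H (xC l j).

(* Artin: [th E] and [E] are linearly disjoint over the invariants [K].  A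
   relation of minimal support, normalized at [i0], is compared with its image
   under the translation of [x] by a second point of [G]. *)
Lemma artin (I : finType) (a : I -> C) (b : I -> E) :
  (forall c : I -> K, \sum_i kC (c i) * a i = 0 -> forall i, c i = 0) ->
  \sum_i th (iC (a i)) * iT (ktl E H (b i)) = 0 -> forall i, b i = 0.
Proof.
move=> ia; pose supp (c : I -> E) := #|[pred i | c i != 0]|.
have [m le_m] := ubnP (supp b); elim: m => // m IH in b le_m *.
move=> rel i1; apply: contrapT => /eqP b1.
have [v bv] := fE.2 _ (elimN eqP b1).
have [b' b'E] : exists b', forall i, b' i = b i * v by exists (fun i => b i * v).
have supp_b' i : (b' i != 0) = (b i != 0).
  apply/idP/idP; first by rewrite b'E; apply: contra => /eqP ->; rewrite mul0r.
  rewrite b'E; move=> /eqP bi; apply/eqP => /(field_domain fE) [//|v0].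
  by apply: fE.1; rewrite -bv v0 mulr0.
have b'1 : b' i1 = 1 by rewrite b'E bv.
pose w i := kt_map H iC (thC (a i)).
have wrel c : \sum_i th (iC (a i)) * iT (ktl E H (c i)) = iT (\sum_i w i * ktl E H (c i)).
  by rewrite rmorph_sum; apply: eq_bigr => i _; rewrite rmorphM thCE.
have rel' : \sum_i w i * ktl E H (b' i) = 0.
  apply: iT_inj; rewrite -wrel rmorph0 -[RHS](mul0r (iT (ktl E H v))) -[in RHS]rel mulr_suml.
  by apply: eq_bigr => i _; rewrite b'E !rmorphM mulrA.
have small c : (forall i, b' i = 0 -> c i = 0) -> c i1 = 0 ->
    \sum_i w i * ktl E H (c i) = 0 -> forall i, c i = 0.
  move=> sc c1 relc; apply: IH; last by rewrite wrel relc rmorph0.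
  rewrite -ltnS; apply: leq_trans le_m; rewrite ltnS /supp.
  apply/proper_card/properP; split.
    apply/fintype.subsetP => i; rewrite !inE -supp_b'; apply: contraNN => /eqP b0.
    by rewrite sc.
  by exists i1; rewrite !inE ?b1 // c1 eqxx.
have [Ls [iLs [ep wE]]] : exists Ls : seq H, indeps Ls /\ exists ep : I -> nat -> E,
    forall i, w i = \sum_(p < size Ls) ktl E H (ep i p) * ktr E H Ls`_p.
  have [J [c [d wE]]] := tens_gen_fam w.
  have [Ls [_ iLs sp]] := indeps_ext (codom d) (@indeps_nil _ H).
  exists Ls; split=> //; have /choice [f fE'] : forall j, exists f, d j = comb Ls f.
    by move=> j; apply: sp; exact: codom_f.
  exists (fun i p => \sum_j c i j * kalg_str E (f j p)) => i; rewrite wE.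
  under eq_bigr do rewrite fE' rmorph_sum mulr_sumr.
  rewrite exchange_big; apply: eq_bigr => p _ /=.
  rewrite rmorph_sum mulr_suml; apply: eq_bigr => j _.
  by rewrite !rmorphM !khom_str mulrA.
pose L2 := kt L H; pose iE := kcomp iT (ktl E H).
(* [gL] is the universal point already present in L and [gH] a second, independent one. [Psi] uses
   translation on E and gH gL^-1 on H; [Phi] uses the inclusion of E and gH. Both send the translate
   of x to ρ(gH) x. *)
have [gL gLE] := G_pt ie (kcomp (ktl L H) (kcomp iT (ktr E H))).
have [gH gHE] := G_pt ie (ktr L H).
have [Psi [Psil Psir]] := kt_lift (kcomp (ktl L H) th) (e _ (gmul gH (ginv gL))).
have [Phi [Phil Phir]] := kt_lift (kcomp (ktl L H) iE) (ktr L H).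
have PsiPhi : kcomp Psi (kcomp (kt_map H iC) thC) = kcomp Phi (kcomp (kt_map H iC) thC).
  apply: C_ext; first by apply: khomP => c; rewrite !kcompE thCk !kt_mapl (kcomp_at Psil) (kcomp_at Phil) !kcompE (kcomp_at iCk) KP.
  move=> i j; rewrite !kcompE thCx !rmorph_sum.
  transitivity (\sum_l e _ (gmul gH (ginv gL)) (h i l) *
     \sum_q e _ gL (h l q) * ktl L H (iE (x q j))).
    apply: eq_bigr => l _; rewrite !rmorphM kt_mapr kt_mapl (kcomp_at Psir) (kcomp_at Psil).
    rewrite iCx kcompE thx !rmorph_sum; congr (_ * _); apply: eq_bigr => q _.
    by rewrite !rmorphM gLE.
  under eq_bigr do rewrite mulr_sumr.
  rewrite exchange_big; apply: eq_bigr => q _ /=.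
  under eq_bigr do rewrite mulrA.
  rewrite -mulr_suml -hM -gmulA gmulV gmulr1 !rmorphM kt_mapr kt_mapl (kcomp_at Phir).
  by rewrite (kcomp_at Phil) gHE iCx.
have PP i : Psi (w i) = Phi (w i) := khom_comp_eq PsiPhi (a i).
(* Applying [Psi] and [Phi] to the relation and subtracting gives a relation for these differences,
   which vanish off the support and at i1, where b' is 1. *)
pose be i := th (b' i) - iE (b' i).
have be0 : \sum_i Phi (w i) * ktl L H (be i) = 0.
  transitivity (Psi (\sum_i w i * ktl E H (b' i)) - Phi (\sum_i w i * ktl E H (b' i))).
    rewrite !rmorph_sum -sumrB; apply: eq_bigr => i _.
    rewrite !rmorphM (kcomp_at Psil) (kcomp_at Phil) PP.
    by rewrite /be rmorphB mulrBr.
  by rewrite rel' !rmorph0 subrr.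
have beE (p : 'I_(size Ls)) : \sum_i iE (ep i p) * be i = 0.
  have := kt_indepr (r := fun q : 'I_(size Ls) => \sum_i iE (ep i q) * be i) (indeps_indep iLs).
  apply.
  rewrite -[RHS]be0; under [RHS]eq_bigr do rewrite wE rmorph_sum mulr_suml.
  rewrite [RHS]exchange_big; apply: eq_bigr => q _ /=.
  rewrite rmorph_sum mulr_suml; apply: eq_bigr => i _.
  by rewrite !rmorphM (kcomp_at Phil) (kcomp_at Phir) /=; ring.
have be_off i : b' i = 0 \/ i = i1 -> be i = 0.
  by rewrite /be; case=> [->|->]; rewrite ?b'1 ?rmorph0 ?rmorph1 subrr.
have bez i : be i = 0.
  (* The [be i] lie in L, not in E. Flatness over E expresses them by solutions in E, and the
     relations indexed by I force these solutions to vanish where [off] holds, so that minimality of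
     the support kills them. *)
  pose off i := (b' i == 0) || (i == i1).
  have [|J [d [s [dE sZ]]]] := @eqflat_simul _ _ _ iE I ('I_(size Ls) + I)%type
    (fun i q => match q with inl p => ep i p | inr i' => ((i == i') && off i)%:R end) be
    (eqflat_field fE).
    case=> [p|i']; first exact: beE.
    rewrite (bigD1 i') //= eqxx /= [X in _ + X]big1 ?addr0 => [|i'' /negPf -> ].
      have [oi|_] := boolP (off i'); last by rewrite !rmorph0 mul0r.
      by rewrite be_off ?mulr0 //; move: oi => /orP[/eqP|/eqP]; [left|right].
    by rewrite !rmorph0 mul0r.
  rewrite dE big1 // => l _; suff -> : s i l = 0 by rewrite !rmorph0 mul0r.
  have soff i' : off i' -> s i' l = 0.
    move=> oi; have := sZ (inr i') l; rewrite (bigD1 i') //= eqxx oi mul1r big1 ?addr0 //.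
    by move=> i'' /negPf ->; rewrite mul0r.
  apply: (small (s^~ l)).
  - by move=> i' /eqP bi; apply: soff; rewrite /off bi.
  - by apply: soff; rewrite /off eqxx orbT.
  under eq_bigr do rewrite wE mulr_suml.
  rewrite exchange_big big1 // => p _ /=.
  transitivity (ktr E H Ls`_p * ktl E H (\sum_i ep i p * s i l)).
    by rewrite rmorph_sum mulr_sumr; apply: eq_bigr => i' _; rewrite rmorphM; ring.
  by rewrite (sZ (inl p) l) rmorph0 mulr0.
have /choice [c cE] i : exists c, iK c = b' i.
  by apply: K_surj; apply: subr0_eq; exact: bez.
have c0 : \sum_i kC (c i) * a i = 0.
  apply: iC_inj; rewrite rmorph0.
  have thinj : injective th.
    apply: fld_inj fE _ => L1; apply: fE.1.
    have : ktl E H 1 = 0 by apply: iT_inj; rewrite rmorph0 !rmorph1.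
    rewrite rmorph1 => z; have [eu euE] := G_pt ie (kcomp (kinit E) (e (kbase k) (gone G _))).
    have [q [ql _]] := kt_lift (kid E) (kcomp (kinit E) (e (kbase k) (gone G _))).
    by rewrite -(rmorph1 q) z rmorph0.
  apply: thinj; rewrite rmorph0 -[RHS](rmorph0 iT) -[in RHS]rel' -wrel rmorph_sum rmorph_sum.
  apply: eq_bigr => i _; rewrite !rmorphM (kcomp_at iCk) KP cE mulrC.
  by [].
have := ia c c0 i1 => /(congr1 iK); rewrite cE b'1 rmorph0; exact: fE.1.
Qed.

(** The same elimination is to be made for two pairs of maps at once, which is why f and g are
    arbitrary maps agreeing on K. *)
Lemma eliminate_term R (f g : khom C R) N (r : 'I_N.+1) (a b : 'I_N.+1 -> C)
    (c : 'I_N.+1 -> K) (v : K) :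
  kcomp f kC = kcomp g kC -> c r * v = 1 -> \sum_i kC (c i) * a i = 0 ->
  \sum_i f (a i) * g (b i) =
  \sum_j f (a (lift r j)) * g (b (lift r j) - kC (v * c (lift r j)) * b r).
Proof.
move=> fg cv rel; rewrite (bigD1_ord r) //=.
have ar : a r = - \sum_j kC (v * c (lift r j)) * a (lift r j).
  apply/eqP; rewrite -addr_eq0 -[a r]mul1r -(rmorph1 kC) -cv [c r * v]mulrC.
  apply/eqP; transitivity (kC v * \sum_i kC (c i) * a i); last by rewrite rel mulr0.
  rewrite (bigD1_ord r) //= mulrDr rmorphM -mulrA mulr_sumr; congr (_ + _).
  by apply: eq_bigr => j _; rewrite rmorphM mulrA.
rewrite [in f (a r)]ar rmorphN mulNr rmorph_sum mulr_suml -sumrN -big_split.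
apply: eq_bigr => j _ /=.
by rewrite rmorphB !rmorphM -!(khom_comp_eq fg); ring.
Qed.

(** Amounts to the injectivity of C ⊗ C → L, the tensor product being over K, without forming it.
    Independent a_i are settled by [artin]; otherwise a relation over K removes a term from both
    sums. *)
Lemma disjoint_eval R (z1 z2 : khom C R) N (a b : 'I_N -> C) :
  kcomp z1 kC = kcomp z2 kC ->
  \sum_i th (iC (a i)) * iT (ktl E H (iC (b i))) = 0 -> \sum_i z2 (a i) * z1 (b i) = 0.
Proof.
move=> z12; elim: N a b => [|N IH] a b rel; first by rewrite big_ord0.
case: (pselect (forall c : 'I_N.+1 -> K, \sum_i kC (c i) * a i = 0 -> forall i, c i = 0)).
  move/artin => /(_ _ rel) b0; rewrite big1 // => i _.
  have -> : b i = 0 by apply: iC_inj; rewrite b0 rmorph0.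
  by rewrite rmorph0 mulr0.
move/existsNP => [c /not_implyP [crel /existsNP [r cr]]].
have [v cv] := fK.2 _ cr.
rewrite (eliminate_term b (esym z12) cv crel); apply: IH.
have agree : kcomp (kcomp th iC) kC = kcomp (kcomp iT (kcomp (ktl E H) iC)) kC.
  by apply: khomP => d; rewrite !kcompE (kcomp_at iCk) KP.
by rewrite -(eliminate_term (f := kcomp th iC) b agree cv crel).
Qed.

Definition gen_act R (g : G R) (z : khom C R) : khom C R :=
  kcomp (kt_pair z (e R g)) thC.

Lemma gen_act_k R (g : G R) (z : khom C R) : kcomp (gen_act g z) kC = kcomp z kC.
Proof. by apply: khomP => a; rewrite !kcompE thCk kt_pairl. Qed.

Lemma gen_act_x R (g : G R) (z : khom C R) i j :
  gen_act g z (xC i j) = \sum_l e R g (h i l) * z (xC l j).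
Proof.
rewrite kcompE thCx rmorph_sum; apply: eq_bigr => l _.
by rewrite rmorphM kt_pairr kt_pairl.
Qed.

Lemma gen_act1 R (z : khom C R) : gen_act (gone G R) z = z.
Proof.
apply: C_ext; first exact: gen_act_k.
move=> i j; rewrite gen_act_x (bigD1 i) //= h1 eqxx mul1r big1 ?addr0 //.
by move=> l /negPf li; rewrite h1 eq_sym li mul0r.
Qed.

Lemma gen_actM R (g g' : G R) (z : khom C R) :
  gen_act (gmul g g') z = gen_act g (gen_act g' z).
Proof.
apply: C_ext; first by rewrite !gen_act_k.
move=> i j; rewrite !gen_act_x.
under eq_bigr do rewrite hM mulr_suml.
rewrite exchange_big; apply: eq_bigr => l _.
by rewrite gen_act_x mulr_sumr; apply: eq_bigr => m _; rewrite mulrA.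
Qed.

Lemma gen_act_nat R R' (f : khom R R') (g : G R) (z : khom C R) :
  gen_act (fmap f g) (kcomp f z) = kcomp f (gen_act g z).
Proof.
apply: C_ext; first by rewrite [LHS]gen_act_k -(kcompA f z) -(kcompA f (gen_act g z)) gen_act_k.
move=> i j; rewrite gen_act_x (kcompE f (gen_act g z)) gen_act_x rmorph_sum; apply: eq_bigr => l _.
by rewrite rmorphM ev_nat.
Qed.

(** The matrix ρ(g) is recovered as the translated matrix times the inverse of the matrix of z, and
    its entries determine g. *)
Lemma gen_act_free R (g g' : G R) (z : khom C R) :
  (forall U, is_subalg U -> (forall i j, U (h i j)) -> forall y, U y) ->
  gen_act g z = gen_act g' z -> g = g'.
Proof.
move=> hgen E0; apply: (G_eq ie) => t.
apply: (hgen [set t | e R g t = e R g' t]) => [|i j] /=.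
  exact: subalg_eq.
have key g0 : e R g0 (h i j) = \sum_m gen_act g0 z (xC i m) * z (yC m j).
  under eq_bigr do rewrite gen_act_x mulr_suml.
  rewrite exchange_big (bigD1 j) //=.
  under eq_bigr do rewrite -mulrA -rmorphM.
  rewrite -mulr_sumr -rmorph_sum xyC eqxx rmorph1 mulr1 big1 ?addr0 // => l /negPf lj.
  under eq_bigr do rewrite -mulrA -rmorphM.
  by rewrite -mulr_sumr -rmorph_sum xyC lj rmorph0 mulr0.
by rewrite !key E0.
Qed.

(** The candidate for ρ(g) is m = z2(x) z1(x)^-1; it gives a point of G once it satisfies every
    polynomial relation F among the h_ij. For the pair formed by translation and inclusion this
    matrix is ρ of the universal point, where F holds; [disjoint_eval] carries the equation over to
    z2 and z1. *)
Lemma gen_act_trans R (z1 z2 : khom C R) :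
  (forall U, is_subalg U -> (forall i j, U (h i j)) -> forall y, U y) ->
  kcomp z1 kC = kcomp z2 kC -> exists g, z2 = gen_act g z1.
Proof.
move=> hgen z12; pose V := ('I_n * 'I_n)%type.
pose m (p : V) := \sum_l z2 (xC p.1 l) * z1 (yC l p.2).
pose ev := pol_ev (kinit H) (fun p : V => h p.1 p.2).
have sur t : exists F, ev F = t.
  apply: (hgen [set t | exists F, ev F = t]) => [|i j].
    exact: subalg_range.
  by exists (pol_var _ (i, j)); rewrite /ev pol_ev_var.
have ker F : ev F = 0 -> pol_ev (kinit R) m F = 0.
  move=> F0; pose cc (p : V) := \sum_l ktl C C (xC p.1 l) * ktr C C (yC l p.2).
  pose u := pol_ev (kinit (kt C C)) cc F.
  have val S (f g : khom C S) c : (forall p, c p = \sum_l f (xC p.1 l) * g (yC l p.2)) ->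
      kt_pair f g u = pol_ev (kinit S) c F.
    move=> cE; rewrite pol_ev_comp; apply: pol_ev_eq; first exact: kinit_comp.
    move=> p; rewrite cE rmorph_sum; apply: eq_bigr => l _.
    by rewrite rmorphM kt_pairl kt_pairr.
  rewrite -(val _ z2 z1) //.
  have : kt_pair (kcomp th iC) (kcomp iT (kcomp (ktl E H) iC)) u = 0.
    rewrite (val _ _ _ (fun p => iT (ktr E H (h p.1 p.2)))).
      have -> : pol_ev (kinit L) (fun p : V => iT (ktr E H (h p.1 p.2))) F = iT (ktr E H (ev F)).
        rewrite /ev !pol_ev_comp; apply: pol_ev_eq => //.
        by rewrite !kinit_comp.
      by rewrite F0 !rmorph0.
    case=> i j /=; under eq_bigr do rewrite iCx thx iCy -rmorphM mulr_suml.
    rewrite -rmorph_sum exchange_big (bigD1 j) //=.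
    under eq_bigr do rewrite -mulrA -rmorphM.
    rewrite -mulr_sumr -rmorph_sum xy eqxx rmorph1 mulr1 big1 ?addr0 // => l /negPf lj.
    under eq_bigr do rewrite -mulrA -rmorphM.
    by rewrite -mulr_sumr -rmorph_sum xy lj rmorph0 mulr0.
  have [N [a [b ->]]] := kt_gen u; rewrite !rmorph_sum => rel.
  rewrite -[RHS](@disjoint_eval _ _ _ N a b z12).
    by apply: eq_bigr => i _; rewrite rmorphM kt_pairl kt_pairr.
  by rewrite -[RHS]rel; apply: eq_bigr => i _; rewrite rmorphM kt_pairl kt_pairr.
have [r rE] := factor_surj sur ker.
have [g gE] := G_pt ie r; exists g; apply: C_ext; first by rewrite gen_act_k z12.
move=> i j; rewrite gen_act_x.
have hE l : e R g (h i l) = m (i, l).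
  by rewrite gE -[RHS](pol_ev_var (kinit R) m) -rE /ev pol_ev_var.
under eq_bigr do rewrite hE /m /= mulr_suml.
rewrite exchange_big (bigD1 j) //=.
under eq_bigr do rewrite -mulrA -rmorphM.
rewrite -mulr_sumr -rmorph_sum yxC eqxx rmorph1 mulr1 big1 ?addr0 // => l /negPf lj.
under eq_bigr do rewrite -mulrA -rmorphM.
by rewrite -mulr_sumr -rmorph_sum yxC lj rmorph0 mulr0.
Qed.

End GenericObjects.

(** * Hilbert's basis theorem and finite presentation *)

Section Hilbert.
Variable k : fieldType.
Implicit Types A B C R K : kalg k.

Definition noeth A : Prop := forall I : set A, is_ideal I ->
  exists s : seq A, (forall x, x \in s -> I x) /\ I `<=` ideal_gen [set` s].

Lemma noeth_field K : is_fld K -> noeth K.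
Proof.
move=> fK I hI; case: (pselect (exists2 x, I x & x <> 0)) => [[x Ix /fK.2 [v xv]]|no].
  exists [:: x]; split=> [y|y _]; first by rewrite inE => /eqP ->.
  rewrite -[y]mul1r -xv -mulrA; apply: (idealMr (ideal_gen_ideal _)).
  by apply: ideal_gen_sub; rewrite /= inE.
exists [::]; split=> // x Ix; suff -> : x = 0 by exact: (ideal0 (ideal_gen_ideal _)).
by apply: contrapT => x0; apply: no; exists x.
Qed.

(* Hilbert's basis theorem; [Ld d] below is the ideal of coefficients of degree [d]. *)
Lemma noeth_step A B (phi : khom A B) (b : B) : noeth A ->
  (forall U, is_subalg U -> (forall a, U (phi a)) -> U b -> forall x, U x) -> noeth B.
Proof.
move=> nA gen I hI.
(* Expressions of degree less than d in b. Since b may satisfy relations, degree is a bound on some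
   expression of x rather than an invariant of x. *)
pose D d := [set x : B | exists a : 'I_d -> A, x = \sum_i phi (a i) * b ^+ i].
have D0 d : D d 0 by exists (fun=> 0); rewrite big1 // => i _; rewrite rmorph0 mul0r.
have DD d x y : D d x -> D d y -> D d (x + y).
  move=> [a ->] [a' ->]; exists (fun i => a i + a' i); rewrite -big_split.
  by apply: eq_bigr => i _; rewrite rmorphD mulrDl.
have DZ d c x : D d x -> D d (phi c * x).
  move=> [a ->]; exists (fun i => c * a i); rewrite mulr_sumr.
  by apply: eq_bigr => i _; rewrite rmorphM mulrA.
have DN d x : D d x -> D d (- x) by rewrite -mulN1r -(rmorph1 phi) -rmorphN; exact: DZ.
have DS d x c : D d x -> D d.+1 (x + phi c * b ^+ d).
  move=> [a ->]; exists (fun i => if unlift ord_max i is Some j then a j else c).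
  rewrite big_ord_recr /= unlift_none; congr (_ + _); apply: eq_bigr => i _.
  by rewrite (_ : widen_ord _ i = lift ord_max i) ?liftK //; apply: val_inj; rewrite /= /bump leqNgt ltn_ord.
have Db d x : D d x -> D d.+1 (b * x).
  move=> [a ->]; exists (fun i => if unlift ord0 i is Some j then a j else 0).
  rewrite big_ord_recl unlift_none rmorph0 mul0r add0r mulr_sumr.
  by apply: eq_bigr => i _; rewrite liftK /= exprS mulrCA.
have Dinv d x : D d.+1 x -> exists a, D d (x - phi a * b ^+ d).
  move=> [a ->]; exists (a ord_max); rewrite big_ord_recr /= addrK.
  by exists (fun i => a (widen_ord (leqnSn d) i)).
have Dmul d e x : D d x -> D (e + d)%N (b ^+ e * x).
  elim: e x => [|e IH] x Dx; first by rewrite expr0 mul1r.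
  by rewrite exprS -mulrA addSn; apply: Db; exact: IH.
have Dle d e x : (d <= e)%N -> D d x -> D e x.
  move=> /subnK <-; elim: (e - d)%N => [//|m IH] /IH Dx.
  by rewrite addSn -[x]addr0 -(mul0r (b ^+ (m + d))) -(rmorph0 phi); exact: DS.
have Dall x : exists d, D d x.
  apply: (gen [set x | exists d, D d x]) => [|a|].
  - split=> [c|u v [d Du] [e Dv]|u [d Du]|u v [d Du] [e Dv]].
    + exists 1%N; exists (fun=> kalg_str A c); rewrite big_ord_recl big_ord0 addr0 mulr1.
      by rewrite khom_str.
    + exists (d + e)%N; apply: DD; first exact: Dle (leq_addr _ _) Du.
      exact: Dle (leq_addl _ _) Dv.
    + by exists d; exact: DN.
    + exists (d + e)%N; case: Du => a ->; rewrite mulr_suml.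
      apply: (big_ind (D (d + e)%N)) => // [|i _]; first exact: DD.
      rewrite -mulrA; apply: DZ; apply: (@Dle (i + e)%N); last exact: Dmul.
      by rewrite leq_add2r ltnW.
  - by exists 1%N; exists (fun=> a); rewrite big_ord_recl big_ord0 addr0 mulr1.
  - exists 2%N; exists (fun i : 'I_2 => if i == ord0 then 0 else 1).
    by rewrite !big_ord_recl big_ord0 /= rmorph0 rmorph1 mul0r add0r mul1r addr0 expr1.
pose Ld d := [set a : A | exists2 x, I x & D d (x - phi a * b ^+ d)].
have hLd (J : set B) d : is_ideal J -> is_ideal [set a : A | exists2 x, J x & D d (x - phi a * b ^+ d)].
  move=> hJ; split.
  - by exists 0; [exact: ideal0 | rewrite rmorph0 mul0r subr0].
  - move=> u v [x Jx Dx] [y Jy Dy]; exists (x + y); first exact: idealD.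
    by rewrite rmorphD mulrDl opprD addrACA; exact: DD.
  - move=> c u [x Jx Dx]; exists (phi c * x); first exact: idealM.
    by rewrite rmorphM -mulrA -mulrBr; exact: DZ.
have Lmono d e a : (d <= e)%N -> Ld d a -> Ld e a.
  move=> /subnK <- [x Ix Dx]; exists (b ^+ (e - d) * x); first exact: idealM.
  by rewrite exprD mulrCA -mulrBr; exact: Dmul.
pose LL := [set a | exists d, Ld d a].
have hLL : is_ideal LL.
  split.
  - by exists 0%N; exact: ideal0 (hLd I 0%N hI).
  - move=> u v [d Lu] [e Lv]; exists (d + e)%N; apply: (idealD (hLd I _ hI)).
      exact: Lmono (leq_addr _ _) Lu.
    exact: Lmono (leq_addl _ _) Lv.
  - by move=> c u [d Lu]; exists d; apply: (idealM (hLd I _ hI)).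
have [s [sLL LLs]] := nA _ hLL.
have [N sN] : exists N, forall a, a \in s -> Ld N a.
  elim: s sLL {LLs} => [_|a s IH sLL]; first by exists 0%N.
  have [|N sN] := IH _; first by move=> c cs; apply: sLL; rewrite inE cs orbT.
  have [d Ld_a] := sLL a (mem_head _ _).
  exists (N + d)%N => c; rewrite inE => /orP[/eqP ->|/sN Lc].
    exact: Lmono (leq_addl _ _) Ld_a.
  exact: Lmono (leq_addr _ _) Lc.
have Ltop d a : Ld d a -> Ld (minn d N) a.
  have [//|Nd] := leqP d N; rewrite ?(minn_idPl _) // => La.
  by apply: (LLs a _ _ (hLd I N hI)); [exists d | exact: sN].
have /choice [sL sLP] d : exists t : seq A, (forall a, a \in t -> Ld d a) /\
    Ld d `<=` ideal_gen [set` t] by exact: nA _ (hLd I d hI).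
have wit d a : exists x, Ld d a -> I x /\ D d (x - phi a * b ^+ d).
  case: (pselect (Ld d a)) => [[x Ix Dx]|no]; first by exists x.
  by exists 0.
pose w d a := projT1 (cid (wit d a)).
have wP d a : Ld d a -> I (w d a) /\ D d (w d a - phi a * b ^+ d).
  by rewrite /w; case: cid.
pose X := flatten [seq [seq w d a | a <- sL d] | d <- iota 0 N.+1].
exists X; split=> [x /flattenP [t /mapP [d _ ->] /mapP [a ad ->]]|x Ix].
  by have [] := wP d a ((sLP d).1 a ad).
have [d Dx] := Dall x; pose J := ideal_gen [set` X].
have hJ : is_ideal J := ideal_gen_ideal _.
elim: d x Ix Dx => [|d IH] x Ix Dx.
  by case: Dx => a ->; rewrite big_ord0; exact: ideal0.
have [a Da] := Dinv _ _ Dx.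
have /Ltop La : Ld d a by exists x.
have dN : (minn d N < N.+1)%N by rewrite ltnS geq_minr.
have ded : (minn d N <= d)%N by exact: geq_minl.
move: (minn d N) La dN ded => e La eN ed.
have [y Jy Dy] : exists2 y, J y & D e (y - phi a * b ^+ e).
  apply: ((sLP e).2 a La _ (hLd J e hJ)) => c ce; exists (w e c).
    apply: ideal_gen_sub; apply/flattenP; exists [seq w e a | a <- sL e].
      by apply: (map_f (fun d => [seq w d a | a <- sL d])); rewrite mem_iota.
    by apply/mapP; exists c.
  by have [] := wP e c ((sLP e).1 c ce).
have Dy' : D d (b ^+ (d - e) * y - phi a * b ^+ d).
  have := Dmul _ (d - e)%N _ Dy; rewrite mulrBr [_ * (phi a * _)]mulrCA -exprD.
  by rewrite subnK.
have JI : J `<=` I.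
  move=> z /(_ I hI); apply => z' /flattenP [t /mapP [d' _ ->] /mapP [a' ad ->]].
  by have [] := wP d' a' ((sLP d').1 a' ad).
rewrite -[x](subrK (b ^+ (d - e) * y)); apply: (idealD hJ); last exact: (idealM hJ).
apply: IH; first by apply: (idealB hI) => //; apply: (idealM hI); exact: JI.
rewrite (_ : _ - _ = (x - phi a * b ^+ d) - (b ^+ (d - e) * y - phi a * b ^+ d)); last by ring.
by apply: DD => //; exact: DN.
Qed.

Lemma generated_noeth A B (phi : khom A B) n (x : 'I_n -> B) :
  noeth A -> generated phi x -> noeth B.
Proof.
move=> nA; elim: n B phi x => [|n IH] B phi x gx.
  apply: (noeth_step (b := 0) nA) => U sU Up _; apply: gx => //; by case.
have [B0 [i [phi0 [x0 [_ ip ix gx0]]]]] := generated_subalgebra phi (x \o lift ord0).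
apply: (noeth_step (phi := i) (b := x ord0) (IH _ _ _ gx0)) => U sU Ui Ux.
apply: gx => // [a|j]; first by rewrite -ip kcompE.
case: (unliftP ord0 j) => [j' ->|-> //].
by rewrite -[x _](ix j'); exact: Ui.
Qed.

(** Finite generation suffices over a field, by the basis theorem applied to the kernel; fppf covers
    require the presentation. *)
Lemma finite_presentation_field K C (kC : khom K C) (J : finType) (x : J -> C) :
  is_fld K -> generated kC x -> finite_presentation_hom kC.
Proof.
move=> fK gx; pose m := #|J|.
exists (pol K 'I_m), (pol_const K 'I_m), m, (@pol_var k K 'I_m).
exists (pol_ev kC (fun i => x (enum_val i))); split.
- exact: pol_polynomial.
- exact: pol_ev_const.
- apply: (gx [set b | exists a, pol_ev kC (fun i => x (enum_val i)) a = b]) => [|a|j].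
  + exact: subalg_range.
  + by exists (pol_const K 'I_m a); rewrite (kcomp_at (pol_ev_const _ _)).
  + by exists (pol_var K (enum_rank j)); rewrite pol_ev_var enum_rankK.
have gP : generated (pol_const K 'I_m) (@pol_var k K 'I_m).
  move=> U sU Uc Uv; apply: pol_ind => //.
  - by move=> u v; exact: subalgD.
  - by move=> u v; exact: subalgM.
  - by move=> u; exact: subalgN.
have [|s [sI Is]] := generated_noeth (noeth_field fK) gP
  (I := [set a | pol_ev kC (fun i => x (enum_val i)) a = 0]).
  split=> [|u v /= u0 v0|a u /= u0]; first exact: rmorph0.
    by rewrite rmorphD u0 v0 addr0.
  by rewrite rmorphM u0 mulr0.
exists (size s), (fun i => tnth (in_tuple s) i); apply/seteqP; split=> F.
  move/Is; apply; first exact: ideal_gen_ideal.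
  move=> G Gs; apply: ideal_gen_sub.
  have Gi : (index G s < size s)%N by rewrite index_mem.
  by exists (Ordinal Gi) => //; rewrite (tnth_nth 0) /= nth_index.
apply => [|_ [i _ <-]]; last by apply: sI; exact: mem_tnth.
split=> [|u v /= u0 v0|a u /= u0]; first exact: rmorph0.
  by rewrite rmorphD u0 v0 addr0.
by rewrite rmorphM u0 mulr0.
Qed.

End Hilbert.

(** * The torsor of a free and transitive action on an affine scheme *)

Section AffineTorsor.
Variable k : fieldType.
Implicit Types R : kalg k.
Variables (G : kgroup k) (K C : kalg k) (kC : khom K C).
Variable a : forall R, G R -> khom C R -> khom C R.
Hypothesis a_k : forall R (g : G R) z, kcomp (a g z) kC = kcomp z kC.
Hypothesis a1 : forall R (z : khom C R), a (gone G R) z = z.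
Hypothesis aM : forall R (g g' : G R) z, a (gmul g g') z = a g (a g' z).
Hypothesis a_nat : forall R R' (f : khom R R') (g : G R) z,
  a (fmap f g) (kcomp f z) = kcomp f (a g z).
Hypothesis a_free : forall R (g g' : G R) z, a g z = a g' z -> g = g'.
Hypothesis a_trans : forall R (z1 z2 : khom C R),
  kcomp z1 kC = kcomp z2 kC -> exists g, z2 = a g z1.
Hypothesis fK : is_fld K.
Hypothesis nzC : (1 : C) <> 0.
Hypothesis fpC : finite_presentation_hom kC.

Definition aff_proj : kmor (Spec C) (Spec K) :=
  @KMor k (Spec C) (Spec K) (fun R z => kcomp z kC)
    (fun R R' f z => esym (kcompA f z kC)).

Definition aff_act : kmor (prodF G (Spec C)) (Spec C) :=
  @KMor k (prodF G (Spec C)) (Spec C) (fun R p => a p.1 p.2)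
    (fun R R' f p => a_nat f p.1 p.2).

Definition aff_gspace : gspace G (Spec K) :=
  @GSpace k G (Spec K) (Spec C) aff_proj aff_act a1 aM a_k.

(** The torsor trivializes itself: the cover is Spec C → Spec K, over which transitivity and
    freeness give the isomorphism. It is flat because K is a field, and surjective because C is
    nonzero and field extensions of K have common extensions. *)
Lemma aff_torsor : is_torsor aff_gspace.
Proof.
split; first exact: Spec_scheme.
  apply: is_iso_bij => R.
    move=> [[z1 z2] /= E]; have [g z2E] := a_trans E.
    by exists (g, z1); apply: sig_ext => /=; rewrite -z2E.
  move=> [g z] [g' z'] /(congr1 sval) /= [zz E]; subst z'.
  by rewrite (a_free E).
have loc (P : forall A B : kalg k, khom A B -> Prop) : P K C kC -> locally_hom P aff_proj.
  move=> PC F iF x; exists K, C, kC, (idmor (Spec C)), (idmor (Spec K)); split=> //.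
  - exact: idmor_open.
  - exact: idmor_open.
  - by exists x.
exists (Spec C), aff_proj; split; first exact: Spec_scheme.
  split; [apply: loc; exact: field_flat | | exact: loc].
  move=> F iF y; have [L [l fL]] := nz_point nzC.
  have [E [g [g' [fE E0]]]] := common_ext (kcomp l kC) y fK fL (fieldType_fld iF).
  have [E' [iE EE]] := fld_kalg fE; subst E.
  by exists E', iE, g', (kcomp g l); rewrite /= -kcompA.
have tr R (p : fibre_product (proj aff_gspace) aff_proj R) :
    exists g, (sval p).1 = a g (sval p).2.
  by apply: a_trans; exact: (esym (svalP p)).
pose f R (p : tot (base_change aff_proj aff_gspace) R) :
    tot (trivial_gspace G (Spec C)) R := (projT1 (cid (tr R p)), (sval p).2).
have fE R p : (sval p).1 = a (f R p).1 (sval p).2 by rewrite /f /=; case: cid.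
have f_nat R R' (q : khom R R') p :
    f R' (fmap q p) = fmap q (f R p).
  have fg : (f R' (fmap q p)).1 = fmap q (f R p).1.
    apply: (@a_free _ _ _ (kcomp q (sval p).2)).
    exact: etrans (esym (fE R' (fmap q p)))
      (etrans (congr1 (kcomp q) (fE R p)) (esym (a_nat q _ _))).
  by rewrite [LHS]surjective_pairing fg.
exists (@KMor k _ _ f f_nat); split=> [|R g p|//].
  apply: is_iso_bij => R.
    move=> [g x]; have E : proj aff_gspace R (a g x) = aff_proj R x by exact: a_k.
    exists (exist _ (a g x, x) E); congr pair.
    by apply: (@a_free _ _ _ x); have := fE R (exist _ (a g x, x) E); rewrite /= => <-.
  move=> p p' E0; have E : f R p = f R p' := E0; apply: sig_ext.
  have E2 : (sval p).2 = (sval p').2 := congr1 snd E.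
  by rewrite [sval p]surjective_pairing [sval p']surjective_pairing !fE E E2.
congr pair; apply: (@a_free _ _ _ (sval p).2).
by rewrite -[LHS](fE R (gact (base_change aff_proj aff_gspace) R (g, p))) aM -fE.
Qed.

(** f0 is the image of the universal point of Spec C; by Yoneda, equivariance of f becomes an
    equation at each point z. *)
Lemma versal_point Y (V : gspace G Y) (y : kmor (Spec K) Y) (f : kmor (Spec C) (tot V)) :
  equivariant (T := aff_gspace) f ->
  (forall R z, proj V R (f R z) = y R (aff_proj R z)) ->
  exists f0 : tot V C, proj V C f0 = fmap kC (y K (kid K)) /\
    forall R (g : G R) (z : khom C R), fmap (a g z) f0 = act g (fmap z f0).
Proof.
move=> eqf pf; exists (f C (kid C)); split.
  by rewrite pf -(yoneda y) /= kidcomp.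
by move=> R g z; rewrite -!(yoneda f) -[RHS](eqf R g z).
Qed.

End AffineTorsor.

Lemma weak_versal_field (k : fieldType) (hk : infinite_set [set: k]) (G : kgroup k)
    (Y : kfunctor k) (V : gspace G Y) (K : kalg k) :
  weakly_1_versal V -> is_fld K -> all_torsors_pulled_back V K.
Proof.
move=> hV fK; have iK : infinite_set [set: K].
  move=> fin; apply: hk; rewrite -(preimage_setT (kalg_str K)).
  apply: finite_preimage fin => x y _ _; exact: (fld_inj (f := kinit K) (kbase_fld k) fK.1).
have [F [iF KE]] := fld_kalg fK.
by rewrite KE; apply: hV => fin; apply: iK; rewrite KE.
Qed.

(** * Invariant matrices on a torsor *)

Section InvariantMatrices.
Variable k : fieldType.
Implicit Types R : kalg k.
Variables (G : kgroup k) (H : kalg k) (e : kmor G (Spec H)).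
Variables (n : nat) (h : 'I_n -> 'I_n -> H).
Hypothesis hM : forall R (g g' : G R) i j,
  e R (gmul g g') (h i j) = \sum_l e R g (h i l) * e R g' (h l j).
Hypothesis h1 : forall R i j, e R (gone G R) (h i j) = (i == j)%:R.
Variables (S B : kalg k) (phi : khom S B) (T : gspace G (Spec S)) (t : tot T B).
Hypothesis fl : eqflat phi.
Hypothesis iT : is_iso (shear T).
Hypothesis tE : proj T B t = phi.

(** The compatibility with the descent datum obtained by twisting the trivial module along T by the
    representation h; such vectors are the sections that descend to S. *)
Definition inv_vector (v : 'I_n -> B) : Prop :=
  forall R (f1 f2 : khom B R) (g : G R), kcomp f1 phi = kcomp f2 phi ->
    fmap f1 t = act g (fmap f2 t) ->
    forall i, f1 (v i) = \sum_j e R g (h i j) * f2 (v j).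

Lemma torsor_pair R (f1 f2 : khom B R) : kcomp f1 phi = kcomp f2 phi ->
  exists g, fmap f1 t = act g (fmap f2 t).
Proof. by move=> E; apply: torsor_trans => //; rewrite !kmor_nat tE. Qed.

(* Descent along [phi] of the twist of the trivial module by [t]. *)
Lemma inv_vectors_generate (J : finType) (b : J -> 'I_n -> B) :
  exists (Q : finType) (v : Q -> J -> 'I_n -> B) (d : Q -> B),
    (forall l r, inv_vector (v l r)) /\ forall r i, b r i = \sum_l v l r i * d l.
Proof.
pose W := tens_kalg phi fl.
have [p1 p1E] : exists p1 : khom B W, p1 = tensl phi fl by exists (tensl phi fl).
have [p2 p2E] : exists p2 : khom B W, p2 = tensr phi fl by exists (tensr phi fl).
have p12 : kcomp p1 phi = kcomp p2 phi by rewrite p1E p2E; exact: tens_comm.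
have lift R (f1 f2 : khom B R) : kcomp f1 phi = kcomp f2 phi ->
    exists f : khom W R, kcomp f p1 = f1 /\ kcomp f p2 = f2.
  by move=> E; rewrite p1E p2E; exact: tens_lift.
have [gu guE] := torsor_pair p12.
have univ R (f : khom W R) (g : G R) :
    fmap (kcomp f p1) t = act g (fmap (kcomp f p2) t) -> g = fmap f gu.
  move=> E; apply: (@torsor_free k G _ T R _ _ (fmap (kcomp f p2) t) iT).
  by rewrite -E -fmapK guE act_nat fmapK.
(* The twisted descent datum applied to the vectors 1 ⊗ b_r; the left factors c of an expansion over
   common d are the first candidates for invariant vectors. *)
pose w (ir : 'I_n * J) := \sum_j e W gu (h ir.1 j) * p2 (b ir.2 j).
have [J' [c [d wE]]] := tens_gen_fam w.
have {}wE ir : w ir = \sum_j p1 (c ir j) * p2 (d j) by rewrite p1E p2E.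
pose psi := kcomp p1 phi.
have [q3 q3E] : exists q3 : khom W (tens_kalg psi fl), q3 = tensl psi fl by exists (tensl psi fl).
have [r3 r3E] : exists r3 : khom B (tens_kalg psi fl), r3 = tensr psi fl by exists (tensr psi fl).
have qr : kcomp q3 psi = kcomp r3 phi by rewrite q3E r3E; exact: tens_comm.
pose rel (j : J') (ir : 'I_n * J) := p1 (c ir j) - \sum_l e W gu (h ir.1 l) * p2 (c (l, ir.2) j).
(* The cocycle condition: over B ⊗ B ⊗ B the vector w transforms by the datum, so the failure [rel]
   of the c_j to be invariant vanishes when contracted with the d_j. *)
have rel0 ir : \sum_j q3 (rel j ir) * r3 (d j) = 0.
  case: ir => i r.
  have E1 : kcomp (kcomp q3 p1) phi = kcomp r3 phi by rewrite -kcompA qr.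
  have E2 : kcomp (kcomp q3 p2) phi = kcomp r3 phi by rewrite -kcompA -p12 qr.
  have [f [f1 f2]] := lift _ _ _ E1; have [f' [f'1 f'2]] := lift _ _ _ E2.
  have cocycle : fmap f gu = gmul (fmap q3 gu) (fmap f' gu).
    apply/esym/univ; rewrite f1 f2 actM -f'2 -fmapK guE act_nat; congr (act _ _).
    by rewrite fmapK -f'1 -!fmapK guE act_nat.
  have key x : (forall m, f (w (m, r)) = \sum_l e _ (fmap q3 gu) (h m l) * f' (w (l, r))) ->
     x = i -> \sum_j q3 (rel j (x, r)) * r3 (d j) = 0.
    move=> /(_ i) K ->; move: K; rewrite !wE !rmorph_sum.
    under eq_bigr do rewrite rmorphM (kcomp_at f1) (kcomp_at f2).
    under [RHS]eq_bigr do rewrite wE rmorph_sum mulr_sumr.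
    rewrite [RHS]exchange_big /= => K.
    rewrite /rel /=; under eq_bigr do rewrite rmorphB mulrBl.
    rewrite sumrB; apply/eqP; rewrite subr_eq0; apply/eqP.
    rewrite -[LHS]/(\sum_j kcomp q3 p1 (c (i, r) j) * r3 (d j)) K.
    apply: eq_bigr => j _; rewrite rmorph_sum mulr_suml; apply: eq_bigr => l _.
    by rewrite !rmorphM (kcomp_at f'1) (kcomp_at f'2) ev_nat -mulrA.
  have wK m : w (m, r) = \sum_j e W gu (h m j) * p2 (b r j) by [].
  apply: (key i) => // m; rewrite wK rmorph_sum.
  under eq_bigr do rewrite rmorphM -ev_nat cocycle hM (kcomp_at f2) mulr_suml.
  rewrite exchange_big; apply: eq_bigr => l _ /=.
  rewrite rmorph_sum mulr_sumr; apply: eq_bigr => j _.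
  by rewrite rmorphM -ev_nat (kcomp_at f'2) mulrA.
(* The certificates of this vanishing are coefficients in S, and the corresponding combinations of
   the c_j are exactly invariant. *)
have [|Q [d' [s [dE sZ]]]] := @tens_zero_simul _ _ _ _ psi phi fl J' _ rel d.
  by move=> ir; have := rel0 ir; rewrite q3E r3E.
pose v l r i := \sum_j phi (s j l) * c (i, r) j.
have psiE x : p1 (phi x) = psi x by [].
have psiE' x : p2 (phi x) = psi x by rewrite (khom_comp_eq (esym p12)).
have vp l r i : p1 (v l r i) = \sum_m e W gu (h i m) * p2 (v l r m).
  apply/eqP; rewrite -subr_eq0; apply/eqP; rewrite -[RHS](sZ (i, r) l) /rel.
  under [RHS]eq_bigr do rewrite mulrBr.
  rewrite sumrB; congr (_ - _); first by rewrite rmorph_sum; apply: eq_bigr => j _; rewrite rmorphM.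
  under eq_bigr do rewrite rmorph_sum mulr_sumr.
  rewrite exchange_big; apply: eq_bigr => j _ /=.
  by rewrite mulr_sumr; apply: eq_bigr => m _; rewrite rmorphM psiE'; ring.
exists Q, v, d'; split=> [l r R f1 f2 g E tg i|r i].
  have [f [f1E f2E]] := lift _ _ _ E.
  have -> : g = fmap f gu by apply: univ; rewrite f1E f2E.
  rewrite -(kcomp_at f1E) vp rmorph_sum; apply: eq_bigr => m _.
  by rewrite rmorphM (kcomp_at f2E) ev_nat.
have [f [f1E f2E]] := lift _ (kid B) (kid B) erefl.
have g1 : fmap f gu = gone G B by apply/esym/univ; rewrite f1E f2E act1.
have -> : b r i = f (w (i, r)).
  rewrite /w rmorph_sum (bigD1 i) //= rmorphM -ev_nat g1 h1 eqxx mul1r (kcomp_at f2E).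
  rewrite big1 ?addr0 // => j /negPf ji.
  by rewrite rmorphM -ev_nat g1 h1 eq_sym ji mul0r.
rewrite wE rmorph_sum.
under eq_bigr do rewrite rmorphM (kcomp_at f1E) (kcomp_at f2E) dE /= mulr_sumr.
rewrite exchange_big; apply: eq_bigr => l _ /=.
by rewrite mulr_suml; apply: eq_bigr => j _; ring.
Qed.

Lemma inv_vector_comb (Q : finType) (v : Q -> 'I_n -> B) (c : Q -> k) :
  (forall l, inv_vector (v l)) -> inv_vector (fun i => \sum_l kalg_str B (c l) * v l i).
Proof.
move=> vinv R f1 f2 g E tg i; rewrite rmorph_sum.
under eq_bigr do rewrite rmorphM (vinv _ _ _ _ g E tg) khom_str mulr_sumr.
rewrite exchange_big; apply: eq_bigr => j _ /=.
rewrite rmorph_sum mulr_sumr; apply: eq_bigr => l _.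
by rewrite rmorphM khom_str mulrCA.
Qed.

Variables (A : kalg k) (x : 'I_n * 'I_n -> A).
Variable ev : forall R, ('I_n * 'I_n -> R) -> khom A R.
Hypothesis evE : forall R (c : 'I_n * 'I_n -> R) p, ev c (x p) = c p.
Hypothesis A_ext : forall R (f f' : khom A R), (forall p, f (x p) = f' (x p)) -> f = f'.
Hypothesis hk : infinite_set [set: k].

(** The columns are sought as combinations Σ c_l v_l with c_l in k. At a point over P, the values of
    the d_l used as coefficients give back the scalar matrix c0, at which a does not vanish. Thus a
    is a nonzero polynomial in c over each field L, and one scalar choice serves all P. *)
Lemma inv_matrix (a : A) (c0 : 'I_n * 'I_n -> kbase k) (Ps : seq (set S)) : ev c0 a <> 0 ->
  (forall P, P \in Ps -> exists L (l : khom B L), is_fld L /\ forall s, P s -> l (phi s) = 0) ->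
  exists m : 'I_n * 'I_n -> B, (forall j, inv_vector (fun i => m (i, j))) /\
    forall P, P \in Ps -> exists L (l : khom B L),
      [/\ is_fld L, forall s, P s -> l (phi s) = 0 & l (ev m a) <> 0].
Proof.
move=> c0a pts.
have [Q [v [d [vinv bE]]]] := inv_vectors_generate (fun r i => kalg_str B (c0 (i, r))).
have evc R R' (f : khom R R') (c : 'I_n * 'I_n -> R) b : f (ev c b) = ev (fun p => f (c p)) b.
  rewrite -[LHS]/(kcomp f (ev c) b); congr (khom_fun _ b).
  by apply: A_ext => p; rewrite kcompE !evE.
have [F FE] : exists F : pol B Q, forall R (chi : khom B R) (c : Q -> R),
    pol_ev chi c F = ev (fun p => \sum_l c l * chi (v l p.2 p.1)) a.
  exists (ev (fun p => \sum_l pol_var B l * pol_const B Q (v l p.2 p.1)) a) => R chi c.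
  rewrite evc -[LHS]/(khom_fun (ev _) a); congr (khom_fun _ a); apply: A_ext => p.
  rewrite !evE rmorph_sum; apply: eq_bigr => l _.
  by rewrite rmorphM pol_ev_var (kcomp_at (pol_ev_const _ _)).
pose good (P : set S) (c : Q -> k) := exists L (l : khom B L),
  [/\ is_fld L, forall s, P s -> l (phi s) = 0 &
      pol_ev l (fun w => kalg_str L (c w)) F <> 0].
have /choice [O OP] (P : set S) : exists O : set (Q -> k),
    P \in Ps -> [/\ lineopen O, O !=set0 & O `<=` good P].
  case: (boolP (P \in Ps)) => [/pts [L [l [fL lP]]]|_]; last by exists set0.
  exists [set c : Q -> k | pol_ev l (fun w => kalg_str L (c w)) F <> 0] => _; split.
  - exact: pol_lineopen.
  - apply: (pol_nonvanishing hk (c := fun w => l (d w))); rewrite FE.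
    have -> : ev (fun p => \sum_j l (d j) * l (v j p.2 p.1)) a = kalg_str L (ev c0 a).
      rewrite -[RHS]/(kinit L (ev c0 a)) evc; congr (khom_fun _ a); apply: A_ext => -[i j].
      rewrite !evE /= -(khom_str l) bE rmorph_sum; apply: eq_bigr => q _.
      by rewrite rmorphM mulrC.
    by move=> E; apply: c0a; apply: (fld_inj (f := kinit L) (kbase_fld k) fL.1); rewrite rmorph0.
  - by move=> c Oc; exists L, l.
have [|c cP] := lineopen_meet hk (Os := [seq O P | P <- Ps]).
  by move=> _ /mapP [P /OP [lo ne _] ->].
exists (fun p => \sum_l kalg_str B (c l) * v l p.2 p.1); split=> [j|P PP].
  by apply: (@inv_vector_comb Q (fun l => v l j)).
have [L [l [fL lP lF]]] : good P c by have [_ _] := OP P PP; apply; apply: cP; exact: map_f.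
exists L, l; split=> //; move: lF; rewrite FE evc.
rewrite (_ : ev _ = ev (fun p => \sum_l0 kalg_str L (c l0) * l (v l0 p.2 p.1))) //.
apply: A_ext => p; rewrite !evE rmorph_sum; apply: eq_bigr => q _.
by rewrite rmorphM khom_str.
Qed.

End InvariantMatrices.

(** * Finite extensions and models *)

Lemma least_nat (P : nat -> Prop) : (exists n, P n) ->
  exists n, P n /\ forall m, P m -> (n <= m)%N.
Proof.
move=> [n Pn]; have ex : exists n, `[< P n >] by exists n; apply/asboolP.
by exists (ex_minn ex); case: ex_minnP => m /asboolP Pm min; split=> // p /asboolP /min.
Qed.

Section FiniteExtensions.
Variable k : fieldType.
Implicit Types A B E L : kalg k.

Definition finext E L (j : khom E L) : Prop :=
  exists (I : finType) (e : I -> L), forall z, exists c : I -> E, z = \sum_i j (c i) * e i.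

Lemma finext_comp E L L' (j : khom E L) (j' : khom L L') :
  finext j -> finext j' -> finext (kcomp j' j).
Proof.
move=> [I [e eP]] [I' [e' e'P]]; exists (I * I')%type, (fun p => j' (e p.1) * e' p.2) => z.
have [c ->] := e'P z; have /choice [d dE] i : exists d : I -> E, c i = \sum_l j (d l) * e l by exact: eP.
exists (fun p => d p.2 p.1); rewrite -(pair_bigA _ (fun l i => kcomp j' j (d i l) * (j' (e l) * e' i))) /=.
rewrite exchange_big; apply: eq_bigr => i _ /=; rewrite dE rmorph_sum mulr_suml.
by apply: eq_bigr => l _; rewrite rmorphM mulrA.
Qed.

Lemma quot_fld A (M : set A) (hM : is_ideal M) : maximal_ideal M -> is_fld (quot_kalg hM).
Proof.
move=> [_ MT max]; split.
  rewrite -(rmorph1 (quot_pi hM)) => /quot_pi0 M1; apply: MT; apply/seteqP; split=> // a _.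
  by rewrite -[a]mulr1; exact: idealM.
move=> x; have [a <-] := quot_pi_surj x => a0.
pose J := [set z | exists m b, M m /\ z = m + a * b].
have hJ : is_ideal J.
  split.
  - by exists 0, 0; split; [exact: ideal0 | rewrite mulr0 addr0].
  - move=> u v [m [b [Mm ->]]] [m' [b' [Mm' ->]]]; exists (m + m'), (b + b').
    by split; [exact: idealD | ring].
  - move=> c u [m [b [Mm ->]]]; exists (c * m), (c * b).
    by split; [exact: idealM | ring].
have MJ : M `<=` J by move=> m Mm; exists m, 0; rewrite mulr0 addr0.
have [JM|JT] := max J hJ MJ.
  exfalso; apply: a0; apply/quot_pi0; rewrite -JM; exists 0, 1.
  by split; [exact: ideal0 | rewrite mulr1 add0r].
have [m [b [Mm E]]] : J 1 by rewrite JT.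
exists (quot_pi hM b); rewrite -rmorphM -(rmorph1 (quot_pi hM)) E rmorphD.
by rewrite (_ : quot_pi hM m = 0) ?add0r //; apply/quot_pi0.
Qed.

Lemma poly_expand (R : comNzRingType) (p : {poly R}) n : (size p <= n)%N ->
  p = \sum_(i < n) (p`_i)%:P * 'X^i.
Proof.
move=> sp; apply/polyP => j; rewrite coef_sum.
under eq_bigr do rewrite coefCM coefXn.
have [jn|nj] := ltnP j n.
  rewrite (bigD1 (Ordinal jn)) //= eqxx mulr1 big1 ?addr0 // => i ij.
  rewrite (_ : (j == i :> nat) = false) ?mulr0 //.
  by apply: contraNF ij => /eqP ji; apply/eqP/val_inj.
rewrite big1 ?nth_default ?(leq_trans sp) // => i _.
by rewrite (_ : (j == i :> nat) = false) ?mulr0 //; apply/eqP => ji; move: (ltn_ord i); rewrite -ji ltnNge nj.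
Qed.

Lemma root_extension (F : fieldType) (iF : {rmorphism k -> F}) (p : {poly F}) : (1 < size p)%N ->
  exists L (j : khom (polyK iF) L),
    [/\ is_fld L, j p = 0 & finext (kcomp j (polyC_hom iF))].
Proof.
move=> sp; pose I : set (polyK iF) := [set q : {poly F} | p %| q].
have hI : is_ideal I.
  split=> [|u v|u v]; [exact: dvdp0 | exact: dvdp_add | exact: dvdp_mull].
have [|M mM IM] := exists_maximal hI.
  by move=> p1; have := dvdp_leq (oner_neq0 _) (p1 : p %| (1 : {poly F})); rewrite size_poly1 leqNgt sp.
have [hM _ _] := mM.
exists (quot_kalg hM), (quot_pi hM); split; first exact: quot_fld.
  by apply/quot_pi0; apply: IM; exact: dvdpp.
exists 'I_(size p), (fun i : 'I_(size p) => quot_pi hM ('X^i : {poly F})) => z.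
have [q <-] := quot_pi_surj z.
have -> : quot_pi hM q = quot_pi hM (q %% p : {poly F}).
  apply/eqP; rewrite -subr_eq0 -rmorphB; apply/eqP/quot_pi0; apply: IM.
  by rewrite /I /= [X in X - _](divp_eq q p) addrK dvdp_mull.
exists (fun i : 'I_(size p) => (q %% p)`_i).
have qE : (q %% p : {poly F}) = \sum_(i < size p) ((q %% p)`_i)%:P * 'X^i.
  by apply: poly_expand; rewrite ltnW // ltn_modp -size_poly_gt0 ltnW.
rewrite [in LHS]qE rmorph_sum; apply: eq_bigr => i _.
by rewrite rmorphM kcompE.
Qed.

Section Simple.
Variables (R : comNzRingType) (iR : {rmorphism k -> R}).
Let A := KAlg iR.
Hypothesis dA : is_domain A.
Variables (B : kalg k) (ev : khom (polyK iR) B).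
Hypothesis dB : is_domain B.
Hypothesis evC_inj : forall c : R, ev c%:P = 0 -> c = 0.

Lemma pseudo_division (p d : {poly R}) : d <> 0 -> exists N (q r : {poly R}),
  [/\ (lead_coef d ^+ N)%:P * p = q * d + r & (size r < size d)%N].
Proof.
move=> /eqP d0; exists (Pdiv.CommonRing.rscalp p d), (Pdiv.CommonRing.rdivp p d),
  (Pdiv.CommonRing.rmodp p d); split; last by rewrite Pdiv.CommonRing.ltn_rmodp.
by rewrite mulrC Pdiv.RingComRreg.rdivp_eq //; exact: mulrC.
Qed.

Lemma domain_exp (C : kalg k) (x : C) N : is_domain C -> x <> 0 -> x ^+ N <> 0.
Proof.
move=> dC x0; elim: N => [|N IH]; first by rewrite expr0; exact: dC.1.
by rewrite exprS => /dC.2 [].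
Qed.

Variable P : {poly R}.
Hypotheses (P0 : P <> 0) (evP : ev P = 0).
Hypothesis Pmin : forall q : {poly R}, q <> 0 -> ev q = 0 -> (size P <= size q)%N.

Lemma lead_neq0 (q : {poly R}) : q <> 0 -> lead_coef q <> 0 :> A.
Proof. by move=> q0 /eqP; rewrite lead_coef_eq0 => /eqP. Qed.

(** P generates the kernel up to powers of its leading coefficient, which need not be invertible in
    A. *)
Lemma ev_kernel (q : {poly R}) : ev q = 0 ->
  exists N r, (lead_coef P ^+ N)%:P * q = r * P.
Proof.
move=> q0; have [N [r [s [E ss]]]] := pseudo_division q P0; exists N, r.
rewrite E; suff -> : s = 0 by rewrite addr0.
apply: contrapT => s0; have := Pmin s0; rewrite leqNgt ss; apply/not_implyP.
split=> //; rewrite (_ : s = (lead_coef P ^+ N)%:P * q - r * P); last by rewrite E addrC addKr.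
by rewrite rmorphB !rmorphM q0 evP !mulr0 subr0.
Qed.

(** Take G of least size whose value is a nonzero multiple of w. Pseudo-division of P by G leaves no
    remainder, and the cofactor lies in the kernel; minimality of P then makes G constant. *)
Lemma algebraic_multiple (w : B) : w <> 0 -> (exists q, ev q = w) ->
  exists (w' : B) (c : R), c <> 0 /\ w * w' = ev c%:P.
Proof.
move=> w0 [q qw]; pose good m := exists (G : {poly R}) w', [/\ size G = m, ev G = w * w' & ev G <> 0].
have [|m [[G [w' [sG GE G0]]] min]] := @least_nat good.
  by exists (size q), q, 1; rewrite mulr1 qw.
have nG : G <> 0 by move=> E; apply: G0; rewrite E rmorph0.
have cN (d : {poly R}) N : d <> 0 -> ev (lead_coef d ^+ N)%:P <> 0.
  by move=> d0 /evC_inj; exact: (@domain_exp A _ N dA (lead_neq0 d0)).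
have sGP : (size G < size P)%N.
  rewrite ltnNge; apply/negP => PG; have [N [r [s [E ss]]]] := pseudo_division G P0.
  have Es : ev s = ev (lead_coef P ^+ N)%:P * ev G.
    by rewrite -rmorphM E rmorphD rmorphM evP mulr0 add0r.
  have : good (size s).
    exists s, (ev (lead_coef P ^+ N)%:P * w'); split=> //; first by rewrite Es GE mulrCA.
    by rewrite Es => /dB.2 [/(cN _ _ P0)|].
  by move/min; rewrite -sG leqNgt (leq_trans ss).
have [N [r [s [E ss]]]] := pseudo_division P nG.
have Es : ev s = - (ev r * ev G).
  by apply/eqP; rewrite -addr_eq0 addrC -rmorphM -rmorphD -E rmorphM evP mulr0.
have s0 : s = 0.
  apply: contrapT => s0; case: (pselect (ev s = 0)) => [es|es].
    by have := Pmin s0 es; rewrite leqNgt (ltn_trans ss).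
  have : good (size s) by exists s, (- (ev r * w')); split=> //; rewrite Es GE mulrN mulrCA.
  by move/min; rewrite -sG leqNgt ss.
have er : ev r = 0.
  by move: Es; rewrite s0 rmorph0 => /esym/eqP; rewrite oppr_eq0 => /eqP /dB.2 [].
have sE : size ((lead_coef G ^+ N)%:P * P) = size P.
  have cP : lead_coef G ^+ N * lead_coef P != 0.
    by apply/eqP => /dA.2 [/(@domain_exp A _ N dA (lead_neq0 nG))|/lead_neq0]; exact.
  rewrite size_proper_mul ?lead_coefC // size_polyC.
  by case: eqP => [z|//]; rewrite z mul0r eqxx in cP.
have r0 : r <> 0.
  move=> r0; move: sE; rewrite E s0 r0 mul0r addr0 size_poly0 => /esym/eqP.
  by rewrite size_poly_eq0 => /eqP.
have sG1 : (size G <= 1)%N.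
  rewrite leqNgt; apply/negP => G1.
  have rG : lead_coef r * lead_coef G != 0 by apply/eqP => /dA.2 [/lead_neq0|/lead_neq0]; exact.
  have := Pmin r0 er; rewrite -sE E s0 addr0 size_proper_mul //.
  have : (0 < size r)%N by rewrite lt0n size_poly_eq0; apply/eqP.
  by lia.
exists w', G`_0; move/size1_polyC: sG1 => GC; split; last by rewrite -GE [in LHS]GC.
by move=> z; apply: nG; rewrite GC z.
Qed.

End Simple.

End FiniteExtensions.

Section ExtensionPoints.
Variable k : fieldType.
Implicit Types A B E L : kalg k.
Hypothesis hk : infinite_set [set: k].

Lemma map_homP (R R' : comNzRingType) (iR : {rmorphism k -> R}) (iR' : {rmorphism k -> R'})
    (f : khom (KAlg iR) (KAlg iR')) : exists m : khom (polyK iR) (polyK iR'),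
  forall p : {poly R}, m p = map_poly f p.
Proof.
have E c : map_poly f (kalg_str (polyK iR) c) = kalg_str (polyK iR') c.
  by rewrite /= map_polyC /= -(khom_str f c).
by exists (@KHom k (polyK iR) (polyK iR') (map_poly f) E).
Qed.

Lemma poly_evaluation (R : comNzRingType) (iR : {rmorphism k -> R}) B
    (i : khom (KAlg iR) B) (z : B) : (1 : B) <> 0 ->
  exists ev : khom (polyK iR) B, (forall c : R, ev c%:P = i c) /\ ev 'X = z.
Proof.
move=> nzB; have [R' [iR' E]] := nz_kalg nzB; subst B.
have [m mE] := map_homP i; exists (kcomp (horner_hom iR' z) m); split=> [c|].
  by rewrite kcompE mE map_polyC; exact: horner_homC.
by rewrite kcompE mE map_polyX; exact: horner_homX.
Qed.

(** The condition for extending a point along one generator. If the generator is transcendental, c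
    is the leading coefficient of a polynomial with value w, and the generator is sent to a scalar
    that is not a root. If it is algebraic, c is the leading coefficient of P times a constant
    multiple of w, and a root of P is adjoined. *)
Lemma extension_step (R : comNzRingType) (iR : {rmorphism k -> R}) B
    (i : khom (KAlg iR) B) (ev : khom (polyK iR) B) (w : B) :
  is_domain (KAlg iR) -> is_domain B -> injective i -> (forall c : R, ev c%:P = i c) ->
  (forall b, exists p, ev p = b) -> w <> 0 ->
  exists c : R, c <> 0 /\ forall L0 (f0 : khom (KAlg iR) L0), is_fld L0 -> f0 c <> 0 ->
    exists L (j : khom L0 L) (f : khom B L),
      [/\ is_fld L, finext j, kcomp f i = kcomp j f0 & f w <> 0].
Proof.
move=> dA dB i_inj evC ev_surj w0; have [q qw] := ev_surj w.
case: (pselect (exists P : {poly R}, P <> 0 /\ ev P = 0)) => [[P1 [P10 evP1]]|noP]; last first.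
  have ev_inj p : ev p = 0 -> p = 0.
    by move=> evp; apply: contrapT => p0; apply: noP; exists p.
  have q0 : q <> 0 by move=> E; apply: w0; rewrite -qw E rmorph0.
  exists (lead_coef q); split; first by move=> /eqP; rewrite lead_coef_eq0 => /eqP.
  move=> L0 f0 fL; have [F [iF E]] := fld_kalg fL; subst L0 => f0q.
  have [m mE] := map_homP f0.
  have [u uq] : exists u, (map_poly f0 q).[iF u] <> 0.
    apply: contrapT => no; have : map_poly f0 q = 0.
      apply: (@poly_infinite_roots k F iF).
      rewrite (_ : [set _ | _] = setT) //; apply/seteqP; split=> // u _ /=.
      by apply: contrapT => nu; apply: no; exists u.
    move=> /(congr1 (fun p : {poly F} => p`_(size q).-1)); rewrite coef_map coef0.
    exact: f0q.
  have [p pz|f fE] := @factor_surj _ _ _ _ ev (kcomp (horner_hom iF (iF u)) m) ev_surj.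
    by rewrite (ev_inj p pz) rmorph0.
  exists (KAlg iF), (kid _), f; split=> //.
  - by exists 'I_1, (fun=> 1) => z; exists (fun=> z); rewrite big_ord_recl big_ord0 addr0 mulr1.
  - apply: khomP => c; rewrite kcompE -evC fE kcompE mE map_polyC.
    exact: horner_homC.
  - by rewrite -qw fE kcompE mE.
have [|n [[P [sP [P0 evP]]] min]] :=
    @least_nat (fun n => exists P : {poly R}, size P = n /\ (P <> 0 /\ ev P = 0)).
  by exists (size P1), P1.
have Pmin (p : {poly R}) : p <> 0 -> ev p = 0 -> (size P <= size p)%N.
  by move=> p0 pz; rewrite sP; apply: min; exists p.
have evC_inj (c : R) : ev c%:P = 0 -> c = 0.
  by rewrite evC => E; apply: i_inj; rewrite rmorph0.
have [w' [c0 [c00 ww]]] := algebraic_multiple dA dB evC_inj P0 evP Pmin w0 (ev_surj w).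
exists (lead_coef P * c0); split; first by move=> /dA.2 [/(@lead_neq0 _ _ iR _ P0)|].
move=> L0 f0 fL; have [F [iF E]] := fld_kalg fL; subst L0 => fc.
have fP : f0 (lead_coef P) <> 0 by move=> E; apply: fc; rewrite rmorphM E mul0r.
have fc0 : f0 c0 <> 0 by move=> E; apply: fc; rewrite rmorphM E mulr0.
have [m mE] := map_homP f0.
have sP1 : (1 < size P)%N.
  rewrite ltnNge; apply/negP => /size1_polyC PC; apply: P0.
  by rewrite PC (evC_inj P`_0) // -PC.
have [L [j [fL' jP fin]]] : exists L (j : khom (polyK iF) L),
    [/\ is_fld L, j (map_poly f0 P) = 0 & finext (kcomp j (polyC_hom iF))].
  by apply: root_extension; rewrite size_map_poly_id0 //; apply/eqP.
have j_inj : injective (kcomp j (polyC_hom iF)) := fld_inj fL fL'.1.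
have jC (c : R) : f0 c <> 0 -> j (f0 c)%:P <> 0.
  move=> f0c jc; apply: f0c; apply: j_inj; rewrite rmorph0; exact: jc.
have [p pz|f fE] := @factor_surj _ _ _ _ ev (kcomp j m) ev_surj.
  have [N [r E]] := ev_kernel P0 evP Pmin pz.
  have := congr1 (fun p => j (m p)) E; rewrite !rmorphM !mE jP mulr0 map_polyC.
  case/(field_domain fL') => Z; last by rewrite kcompE mE.
  exfalso; move: Z; apply: jC.
  have -> : f0 (lead_coef P ^+ N) = f0 (lead_coef P) ^+ N by exact: rmorphXn.
  exact: (@domain_exp _ (KAlg iF) _ N (conj fL.1 (fun x y => field_domain fL)) fP).
have fi c : f (i c) = j (f0 c)%:P by rewrite -evC fE kcompE mE map_polyC.
exists L, (kcomp j (polyC_hom iF)), f; split=> //; first exact: khomP.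
move=> fw; apply: (jC _ fc0); rewrite -fi -evC -ww rmorphM fw mul0r //.
Qed.

(* Zariski's lemma: finitely generated algebras have points in finite extensions. *)
Lemma extension_point n E B (phi : khom E B) (x : 'I_n -> B) (w : B) :
  is_fld E -> is_domain B -> generated phi x -> w <> 0 ->
  exists L (j : khom E L) (f : khom B L),
    [/\ is_fld L, finext j, kcomp f phi = j & f w <> 0].
Proof.
move=> fE; elim: n B phi x w => [|n IH] B phi x w dB gx w0.
  have phi_inj : injective phi := fld_inj fE dB.1.
  have sur b : exists a, phi a = b.
    apply: (gx [set b | exists a, phi a = b]) => [|a|[]//]; last by exists a.
    exact: subalg_range.
  have [a az|f fP] := @factor_surj _ _ _ _ phi (kid E) sur.
    by apply: phi_inj; rewrite az rmorph0.
  exists E, (kid E), f; split=> //; first by exists 'I_1, (fun=> 1) => z; exists (fun=> z); rewrite big_ord_recl big_ord0 addr0 mulr1.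
    exact: khomP.
  by have [a aw] := sur w; move: w0; rewrite -aw fP /= => a0 E0; apply: a0; rewrite E0 rmorph0.
have [A [i [phi0 [x0 [i_inj ip ix gx0]]]]] := generated_subalgebra phi (x \o lift ord0).
have dA : is_domain A.
  split=> [E1|u v uv]; first by apply: dB.1; rewrite -(rmorph1 i) E1 rmorph0.
  have : i u * i v = 0 by rewrite -rmorphM uv rmorph0.
  by case/dB.2 => z; [left|right]; apply: i_inj; rewrite z rmorph0.
have [R [iR AE]] := nz_kalg dA.1; subst A.
have [ev [evC evX]] := poly_evaluation i (x ord0) dB.1.
have ev_surj b : exists p, ev p = b.
  apply: (gx [set b | exists p, ev p = b]) => [|a|l].
  - exact: subalg_range.
  - by exists (phi0 a)%:P; rewrite evC -ip.
  - case: (unliftP ord0 l) => [l' ->|->]; last by exists 'X.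
    by exists (x0 l')%:P; rewrite evC ix.
have [c [c0 step]] := extension_step dA dB i_inj evC ev_surj w0.
have [L0 [j0 [f0 [fL0 fin0 f0j f0c]]]] := IH _ phi0 x0 c dA gx0 c0.
have [L [j [f [fL fin fi fw]]]] := step L0 f0 fL0 f0c.
exists L, (kcomp j j0), f; split=> //; first exact: finext_comp.
by rewrite -ip kcompA fi -kcompA f0j.
Qed.

(** A spanning family of least size among those starting with 1. A dependence involves some index
    other than 0, since 1 is nonzero, and that vector could be dropped. The normalization provides
    the vector needed for surjectivity onto D(a) in the model. *)
Lemma finext_basis E L (j : khom E L) : is_fld E -> is_fld L -> finext j ->
  exists d (e : 'I_d.+1 -> L), [/\ e ord0 = 1,
    forall z, exists c, z = \sum_i j (c i) * e i &
    forall c, \sum_i j (c i) * e i = 0 -> forall i, c i = 0].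
Proof.
move=> fE fL [I [e0 e0P]].
pose good d := exists e : 'I_d.+1 -> L, e ord0 = 1 /\
  forall z, exists c, z = \sum_i j (c i) * e i.
have [|d [[e [e1 eP]] min]] := @least_nat good.
  exists #|I|, (fun i => if unlift ord0 i is Some i' then e0 (enum_val i') else 1).
  split=> [|z]; first by rewrite unlift_none.
  have [c ->] := e0P z.
  exists (fun i => if unlift ord0 i is Some i' then c (enum_val i') else 0).
  rewrite big_ord_recl unlift_none rmorph0 mul0r add0r.
  rewrite (reindex (@enum_val I I)) /=; last by apply: onW_bij; exact: enum_val_bij.
  by apply: eq_bigr => i _; rewrite liftK.
exists d, e; split=> // c cz i; apply: contrapT => ci.
have [m [m0 cm]] : exists m, m <> ord0 /\ c m <> 0.
  apply: contrapT => no; have c0 l : l <> ord0 -> c l = 0.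
    by move=> l0; apply: contrapT => cl; apply: no; exists l.
  apply: ci; have [->|/eqP/c0//] := eqVneq i ord0.
  apply: (fld_inj fE fL.1); rewrite rmorph0 -[RHS]cz (bigD1 ord0) //= e1 mulr1.
  by rewrite big1 ?addr0 // => l /eqP /c0 ->; rewrite rmorph0 mul0r.
have d0 : (0 < d)%N.
  by rewrite lt0n; apply/eqP => d0; subst d; apply: m0; rewrite ord1.
move: d d0 e e1 eP c cz i ci m m0 cm min => [//|d] _ e e1 eP c cz i ci m m0 cm min.
have [v cv] := fE.2 _ cm.
have : good d; last by move/min; rewrite ltnn.
exists (fun l => e (lift m l)); split.
  rewrite -[RHS]e1; congr e; apply: val_inj; rewrite /= /bump leqn0.
  by case: eqP => // m0'; exfalso; apply: m0; apply: val_inj.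
move=> z; have [b ->] := eP z.
exists (fun l => b (lift m l) - b m * v * c (lift m l)).
have em : e m = - \sum_(l < d.+1) j (v * c (lift m l)) * e (lift m l).
  move: cz; rewrite (bigD1_ord m) //= => /eqP; rewrite addr_eq0 => /eqP cz.
  rewrite -[LHS]mul1r -(rmorph1 j) -cv mulrC rmorphM mulrA [e m * _]mulrC cz mulNr mulr_suml.
  by congr (- _); apply: eq_bigr => l _; rewrite rmorphM; ring.
rewrite (bigD1_ord m) //= em mulrN mulr_sumr -sumrN -big_split.
by apply: eq_bigr => l _ /=; rewrite rmorphB !rmorphM; ring.
Qed.

End ExtensionPoints.

(** * Models of a finite extension, free over a localization *)

Section Models.
Variable k : fieldType.
Implicit Types C D R L : kalg k.
Variables (A E : kalg k) (i : khom A E).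
Hypothesis i_inj : injective i.
Hypothesis fE : is_fld E.
Hypothesis fracE : forall x, exists a s, s <> 0 /\ x * i s = i a.

Lemma frac_neq0 a : a <> 0 -> i a <> 0.
Proof. by move=> a0 E0; apply: a0; apply: i_inj; rewrite E0 rmorph0. Qed.

Lemma base_domain : is_domain A.
Proof.
split=> [E1|a b ab]; first by apply: fE.1; rewrite -(rmorph1 i) E1 rmorph0.
have : i a * i b = 0 by rewrite -rmorphM ab rmorph0.
by case/(field_domain fE) => z; [left|right]; apply: i_inj; rewrite z rmorph0.
Qed.

(** The localization A_a inside its fraction field E. *)
Definition frac_set (a : A) : set E := [set x | exists N c, x * i a ^+ N = i c].

Lemma frac_pow a x N c M : (N <= M)%N -> x * i a ^+ N = i c ->
  x * i a ^+ M = i (c * a ^+ (M - N)).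
Proof. by move=> NM E0; rewrite -{1}(subnKC NM) exprD mulrA E0 rmorphM rmorphXn. Qed.

Lemma frac_in a c : frac_set a (i c).
Proof. by exists 0%N, c; rewrite mulr1. Qed.

Lemma frac_common a (I : finType) (x : I -> E) : (forall l, frac_set a (x l)) ->
  exists N (c : I -> A), forall l, x l * i a ^+ N = i (c l).
Proof.
move=> /choice [M /choice [c cP]]; exists (\sum_l M l)%N.
exists (fun l => c l * a ^+ (\sum_l M l - M l)) => l.
by apply: (frac_pow _ (cP l)); rewrite (bigD1 l) //= leq_addr.
Qed.

Lemma frac_subalg a : is_subalg (frac_set a).
Proof.
split=> [c|x y [N [c xc]] [M [d yd]]|x [N [c xc]]|x y [N [c xc]] [M [d yd]]].
- by exists 0%N, (kalg_str A c); rewrite mulr1 khom_str.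
- exists (N + M)%N, (c * a ^+ M + d * a ^+ N).
  rewrite rmorphD !rmorphM !rmorphXn -xc -yd exprD; ring.
- by exists N, (- c); rewrite rmorphN -xc mulNr.
- by exists (N + M)%N, (c * d); rewrite rmorphM -xc -yd exprD; ring.
Qed.

Lemma frac_mul a b x : frac_set a x -> frac_set (a * b) x.
Proof.
move=> [N [c xc]]; exists N, (c * b ^+ N).
by rewrite !rmorphM exprMn mulrA xc rmorphXn.
Qed.

Lemma frac_fin (I : finType) (x : I -> E) : exists b, b <> 0 /\ forall l, frac_set b (x l).
Proof.
have /choice [c /choice [s sP]] l : exists c s, s <> 0 /\ x l * i s = i c by exact: fracE.
exists (\prod_l s l); split=> [|l].
  apply: (big_ind (fun z : A => z <> 0)) => [|u v u0 v0 /base_domain.2 []//|l _].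
    exact: base_domain.1.
  by case: (sP l).
by rewrite (bigD1 l) //=; apply: frac_mul; exists 1%N, (c l); rewrite expr1; case: (sP l).
Qed.

(* [D] is the module spanned by a basis of [L] over the localization [frac_set a],
   [a] clearing the structure constants; hence [A -> D] is flat, and faithfully so
   where [a] is invertible. *)
Lemma free_model L (j : khom E L) (I : finType) (z : I -> L) (a0 : A) : is_fld L -> finext j ->
    a0 <> 0 -> exists (a : A) D (dL : khom D L) (aD : khom A D),
  [/\ a <> 0, injective dL, kcomp dL aD = kcomp j i,
      (forall x, frac_set a0 x -> exists d, dL d = j x) /\ (forall l, exists d, dL d = z l) &
      forall (J : finType) (d : J -> D), exists (Q : finType) (b : Q -> D) (c : J -> Q -> A),
        [/\ forall l, d l = \sum_m aD (c l m) * b m,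
            forall r : Q -> E, \sum_m j (r m) * dL (b m) = 0 -> forall m, r m = 0 &
            exists N m0, aD (a ^+ N) * b m0 = 1] ].
Proof.
move=> fL fin a00; have [d [e [e1 eP e_ind]]] := finext_basis fE fL fin.
have /choice [t /= tP] (p : 'I_d.+1 * 'I_d.+1) : exists t, e p.1 * e p.2 = \sum_l j (t l) * e l by exact: eP.
have /choice [zc zcP] l : exists c, z l = \sum_m j (c m) * e m by exact: eP.
have [b1 [b10 b1P]] := frac_fin (fun q : ('I_d.+1 * 'I_d.+1) * 'I_d.+1 => t q.1 q.2).
have [b2 [b20 b2P]] := frac_fin (fun q : I * 'I_d.+1 => zc q.1 q.2).
pose a := a0 * b1 * b2.
have Fa0 x : frac_set a0 x -> frac_set a x by move=> Fx; do 2 apply: frac_mul.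
have Fb1 p l : frac_set a (t p l).
  by apply: frac_mul; rewrite mulrC; apply: frac_mul; exact: (b1P (p, l)).
have Fb2 l m : frac_set a (zc l m).
  by rewrite /a mulrC; apply: frac_mul; exact: (b2P (l, m)).
have aN0 : a <> 0 by move=> /base_domain.2 [/base_domain.2 []|].
have sFa := frac_subalg a.
pose U := [set w : L | exists x : 'I_d.+1 -> E, (forall m, frac_set a (x m)) /\
  w = \sum_m j (x m) * e m].
have Fdelta (m : 'I_d.+1) x : \sum_l j (if l == m then x else 0) * e l = j x * e m.
  rewrite (bigD1 m) //= eqxx big1 ?addr0 // => l /negPf ->.
  by rewrite rmorph0 mul0r.
have Udelta m x : frac_set a x -> U (j x * e m).
  move=> Fx; exists (fun l => if l == m then x else 0); split; last by rewrite Fdelta.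
  by move=> l; case: (l == m) => //; exact: subalg0.
have U1 x : frac_set a x -> U (j x) by move=> Fx; rewrite -[j x]mulr1 -e1; exact: Udelta.
have UD u v : U u -> U v -> U (u + v).
  move=> [x [Fx ->]] [y [Fy ->]]; exists (fun m => x m + y m); split.
    by move=> m; exact: subalgD.
  by rewrite -big_split; apply: eq_bigr => m _; rewrite rmorphD mulrDl.
have U0 : U 0 by rewrite -(rmorph0 j); apply: U1; exact: subalg0.
have sU : is_subalg U.
  split=> [c|//|u [x [Fx ->]]|u v [x [Fx ->]] [y [Fy ->]]].
  - by rewrite -(khom_str j); apply: U1; case: sFa.
  - exists (fun m => - x m); split; first by move=> m; exact: subalgN.
    by rewrite -sumrN; apply: eq_bigr => m _; rewrite rmorphN mulNr.
  - rewrite mulr_suml; apply: (big_ind U) => // m _.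
    rewrite mulr_sumr; apply: (big_ind U) => // m' _.
    rewrite (_ : _ * _ = \sum_l j (x m * y m' * t (m, m') l) * e l).
      by exists (fun l => x m * y m' * t (m, m') l); split=> // l; do 2 apply: subalgM => //.
    rewrite (_ : _ * _ = j (x m * y m') * (e m * e m')); last by rewrite rmorphM; ring.
    by rewrite (tP (m, m')) mulr_sumr; apply: eq_bigr => l _; rewrite [in RHS]rmorphM mulrA.
have [aD aDP] : exists aD : khom A (sub_kalg sU), forall c, sub_val sU (aD c) = kcomp j i c.
  apply: factor_inj; first exact: sub_val_inj.
  by move=> c; apply: sub_val_surj; apply: U1; exact: frac_in.
exists a, (sub_kalg sU), (sub_val sU), aD; split=> //.
- exact: sub_val_inj.
- exact: khomP.
- split=> [x /Fa0 Fx|l]; first by apply: sub_val_surj; exact: U1.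
  by apply: sub_val_surj; rewrite zcP; exists (zc l).
move=> J w; have /choice [x xP] l : exists x : 'I_d.+1 -> E, (forall m, frac_set a (x m)) /\
    sub_val sU (w l) = \sum_m j (x m) * e m by exact: (sub_valP (w l)).
have [|N [c cP]] := @frac_common a (J * 'I_d.+1)%type (fun p => x p.1 p.2).
  by case=> l m; case: (xP l).
have [v av] := fE.2 _ (frac_neq0 aN0).
have avN : i a ^+ N * v ^+ N = 1 by rewrite -exprMn av expr1n.
have /choice [b bP] m : exists b, sub_val sU b = j (v ^+ N) * e m.
  by apply: sub_val_surj; apply: Udelta; exists N, 1; rewrite rmorph1 mulrC.
exists 'I_d.+1, b, (fun l m => c (l, m)); split.
- move=> l; apply: (@sub_val_inj _ _ _ sU); rewrite (xP l).2 rmorph_sum.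
  apply: eq_bigr => m _; rewrite rmorphM aDP bP kcompE -(cP (l, m)) /= mulrA -rmorphM.
  by rewrite -mulrA avN mulr1.
- move=> r; under eq_bigr do rewrite bP mulrA -rmorphM.
  move=> /e_ind r0 m; rewrite -[LHS]mulr1 -avN mulrCA r0 mulr0 //.
- exists N, ord0; apply: (@sub_val_inj _ _ _ sU).
  by rewrite rmorphM aDP bP e1 mulr1 kcompE -rmorphM rmorphXn avN !rmorph1.
Qed.

Section Consequences.
Variables (L D : kalg k) (j : khom E L) (dL : khom D L) (aD : khom A D) (a : A).
Hypothesis dL_inj : injective dL.
Hypothesis dLa : kcomp dL aD = kcomp j i.
Hypothesis free : forall (J : finType) (d : J -> D), exists (Q : finType) (b : Q -> D) (c : J -> Q -> A),
        [/\ forall l, d l = \sum_m aD (c l m) * b m,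
            forall r : Q -> E, \sum_m j (r m) * dL (b m) = 0 -> forall m, r m = 0 &
            exists N m0, aD (a ^+ N) * b m0 = 1].

Lemma model_flat : eqflat aD.
Proof.
move=> J s d E0; have [Q [b [c [dE ind _]]]] := free d.
exists Q, b, c; split=> // m; apply: i_inj; rewrite rmorph0.
apply: (ind (fun m => i (\sum_l s l * c l m))); rewrite -[RHS](rmorph0 dL) -E0 rmorph_sum.
under [RHS]eq_bigr do rewrite dE mulr_sumr rmorph_sum.
rewrite exchange_big; apply: eq_bigr => q _ /=.
rewrite !rmorph_sum mulr_suml; apply: eq_bigr => l _.
by rewrite !rmorphM !(kcomp_at dLa) !kcompE mulrA.
Qed.

(** Comparison of the coefficients of b m0, the inverse of a^N in D. It says that the image of Spec
    D contains D(a). *)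
Lemma model_unit (J : finType) (s : J -> A) (d : J -> D) : \sum_l aD (s l) * d l = 1 ->
  exists N (c : J -> A), a ^+ N = \sum_l s l * c l.
Proof.
move=> E1; have [Q [b [c [dE ind [N [m0 bN]]]]]] := free d.
exists N, (fun l => c l m0); apply: i_inj.
pose r m := i (\sum_l s l * c l m) - (if m == m0 then i (a ^+ N) else 0).
have : r m0 = 0.
  apply: ind; rewrite /r; under eq_bigr do rewrite rmorphB mulrBl.
  rewrite sumrB [X in _ - X](bigD1 m0) //= eqxx.
  rewrite [X in _ - (_ + X)]big1 ?addr0 => [|m /negPf ->]; last by rewrite rmorph0 mul0r.
  rewrite -[j (i (a ^+ N))](kcomp_at dLa) -rmorphM bN -E1 rmorph_sum.
  apply/eqP; rewrite subr_eq0; apply/eqP.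
  under [RHS]eq_bigr do rewrite dE mulr_sumr rmorph_sum.
  rewrite [RHS]exchange_big; apply: eq_bigr => q _ /=.
  rewrite !rmorph_sum mulr_suml; apply: eq_bigr => l _.
  by rewrite !rmorphM !(kcomp_at dLa) !kcompE mulrA.
by rewrite /r eqxx => /eqP; rewrite subr_eq0 => /eqP.
Qed.

(** C ⊗ D over A embeds in L: a tensor is rewritten over elements of D that are independent over E,
    and the coefficients in C embed in E. Identities over C ⊗ D can thus be tested in L. *)
Lemma model_tens_inj C (iC : khom C E) (xA : khom A C) (fl : eqflat aD)
    (f : khom (tens_kalg xA fl) L) : injective iC -> kcomp iC xA = i ->
  kcomp f (tensl xA fl) = kcomp j iC -> kcomp f (tensr xA fl) = dL -> injective f.
Proof.
move=> iC_inj iCx fl1 fr; have inj0 w : f w = 0 -> w = 0.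
  have [n [c [d ->]]] := tens_gen_fin w.
  have [Q [b [s [dE ind _]]]] := free d.
  have -> : \sum_l tensl xA fl (c l) * tensr xA fl (d l) =
      \sum_m tensl xA fl (\sum_l c l * xA (s l m)) * tensr xA fl (b m).
    under eq_bigr do rewrite dE rmorph_sum mulr_sumr.
    rewrite exchange_big; apply: eq_bigr => m _ /=.
    rewrite rmorph_sum mulr_suml; apply: eq_bigr => l _.
    by rewrite !rmorphM (khom_comp_eq (tens_comm xA fl)) mulrA.
  rewrite rmorph_sum => E0; rewrite big1 // => m _.
  suff -> : \sum_l c l * xA (s l m) = 0 by rewrite rmorph0 mul0r.
  apply: iC_inj; rewrite rmorph0; apply: (ind (fun m => iC (\sum_l c l * xA (s l m)))).
  rewrite -[RHS]E0; apply: eq_bigr => q _.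
  by rewrite rmorphM (kcomp_at fl1) (kcomp_at fr).
by move=> u v uv; apply/eqP; rewrite -subr_eq0; apply/eqP/inj0; rewrite rmorphB uv subrr.
Qed.

End Consequences.
End Models.

(** * Spreading out *)

Section Spreading.
Variable k : fieldType.
Implicit Types B D F R L : kalg k.
Implicit Types X : kfunctor k.
Hypothesis hk : infinite_set [set: k].
Variables (G : kgroup k) (H : kalg k) (e : kmor G (Spec H)).
Hypothesis ie : is_iso e.
Variables (n : nat) (h : 'I_n -> 'I_n -> H).
Hypothesis hgen : forall U, is_subalg U -> (forall i j, U (h i j)) -> forall y, U y.
Variables (A E : kalg k) (i : khom A E).
Hypothesis i_inj : injective i.
Hypothesis fE : is_fld E.
Hypothesis fracE : forall x, exists a s, s <> 0 /\ x * i s = i a.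
Variables (K C : kalg k) (iK : khom K E) (iC : khom C E) (kC : khom K C).
Hypothesis fK : is_fld K.
Hypothesis iCk : kcomp iC kC = iK.
Variables (Y : kfunctor k) (V : gspace G Y).
Hypothesis hYft : finite_type Y.
Hypothesis hV : is_torsor V.
Variables (U : subfun Y) (y0 : Y K) (f0 : tot V C).
Hypothesis hU : is_open U.
Hypothesis Uy0 : U K y0.
Hypothesis pf0 : proj V C f0 = fmap kC y0.

Lemma open_field X (W : subfun X) F F' (f : khom F F') (x : X F) : is_open W ->
  is_fld F -> is_fld F' -> W F' (fmap f x) -> W F x.
Proof.
move=> oW fF fF' Wx; have [I _ [h1 [h2 _]]] := open_unit oW x.
have [c Ic fc] := h2 F' f fF' Wx; rewrite -[x]fmap_id; apply: (h1 _ _ c) => //.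
by apply: fF.2 => c0; apply: fc; rewrite -[RHS](rmorph0 f) -c0.
Qed.

Lemma open_shrink X (W : subfun X) R F (f : khom R F) (x : X R) : is_open W ->
  is_fld F -> W F (fmap f x) ->
  exists z, f z <> 0 /\ forall R' (g : khom R R'), is_unit (g z) -> W R' (fmap g x).
Proof.
move=> oW fF Wx; have [I _ [h1 [h2 _]]] := open_unit oW x.
have [c Ic fc] := h2 F f fF Wx; exists c; split=> // R' g gu; exact: (h1 _ _ c).
Qed.

Lemma finite_chart F (y : Y F) : is_fld F ->
  exists R (j : kmor (Spec R) Y) (r : khom R F) m (x : 'I_m -> R),
    [/\ open_immersion j, j F r = y & generated (kinit R) x].
Proof.
move=> fF; have [m [R [j [jP cov]]]] := hYft.
have [F' [iF EF]] := fld_kalg fF; subst F.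
have [l [r _ ry]] := cov F' iF y; have [oj ft] := jP l.
by have [p [x gx]] := ft_generated ft; exists (R l), (j l), r, p, x.
Qed.

(** V is reached through a cover of Y over which it has a section sg. Once the cover has a point
    over L above y0, f0 becomes g·sg there with g in G(L), and D has only to contain the finitely
    many coordinates of that point and of g. The chart [jr] is recorded in order to compare base
    points later. *)
Lemma spread : exists (a : A) D L (j : khom E L) (dL : khom D L) (aD : khom A D) (v : tot V D),
  [/\ a <> 0, injective dL, kcomp dL aD = kcomp j i &
      forall (J : finType) (d : J -> D), exists (Q : finType) (b : Q -> D) (c : J -> Q -> A),
        [/\ forall l, d l = \sum_m aD (c l m) * b m,
            forall r : Q -> E, \sum_m j (r m) * dL (b m) = 0 -> forall m, r m = 0 &
            exists N m0, aD (a ^+ N) * b m0 = 1] ] /\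
  [/\ is_fld L, fmap dL v = fmap (kcomp j iC) f0, U D (proj V D v) &
      exists R (jr : kmor (Spec R) Y) (r0 : khom R K) (ra : khom R D),
      [/\ open_immersion jr, jr K r0 = y0, proj V D v = jr D ra &
          kcomp dL ra = kcomp (kcomp j iK) r0] ].
Proof.
have [R [jr [r0 [m [xs [ojr r0y gxs]]]]]] := finite_chart y0 fK.
have jrE R' (r : khom R R') : jr R' r = fmap r (jr R (kid R)) by exact: yoneda.
(* A common denominator for the coordinates of y0 in the chart, so that y0 extends to a point [y1]
   over A localized at a1. *)
have [a1 [a10 a1P]] := frac_fin i_inj fE fracE (fun l => iK (r0 (xs l))).
pose A1 := sub_kalg (frac_subalg i a1); pose val1 : khom A1 E := sub_val (frac_subalg i a1).
have val1_inj : injective val1 by exact: sub_val_inj.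
have [r1 r1E] : exists r1 : khom R A1, kcomp val1 r1 = kcomp iK r0.
  have [|r1 r1E] := @factor_inj _ R _ _ val1 (kcomp iK r0) val1_inj; last first.
    by exists r1; apply: khomP.
  move=> t; apply: sub_val_surj; rewrite kcompE.
  have sF := frac_subalg i a1.
  apply: (gxs [set t | frac_set i a1 (iK (r0 t))]) => //=.
    exact: (subalg_preim (kcomp iK r0)).
  by move=> c; rewrite !khom_str; case: sF.
pose y1 := jr A1 r1.
have y1E : fmap val1 y1 = fmap iK y0 by rewrite /y1 -r0y -!kmor_nat /= r1E.
have [X' [f' [[_ surf lfp] sec]]] := torsor_section hV.
have [E' [hE [x' [fE' x'E]]]] : exists E' (hE : khom E E') (x' : X' E'),
    is_fld E' /\ f' E' x' = fmap hE (fmap iK y0).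
  have fE1 := fE; move: (iK) => iK'; have [F [iF EF]] := fld_kalg fE1; subst E.
  have [F' [iF' [hF [x' x'E]]]] := surf F iF (fmap iK' y0).
  by exists (KAlg iF'), hF, x'; split=> //; exact: fieldType_fld.
have [A' [B' [phi [jB [jA [b [oB oA jb fpphi fj]]]]]]] :
    exists A' B' (phi : khom A' B') (jB : kmor (Spec B') X') (jA : kmor (Spec A') Y)
      (b : khom B' E'), [/\ open_immersion jB, open_immersion jA, jB E' b = x',
       finite_presentation_hom phi &
       forall R' (u : khom B' R'), f' R' (jB R' u) = jA R' (kcomp u phi)].
  move: (x') => x''; have [F' [iF' EF]] := fld_kalg fE'; subst E'.
  have [A' [B' [phi [jB [jA [oB oA [b _ jb] fpphi fj]]]]]] := lfp F' iF' x''.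
  by exists A', B', phi, jB, jA, b.
have jAE R' (r : khom A' R') : jA R' r = fmap r (jA A' (kid A')) by exact: yoneda.
have [s sE] : exists s : khom A' E, jA E s = fmap iK y0.
  have : image jA E (fmap iK y0); last by case=> s _ sE; exists s.
  apply: (open_field (f := hE)) => //; first exact: oA.2.
  by exists (kcomp b phi) => //; rewrite -fj jb.
have bphi : kcomp b phi = kcomp hE s.
  by apply: (oA.1 E'); rewrite -fj jb x'E -sE -kmor_nat.
have [nB [xB gxB]] : exists nB (xB : 'I_nB -> B'), generated phi xB.
  by apply: ft_generated; have [P [io [p [x [pi [h1 h2 h3 _]]]]]] := fpphi; exists P, io, p, x, pi.
(* The field E' may be any extension of E; only the subalgebra generated over E by the values of the
   generators of B' is kept, a domain to which Zariski's lemma applies. *)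
have [B0 [iB [h0 [x0 [iB_inj ih0 ix0 gx0]]]]] := generated_subalgebra hE (fun l => b (xB l)).
have dB0 : is_domain B0.
  split=> [E1|u w uw]; first by apply: fE'.1; rewrite -(rmorph1 iB) E1 rmorph0.
  have : iB u * iB w = 0 by rewrite -rmorphM uw rmorph0.
  by case/(field_domain fE') => z; [left|right]; apply: iB_inj; rewrite z rmorph0.
have [L [j [fB [fL fin fBj _]]]] := extension_point hk fE dB0 gx0 dB0.1.
have [b0 b0E] : exists b0 : khom B' B0, kcomp iB b0 = b.
  have [|b0 b0E] := @factor_inj _ B' _ _ iB b iB_inj; last by exists b0; apply: khomP.
  apply: (gxB [set t | exists u, iB u = b t]) => [|c|l].
  - exact: subalg_lift.
  - by exists (h0 (s c)); rewrite (kcomp_at ih0) (khom_comp_eq bphi).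
  - by exists (x0 l).
have b0phi : kcomp b0 phi = kcomp h0 s.
  by apply: khomP => c; apply: iB_inj; rewrite !kcompE (kcomp_at b0E) (kcomp_at ih0) (khom_comp_eq bphi).
pose b' := kcomp fB b0.
have b'phi : kcomp b' phi = kcomp j s by rewrite -kcompA b0phi kcompA fBj.
have [sg sgE] := sec B' (jB B' (kid B')).
have psg R' (c : khom B' R') : proj V R' (fmap c sg) = jA R' (kcomp c phi).
  rewrite kmor_nat sgE -!kmor_nat fj; congr (jA _ (kcomp _ _)); exact: kcompid.
have [g gE] : exists g : G L, fmap (kcomp j iC) f0 = act g (fmap b' sg).
  apply: torsor_trans; first by case: hV.
  by rewrite psg b'phi !kmor_nat pf0 fmapK -kcompA iCk fmap_comp -sE -kmor_nat.
(* [y1] lies in [U], resp. in the chart [jA], wherever [z1], resp. [z2], is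
   invertible; [D] will contain their inverses. *)
have [z1 [z10 z1P]] := open_shrink (f := val1) (x := y1) hU fE (ltac:(rewrite y1E; exact: sub_stable)).
have [z2 [z20 z2P]] := open_shrink (f := val1) (x := y1) oA.2 fE (ltac:(rewrite y1E -sE; by exists s)).
have [w1 w1E] := fE.2 _ z10; have [w2 w2E] := fE.2 _ z20.
have [b2 [b20 b2P]] := frac_fin i_inj fE fracE (fun q : bool => if q then w1 else w2).
have a2P q : frac_set i (a1 * b2) (if q then w1 else w2).
  by rewrite mulrC; apply: frac_mul; exact: b2P.
have a20 : a1 * b2 <> 0 by move=> /(base_domain i_inj fE).2 [].
(* D receives the values of the generators of B' and the matrix entries of g. Since these entries
   generate the coordinate algebra, g itself is defined over D, and therefore so is g·sg. *)
have [a [D [dL [aD [a0 dL_inj dLa [inF inz] free]]]]] := free_model i_inj fE fracE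
  (fun q : 'I_nB + 'I_n * 'I_n => match q with inl l => b' (xB l) | inr p => e L g (h p.1 p.2) end) fL fin a20.
exists a, D, L, j, dL, aD.
have [f1 f1E] : exists f1 : khom A1 D, forall u, dL (f1 u) = kcomp j val1 u.
  apply: factor_inj => // u; have [|d dE] := inF (val1 u); last by exists d.
  by apply: frac_mul; exact: (@sub_valP _ _ _ (frac_subalg i a1)).
have f1z z w : val1 z * w = 1 -> (exists q, w = if q then w1 else w2) -> is_unit (f1 z).
  move=> zw [q wq]; have [|d dE] := inF w; first by rewrite wq; exact: a2P.
  by exists d; apply: dL_inj; rewrite rmorphM f1E dE kcompE -rmorphM zw !rmorph1.
have [sD _ sDE] : image jA D (fmap f1 y1) by apply: z2P; apply: (f1z _ w2) => //; exists false.
have dLsD : kcomp dL sD = kcomp j s.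
  apply: (oA.1 L); transitivity (fmap dL (fmap f1 y1)).
    by rewrite -sDE -kmor_nat.
  rewrite fmapK (_ : kcomp dL f1 = kcomp j val1); last exact: khomP.
  by rewrite fmap_comp y1E -sE -kmor_nat.
have [bD bDE] : exists bD : khom B' D, forall t, dL (bD t) = b' t.
  apply: factor_inj => //.
  apply: (gxB [set t | exists u, dL u = b' t]) => [|c|l].
  - exact: subalg_lift.
  - by exists (sD c); rewrite (khom_comp_eq dLsD) (khom_comp_eq b'phi).
  - by have [d dE] := inz (inl l); exists d.
have bDphi : kcomp bD phi = sD.
  by apply: khomP => c; apply: dL_inj; rewrite kcompE bDE (khom_comp_eq dLsD) (khom_comp_eq b'phi).
have [eD eDE] : exists eD : khom H D, forall t, dL (eD t) = e L g t.
  apply: factor_inj => //.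
  apply: (hgen (U := [set t | exists u, dL u = e L g t])) => [|l l'].
  - exact: subalg_lift.
  - by have [d dE] := inz (inr (l, l')); exists d.
have [gD gDE] := G_pt ie eD.
have dLg : fmap dL gD = g by apply: (G_eq ie) => t; rewrite ev_nat gDE eDE.
have pv : proj V D (act gD (fmap bD sg)) = fmap f1 y1 by rewrite act_proj psg bDphi.
exists (act gD (fmap bD sg)); split; first by split.
split=> //.
- rewrite gE act_nat dLg fmapK; congr (act _ (fmap _ _)); exact: khomP.
- by rewrite pv; apply: z1P; apply: (f1z _ w1) => //; exists true.
exists R, jr, r0, (kcomp f1 r1); split=> //; first by rewrite pv /y1 -kmor_nat.
rewrite kcompA (_ : kcomp dL f1 = kcomp j val1); last exact: khomP.
by rewrite -kcompA r1E kcompA.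
Qed.

End Spreading.

(** * Equivariance of the spread-out point *)

Section ModelEquivariance.
Variable k : fieldType.
Implicit Types Q R : kalg k.
Variables (G : kgroup k) (H : kalg k) (e : kmor G (Spec H)).
Hypothesis ie : is_iso e.
Variables (n : nat) (h : 'I_n -> 'I_n -> H).
Variables (A E : kalg k) (i : khom A E) (x : 'I_n * 'I_n -> A).
Hypothesis i_inj : injective i.
Hypothesis A_ext : forall R (f f' : khom A R), (forall p, f (x p) = f' (x p)) -> f = f'.
Variable ev : forall R, ('I_n * 'I_n -> R) -> khom A R.
Hypothesis evE : forall R (c : 'I_n * 'I_n -> R) p, ev c (x p) = c p.
Variables (K C : kalg k) (iK : khom K E) (iC : khom C E) (kC : khom K C) (xA : khom A C).
Hypothesis iC_inj : injective iC.
Hypothesis iCk : kcomp iC kC = iK.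
Hypothesis iCx : kcomp iC xA = i.
Variable ac : forall R, G R -> khom C R -> khom C R.
Hypothesis ac_k : forall R (g : G R) z, kcomp (ac g z) kC = kcomp z kC.
Hypothesis ac_x : forall R (g : G R) z p,
  ac g z (xA (x p)) = \sum_l e R g (h p.1 l) * z (xA (x (l, p.2))).
Variables (Y : kfunctor k) (V : gspace G Y).
Hypothesis iV : is_iso (shear V).
Variables (y0 : Y K) (f0 : tot V C).
Hypothesis pf0 : proj V C f0 = fmap kC y0.
Hypothesis f0_act : forall R (g : G R) (z : khom C R), fmap (ac g z) f0 = act g (fmap z f0).
Variables (a : A) (D L : kalg k) (j : khom E L) (dL : khom D L) (aD : khom A D) (v : tot V D).
Hypothesis dL_inj : injective dL.
Hypothesis dLa : kcomp dL aD = kcomp j i.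
Hypothesis free : forall (J : finType) (d : J -> D), exists (Q : finType) (b : Q -> D) (c : J -> Q -> A),
  [/\ forall l, d l = \sum_m aD (c l m) * b m,
      forall r : Q -> E, \sum_m j (r m) * dL (b m) = 0 -> forall m, r m = 0 &
      exists N m0, aD (a ^+ N) * b m0 = 1].
Hypothesis vL : fmap dL v = fmap (kcomp j iC) f0.
Variables (R0 : kalg k) (jr : kmor (Spec R0) Y) (r0 : khom R0 K) (ra : khom R0 D).
Hypothesis jr_inj : forall R, injective (kmor_fun jr (A := R)).
Hypothesis jr0 : jr K r0 = y0.
Hypothesis pv : proj V D v = jr D ra.
Hypothesis dLra : kcomp dL ra = kcomp (kcomp j iK) r0.

Let fl : eqflat aD := model_flat i_inj dLa free.

Lemma G_fmap_inj R R' (f : khom R R') (g g' : G R) : injective f ->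
  fmap f g = fmap f g' -> g = g'.
Proof.
move=> f_inj E0; apply: (G_eq ie) => t; apply: f_inj.
by rewrite -!ev_nat E0.
Qed.

Lemma proj_v R (d : khom D R) : proj V R (fmap d v) = jr R (kcomp d ra).
Proof. by rewrite kmor_nat pv -kmor_nat. Qed.

Lemma proj_f0 R (c : khom C R) : proj V R (fmap c f0) = jr R (kcomp (kcomp c kC) r0).
Proof. by rewrite kmor_nat pf0 fmapK -jr0 -kmor_nat. Qed.

(* [V] need not be separated, so that equality over [L] does not suffice: the
   projections are compared in the chart [jr], then the points in the fibre. *)
Lemma model_agree R (c : khom C R) (d : khom D R) :
  kcomp c xA = kcomp d aD -> fmap c f0 = fmap d v.
Proof.
move=> cd; have [W [tl [tr [W_lift [f [f_inj ftl ftr]]]]]] :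
    exists W (tl : khom C W) (tr : khom D W),
      (forall R (c : khom C R) (d : khom D R), kcomp c xA = kcomp d aD ->
         exists q : khom W R, kcomp q tl = c /\ kcomp q tr = d) /\
      exists f : khom W L, [/\ injective f, kcomp f tl = kcomp j iC & kcomp f tr = dL].
  exists (tens_kalg xA fl), (tensl xA fl), (tensr xA fl); split.
    by move=> R' c' d' E0; exact: tens_lift.
  have [|f [ftl ftr]] := @tens_lift _ _ _ _ xA aD fl L (kcomp j iC) dL.
    by rewrite dLa -kcompA iCx.
  by exists f; split=> //; exact: (model_tens_inj free iC_inj iCx ftl ftr).
have E0 : kcomp (kcomp tl kC) r0 = kcomp tr ra.
  apply: khomP => t; apply: f_inj; rewrite -[LHS]/(kcomp f (kcomp (kcomp tl kC) r0) t).
  rewrite -[RHS]/(kcomp f (kcomp tr ra) t) !kcompA ftl ftr dLra -(kcompA j iC kC) iCk //.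
have [g gE] : exists g, fmap tl f0 = act g (fmap tr v).
  by apply: torsor_trans => //; rewrite proj_v proj_f0 E0.
have g1 : g = gone G W.
  apply: (G_fmap_inj f_inj); rewrite gone_nat.
  apply: (@torsor_free k G _ V L _ _ (fmap dL v) iV).
  by rewrite act1 {2}vL -ftl -ftr fmap_comp -act_nat -gE -fmap_comp.
have [q [<- <-]] := W_lift R c d cd.
by rewrite !fmap_comp gE g1 act1.
Qed.

(** Proved for the universal triple (d1, g, d2), over Q = (D ⊗ H) ⊗ D, the outer tensor product
    being over A through the translated matrix. Q embeds in W = (L ⊗ H) ⊗ D, where the first copy of
    v comes from f0, whose equivariance is known, and [model_agree] identifies its translate with
    the second copy. Base points and the group element then descend to Q. *)
Lemma model_equivariant R (d1 d2 : khom D R) (g : G R) :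
  (forall p, d2 (aD (x p)) = \sum_l e R g (h p.1 l) * d1 (aD (x (l, p.2)))) ->
  fmap d2 v = act g (fmap d1 v).
Proof.
move=> d12; pose psi : khom A (kt D H) :=
  ev (fun p => \sum_l ktr D H (h p.1 l) * ktl D H (aD (x (l, p.2)))).
pose m := kt_map H dL.
have m_inj : injective m by exact: kt_map_inj.
have [Q [tl [tr [Q_lift [W [tl2 [tr2 [f [f_inj ftl ftr W_comm]]]]]]]]] :
    exists Q (tl : khom (kt D H) Q) (tr : khom D Q),
      (forall R (c : khom (kt D H) R) (d : khom D R), kcomp c psi = kcomp d aD ->
         exists q : khom Q R, kcomp q tl = c /\ kcomp q tr = d) /\
      exists W (tl2 : khom (kt L H) W) (tr2 : khom D W) (f : khom Q W),
      [/\ injective f, kcomp f tl = kcomp tl2 m, kcomp f tr = tr2 &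
          kcomp tl2 (kcomp m psi) = kcomp tr2 aD].
  exists (tens_kalg psi fl), (tensl psi fl), (tensr psi fl); split.
    by move=> R' c' d' E0; exact: tens_lift.
  exists (tens_kalg (kcomp m psi) fl), (tensl (kcomp m psi) fl), (tensr (kcomp m psi) fl).
  have cm := tens_comm (kcomp m psi) fl.
  have [|f [ftl ftr]] := @tens_lift _ _ _ _ psi aD fl _
    (kcomp (tensl (kcomp m psi) fl) m) (tensr (kcomp m psi) fl).
    by rewrite -kcompA.
  exists f; split=> //; apply: (tens_map_inj (f := kid _)) m_inj _ _ _ => //.
    by rewrite kidcomp.
  by rewrite kidcomp.
have [gu guE] := G_pt ie (kcomp tl (ktr D H)).
pose c1 : khom C W := kcomp (kcomp tl2 (ktl L H)) (kcomp j iC).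
have c1v : fmap c1 f0 = fmap (kcomp (kcomp tl2 (ktl L H)) dL) v by rewrite !fmap_comp vL fmap_comp.
have ftlD : kcomp f (kcomp tl (ktl D H)) = kcomp (kcomp tl2 (ktl L H)) dL.
  by apply: khomP => t; rewrite kcompA ftl !kcompE kt_mapl.
have c2E : kcomp (ac (fmap f gu) c1) xA = kcomp tr2 aD.
  apply: A_ext => p; rewrite kcompE ac_x -W_comm !kcompE evE !rmorph_sum.
  apply: eq_bigr => l _; rewrite !rmorphM kt_mapr kt_mapl ev_nat guE; congr (_ * _).
    by rewrite kcompE (khom_comp_eq ftl) kt_mapr.
  by rewrite /c1 !kcompE (kcomp_at iCx) (khom_comp_eq dLa).
have Wv := model_agree c2E.
have tr2ra : kcomp tr2 ra = kcomp (kcomp (kcomp tl2 (ktl L H)) dL) ra.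
  apply: jr_inj; rewrite -proj_v -Wv proj_f0 ac_k -proj_f0 c1v proj_v //.
have E0 : kcomp tr ra = kcomp (kcomp tl (ktl D H)) ra.
  apply: khomP => t; apply: f_inj; rewrite -[LHS]/(kcomp f (kcomp tr ra) t).
  by rewrite -[RHS]/(kcomp f (kcomp (kcomp tl (ktl D H)) ra) t) !kcompA ftr -kcompA tr2ra -ftlD !kcompA.
have [g' g'E] : exists g', fmap tr v = act g' (fmap (kcomp tl (ktl D H)) v).
  by apply: torsor_trans => //; rewrite !proj_v E0.
have gg : g' = gu.
  apply: (G_fmap_inj f_inj); apply: (@torsor_free k G _ V W _ _ (fmap c1 f0) iV).
  rewrite -[RHS]f0_act Wv c1v -ftlD (fmap_comp f) -act_nat -g'E -fmap_comp ftr //.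
have [|q [q1 q2]] := Q_lift R (kt_pair d1 (e R g)) d2.
  apply: A_ext => p; rewrite !kcompE evE d12 rmorph_sum; apply: eq_bigr => l _.
  by rewrite rmorphM kt_pairl kt_pairr.
have qg : fmap q gu = g.
  apply: (G_eq ie) => t; rewrite ev_nat guE kcompE (kcomp_at q1).
  exact: kt_pairr.
have q1' : kcomp q (kcomp tl (ktl D H)) = d1.
  by apply: khomP => t; rewrite !kcompE (kcomp_at q1); exact: kt_pairl.
by rewrite -q2 fmap_comp g'E gg act_nat qg -fmap_comp q1'.
Qed.

End ModelEquivariance.

Lemma finite_type_iso (k : fieldType) (X Z : kfunctor k) (e : kmor X Z) :
  is_iso e -> finite_type X -> finite_type Z.
Proof.
move=> ie [n [R [j [jP cov]]]].
pose ej l : kmor (Spec (R l)) Z := @KMor k (Spec (R l)) Z (fun A r => e A (j l A r))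
  (fun A B f r => etrans (congr1 (e B) (kmor_nat (j l) f r)) (kmor_nat e f _)).
exists n, R, ej; split=> [l|F iF z].
  have [[j_inj oj] ft] := jP l; split=> //; split=> [A r r' /(iso_inj ie) /j_inj //|A z].
  have [x xz] := iso_surj z ie; have [I hI IP] := oj A x; exists I => // B f.
  rewrite -(IP B f) -xz -kmor_nat; split=> -[r _ rE]; exists r => //.
    exact: (iso_inj ie rE).
  by rewrite /= rE.
have [x xz] := iso_surj z ie; have [l [r _ rx]] := cov F iF x.
by exists l; exists r => //; rewrite /= rx.
Qed.

(** * The generic data attached to V *)

Section GenericData.
Variables (k : fieldType) (hk : infinite_set [set: k]).
Implicit Types R K Q : kalg k.
Variables (G : kgroup k) (H : kalg k) (e : kmor G (Spec H)).
Hypotheses (ie : is_iso e) (ftG : finite_type G).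
Variables (Y : kfunctor k) (V : gspace G Y) (U : subfun Y).
Hypothesis hYft : finite_type Y.
Hypothesis hV : is_torsor V.
Hypothesis hU : is_open U.
Hypothesis pbU : forall K (T : gspace G (Spec K)), is_fld K -> is_torsor T ->
  exists (y : kmor (Spec K) Y) (f : kmor (tot T) (tot V)),
    [/\ equivariant f, forall R t, proj V R (f R t) = y R (proj T R t) & U K (y K (kid K))].

(** What the semi-local case retains of the generic torsor. Versality enters through [pbU], whose
    form fits both V itself and its restriction to an open subfunctor U. *)
Lemma generic_data : exists n (h : 'I_n -> 'I_n -> H) (A : kalg k) (x : 'I_n * 'I_n -> A)
    (ev : forall R, ('I_n * 'I_n -> R) -> khom A R) (a : A) (c0 : 'I_n * 'I_n -> kbase k)
    (D : kalg k) (aD : khom A D) (v : tot V D) (R0 : kalg k) (jr : kmor (Spec R0) Y) (ra : khom R0 D),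
  [/\ forall R (g g' : G R) i j,
        e R (gmul g g') (h i j) = \sum_l e R g (h i l) * e R g' (h l j),
      forall R i j, e R (gone G R) (h i j) = (i == j)%:R,
      forall R (c : 'I_n * 'I_n -> R) p, ev R c (x p) = c p,
      forall R (f f' : khom A R), (forall p, f (x p) = f' (x p)) -> f = f' &
      ev (kbase k) c0 a <> 0] /\
  [/\ eqflat aD, forall (J : finType) (s : J -> A) (d : J -> D), \sum_l aD (s l) * d l = 1 ->
        exists N (c : J -> A), a ^+ N = \sum_l s l * c l,
      U D (proj V D v),
      (forall R, injective (kmor_fun jr (A := R))) /\ proj V D v = jr D ra &
      forall R (d1 d2 : khom D R) (g : G R),
        (forall p, d2 (aD (x p)) = \sum_l e R g (h p.1 l) * d1 (aD (x (l, p.2)))) ->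
        fmap d2 v = act g (fmap d1 v)].
Proof.
have [m [gH gHP]] := affine_finite_type (finite_type_iso ie ftG).
have [n [h [hM h1 hgen]]] := matrix_rep ie gHP.
have [A [E [i [x [ev [y [L [iT [th [[evE A_ext dA c0P] [fE i_inj fracE iT_inj [xy yx thx]]]]]]]]]]]] :=
  generic_matrix hk ie hM h1.
have [K [iK [iK_inj fK KP K_surj]]] := invariant_field fE iT th.
have [C [iC [kC [xC [yC [iC_inj iCk iCx iCy Cgen]]]]]] :=
  matrix_subalgebra (fun p q => i (x (p, q))) y iK.
have [thC [thCE thCk thCx]] :=
  coaction_exists ie hM h1 xy yx iT_inj thx KP iC_inj iCk iCx iCy Cgen.
have [ac [ac_k ac_x [ac1 acM ac_nat] [ac_free ac_trans]]] :
    exists ac : forall R, G R -> khom C R -> khom C R,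
    [/\ forall R (g : G R) z, kcomp (ac R g z) kC = kcomp z kC,
        forall R (g : G R) z i j, ac R g z (xC i j) = \sum_l e R g (h i l) * z (xC l j),
        [/\ forall R (z : khom C R), ac R (gone G R) z = z,
            forall R (g g' : G R) z, ac R (gmul g g') z = ac R g (ac R g' z) &
            forall R R' (f : khom R R') (g : G R) z,
              ac R' (fmap f g) (kcomp f z) = kcomp f (ac R g z)] &
        (forall R (g g' : G R) z, ac R g z = ac R g' z -> g = g') /\
        forall R (z1 z2 : khom C R), kcomp z1 kC = kcomp z2 kC -> exists g, z2 = ac R g z1].
  exists (fun R => @gen_act _ _ _ e _ thC R); split.
  - by move=> R g z; apply: gen_act_k.
  - by move=> R g z p q; apply: gen_act_x.
  - split=> [R z|R g g' z|R R' f g z].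
    + exact: (gen_act1 h1 xy yx iC_inj iCx iCy Cgen thCk thCx).
    + exact: (gen_actM hM xy yx iC_inj iCx iCy Cgen thCk thCx).
    + exact: (gen_act_nat e xy yx iC_inj iCx iCy Cgen thCk thCx).
  - split=> [R g g' z|R z1 z2].
    + exact: (gen_act_free ie xy iC_inj iCx iCy thCx hgen).
    + exact: (gen_act_trans ie hM fE xy yx iT_inj thx fK KP K_surj iC_inj iCk iCx iCy
        Cgen thCE thCk thCx hgen).
have nzC : (1 : C) <> 0 by move=> E0; apply: fE.1; rewrite -(rmorph1 iC) E0 rmorph0.
have fpC : finite_presentation_hom kC.
  apply: (@finite_presentation_field _ _ _ _ ('I_n * 'I_n + 'I_n * 'I_n)%type
    (fun q => match q with inl p => xC p.1 p.2 | inr p => yC p.1 p.2 end) fK).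
  move=> W sW Wk Wx; apply: Cgen => // p q; first exact: (Wx (inl (p, q))).
  exact: (Wx (inr (p, q))).
have [yy [ff [eqf pf Uy]]] := pbU fK (aff_torsor ac_k ac1 acM ac_nat ac_free ac_trans fK nzC fpC).
have [f0 [pf0 f0_act]] := versal_point eqf pf.
have [a [D [L' [j [dL [aD [v [[a0 dL_inj dLa free] [fL' vL Uv]]]]]]]]] :=
  spread hk ie hgen i_inj fE fracE fK iCk hYft hV hU Uy pf0.
move=> [R0 [jr [r0 [ra [ojr jr0 pv dLra]]]]].
pose xA := ev C (fun p => xC p.1 p.2).
have iCxA : kcomp iC xA = i by apply: A_ext => -[p q]; rewrite kcompE evE iCx.
have [c0 c0a] := c0P a a0.
exists n, h, A, x, ev, a, c0, D, aD, v, R0, jr, ra; split; split=> //.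
- exact: (model_flat i_inj dLa free).
- exact: (model_unit i_inj dLa free).
- by split=> //; case: ojr.
move=> R d1 d2 g; apply: (@model_equivariant k G H e ie n h A E i x i_inj A_ext ev evE
  K C iK iC kC xA iC_inj iCk iCxA ac ac_k _ Y V _ (yy K (kid K)) f0 pf0 f0_act
  a D L' j dL aD v dL_inj dLa free vL R0 jr r0 ra) => //.
- by move=> R' g' z [p q]; rewrite !evE ac_x; apply: eq_bigr => l _; rewrite evE.
- by case: hV.
- by case: ojr.
Qed.

End GenericData.

(** * Descent *)

Section DescentOfPoints.
Variable k : fieldType.
Implicit Types Q R : kalg k.
Variable G : kgroup k.
Variables (S B : kalg k) (chi : khom S B).
Hypothesis ff : ffhom chi.

Lemma base_cover R (sg : khom S R) : exists R' (rl : khom R R') (rr : khom B R'),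
  [/\ ffhom rl, kcomp rl sg = kcomp rr chi &
      forall Q (u : khom R Q) (b : khom B Q), kcomp u sg = kcomp b chi ->
        exists q : khom R' Q, kcomp q rl = u /\ kcomp q rr = b].
Proof.
exists (tens_kalg sg ff.1), (tensl sg ff.1), (tensr sg ff.1); split.
- exact: ff_tensl.
- exact: tens_comm.
- by move=> Q u b E0; exact: tens_lift.
Qed.

(* [w] corresponds to [tau] under the isomorphism of torsors over [B] that sends
   [t1] to [t2]; [coherent] says that this isomorphism descends to [S]. *)
Definition matches X1 X2 (T1 : gspace G X1) (T2 : gspace G X2) (t1 : tot T1 B) (t2 : tot T2 B)
    R (sg : khom S R) (tau : tot T1 R) (w : tot T2 R) : Prop :=
  forall Q (u : khom R Q) (b : khom B Q) (g : G Q), kcomp u sg = kcomp b chi ->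
    fmap u tau = act g (fmap b t1) -> fmap u w = act g (fmap b t2).

Definition coherent X1 X2 (T1 : gspace G X1) (T2 : gspace G X2) (t1 : tot T1 B) (t2 : tot T2 B) :=
  forall Q (p q : khom B Q) (g : G Q), kcomp p chi = kcomp q chi ->
    fmap p t1 = act g (fmap q t1) -> fmap p t2 = act g (fmap q t2).

(** After base change to B, tau becomes g'·t1, and its match there is g'·t2. By coherence the two
    pullbacks of this point agree, so it descends to R. *)
Lemma matches_exists X1 X2 (T1 : gspace G X1) (T2 : gspace G X2) t1 t2
    R (sg : khom S R) (tau : tot T1 R) :
  is_iso (shear T1) -> is_scheme (tot T2) -> @coherent X1 X2 T1 T2 t1 t2 ->
  (forall Q (u : khom R Q) (b : khom B Q), kcomp u sg = kcomp b chi ->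
     exists g, fmap u tau = act g (fmap b t1)) ->
  exists w : tot T2 R, matches t1 t2 sg tau w.
Proof.
move=> i1 s2 coh loc.
have [R' [rl [rr [ffr comm lift]]]] := base_cover sg.
have [g' g'E] := loc _ _ _ comm.
have [|w wE] := @ff_descent _ _ _ _ rl (act g' (fmap rr t2)) s2 ffr.
  move=> Q p q pq; rewrite !act_nat !fmapK.
  have E0 : kcomp (kcomp p rr) chi = kcomp (kcomp q rr) chi.
    by rewrite -!kcompA -comm !kcompA pq.
  have pqt : act (fmap p g') (fmap (kcomp p rr) t1) = act (fmap q g') (fmap (kcomp q rr) t1).
    by rewrite -!fmapK -!act_nat -g'E !fmapK pq.
  rewrite (coh Q (kcomp p rr) (kcomp q rr) (gmul (ginv (fmap p g')) (fmap q g')) E0).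
    by rewrite -actM gmulA gmulrV gmul1.
  by rewrite actM -pqt -actM gmulV act1.
exists w => Q u b g E0 ut; have [q [ql qr]] := lift _ _ _ E0.
rewrite -ql -fmapK wE act_nat fmapK qr; congr (act _ _).
apply: (torsor_free (t := fmap b t1) i1); rewrite -ut -ql -qr -[in RHS]fmapK g'E.
by rewrite act_nat fmapK.
Qed.

Lemma matches_uniq X1 X2 (T1 : gspace G X1) (T2 : gspace G X2) t1 t2
    R (sg : khom S R) (tau : tot T1 R) (w w' : tot T2 R) : is_scheme (tot T2) ->
  (forall Q (u : khom R Q) (b : khom B Q), kcomp u sg = kcomp b chi ->
     exists g, fmap u tau = act g (fmap b t1)) ->
  matches t1 t2 sg tau w -> matches t1 t2 sg tau w' -> w = w'.
Proof.
move=> s2 loc mw mw'; have [R' [rl [rr [ffr comm _]]]] := base_cover sg.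
have [g gE] := loc _ _ _ comm.
by apply: (ff_separated s2 ffr); rewrite (mw _ _ _ _ comm gE) (mw' _ _ _ _ comm gE).
Qed.

(** A point of T is sent to the point matching it. As V is a torsor too, coherence also holds with t
    and v exchanged, so that a point of V over y is matched by a point of T; this gives the
    Cartesian property. *)
Lemma torsor_pullback (T : gspace G (Spec S)) Y (V : gspace G Y) (t : tot T B) (v : tot V B)
    (y : Y S) : is_torsor T -> is_torsor V -> is_scheme Y ->
  proj T B t = chi -> proj V B v = fmap chi y -> coherent t v ->
  exists F : kmor (tot T) (tot V), equivariant F /\ is_cartesian F (pt y).
Proof.
move=> [sT iT _] [sV iV _] sY pt0 pv coh.
have locT R (tau : tot T R) Q (u : khom R Q) (b : khom B Q) :
    kcomp u (proj T R tau) = kcomp b chi -> exists g, fmap u tau = act g (fmap b t).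
  by move=> E0; apply: torsor_trans => //; rewrite !kmor_nat pt0 [RHS]E0.
have locV R (sg : khom S R) (w : tot V R) : proj V R w = fmap sg y ->
    forall Q (u : khom R Q) (b : khom B Q), kcomp u sg = kcomp b chi ->
    exists g, fmap u w = act g (fmap b v).
  move=> pw Q u b E0; apply: torsor_trans => //.
  by rewrite !kmor_nat pv pw !fmapK E0.
have coh' : coherent v t.
  move=> Q p q g E0 pq; have [g0 g0E] : exists g0, fmap p t = act g0 (fmap q t).
    by apply: torsor_trans => //; rewrite !kmor_nat pt0 [RHS]E0.
  rewrite g0E; congr (act _ _); apply: (torsor_free (t := fmap q v) iV).
  by rewrite -(coh _ _ _ _ E0 g0E).
have ex R (tau : tot T R) : exists w : tot V R, matches t v (proj T R tau) tau w.
  by apply: matches_exists => //; exact: locT.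
pose F R tau := projT1 (cid (ex R tau)).
have FP R tau : matches t v (proj T R tau) tau (F R tau) by rewrite /F; case: cid.
have FU R tau w : matches t v (proj T R tau) tau w -> F R tau = w.
  by move=> mw; exact: (matches_uniq sV (locT R tau) (FP R tau) mw).
have F_nat R R' (f : khom R R') tau : F R' (fmap f tau) = fmap f (F R tau).
  apply: FU => Q u b g E0 ut; rewrite fmapK; apply: FP; last by rewrite -fmapK.
  by rewrite -E0 kmor_nat -kcompA.
exists (@KMor k _ _ F F_nat).
have eqF R g tau : F R (act g tau) = act g (F R tau).
  apply: FU => Q u b g1 E0 ut; rewrite act_nat.
  rewrite (FP R tau Q u b (gmul (ginv (fmap u g)) g1)).
  - by rewrite -actM gmulA gmulrV gmul1.
  - by rewrite -E0 act_proj.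
  - by rewrite actM -ut act_nat -actM gmulV act1.
split; first exact: eqF.
have pF R tau : proj V R (F R tau) = fmap (proj T R tau) y.
  have [R' [rl [rr [ffr comm _]]]] := base_cover (proj T R tau).
  have [g gE] := locT _ _ _ _ _ comm.
  apply: (ff_separated sY ffr); rewrite -kmor_nat (FP _ _ _ _ _ _ comm gE) act_proj.
  by rewrite kmor_nat pv !fmapK comm.
split=> [R tau|R w sg pw]; first exact: pF.
have [tau mt] := matches_exists iV sT coh' (locV R sg w pw).
have [R' [rl [rr [ffr comm _]]]] := base_cover sg.
have [g gE] := locV R sg w pw _ _ _ comm.
have gtau := mt _ _ _ _ comm gE.
have ptau : proj T R tau = sg.
  apply: (ff_separated (Spec_scheme S) ffr); rewrite -kmor_nat gtau act_proj kmor_nat pt0.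
  exact: (esym comm).
exists tau; split.
  split=> //; apply: (ff_separated sV ffr); rewrite gE.
  by apply: FP => //; rewrite ptau.
move=> tau' [Ft' pt']; have [g1 g1E] : exists g1, tau' = act g1 tau.
  by apply: torsor_trans => //; rewrite ptau pt'.
have Ft : F R tau = w.
  apply: (ff_separated sV ffr); rewrite gE; apply: FP => //; by rewrite ptau.
have g1w : act g1 w = w by rewrite -{1}Ft -eqF -g1E.
by rewrite g1E (torsor_free (g' := gone G R) iV (etrans g1w (esym (act1 w)))) act1.
Qed.

End DescentOfPoints.

(** * Torsors over semi-local rings as pull-backs *)

Section Versality.
Variables (k : fieldType) (hk : infinite_set [set: k]).
Implicit Types R K Q : kalg k.
Variables (G : kgroup k) (H : kalg k) (e : kmor G (Spec H)).
Hypotheses (ie : is_iso e) (ftG : finite_type G).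
Variables (Y : kfunctor k) (V : gspace G Y) (U : subfun Y).
Hypotheses (hY : is_scheme Y) (hYft : finite_type Y).
Hypothesis hV : is_torsor V.
Hypothesis hU : is_open U.
Hypothesis pbU : forall K (T : gspace G (Spec K)), is_fld K -> is_torsor T ->
  exists (y : kmor (Spec K) Y) (f : kmor (tot T) (tot V)),
    [/\ equivariant f, forall R t, proj V R (f R t) = y R (proj T R t) & U K (y K (kid K))].

Lemma open_descent S B (chi : khom S B) (y : Y S) : ffhom chi -> U B (fmap chi y) -> U S y.
Proof.
move=> ff Uy; have [I hI [h1 [_ [_ h2]]]] := open_unit hU y.
have [n [c [s [Is /ff.2 [d ds]]]]] := h2 B chi Uy.
rewrite -[y]fmap_id; apply: (h1 _ _ 1); last by exists 1; rewrite mulr1 rmorph1.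
by rewrite -ds; apply: (ideal_sum hI) => l; apply: (idealMr hI); exact: Is.
Qed.

Lemma semilocal_pullback S (T : gspace G (Spec S)) : is_semilocal_ring S -> is_torsor T ->
  exists (y : Y S) (F : kmor (tot T) (tot V)),
    [/\ U S y, equivariant F & is_cartesian F (pt y)].
Proof.
move=> /finite_seqP [Ps PsE] hT.
have mP P : P \in Ps <-> maximal_ideal P by rewrite PsE.
have [n [h [A [x [ev [a [c0 [D [aD [v [R0 [jr [ra data]]]]]]]]]]]]] :=
  generic_data hk ie ftG hYft hV hU pbU.
move: data => [[hM h1 evE A_ext c0a] [fl aunit Uv [jr_inj pv] veq]].
have [B [phi [t [flphi pt0 pts]]]] := torsor_flat_sections hT (fun P => (mP P).1).
have iT : is_iso (shear T) by case: hT.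
have [m [minv mpts]] := inv_matrix hM h1 flphi iT pt0 evE A_ext hk c0a pts.
have [mA mAE] : exists mA : khom A B, mA = ev B m by exists (ev B m).
have [B2 [tl [tr [fltl comm unit2]]]] : exists B2 (tl : khom B B2) (tr : khom D B2),
  [/\ eqflat tl, kcomp tl mA = kcomp tr aD &
      forall (I : finType) (b : I -> B) (w : I -> B2), \sum_i tl (b i) * w i = 1 ->
        exists (L : finType) (d : L -> D) (s : L -> A) (u : I -> L -> B),
        \sum_l aD (s l) * d l = 1 /\ forall l, mA (s l) = \sum_i b i * u i l].
  exists (tens_kalg mA fl), (tensl mA fl), (tensr mA fl); split.
  - exact: eqflat_tensl.
  - exact: tens_comm.
  - by move=> I b w; exact: tens_unit.
pose chi := kcomp tl phi.
have ff : ffhom chi.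
  apply: ff_criterion => [|P maxP]; first exact: eqflat_comp.
  have hJ := ideal_gen_ideal (chi @` P).
  case: (pselect (ideal_gen (chi @` P) 1)) => [J1|nJ1]; last first.
    have [M mM JM] := exists_maximal hJ nJ1; have [L [l [fL lM]]] := max_point mM.
    exists L, l; split=> // s Ps'; apply/lM; apply: JM; apply: ideal_gen_sub.
    by exists s.
  (* If P generated the unit ideal of B2, [unit2] and [aunit] would put a power of [ev m a] into the
     ideal of B generated by P. At the point l over P this element is nonzero. *)
  exfalso; have [L [l [fL lP la]]] := mpts P ((mP P).2 maxP).
  have /ideal_gen_image1 [p [w [s [Ps' sw]]]] : ideal_gen (chi @` P) = setT by apply/ideal_genT.
  have [J [d [s' [u [sd su]]]]] := unit2 _ (fun i => phi (s i)) w sw.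
  have [N [c ac]] := aunit _ _ _ sd.
  have [b lb] := fL.2 _ la.
  apply: fL.1; have -> : (1 : L) = l (ev B m a) ^+ N * b ^+ N by rewrite -exprMn lb expr1n.
  rewrite -mAE -!rmorphXn ac !rmorph_sum big1 ?mul0r // => q _.
  rewrite !rmorphM su rmorph_sum big1 ?mul0r // => i _.
  by rewrite rmorphM lP ?mul0r.
have coh : coherent chi (fmap tl t) (fmap tr v).
  (* Invariance of the columns of m means that the two pullbacks of the matrix differ by ρ(g), which
     is the condition under which v is equivariant. *)
  move=> Q p q g E0; rewrite !fmapK => tg; apply: veq => -[i j'].
  rewrite !kcompE -!(khom_comp_eq comm) mAE evE.
  have E1 : kcomp (kcomp p tl) phi = kcomp (kcomp q tl) phi by rewrite -!kcompA.
  have := minv j' Q (kcomp p tl) (kcomp q tl) g E1 tg i; rewrite kcompE => ->.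
  by apply: eq_bigr => l _; rewrite !kcompE -(khom_comp_eq comm) mAE evE.
have pt2 : proj T B2 (fmap tl t) = chi by rewrite kmor_nat pt0.
have [ys ysE] : exists ys : khom R0 S, kcomp chi ys = kcomp tr ra.
  have [|ys ysE] := @factor_inj _ R0 _ _ chi (kcomp tr ra) (ff_inj ff); last first.
    by exists ys; exact: khomP.
  move=> r; apply: (ff_equalizer ff) => R f g fg.
  have [g0 g0E] := torsor_pair iT pt2 fg.
  have := congr1 (proj V R) (coh _ _ _ _ fg g0E).
  rewrite act_proj !kmor_nat pv -!kmor_nat => /jr_inj E0.
  exact: (congr1 (fun z : khom R0 R => z r) E0).
pose y := jr S ys.
have pv2 : proj V B2 (fmap tr v) = fmap chi y.
  by rewrite kmor_nat pv /y -!kmor_nat; congr (jr _ _); exact: (esym ysE).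
have [F [eqF carF]] := torsor_pullback ff hT hV hY pt2 pv2 coh.
exists y, F; split=> //; apply: (open_descent ff).
by rewrite -pv2 kmor_nat; exact: sub_stable.
Qed.

End Versality.

(** * The implications between the notions of versality *)

Section Implications.
Variables (k : fieldType) (G : kgroup k).
Implicit Types R S : kalg k.

Lemma weakly_3_2 Y (V : gspace G Y) : weakly_3_versal V -> weakly_2_versal V.
Proof.
move=> hV R inj [I [mI uI]]; apply: hV => //.
rewrite /is_semilocal_ring (_ : maximal_ideal (A:=R) = [set I]); first exact: finite_set1.
by apply/seteqP; split=> [J /uI <-|J ->].
Qed.

Lemma weakly_2_1 Y (V : gspace G Y) : weakly_2_versal V -> weakly_1_versal V.
Proof.
move=> hV K iK _; apply: hV; first exact: fmorph_inj.
have fK := fieldType_fld iK; pose Z := [set x : KAlg iK | x = 0].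
have hZ : is_ideal Z.
  by split=> //= [x y -> ->|a x ->]; rewrite ?addr0 ?mulr0.
have dich (J : set (KAlg iK)) : is_ideal J -> J = Z \/ J = setT.
  move=> hJ; case: (pselect (exists2 x, J x & x <> 0)) => [[x Jx /fK.2 [y xy]]|no].
    right; apply/seteqP; split=> // z _; rewrite -[z]mul1r -xy -mulrA.
    exact: (idealMr hJ).
  left; apply/seteqP; split=> [x Jx|x ->]; last exact: ideal0.
  by apply: contrapT => x0; apply: no; exists x.
exists Z; split.
  split=> // [ZT|J hJ _]; last exact: dich.
  by apply: fK.1; have : Z 1 by rewrite ZT.
by move=> J [/dich [->//|->]].
Qed.

Hypothesis hk : infinite_set [set: k].
Hypothesis hG : linear_algebraic_group G.
Variables (Y : kfunctor k) (V : gspace G Y).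
Hypotheses (hY : is_scheme Y) (hYft : finite_type Y) (hV : is_torsor V).

Lemma weakly_1_3 : weakly_1_versal V -> weakly_3_versal V.
Proof.
move=> w1 S _ sS T hT; have [_ ftG [H [e ie]]] := hG.
pose U := @SubFun k Y (fun=> setT) (fun _ _ _ _ _ => I).
have oU : is_open U.
  move=> A x; exists setT => // B f; split=> // _; apply/ideal_genT.
  by apply: ideal_gen_sub; exists 1 => //; exact: rmorph1.
have [|y [F [_ eqF carF]]] := semilocal_pullback hk ie ftG hY hYft hV oU _ sS hT.
  move=> K T' fK hT'; have [y [f [eqf [pf _]]]] := weak_versal_field hk w1 fK hT'.
  by exists y, f.
by exists (pt y), F.
Qed.

(** The construction is carried out on V over Y, recording that the base points lie in U. This
    avoids showing that U is itself a scheme of finite type and the restriction a torsor; at the end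
    the square is rewritten over U. *)
Lemma weakly_1_3_open (U : subfun Y) : is_open U ->
  weakly_1_versal (restriction V U) -> weakly_3_versal (restriction V U).
Proof.
move=> oU w1 S _ sS T hT; have [_ ftG [H [e ie]]] := hG.
have [|y [F [Uy eqF [pF carF]]]] := semilocal_pullback hk ie ftG hY hYft hV oU _ sS hT.
  move=> K T' fK hT'; have [y [f [eqf [pf _]]]] := weak_versal_field hk w1 fK hT'.
  exists (@KMor k _ _ (fun R z => sval (y R z)) (fun R R' q z => congr1 sval (kmor_nat y q z))).
  exists (@KMor k _ _ (fun R t => (sval (f R t)).1)
    (fun R R' q t => congr1 (fun z => (sval z).1) (kmor_nat f q t))).
  split=> [R g t|R t|] /=.
  - by rewrite eqf.
  - by rewrite (svalP (f R t)) /= -pf.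
  - exact: (svalP (y K (kid K))).
pose yU : kmor (Spec S) (subF U) := pt (exist _ y Uy : subF U S).
have E R (t : tot T R) : proj V R (F R t) = sval (yU R (proj T R t)) by exact: pF.
pose fU R (t : tot T R) : tot (restriction V U) R :=
  exist _ (F R t, yU R (proj T R t)) (E R t).
have fU_nat R R' (q : khom R R') t : fU R' (fmap q t) = fmap q (fU R t).
  apply: sig_ext; exact: (congr2 pair (kmor_nat F q t)
    (etrans (congr1 (yU R') (kmor_nat (proj T) q t)) (kmor_nat yU q _))).
exists yU, (@KMor k _ _ fU fU_nat); split=> [R g t|].
  by apply: sig_ext; rewrite /= eqF gact_proj.
split=> // R [[v z] vz] x /= zx.
have vx : proj V R v = pt y R x by rewrite vz /= zx.
have [t [[Ft pt0] tu]] := carF R v x vx.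
exists t; split.
  by split=> //; apply: sig_ext; rewrite /= Ft pt0 zx.
move=> t' [/(congr1 sval) [Ft' _] pt']; exact: tu.
Qed.

End Implications.

Theorem theorem1p4 (k : fieldType) (hk : infinite_set [set: k])
    (G : kgroup k) (hG : linear_algebraic_group G)
    (Y : kfunctor k) (hY : is_scheme Y) (hYint : is_integral Y)
    (hYft : finite_type Y)
    (tau : gspace G Y) (htau : is_torsor tau) :
  ((weakly_1_versal tau <-> weakly_2_versal tau) /\
   (weakly_2_versal tau <-> weakly_3_versal tau)) /\
  ((versal_1 tau <-> versal_2 tau) /\
   (versal_2 tau <-> versal_3 tau)).
Proof.
have w13 := weakly_1_3 hk hG hY hYft htau.
have o13 := weakly_1_3_open hk hG hY hYft htau.
split; split.
- by split=> [/w13/weakly_3_2|/weakly_2_1].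
- by split=> [/weakly_2_1/w13|/weakly_3_2].
- split=> hv U oU dU; first by apply/weakly_3_2/o13 => //; exact: hv.
  by apply/weakly_2_1; exact: hv.
- split=> hv U oU dU; last by apply/weakly_3_2; exact: hv.
  by apply/o13 => //; apply/weakly_2_1; exact: hv.
Qed.
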